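(* For every choice of positive reals $\mathbf{c}=(c_i)_{i=1}^n$ and every symmetric linear map $Q$ on $E$, one has $D(\mathbf{c},Q)=D_g(\mathbf{c},Q)$ (as elements of $\mathbb{R}\cup\{+\infty\}$). That is, the sharp constant in the multimarginal entropy inequality $$\sum_{i=1}^n c_i h(\mu_i)\le \sup_{\mu\in\Pi(\mu_1,\dots,\mu_n)}\int_E\langle x,Qx\rangle\,d\mu(x)+D$$ over all centered $\mu_i\in\mathcal P(E_i)$ coincides with the sharp constant over centered Gaussian $\mu_i$.
   Context: Let $n\ge 1$, $E_i=\mathbb{R}^{d_i}$ for $i=1,\dots,n$, and $E=\bigoplus_{i=1}^n E_i$. Let $\pi_i:E\to E_i$ be the coordinate projection, $\pi_i^*$ its adjoint (the inclusion $E_i\to E$), and write $x_i=\pi_i(x)$. Fix a symmetric linear map $Q$ on $E$ and positive reals $\mathbf c=(c_i)_{i=1}^n$. $\mathcal P(E_i)$ denotes the set of Borel probability measures on $E_i$ that are absolutely continuous with respect to Lebesgue measure and have finite second moments. For $\mu_i\in\mathcal P(E_i)$ with density $\rho_i$, the Shannon entropy is $h(\mu_i)=-\int\rho_i\log\rho_i\,dx_i\in[-\infty,\infty)$. $\Pi(\mu_1,\dots,\mu_n)$ is the set of couplings: Borel probability measures $\mu$ on $E$ with $\pi_i\sharp\mu=\mu_i$ for all $i$. A measure is centered if it has mean zero. Call the displayed inequality $(\star)$. $D(\mathbf c,Q)\in\mathbb R\cup\{+\infty\}$ is the smallest constant $D$ such that $(\star)$ holds for all centered $\mu_i\in\mathcal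 P(E_i)$, $i=1,\dots,n$; $D_g(\mathbf c,Q)$ is the smallest constant $D$ such that $(\star)$ holds for all centered (nondegenerate) Gaussian measures $\mu_i$ on $E_i$. *)

(* Defs.v *)
From HB Require Import structures.
From mathcomp Require Import all_boot all_order all_algebra.
From mathcomp Require Import all_classical all_reals all_analysis.
Set Implicit Arguments. Unset Strict Implicit. Unset Printing Implicit Defensive.
Import Order.TTheory GRing.Theory Num.Theory.
Local Open Scope ring_scope.
Local Open Scope classical_set_scope.

(* E_i = R^m is represented by m.-tuple R, with the product sigma-algebra
   of the Borel sigma-algebra of R (= Borel sigma-algebra of R^m). *)

(* Lebesgue integral over R^m of a NONNEGATIVE function, defined as the
   iterated one-dimensional Lebesgue integral (equal to the integral against
   the m-dimensional Lebesgue measure by Tonelli). *)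
Fixpoint leb_int_nn (R : realType) (m : nat) : (m.-tuple R -> \bar R) -> \bar R :=
  match m return (m.-tuple R -> \bar R) -> \bar R with
  | 0 => fun f => f [tuple]
  | k.+1 => fun f =>
      (\int[@lebesgue_measure R]_x leb_int_nn (fun t : k.-tuple R => f (cons_tuple x t)))%E
  end.

Definition leb_int (R : realType) (m : nat) (f : m.-tuple R -> \bar R) : \bar R :=
  (leb_int_nn (f^\+) - leb_int_nn (f^\-))%E.

(* rho is the Lebesgue density of a centered Borel probability measure on R^m
   with finite second moment (i.e. of an element of P(R^m) that is centered). *)
Definition centered_density (R : realType) (m : nat) (rho : m.-tuple R -> R) : Prop :=
  [/\ measurable_fun setT rho,
      (forall x, 0 <= rho x),
      leb_int_nn (fun x => (rho x)%:E) = 1%E,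
      (leb_int_nn (fun x => ((\sum_(j < m) tnth x j ^+ 2) * rho x)%:E) < +oo)%E &
      (forall j : 'I_m, leb_int (fun x => (tnth x j * rho x)%:E) = 0%E)].

(* Shannon entropy h(mu) = - int rho log rho  (with 0 log 0 = 0, as ln 0 = 0). *)
Definition entropy (R : realType) (m : nat) (rho : m.-tuple R -> R) : \bar R :=
  (- leb_int (fun x => (rho x * ln (rho x))%:E))%E.

(* Coordinate projection pi_i : E = (+)_i E_i -> E_i, with
   E = R^(sum_i d_i), the i-th block of coordinates being E_i. *)
Definition proj (R : realType) (n : nat) (d : 'I_n -> nat) (i : 'I_n)
  (x : (\sum_(k < n) d k).-tuple R) : (d i).-tuple R :=
  [tuple tnth x (@tagnat.Rank n d i j) | j < d i].

Definition qform (R : realType) (N : nat) (Q : 'M[R]_N) (x : N.-tuple R) : R :=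
  \sum_(a < N) \sum_(b < N) tnth x a * Q a b * tnth x b.

Definition is_coupling (R : realType) (n : nat) (d : 'I_n -> nat)
  (rho : forall i : 'I_n, (d i).-tuple R -> R)
  (mu : probability ((\sum_(k < n) d k).-tuple R) R) : Prop :=
  forall (i : 'I_n) (A : set ((d i).-tuple R)), measurable A ->
    mu (proj i @^-1` A) = leb_int_nn (fun x => (\1_A x * rho i x)%:E).

Definition sup_couplings (R : realType) (n : nat) (d : 'I_n -> nat)
  (Q : 'M[R]_(\sum_(k < n) d k)) (rho : forall i : 'I_n, (d i).-tuple R -> R) : \bar R :=
  ereal_sup [set (\int[mu]_x (qform Q x)%:E)%E
            | mu in [set mu | @is_coupling R n d rho mu]].

Definition star_ineq (R : realType) (n : nat) (d : 'I_n -> nat) (c : 'I_n -> R)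
  (Q : 'M[R]_(\sum_(k < n) d k)) (rho : forall i : 'I_n, (d i).-tuple R -> R) (D : R) : Prop :=
  (\sum_(i < n) (c i)%:E * entropy (rho i) <= sup_couplings Q rho + D%:E)%E.

Definition D_const (R : realType) (n : nat) (d : 'I_n -> nat) (c : 'I_n -> R)
  (Q : 'M[R]_(\sum_(k < n) d k)) : \bar R :=
  ereal_inf [set D%:E | D in
    [set D : R | forall rho : forall i : 'I_n, (d i).-tuple R -> R,
        (forall i, centered_density (rho i)) -> star_ineq c Q rho D]].

Definition posdef (R : realType) (m : nat) (S : 'M[R]_m) : Prop :=
  S^T = S /\ forall v : 'rV[R]_m, v != 0 -> 0 < (v *m S *m v^T) 0 0.

Definition gauss_density (R : realType) (m : nat) (S : 'M[R]_m) (x : m.-tuple R) : R :=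
  let v := \row_(j < m) tnth x j in
  (Num.sqrt ((2 * pi) ^+ m * \det S))^-1 * expR (- ((v *m invmx S *m v^T) 0 0) / 2).

Definition is_centered_gaussian (R : realType) (m : nat) (rho : m.-tuple R -> R) : Prop :=
  exists S : 'M[R]_m, posdef S /\ rho = gauss_density S.

Definition Dg_const (R : realType) (n : nat) (d : 'I_n -> nat) (c : 'I_n -> R)
  (Q : 'M[R]_(\sum_(k < n) d k)) : \bar R :=
  ereal_inf [set D%:E | D in
    [set D : R | forall rho : forall i : 'I_n, (d i).-tuple R -> R,
        (forall i, is_centered_gaussian (rho i)) -> star_ineq c Q rho D]].

(* Main.v *)
(** The entropy [h(mu_i)] is the infimum of [- E ln g] over test densities [g], and once [Q] is
    shifted to be positive semidefinite the value of the best coupling is the supremum of the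
    values of finite decompositions: partitions of unity [F_k] on every [E_i], the mass [a_k] of
    [F_k] not depending on [i], with value [sum_k (2 q(m_k, xi_k) - a_k q(xi_k, xi_k))] where [m_k]
    collects the means of [x F_k].  An upper bound for [sum_i c_i h(mu_i)] minus the best coupling
    is therefore witnessed by tests and a decomposition.  For independent copies [x, x'] of
    [mu], with [u = (x + x') / sqrt 2] and [v = (x - x') / sqrt 2], witnesses for the law of [u] and
    for the laws of [v] conditioned by the [F_k(u)] combine into a witness for [mu].  With a
    strictly convex penalty in the covariances, this shows first that the supremum over centered
    laws is the one over even laws, and then that for near-maximizers the covariance of [v] given
    [u] is almost constant.  Hence their characteristic functions [psi] along lines almost solve
    [psi psi'' - psi'^2 + s^2 psi^2 = 0], and they converge along an ultrafilter to Gaussians,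
    nondegenerate by an entropy bound.  An optimal coupling of these Gaussians
    is transferred to decompositions of the near-maximizers, so the supremum is at most the
    Gaussian constant up to the penalty, which is then sent to zero. *)
From Pilot Require Import Defs.
From HB Require Import structures.
From mathcomp Require Import all_boot all_order all_algebra.
From mathcomp Require Import all_classical all_reals all_analysis measurable_realfun.
From mathcomp Require Import ring lra.
Import Order.TTheory GRing.Theory Num.Theory.
Import numFieldNormedType.Exports.
Local Open Scope classical_set_scope.
Local Open Scope ring_scope.
Set Implicit Arguments.
Unset Strict Implicit.
Unset Printing Implicit Defensive.

(** * Integration of real functions *)

(** Exact conditional entropies and couplings would call for disintegrations, measurable selections
    and differences of infinite quantities; with finite witnesses every term is an integral of a
    function of at most quadratic growth. Swapping [x] and [x'] fixes [u] and negates [v], so the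
    conditional laws of [v] are even for any [mu]: a bound on even laws halves the excess of any
    bound on centered laws. Evenness also makes characteristic functions real. The convex term is
    added to the functional that is maximized. The rotation keeps the covariances of [u], and those
    of [v] on average over [u], so by Jensen conditioning can only increase that term, and a
    near-maximizer leaves no room for an increase. Its growth must be linear at most: it then stays
    below half of [lam] times the trace, which is subtracted, bounds the second moments of
    near-maximizers and disappears with [lam]. Hence [sqrt (1 + t ^ 2) - 1]. Where [psi > 0] the
    equation reads [(ln psi)'' = - s ^ 2]; positivity is kept by a continuation argument in [t]. *)

Definition intg d (T : measurableType d) (R : realType)
  (mu : {measure set T -> \bar R}) (f : T -> R) := mu.-integrable setT (EFin \o f).

Definition Ex d (T : measurableType d) (R : realType)
  (mu : {measure set T -> \bar R}) (f : T -> R) : R := \int[mu]_x f x.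

Section integration.
Context d (T : measurableType d) (R : realType).
Variable mu : {measure set T -> \bar R}.
Implicit Types f g : T -> R.

Lemma intg_meas f : intg mu f -> measurable_fun setT f.
Proof. by move=> /integrableP[/measurable_EFinP]. Qed.

Lemma intg_dom f g : measurable_fun setT f -> intg mu g ->
  (forall x, `|f x| <= g x) -> intg mu f.
Proof.
move=> mf ig fg; apply: (le_integrable measurableT _ _ ig).
  exact/measurable_EFinP.
by move=> x _ /=; rewrite lee_fin (le_trans (fg x))// ler_norm.
Qed.

Lemma eq_intg f g : f =1 g -> intg mu f -> intg mu g.
Proof. by move=> /funext ->. Qed.

Lemma eq_Ex f g : f =1 g -> Ex mu f = Ex mu g.
Proof. by move=> /funext ->. Qed.

Lemma intgD f g : intg mu f -> intg mu g -> intg mu (fun x => f x + g x).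
Proof.
by move=> fi gi; rewrite /intg (_ : _ \o _ = (EFin \o f) \+ (EFin \o g))%E //;
  exact: integrableD.
Qed.

Lemma intgB f g : intg mu f -> intg mu g -> intg mu (fun x => f x - g x).
Proof.
by move=> fi gi; rewrite /intg (_ : _ \o _ = (EFin \o f) \- (EFin \o g))%E //;
  exact: integrableB.
Qed.

Lemma intgZ k f : intg mu f -> intg mu (fun x => k * f x).
Proof.
move=> fi; rewrite /intg (_ : _ \o _ = (fun x => k%:E * (EFin \o f) x))%E //.
exact: integrableZl.
Qed.

Lemma intgN f : intg mu f -> intg mu (fun x => - f x).
Proof. by move=> /(intgZ (-1)); apply: eq_intg => x; rewrite mulN1r. Qed.

Lemma intg_norm f : intg mu f -> intg mu (fun x => `|f x|).
Proof. by move=> /integrable_abse. Qed.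

Lemma intg0 : intg mu (fun=> 0).
Proof. exact: integrable0. Qed.

Lemma intg_sum (I : Type) (r : seq I) (P : pred I) (F : I -> T -> R) :
  (forall i, P i -> intg mu (F i)) -> intg mu (fun x => \sum_(i <- r | P i) F i x).
Proof.
move=> h; elim: r => [|i r ih].
  have -> : (fun x => \sum_(i <- [::] | P i) F i x) = (fun=> 0) by apply/funext => x; rewrite big_nil.
  exact: intg0.
have -> : (fun x => \sum_(j <- i :: r | P j) F j x) =
    (fun x => (if P i then F i x else 0) + \sum_(j <- r | P j) F j x).
  by apply/funext => x; rewrite big_cons; case: ifP; rewrite ?add0r.
apply: (intgD _ ih); case Pi : (P i); [exact: h|exact: intg0].
Qed.

Lemma ExD f g : intg mu f -> intg mu g ->
  Ex mu (fun x => f x + g x) = Ex mu f + Ex mu g.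
Proof. exact: RintegralD. Qed.

Lemma ExB f g : intg mu f -> intg mu g ->
  Ex mu (fun x => f x - g x) = Ex mu f - Ex mu g.
Proof. exact: RintegralB. Qed.

Lemma ExZ k f : intg mu f -> Ex mu (fun x => k * f x) = k * Ex mu f.
Proof. exact: RintegralZl. Qed.

Lemma ExN f : intg mu f -> Ex mu (fun x => - f x) = - Ex mu f.
Proof.
by move=> fi; rewrite -mulN1r -ExZ//; apply: eq_Ex => x; rewrite mulN1r.
Qed.

Lemma Ex0 : Ex mu (fun=> 0) = 0.
Proof. by rewrite /Ex Rintegral_cst// mul0r. Qed.

Lemma Ex_sum (I : Type) (r : seq I) (P : pred I) (F : I -> T -> R) :
  (forall i, P i -> intg mu (F i)) ->
  Ex mu (fun x => \sum_(i <- r | P i) F i x) = \sum_(i <- r | P i) Ex mu (F i).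
Proof.
move=> h; elim: r => [|i r ih].
  have -> : (fun x => \sum_(i <- [::] | P i) F i x) = (fun=> 0) by apply/funext => x; rewrite big_nil.
  by rewrite big_nil Ex0.
have -> : (fun x => \sum_(j <- i :: r | P j) F j x) =
    (fun x => (if P i then F i x else 0) + \sum_(j <- r | P j) F j x).
  by apply/funext => x; rewrite big_cons; case: ifP; rewrite ?add0r.
rewrite big_cons -ih ExD; first by case Pi : (P i); rewrite ?Ex0 ?add0r.
  by case Pi : (P i); [exact: h|exact: intg0].
exact: intg_sum.
Qed.

Lemma Ex_le f g : intg mu f -> intg mu g -> (forall x, f x <= g x) ->
  Ex mu f <= Ex mu g.
Proof. by move=> fi gi fg; apply: le_Rintegral. Qed.

Lemma Ex_ge0 f : (forall x, 0 <= f x) -> 0 <= Ex mu f.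
Proof. by move=> f0; apply: Rintegral_ge0. Qed.

Lemma Ex_norm f : intg mu f -> `|Ex mu f| <= Ex mu (fun x => `|f x|).
Proof. by move=> fi; apply: le_normr_Rintegral. Qed.

Lemma ExE f : intg mu f -> (\int[mu]_x (f x)%:E)%E = (Ex mu f)%:E.
Proof.
by move=> fi; rewrite /Ex /Rintegral fineK//; exact: integrable_fin_num.
Qed.

Lemma intg_ge0 f : measurable_fun setT f -> (forall x, 0 <= f x) ->
  (\int[mu]_x (f x)%:E < +oo)%E -> intg mu f.
Proof.
move=> mf f0 fo; apply/integrableP; split; first exact/measurable_EFinP.
by under eq_integral => x _ do rewrite /= ger0_norm//.
Qed.

End integration.

Section probability_integration.
Context d (T : measurableType d) (R : realType).
Variable P : probability T R.

Lemma intg_cst (k : R) : intg P (fun=> k).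
Proof.
apply/integrableP; split; first exact/measurable_EFinP.
rewrite (_ : (fun x => _) = cst `|k|%:E)//.
rewrite integral_cst//; have := @probability_setT _ _ _ P; rewrite /= => ->; rewrite mule1 ltry//.
Qed.

Lemma Ex_cst (k : R) : Ex P (fun=> k) = k.
Proof.
rewrite /Ex Rintegral_cst//; have := @probability_setT _ _ _ P; rewrite /= => ->.
by rewrite mulr1.
Qed.

Lemma intg_bd (f : T -> R) k : measurable_fun setT f -> (forall x, `|f x| <= k) -> intg P f.
Proof. by move=> mf fk; apply: (intg_dom mf (intg_cst k)). Qed.

End probability_integration.

Section product_integration.
Context d1 d2 (T1 : measurableType d1) (T2 : measurableType d2) (R : realType).
Variables (m1 : {sigma_finite_measure set T1 -> \bar R})
  (m2 : {sigma_finite_measure set T2 -> \bar R}).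
Variable f : T1 * T2 -> R.
Hypothesis fi : intg (m1 \x m2)%E f.

Lemma intg_fst : (forall x, intg m2 (fun y => f (x, y))) ->
  intg m1 (fun x => Ex m2 (fun y => f (x, y))).
Proof.
move=> si; have := integrable_fubini_F fi.
rewrite /intg (_ : fubini_F _ _ = EFin \o (fun x => Ex m2 (fun y => f (x, y))))//.
by apply/funext => x; rewrite /fubini_F /= -ExE.
Qed.

Lemma intg_snd : (forall y, intg m1 (fun x => f (x, y))) ->
  intg m2 (fun y => Ex m1 (fun x => f (x, y))).
Proof.
move=> si; have := @measurable_fubini_G _ _ _ _ _ m1 m2 _ fi.
rewrite (_ : fubini_G _ _ = EFin \o (fun y => Ex m1 (fun x => f (x, y))));
  last by apply/funext => y; rewrite /fubini_G /= -ExE.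
move=> /measurable_EFinP mG.
have mf : measurable_fun setT (EFin \o f) := measurable_int _ fi.
have h := (@integrable21ltyP _ _ _ _ _ m1 m2 _ mf).1 fi.
have mG' : measurable_fun setT (fubini_G m1 (abse \o (EFin \o f))).
  apply: (@measurable_fun_fubini_tonelli_G _ _ _ _ _ m1).
    exact: measurableT_comp.
  by move=> x; exact: abse_ge0.
apply/integrableP; split; first exact/measurable_EFinP.
apply: le_lt_trans h; apply: ge0_le_integral => //.
- by apply: measurableT_comp => //; exact/measurable_EFinP.
- move=> y _; rewrite (_ : (EFin \o _) y = \int[m1]_x (f (x, y))%:E)%E; last first.
    by rewrite (ExE (si y)).
  by apply: le_abse_integral => //; exact: (measurable_int _ (si y)).
Qed.

Lemma Ex_fst : (forall x, intg m2 (fun y => f (x, y))) ->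
  Ex (m1 \x m2)%E f = Ex m1 (fun x => Ex m2 (fun y => f (x, y))).
Proof.
move=> si; rewrite /Ex /Rintegral -(integral12_prod_meas1 fi); congr fine.
by apply: eq_integral => x _; rewrite /fubini_F ExE.
Qed.

Lemma Ex_snd : (forall y, intg m1 (fun x => f (x, y))) ->
  Ex (m1 \x m2)%E f = Ex m2 (fun y => Ex m1 (fun x => f (x, y))).
Proof.
move=> si; rewrite /Ex /Rintegral -(integral21_prod_meas1 fi); congr fine.
by apply: eq_integral => x _; rewrite /fubini_G ExE.
Qed.

End product_integration.

Section transport.
Context d1 d2 d' (T1 : measurableType d1) (T2 : measurableType d2) (T' : measurableType d')
  (R : realType).
Variables (mu1 : {measure set T1 -> \bar R}) (W1 : T1 -> R) (f1 : T1 -> T')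
  (mu2 : {measure set T2 -> \bar R}) (W2 : T2 -> R) (f2 : T2 -> T').
Hypotheses (mW2 : measurable_fun setT W2)
  (W20 : forall x, 0 <= W2 x)
  (mW1 : measurable_fun setT W1) (mf1 : measurable_fun setT f1) (mf2 : measurable_fun setT f2)
  (h : forall g : T' -> \bar R, measurable_fun setT g -> (forall y, 0 <= g y)%E ->
    (\int[mu2]_x ((W2 x)%:E * g (f2 x)) = \int[mu1]_x ((W1 x)%:E * g (f1 x)))%E).

(** The hypothesis on nonnegative functions transfers finiteness of the integral together with its
    value, so integrability on the side of [mu2] is a conclusion; positive and negative parts do the
    rest. *)
Lemma weighted_transport (g : T' -> R) : measurable_fun setT g ->
  intg mu1 (fun x => W1 x * g (f1 x)) ->
  intg mu2 (fun x => W2 x * g (f2 x)) /\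
  Ex mu2 (fun x => W2 x * g (f2 x)) = Ex mu1 (fun x => W1 x * g (f1 x)).
Proof.
move=> mg ig.
have h0 (g1 : T' -> R) : measurable_fun setT g1 -> (forall y, 0 <= g1 y) ->
    intg mu1 (fun x => W1 x * g1 (f1 x)) ->
    intg mu2 (fun x => W2 x * g1 (f2 x)) /\
    Ex mu2 (fun x => W2 x * g1 (f2 x)) = Ex mu1 (fun x => W1 x * g1 (f1 x)).
  move=> mg1 g10 ig1.
  have e : (\int[mu2]_x (W2 x * g1 (f2 x))%:E = (Ex mu1 (fun x => W1 x * g1 (f1 x)))%:E)%E.
    under eq_integral do rewrite EFinM.
    rewrite (h (g := EFin \o g1))//; last exact/measurable_EFinP.
    by rewrite -ExE//; apply: eq_integral => x _; rewrite EFinM.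
  have i2 : intg mu2 (fun x => W2 x * g1 (f2 x)).
    apply: intg_ge0; rewrite ?e ?ltry//; last by move=> x; rewrite mulr_ge0.
    by apply: measurable_funM => //; exact: measurableT_comp.
  by split=> //; move: e; rewrite ExE// => -[].
have ip : intg mu1 (fun x => W1 x * g^\+ (f1 x)).
  apply: (intg_dom _ (intg_norm ig)).
    apply: measurable_funM => //; apply: measurableT_comp => //.
    exact: measurable_funrpos.
  move=> x; rewrite !normrM ler_wpM2l// /funrpos.
  by rewrite ger0_norm ?le_max ?lexx ?orbT// ge_max ler_norm normr_ge0.
have iN : intg mu1 (fun x => W1 x * g^\- (f1 x)).
  apply: (intg_dom _ (intg_norm ig)).
    apply: measurable_funM => //; apply: measurableT_comp => //.
    exact: measurable_funrneg.
  move=> x; rewrite !normrM ler_wpM2l// /funrneg.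
  by rewrite ger0_norm ?le_max ?lexx ?orbT// ge_max -normrN ler_norm normr_ge0.
have [|y|ip' ep] := h0 _ _ _ ip; [exact: measurable_funrpos|exact: funrpos_ge0|].
have [|y|iN' en] := h0 _ _ _ iN; [exact: measurable_funrneg|exact: funrneg_ge0|].
have E y : g y = g^\+ y - g^\- y by have /(congr1 (@^~ y)) := funrposBneg g.
have e2 x : W2 x * g (f2 x) = W2 x * g^\+ (f2 x) - W2 x * g^\- (f2 x) by rewrite E mulrBr.
have e1 x : W1 x * g (f1 x) = W1 x * g^\+ (f1 x) - W1 x * g^\- (f1 x) by rewrite E mulrBr.
rewrite (funext e2); split; first exact: intgB.
by rewrite (eq_Ex _ e1) !ExB// ep en.
Qed.

End transport.

Lemma law_transport d1 d2 d' (T1 : measurableType d1) (T2 : measurableType d2)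
    (T' : measurableType d') (R : realType)
    (mu1 : {measure set T1 -> \bar R}) (f1 : T1 -> T')
    (mu2 : {measure set T2 -> \bar R}) (f2 : T2 -> T') :
  measurable_fun setT f1 -> measurable_fun setT f2 ->
  (forall g : T' -> \bar R, measurable_fun setT g -> (forall y, 0 <= g y)%E ->
    (\int[mu2]_x g (f2 x) = \int[mu1]_x g (f1 x))%E) ->
  forall g : T' -> R, measurable_fun setT g -> intg mu1 (fun x => g (f1 x)) ->
  intg mu2 (fun x => g (f2 x)) /\ Ex mu2 (fun x => g (f2 x)) = Ex mu1 (fun x => g (f1 x)).
Proof.
move=> m1 m2 h g mg ig.
have := @weighted_transport _ _ _ T1 T2 T' R mu1 (fun=> 1) f1 mu2 (fun=> 1) f2 (measurable_cst _)
  (fun=> ler01) (measurable_cst _) m1 m2 _ g mg.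
have e1 x : 1 * g (f1 x) = g (f1 x) by rewrite mul1r.
have e2 x : 1 * g (f2 x) = g (f2 x) by rewrite mul1r.
rewrite (eq_Ex _ e1) (eq_Ex _ e2) (funext e1) (funext e2); apply => //.
move=> k mk k0; under eq_integral do rewrite mul1e.
by under [RHS]eq_integral do rewrite mul1e; exact: h.
Qed.

Import HBNNSimple.

Section weighted_law.
Context d d' (T : measurableType d) (T' : measurableType d') (R : realType).
Variables (mu : {measure set T -> \bar R}) (W : T -> R) (f : T -> T').
Hypotheses (mW : measurable_fun setT W) (W0 : forall x, 0 <= W x)
  (W1 : (\int[mu]_x (W x)%:E = 1)%E) (mf : measurable_fun setT f).

(** Image under [f] of the measure of density [W]. [W = 1] gives plain images, [f = id] changes of
    density, and [W = F (u) / a] with [f = vv] the conditional laws of [v]. *)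
Definition wpush (A : set T') : \bar R := (\int[mu]_(x in f @^-1` A) (W x)%:E)%E.

Let mpre A : measurable A -> measurable (f @^-1` A).
Proof. by move=> mA; rewrite -(setTI (_ @^-1` _)); exact: mf. Qed.

Let wpush0 : wpush set0 = 0%E.
Proof. by rewrite /wpush preimage_set0 integral_set0. Qed.

Let wpush_ge0 A : (0 <= wpush A)%E.
Proof. by apply: integral_ge0 => x _; rewrite lee_fin. Qed.

Let wpush_additive : semi_sigma_additive wpush.
Proof.
move=> A mA tA mUA; rewrite /wpush preimage_bigcup ge0_integral_bigcup//=.
- apply: is_cvg_ereal_nneg_natsum_cond => n _ _.
  by apply: integral_ge0 => x _; rewrite lee_fin.
- by move=> k; exact: mpre.
- by apply/measurable_EFinP; exact: measurable_funTS.
- by move=> x _; rewrite lee_fin.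
- by apply/trivIsetP => i j _ _ ij; move/trivIsetP : tA => /(_ i j I I ij);
    rewrite -preimage_setI => ->; rewrite preimage_set0.
Qed.

Let wpush_m : {measure set T' -> \bar R} :=
  HB.pack wpush (isMeasure.Build _ _ _ wpush wpush0 wpush_ge0 wpush_additive).

Let wpush_P : probability T' R :=
  HB.pack wpush (Measure.on wpush_m)
   (Measure_isProbability.Build _ _ _ wpush_m (etrans (congr1 (fun A => (\int[mu]_(x in A) (W x)%:E)%E) (preimage_setT f)) W1)).

(** For a simple function the identity is a finite sum over its level sets; monotone convergence
    along [nnsfun_approx] extends it. *)
Lemma wlaw_ex : exists nu : probability T' R,
  forall g : T' -> \bar R, measurable_fun setT g -> (forall y, 0 <= g y)%E ->
  (\int[nu]_y g y = \int[mu]_x ((W x)%:E * g (f x)))%E.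
Proof.
exists wpush_P => g mg g0.
pose g_ := nnsfun_approx measurableT mg.
have cg y : limn (fun n => ((g_ n y)%:E)) = g y.
  by apply/cvg_lim => //; apply: cvg_nnsfun_approx.
transitivity (limn (fun n => \int[wpush_P]_x (g_ n x)%:E))%E.
  rewrite -monotone_convergence//.
  - by apply: eq_integral => y _; rewrite cg.
  - by move=> n; exact/measurable_EFinP/measurable_funP.
  - by move=> n y _; rewrite lee_fin.
  - by move=> y _ m n mn; rewrite lee_fin; exact/lefP/nd_nnsfun_approx.
rewrite (_ : (fun n => _) = (fun n => \int[mu]_x ((W x * g_ n (f x))%:E))%E).
  rewrite -monotone_convergence//.
  - apply: eq_integral => x _; rewrite -cg -limeMl//.
      by apply: ereal_nondecreasing_is_cvgn => m n mn; rewrite lee_fin; exact/lefP/nd_nnsfun_approx.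
  - by move=> n; apply/measurable_EFinP/measurable_funM => //; apply: measurableT_comp.
  - by move=> n x _; rewrite lee_fin mulr_ge0.
  - by move=> x _ m n mn; rewrite lee_fin ler_wpM2l//; exact/lefP/nd_nnsfun_approx.
apply/funext => n.
rewrite integralT_nnsfun sintegralE.
transitivity (\int[mu]_x (\sum_(r \in range (g_ n)) r%:E * ((W x)%:E * (\1_(f @^-1` (g_ n @^-1` [set r])) x)%:E)))%E; last first.
  apply: eq_integral => x _; rewrite EFinM (fimfunE (g_ n)) -fsumEFin//.
  rewrite ge0_mule_fsumr; last by move=> r; exact: (nnfun_muleindic_ge0 (g_ n) r (f x)).
  by apply: eq_fsbigr => r _; rewrite EFinM muleCA.
rewrite ge0_integral_fsum//.
- apply: eq_fsbigr => r; rewrite inE => -[y _ <-].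
  have mA : measurable (f @^-1` (g_ n @^-1` [set g_ n y])) by exact: mpre.
  rewrite ge0_integralZl_EFin//.
  + congr (_ * _)%E; rewrite -[LHS]/(\int[mu]_(x in f @^-1` (g_ n @^-1` [set g_ n y])) (W x)%:E)%E integral_mkcond.
    apply: eq_integral => x _; rewrite patchE indicE.
    by case: ifP => _; rewrite ?mule1 ?mule0.
  + by move=> x _; rewrite mule_ge0// lee_fin.
  + by apply: emeasurable_funM => //; apply/measurable_EFinP.
- move=> r; apply: measurable_funeM; apply: emeasurable_funM; apply/measurable_EFinP => //.
  by apply: measurable_indic; exact: mpre.
- move=> r x _; rewrite muleCA; apply: mule_ge0; rewrite ?lee_fin//.
  exact: (nnfun_muleindic_ge0 (g_ n) r (f x)).
Qed.

Lemma wlaw_ex2 : exists nu : probability T' R,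
  (forall g : T' -> \bar R, measurable_fun setT g -> (forall y, 0 <= g y)%E ->
  (\int[nu]_y g y = \int[mu]_x ((W x)%:E * g (f x)))%E) /\
  (forall g : T' -> R, measurable_fun setT g ->
  intg mu (fun x => W x * g (f x)) ->
  intg nu g /\ Ex nu g = Ex mu (fun x => W x * g (f x))).
Proof.
have [nu h] := wlaw_ex; clear wpush_P wpush_m; exists nu; split => // g mg ig.
have := @weighted_transport _ _ _ T T' T' R mu W f nu (fun=> 1) id (measurable_cst _)
  (fun=> ler01) mW mf (@measurable_id _ _ _) _ g mg ig.
have e2 x : 1 * g (id x) = g x by rewrite mul1r.
rewrite (eq_Ex _ e2) (funext e2); apply => k mk k0.
by under eq_integral do rewrite mul1e; exact: h.
Qed.

Lemma wlawP : exists nu : probability T' R,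
  forall g : T' -> R, measurable_fun setT g ->
  intg mu (fun x => W x * g (f x)) ->
  intg nu g /\ Ex nu g = Ex mu (fun x => W x * g (f x)).
Proof. by have [nu [_ h]] := wlaw_ex2; exists nu. Qed.

End weighted_law.

(** * Lebesgue measure on tuples and its rotations *)

Section tuples.
Context (R : realType).

Definition n2 m (x : m.-tuple R) : R := \sum_(j < m) tnth x j ^+ 2.

Definition aff m (a : R) (b x : m.-tuple R) : m.-tuple R :=
  [tuple a * tnth x j + tnth b j | j < m].

Lemma aff_cons m a y (b : m.-tuple R) x t :
  aff a (cons_tuple y b) (cons_tuple x t) = cons_tuple (a * x + y) (aff a b t).
Proof.
apply: eq_from_tnth => i; rewrite tnth_mktuple.
by case: (unliftP ord0 i) => [j|] ->; rewrite ?tnth0 ?tnthS ?tnth_mktuple.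
Qed.

Lemma meas_tuple d (T : measurableType d) m (f : T -> m.-tuple R) :
  (forall j, measurable_fun setT (fun x => tnth (f x) j)) -> measurable_fun setT f.
Proof. by move=> h; apply/measurable_fun_tnthP. Qed.

Lemma meas_tnth d (T : measurableType d) m (f : T -> m.-tuple R) j :
  measurable_fun setT f -> measurable_fun setT (fun x => tnth (f x) j).
Proof. by move=> /measurable_fun_tnthP/(_ j). Qed.

Lemma meas_cons m : measurable_fun setT
  (fun p : R * m.-tuple R => cons_tuple p.1 p.2 : m.+1.-tuple R).
Proof. exact: measurable_cons. Qed.

Lemma meas_aff m a (b : m.-tuple R) : measurable_fun setT (aff a b).
Proof.
apply: meas_tuple => j; under eq_fun do rewrite tnth_mktuple.
apply: measurable_funD => //; apply: measurable_funM => //; exact: measurable_tnth.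
Qed.

Lemma meas_n2 m : measurable_fun setT (@n2 m).
Proof.
apply: measurable_sum => j; apply: measurable_funX; exact: measurable_tnth.
Qed.

Lemma n2_ge0 m (x : m.-tuple R) : 0 <= n2 x.
Proof. by apply: sumr_ge0 => j _; exact: sqr_ge0. Qed.

Lemma n2_cons m x (t : m.-tuple R) : n2 (cons_tuple x t) = x ^+ 2 + n2 t.
Proof.
rewrite /n2 big_ord_recl tnth0; congr (_ + _).
by apply: eq_bigr => j _; rewrite tnthS.
Qed.

End tuples.

Lemma pushm_ex d d' (T1 : measurableType d) (T2 : measurableType d') (R : realType)
    (m : {measure set T1 -> \bar R}) (f : T1 -> T2) : measurable_fun setT f ->
  exists nu : {measure set T2 -> \bar R}, nu = pushforward m f :> (set T2 -> \bar R).
Proof. by move=> mf; unshelve refine (ex_intro _ _ (erefl (pushforward m f))). Qed.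

Lemma prod_sigma_finite d1 d2 (T1 : measurableType d1) (T2 : measurableType d2)
    (R : realType) (m1 : {sigma_finite_measure set T1 -> \bar R})
    (m2 : {sigma_finite_measure set T2 -> \bar R}) : sigma_finite setT (m1 \x m2)%E.
Proof.
have /sigma_finiteP[F [TF ndF Foo]] := sigma_finiteT m1.
have /sigma_finiteP[G [TG ndG Goo]] := sigma_finiteT m2.
exists (fun n => F n `*` G n).
  rewrite -setXTT TF TG predeqE => -[x y]; split; last by move=> [n _ []/= ? ?]; split; exists n.
  move=> [/= [n _ Fnx] [k _ Gky]]; exists (maxn n k) => //; split.
  - by move: x Fnx; exact/subsetPset/ndF/leq_maxl.
  - by move: y Gky; exact/subsetPset/ndG/leq_maxr.
move=> k; have [? ?] := Foo k; have [? ?] := Goo k.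
split; first exact: measurableX.
by rewrite product_measure1E// lte_mul_pinfty// ge0_fin_numE.
Qed.

Lemma mk_sigma_finite d (T : measurableType d) (R : realType)
    (nu : {measure set T -> \bar R}) : sigma_finite setT nu ->
  exists s : {sigma_finite_measure set T -> \bar R}, s = nu :> (set T -> \bar R).
Proof.
case: nu => nu cl sf.
pose num : {measure set T -> \bar R} := Measure.Pack cl.
pose s : {sigma_finite_measure set T -> \bar R} :=
  HB.pack nu (Measure.on num) (Measure_isSigmaFinite.Build _ _ _ num sf).
by exists s.
Qed.

Section lebesgue_affine.
Context (R : realType).
Notation leb1 := (@lebesgue_measure R).

(** The image of Lebesgue measure multiplied by [|a|] gives every interval its length, and
    uniqueness of Lebesgue measure applies. A negative [a] exchanges the open and the closed end,
    which is why the two signs are separate. *)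
Lemma lebesgue_measure_affine (a b : R) (A : set R) : a != 0 -> measurable A ->
  leb1 ((fun x => a * x + b) @^-1` A) = (`|a|^-1%:E * leb1 A)%E.
Proof.
move=> a0 mA.
have mphi : measurable_fun setT ((fun x => a * x + b) : measurableTypeR R -> measurableTypeR R).
  by apply: measurable_funD => //; apply: measurable_funM.
pose phi := (fun x => a * x + b) : measurableTypeR R -> measurableTypeR R.
have a0' : (0 <= `|a|)%R by [].
have [nu0 nu0E] := pushm_ex leb1 mphi.
pose nu := mscale (NngNum a0') nu0.
have h : leb1 A = nu A.
  apply: lebesgue_measure_unique => // _ [[c e]] _ <-.
  rewrite /nu /= /mscale /= nu0E /pushforward lebesgue_measure_itv/= lte_fin.
  have [ap|an|az] := ltgtP 0 a; last by rewrite az eqxx in a0.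
  - have -> : phi @^-1` [set` `]c, e]] = `](c - b) / a, (e - b) / a]%classic.
      rewrite predeqE => x; rewrite /= !in_itv /= ltr_pdivrMr// ler_pdivlMr// ltrBlDr lerBrDr.
      by rewrite (mulrC x).
    rewrite lebesgue_measure_itv/= lte_fin ltr_pM2r ?invr_gt0// ltrD2r.
    case: ifP => ce; last by rewrite mule0.
    by rewrite -!EFinB -EFinM gtr0_norm//; congr EFin; field; rewrite gt_eqF.
  - have -> : phi @^-1` [set` `]c, e]] = `[(e - b) / a, (c - b) / a[%classic.
      rewrite predeqE => x; rewrite /= !in_itv /= ltr_ndivlMr// ler_ndivrMr// ltrBlDr lerBrDr.
      by rewrite (mulrC x) andbC.
    rewrite lebesgue_measure_itv/= lte_fin ltr_nM2r ?invr_lt0// ltrD2r.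
    case: ifP => ce; last by rewrite mule0.
    by rewrite -!EFinB -EFinM ltr0_norm//; congr EFin; field; rewrite lt_eqF.
rewrite h /nu /mscale /= nu0E muleA -EFinM mulVf ?normr_eq0// mul1e.
by [].
Qed.

Lemma integral_lebesgue_affine (a b : R) (f : R -> \bar R) : a != 0 ->
  measurable_fun setT f -> (forall x, 0 <= f x)%E ->
  (\int[leb1]_x f (a * x + b)%R = `|a|^-1%:E * \int[leb1]_x f x)%E.
Proof.
move=> a0 mf f0.
have mphi : measurable_fun setT ((fun x => a * x + b) : measurableTypeR R -> measurableTypeR R).
  by apply: measurable_funD => //; apply: measurable_funM.
have a0' : (0 <= `|a|^-1)%R by rewrite invr_ge0.
rewrite -[`|a|^-1]/((NngNum a0')%:num) -ge0_integral_mscale//.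
rewrite -(@ge0_integral_pushforward _ _ _ _ _ _ mphi leb1 setT f)//.
apply: eq_measure_integral => //= A mA _.
by rewrite /mscale /= /pushforward lebesgue_measure_affine.
Qed.

End lebesgue_affine.

Section leb.
Context (R : realType).
Notation leb1 := (@lebesgue_measure R).

(** Turns the iterated integral of the statement into an integral against one sigma-finite measure,
    so that Tonelli's theorem holds on pairs of tuples. Each step takes the image of a product under
    [cons]; splitting off the head carries the exhausting sets of the product over. *)
Lemma leb_ex m : exists mu : {sigma_finite_measure set (m.-tuple R) -> \bar R},
  forall f, measurable_fun setT f -> (forall x, 0 <= f x)%E ->
  leb_int_nn f = (\int[mu]_x f x)%E.
Proof.
elim: m => [|m [mu h]].
  exists (\d_ ([tuple] : 0.-tuple R)) => f mf f0.
  by rewrite /= integral_dirac// diracT mul1e.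
pose phi := (fun p : R * m.-tuple R => cons_tuple p.1 p.2 : m.+1.-tuple R).
have [nu0 nu0E] := pushm_ex (leb1 \x mu)%E (@meas_cons R m).
have sf : sigma_finite setT nu0.
  have [F UF mFo] := prod_sigma_finite leb1 mu.
  pose inv (t : m.+1.-tuple R) : R * m.-tuple R := (thead t, [tuple of behead t]).
  have minv : measurable_fun setT inv.
    by apply/measurable_fun_pair => //=; [exact: measurable_tnth|exact: measurable_behead].
  have invK p : inv (phi p) = p.
    case: p => x t; rewrite /inv /=; congr pair.
    by apply: val_inj.
  exists (fun n => inv @^-1` F n).
    by rewrite -preimage_bigcup -UF preimage_setT.
  move=> n; have [mF Fo] := mFo n; split; first by rewrite -(setTI (_ @^-1` _)); exact: minv.
  rewrite nu0E /pushforward (_ : _ @^-1` _ = F n)//.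
  by rewrite predeqE => p /=; rewrite invK.
have [nu nuE] := mk_sigma_finite sf.
exists nu => f mf f0 /=.
have -> : (\int[nu]_x f x = \int[nu0]_x f x)%E by congr (integral _ _ _).
have mfp : measurable_fun setT (f \o phi) by apply: (measurableT_comp mf); exact: meas_cons.
rewrite nu0E ge0_integral_pushforward//=; last exact: meas_cons.
rewrite (_ : (fun x => _) = f \o phi)//.
rewrite (@fubini_tonelli1 _ _ _ _ _ leb1 mu (f \o phi))//; last by move=> p /=; exact: f0.
apply: eq_integral => x _; rewrite h//.
by apply: (measurableT_comp mf); exact: measurable_cons.
Qed.

Definition leb m : {sigma_finite_measure set (m.-tuple R) -> \bar R} :=
  projT1 (cid (leb_ex m)).

Lemma leb_int_nnE m (f : m.-tuple R -> \bar R) : measurable_fun setT f ->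
  (forall x, 0 <= f x)%E -> leb_int_nn f = (\int[leb m]_x f x)%E.
Proof. exact: (projT2 (cid (leb_ex m))). Qed.

Lemma leb_affine m (a : R) (b : m.-tuple R) (f : m.-tuple R -> \bar R) : a != 0 ->
  measurable_fun setT f -> (forall x, 0 <= f x)%E ->
  (\int[leb m]_x f (aff a b x) = (`|a| ^- m)%:E * \int[leb m]_x f x)%E.
Proof.
move=> a0 mf f0; rewrite -!leb_int_nnE//; last first.
  by apply: measurableT_comp => //; exact: meas_aff.
elim: m b f mf f0 => [|m ih] b f mf f0.
  by rewrite /= expr0 invr1 mul1e; congr f; apply: eq_from_tnth => -[].
have be : b = cons_tuple (thead b) [tuple of behead b] by rewrite [LHS]tuple_eta; apply: val_inj.
rewrite /= be.
under eq_integral => x _.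
  rewrite (_ : (fun t => _) = (fun t => f (cons_tuple (a * x + thead b) (aff a [tuple of behead b] t)))); last first.
    by apply/funext => t; rewrite aff_cons.
  rewrite (ih _ (fun t => f (cons_tuple (a * x + thead b) t)))//; last first.
    by apply: (measurableT_comp mf); exact: measurable_cons.
  over.
have mI : measurable_fun setT (fun x => leb_int_nn (fun t : m.-tuple R => f (cons_tuple x t))).
  have := @measurable_fun_fubini_tonelli_F _ _ _ _ _ (leb m) (fun p : R * m.-tuple R => f (cons_tuple p.1 p.2)).
  rewrite /fubini_F /= => H.
  under eq_fun => x.
    rewrite leb_int_nnE//; last by apply: (measurableT_comp mf); exact: measurable_cons.
    over.
  by apply: H => //; apply: (measurableT_comp mf); exact: meas_cons.
have I0 x : (0 <= leb_int_nn (fun t : m.-tuple R => f (cons_tuple x t)))%E.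
  rewrite leb_int_nnE//; first exact: integral_ge0.
  by apply: (measurableT_comp mf); exact: measurable_cons.
have mI' : measurable_fun setT
    (fun x : R => leb_int_nn (fun t : m.-tuple R => f (cons_tuple (a * x + thead b) t))).
  by apply: (measurableT_comp mI); apply: measurable_funD => //; apply: measurable_funM.
rewrite ge0_integralZl_EFin//.
rewrite (integral_lebesgue_affine (thead b) a0 mI)//.
by rewrite muleA -EFinM exprSr invfM.
Qed.

End leb.

Section rotation.
Context (R : realType) (m : nat).
Notation T := (m.-tuple R).
Notation s2 := (Num.sqrt 2 : R).

Lemma s2_gt0 : 0 < s2. Proof. by rewrite sqrtr_gt0. Qed.

Lemma s2_neq0 : s2 != 0. Proof. by rewrite gt_eqF// s2_gt0. Qed.

Lemma s2_sqr : s2 ^+ 2 = 2. Proof. by rewrite sqr_sqrtr. Qed.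

Definition uu (p : T * T) : T := [tuple (tnth p.1 j + tnth p.2 j) / s2 | j < m].

Definition vv (p : T * T) : T := [tuple (tnth p.1 j - tnth p.2 j) / s2 | j < m].

Lemma meas_uu : measurable_fun setT uu.
Proof.
apply: meas_tuple => j; under eq_fun do rewrite tnth_mktuple.
by apply: measurable_funM => //; apply: measurable_funD; apply: meas_tnth.
Qed.

Lemma meas_vv : measurable_fun setT vv.
Proof.
apply: meas_tuple => j; under eq_fun do rewrite tnth_mktuple.
by apply: measurable_funM => //; apply: measurable_funB; apply: meas_tnth.
Qed.

Lemma n2_rot p : n2 (uu p) + n2 (vv p) = n2 p.1 + n2 p.2.
Proof.
rewrite /n2 -!big_split; apply: eq_bigr => j _ /=.
rewrite !tnth_mktuple !exprMn exprVn s2_sqr; by field.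
Qed.

Lemma n2_uu_le p : n2 (uu p) <= n2 p.1 + n2 p.2.
Proof. by rewrite -n2_rot lerDl n2_ge0. Qed.

Lemma n2_vv_le p : n2 (vv p) <= n2 p.1 + n2 p.2.
Proof. by rewrite -n2_rot lerDr n2_ge0. Qed.

(** Two affine substitutions in one variable. At fixed [x], replace [y] by [v = (x - y) / sqrt 2];
    at fixed [v], replace [x] by [u = sqrt 2 x - v]. The factors [sqrt 2 ^ m] and its inverse
    cancel. *)
Lemma leb_rot (H : T * T -> \bar R) : measurable_fun setT H -> (forall p, 0 <= H p)%E ->
  (\int[leb R m \x leb R m]_p H (uu p, vv p) = \int[leb R m \x leb R m]_p H p)%E.
Proof.
move=> mH H0.
have mr : measurable_fun setT (fun p : T * T => H (uu p, vv p)).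
  apply: (measurableT_comp mH); apply: measurable_fun_pair; [exact: meas_uu|exact: meas_vv].
rewrite fubini_tonelli1//.
rewrite [RHS]fubini_tonelli2//.
have sub a b : measurable_fun setT (fun p : T * T => H (aff a (aff b [tuple 0 | _ < m] p.2) p.1, p.2)).
  apply: (measurableT_comp mH); apply: measurable_fun_pair => //.
  apply: meas_tuple => j; under eq_fun do rewrite !tnth_mktuple.
  apply: measurable_funD; first by apply: measurable_funM => //; exact: meas_tnth.
  by apply: measurable_funD => //; apply: measurable_funM => //; exact: meas_tnth.
(* [K] is [H] in the coordinates [(x, v)]. *)
pose K (p : T * T) := H (aff s2 (aff (-1) [tuple 0 | _ < m] p.2) p.1, p.2).
have mK : measurable_fun setT K by exact: sub.
have K0 p : (0 <= K p)%E by exact: H0.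
have e1 x : fubini_F (leb R m) (fun p => H (uu p, vv p)) x =
    ((`|s2^-1| ^- m)%:E * \int[leb R m]_y K (x, y))%E.
  rewrite /fubini_F -[`|s2^-1|]normrN.
  rewrite -(leb_affine (aff s2^-1 [tuple 0 | _ < m] x) (f := fun y => K (x, y))) ?oppr_eq0 ?invr_eq0 ?s2_neq0//.
    apply: eq_integral => y _; rewrite /K /=; congr (H (_, _)); apply: eq_from_tnth => j;
      rewrite !tnth_mktuple; field: s2_sqr; rewrite ?s2_neq0//.
  by apply: (measurableT_comp mK).
under eq_integral do rewrite e1.
rewrite ge0_integralZl_EFin//; last 2 first.
- by move=> x _; exact: integral_ge0.
- exact: (measurable_fun_fubini_tonelli_F K).
rewrite (@fubini_tonelli _ _ _ _ _ (leb R m) (leb R m) K)//.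
have e2 y : (\int[leb R m]_x K (x, y) = (`|s2| ^- m)%:E * fubini_G (leb R m) H y)%E.
  rewrite -(leb_affine (aff (-1) [tuple 0 | _ < m] y) (f := fun x => H (x, y))) ?s2_neq0//.
  by apply: (measurableT_comp mH).
under eq_integral do rewrite e2.
rewrite ge0_integralZl_EFin//; last 2 first.
- by move=> x _; exact: integral_ge0.
- exact: (measurable_fun_fubini_tonelli_G H).
rewrite muleA -EFinM normfV exprVn invrK mulfV ?mul1e//.
by rewrite expf_eq0 normr_eq0 (negbTE s2_neq0) andbF.
Qed.

End rotation.

Section gaussian_mass.
Context (R : realType).

Lemma integral_gauss_scaled (a : R) : 0 < a ->
  (\int[@lebesgue_measure R]_x (expR (- a * x ^+ 2))%:E = (Num.sqrt pi / Num.sqrt a)%:E)%E.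
Proof.
move=> a0; have sa : 0 < Num.sqrt a by rewrite sqrtr_gt0.
have := @integral_lebesgue_affine R (Num.sqrt a) 0 (EFin \o @gauss_fun R).
rewrite integralT_gauss -EFinM gtr0_norm// [_ * Num.sqrt pi]mulrC => <-.
- apply: eq_integral => x _; rewrite /= /gauss_fun addr0 exprMn sqr_sqrtr ?mulNr//.
  exact: ltW.
- by rewrite gt_eqF.
- by apply/measurable_EFinP; exact: measurable_gauss_fun.
- by move=> x; rewrite lee_fin gauss_fun_ge0.
Qed.

Lemma leb_gauss_mass m (a : R) : 0 < a ->
  exists2 k : R, 0 < k & (\int[leb R m]_x (expR (- a * n2 x))%:E = k%:E)%E.
Proof.
move=> a0.
have mg m' : measurable_fun setT (fun x : m'.-tuple R => (expR (- a * n2 x))%:E).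
  apply/measurable_EFinP; apply: measurableT_comp => //.
  by apply: measurable_funM => //; exact: meas_n2.
have g0 m' (x : m'.-tuple R) : (0 <= (expR (- a * n2 x))%:E)%E by rewrite lee_fin expR_ge0.
have kE := integral_gauss_scaled a0; set k := _ / _ in kE.
have k0 : 0 < k by rewrite divr_gt0 ?sqrtr_gt0 ?pi_gt0.
exists (k ^+ m); first by rewrite exprn_gt0.
rewrite -leb_int_nnE//.
elim: m => [|m ih]; first by rewrite /= /n2 big_ord0 mulr0 expR0 expr0.
rewrite /=.
transitivity (\int[@lebesgue_measure R]_x ((k ^+ m)%:E * (expR (- a * x ^+ 2))%:E))%E.
  apply: eq_integral => x _.
  rewrite (_ : (fun t => _) = (fun t : m.-tuple R => (expR (- a * x ^+ 2))%:E * (expR (- a * n2 t))%:E)%E); last first.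
    by apply/funext => t; rewrite n2_cons mulrDr expRD EFinM.
  rewrite leb_int_nnE; last 2 first.
  - by apply: measurable_funeM; exact: mg.
  - by move=> t; rewrite mule_ge0// lee_fin expR_ge0.
  rewrite ge0_integralZl_EFin ?expR_ge0//; last exact: mg.
  by rewrite -leb_int_nnE// ih muleC.
have m1 : measurable_fun setT (fun x : R => (expR (- a * x ^+ 2))%:E).
  apply/measurable_EFinP; apply: measurableT_comp => //.
  by apply: measurable_funM.
rewrite ge0_integralZl_EFin//; last by rewrite exprn_ge0// ltW.
by rewrite kE exprSr EFinM.
Qed.

End gaussian_mass.

(** * Tests for the entropy *)

Section tests.
Context (R : realType).

(** The two-sided Gaussian bounds dominate [ln g] by a quadratic function, so that it is integrable
    for every law with second moments, and they survive taking marginals and sections. Mass at most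
    one is what Gibbs' inequality uses and what the arithmetic-geometric inequality yields. *)
Definition test m (g : m.-tuple R -> R) : Prop :=
  [/\ measurable_fun setT g,
      exists2 A : R, 0 < A & forall x,
        expR (- A * (1 + n2 x)) <= g x <= expR (A - n2 x / A) &
      (\int[leb R m]_x (g x)%:E <= 1)%E].

Definition law2 m (P : probability (m.-tuple R) R) : Prop := intg P (@n2 R m).

Definition nn2 m (p : m.-tuple R * m.-tuple R) : R := n2 p.1 + n2 p.2.

Lemma nn2_ge0 m p : 0 <= @nn2 m p.
Proof. by rewrite addr_ge0 ?n2_ge0. Qed.

Lemma test_gt0 m (g : m.-tuple R -> R) x : test g -> 0 < g x.
Proof.
by move=> [_ [A _ /(_ x)/andP[h _]] _]; exact: lt_le_trans (expR_gt0 _) h.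
Qed.

Lemma test_meas m (g : m.-tuple R -> R) : test g -> measurable_fun setT g.
Proof. by case. Qed.

Lemma ln_bounds (A N y : R) : 0 < A -> 0 <= N ->
  expR (- A * (1 + N)) <= y <= expR (A - N / A) -> - A * (1 + N) <= ln y <= A - N / A.
Proof.
move=> A0 N0 /andP[h1 h2].
have y0 : 0 < y by exact: lt_le_trans (expR_gt0 _) h1.
by apply/andP; split; rewrite -ler_expR lnK ?posrE.
Qed.

Lemma ln_norm_bound (A N y : R) : 0 < A -> 0 <= N ->
  expR (- A * (1 + N)) <= y <= expR (A - N / A) -> `|ln y| <= A * (1 + N).
Proof.
move=> A0 N0 /(ln_bounds A0 N0)/andP[h1 h2]; rewrite ler_norml -mulNr h1 /=.
apply: (le_trans h2); rewrite mulrDr mulr1 lerD// (le_trans (y := 0))//.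
  by rewrite oppr_le0 divr_ge0// ltW.
by rewrite mulr_ge0// ltW.
Qed.

Lemma test_ln m (g : m.-tuple R -> R) : test g ->
  exists2 A : R, 0 < A & forall x, `|ln (g x)| <= A * (1 + n2 x).
Proof.
move=> [_ [A A0 h] _]; exists A => // x.
by apply: ln_norm_bound => //; exact: n2_ge0.
Qed.

Lemma test_meas_ln m (g : m.-tuple R -> R) : test g ->
  measurable_fun setT (fun x => ln (g x)).
Proof. by move=> tg; apply: measurableT_comp => //; exact: test_meas. Qed.

Lemma intg_quad m (P : probability (m.-tuple R) R) (f : m.-tuple R -> R) A :
  law2 P -> measurable_fun setT f -> (forall x, `|f x| <= A * (1 + n2 x)) -> intg P f.
Proof.
move=> P2 mf fA; apply: (intg_dom mf _ fA).
by apply: intgZ; apply: intgD => //; exact: intg_cst.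
Qed.

Lemma intg_ln_test m (P : probability (m.-tuple R) R) g : law2 P -> test g ->
  intg P (fun x => ln (g x)).
Proof.
move=> P2 tg; have [A A0 h] := test_ln tg.
by apply: intg_quad h => //; exact: test_meas_ln.
Qed.

Lemma prob_integral_cst d (T : measurableType d) (P : probability T R) (c : \bar R) :
  (\int[P]_x c = c)%E.
Proof.
rewrite (_ : (fun=> c) = cst c)// integral_cst//.
by have := @probability_setT _ _ _ P; rewrite /= => ->; rewrite mule1.
Qed.

Lemma intg2_fst d1 d2 (T1 : measurableType d1) (T2 : measurableType d2)
    (P : probability T1 R) (Q : probability T2 R) (f : T1 -> R) : intg P f ->
  intg (P \x Q)%E (fun p => f p.1).
Proof.
move=> fi; have mf := intg_meas fi.
have mf1 : measurable_fun setT (fun p : T1 * T2 => f p.1) by exact: measurableT_comp.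
apply/integrable12ltyP; first exact/measurable_EFinP.
under eq_integral => x _.
  rewrite /= prob_integral_cst.
  over.
by move: fi => /integrableP[].
Qed.

Lemma intg2_snd d1 d2 (T1 : measurableType d1) (T2 : measurableType d2)
    (P : probability T1 R) (Q : probability T2 R) (f : T2 -> R) : intg Q f ->
  intg (P \x Q)%E (fun p => f p.2).
Proof.
move=> fi; have mf := intg_meas fi.
have mf1 : measurable_fun setT (fun p : T1 * T2 => f p.2) by exact: measurableT_comp.
apply/integrable21ltyP; first exact/measurable_EFinP.
under eq_integral => x _.
  rewrite /= prob_integral_cst.
  over.
by move: fi => /integrableP[].
Qed.

Lemma intg_nn2 m (P : probability (m.-tuple R) R) : law2 P -> intg (P \x P)%E (@nn2 m).
Proof. by move=> P2; apply: intgD; [exact: intg2_fst|exact: intg2_snd]. Qed.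

Lemma intg_quad2 m (P : probability (m.-tuple R) R) (f : m.-tuple R * m.-tuple R -> R) A :
  law2 P -> measurable_fun setT f -> (forall p, `|f p| <= A * (1 + nn2 p)) ->
  intg (P \x P)%E f.
Proof.
move=> P2 mf fA; apply: (intg_dom mf _ fA).
by apply: intgZ; apply: intgD; [exact: (@intg_cst _ _ _ (P \x P)%E)|exact: intg_nn2].
Qed.

End tests.

(** * Halving a test on pairs: marginal and sections *)

Section split.
Context (R : realType) (m : nat).
Notation T := (m.-tuple R).
Variables (P : probability T R) (G : T * T -> R) (A : R).
Hypotheses (P2 : law2 P) (mG : measurable_fun setT G) (A0 : 0 < A)
  (GA : forall p, expR (- A * (1 + nn2 p)) <= G p <= expR (A - nn2 p / A))
  (G1 : (\int[leb R m \x leb R m]_p (G p)%:E <= 1)%E).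

Let G0 p : 0 < G p.
Proof. by have /andP[h _] := GA p; exact: lt_le_trans (expR_gt0 _) h. Qed.

Let mGs x : measurable_fun setT (fun y => G (x, y)).
Proof. exact: measurableT_comp. Qed.

Let ub (x y : T) : G (x, y) <= expR (A - n2 x / A) * expR (- A^-1 * n2 y).
Proof.
have /andP[_ h] := GA (x, y); apply: (le_trans h).
by rewrite -expRD ler_expR /nn2 /=; lra.
Qed.

Let lb (x y : T) : expR (- A * (1 + n2 x)) * expR (- A * n2 y) <= G (x, y).
Proof.
have /andP[h _] := GA (x, y); apply: le_trans h.
by rewrite -expRD ler_expR /nn2 /=; lra.
Qed.

Let intg_exp a : 0 < a -> intg (leb R m) (fun y => expR (- a * n2 y)).
Proof.
move=> a0; have [k k0 kE] := @leb_gauss_mass R m a a0.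
apply: intg_ge0; last by rewrite kE ltry.
- apply: measurableT_comp => //.
  by apply: measurable_funM => //; exact: meas_n2.
- by move=> x; exact: expR_ge0.
Qed.

Let Gi x : intg (leb R m) (fun y => G (x, y)).
Proof.
apply: (intg_dom (mGs x) (intgZ (expR (A - n2 x / A)) (intg_exp (a := A^-1) _))).
  by rewrite invr_gt0.
by move=> y; rewrite gtr0_norm.
Qed.

Let g1 x := Ex (leb R m) (fun y => G (x, y)).

Let mg1 : measurable_fun setT g1.
Proof.
apply/measurable_EFinP; rewrite (_ : _ \o _ = fubini_F (leb R m) (EFin \o G)).
  apply: (measurable_fun_fubini_tonelli_F (EFin \o G)); first exact/measurable_EFinP.
  by move=> p; rewrite lee_fin ltW.
by apply/funext => x; rewrite /= /fubini_F /g1 -ExE.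
Qed.

(** Integrating the bounds of [G] over [y] multiplies them by the masses [k] and [l] of two
    Gaussians, whose logarithms are absorbed in the new constant. *)
Let g1_bounds : exists2 B : R, A <= B &
  forall x, expR (- B * (1 + n2 x)) <= g1 x <= expR (B - n2 x / B).
Proof.
have A10 : 0 < A^-1 by rewrite invr_gt0.
have [k k0 kE] := @leb_gauss_mass R m A A0.
have [l l0 lE] := @leb_gauss_mass R m A^-1 A10.
have kE' : Ex (leb R m) (fun y => expR (- A * n2 y)) = k.
  by apply: EFin_inj; rewrite -kE -ExE//; exact: intg_exp.
have lE' : Ex (leb R m) (fun y => expR (- A^-1 * n2 y)) = l.
  by apply: EFin_inj; rewrite -lE -ExE//; exact: intg_exp.
exists (A + `|ln k| + `|ln l|); first by rewrite -addrA lerDl addr_ge0.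
move=> x; set B := A + _ + _.
have AB : A <= B by rewrite /B -addrA lerDl addr_ge0.
have n0 := n2_ge0 x.
apply/andP; split.
- apply: (@le_trans _ _ (expR (- A * (1 + n2 x)) * k)).
    rewrite -[k in leRHS]lnK ?posrE// -expRD ler_expR.
    have := ler_norm (- ln k); rewrite normrN => h.
    have h2 : A * n2 x <= B * n2 x by rewrite ler_wpM2r.
    by have := normr_ge0 (ln l); rewrite /B in h2 *; lra.
  rewrite -kE' -ExZ; last exact: intg_exp.
  by apply: Ex_le => //; apply: intgZ; exact: intg_exp.
- apply: (@le_trans _ _ (expR (A - n2 x / A) * l)).
    rewrite -lE' -ExZ; last exact: intg_exp.
    by apply: Ex_le => //; apply: intgZ; exact: intg_exp.
  rewrite -[l in leLHS]lnK ?posrE// -expRD ler_expR.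
  have h2 : n2 x / B <= n2 x / A by rewrite ler_wpM2l// lef_pV2 ?posrE// (lt_le_trans A0).
  have := ler_norm (ln l); have := normr_ge0 (ln k).
  by move: h2; move: (n2 x / B) => z; rewrite /B; lra.
Qed.

Let g1_gt0 x : 0 < g1 x.
Proof. by have [B _ /(_ x)/andP[h _]] := g1_bounds; exact: lt_le_trans (expR_gt0 _) h. Qed.

Let tg1 : test g1.
Proof.
split => //.
- by have [B AB h] := g1_bounds; exists B => //; exact: lt_le_trans A0 AB.
- apply: le_trans G1; rewrite fubini_tonelli1//.
  + rewrite le_eqVlt; apply/orP; left; apply/eqP; apply: eq_integral => x _.
    by rewrite /fubini_F /g1 -ExE.
  + exact/measurable_EFinP.
  + by move=> p; rewrite lee_fin ltW.
Qed.

Let sec x y := G (x, y) / g1 x.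

Let tsec x : test (sec x).
Proof.
split.
- by apply: measurable_funM.
- have := ltW A0 => A0'; have n0 := n2_ge0 x; have n0' : 0 <= A * n2 x by rewrite mulr_ge0.
  pose C := A + A * n2 x + `|ln (g1 x)|.
  have AC : A <= C by rewrite /C -addrA lerDl addr_ge0.
  have C0 : 0 < C by exact: lt_le_trans A0 AC.
  exists C => // y; have y0 := n2_ge0 y.
  have -> : sec x y = G (x, y) * expR (- ln (g1 x)) by rewrite expRN lnK ?posrE.
  have := ler_norm (ln (g1 x)); have := ler_norm (- ln (g1 x)); rewrite normrN => h1 h2.
  apply/andP; split.
  + rewrite (le_trans _ (ler_wpM2r (expR_ge0 _) (lb x y)))// -!expRD ler_expR.
    have h3 : A * n2 y <= C * n2 y by rewrite ler_wpM2r.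
    by rewrite /C in h3 *; lra.
  + rewrite (le_trans (ler_wpM2r (expR_ge0 _) (ub x y)))// -!expRD ler_expR.
    have h3 : n2 y / C <= n2 y / A by rewrite ler_wpM2l// lef_pV2 ?posrE.
    have h4 : 0 <= n2 x / A by rewrite divr_ge0.
    by move: h3; move: (n2 y / C) => z; rewrite /C; lra.
- rewrite (_ : (fun y => _) = (fun y => (((g1 x)^-1 * G (x, y))%:E))); last first.
    by apply/funext => y; rewrite mulrC.
  by rewrite ExE ?ExZ ?mulVf ?gt_eqF//; exact: intgZ.
Qed.

(** Chain rule [ln G = ln g1 + ln (sec x)]: of the two means [a] and [b], the larger is at least
    half of their sum. If it is [b], some single section does as well as the average up to [e / 2],
    and that section is the test; this choice is the only loss. *)
Lemma test_split e : 0 < e -> exists2 g, test g &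
  2 * - Ex P (fun x => ln (g x)) <= - Ex (P \x P)%E (fun p => ln (G p)) + e.
Proof.
move=> e0.
have iG : intg (P \x P)%E (fun p => ln (G p)).
  apply: (intg_quad2 (A := A)) => //; first exact: measurableT_comp.
  by move=> p; apply: ln_norm_bound => //; exact: nn2_ge0.
have lnsec x y : ln (G (x, y)) = ln (g1 x) + ln (sec x y).
  by rewrite -lnM ?posrE ?divr_gt0// /sec mulrC divfK ?gt_eqF.
have isec x : intg P (fun y => ln (sec x y)) by exact: intg_ln_test.
have iGx x : intg P (fun y => ln (G (x, y))).
  by under [fun y => _]eq_fun do rewrite lnsec; apply: intgD => //; exact: intg_cst.
have ig1 : intg P (fun x => ln (g1 x)) by exact: intg_ln_test.
have E1 x : Ex P (fun y => ln (G (x, y))) = ln (g1 x) + Ex P (fun y => ln (sec x y)).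
  rewrite -[in RHS](Ex_cst P (ln (g1 x))) -ExD//; last exact: intg_cst.
  by apply: eq_Ex => y; rewrite lnsec.
have iL : intg P (fun x => Ex P (fun y => ln (sec x y))).
  have -> : (fun x => Ex P (fun y => ln (sec x y))) =
      (fun x => Ex P (fun y => ln (G (x, y))) - ln (g1 x)).
    by apply/funext => x; rewrite E1 addrC addKr.
  by apply: intgB => //; exact: (intg_fst iG).
have -> : Ex (P \x P)%E (fun p => ln (G p)) =
    Ex P (fun x => ln (g1 x)) + Ex P (fun x => Ex P (fun y => ln (sec x y))).
  by rewrite (Ex_fst iG)// -ExD//; apply: eq_Ex => x; rewrite E1.
set a := Ex P (fun x => ln (g1 x)); set b := Ex P _.
have [ab|ab] := leP b a.
  by exists g1 => //; rewrite -/a; lra.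
have [[x hx]|/forallNP hx] := pselect (exists x, - Ex P (fun y => ln (sec x y)) <= - b + e / 2).
  by exists (sec x) => //; lra.
have : Ex P (fun x => Ex P (fun y => ln (sec x y))) <= Ex P (fun=> b - e / 2).
  apply: Ex_le => //; first exact: intg_cst.
  by move=> x; move/negP: (hx x); rewrite -ltNge; lra.
by rewrite Ex_cst -/b; lra.
Qed.

End split.

Section entropy_chain.
Context (R : realType) (m : nat) (K : finType).
Notation T := (m.-tuple R).

Lemma expR_jensen (w y : K -> R) : (forall k, 0 <= w k) -> \sum_k w k = 1 ->
  expR (\sum_k w k * y k) <= \sum_k w k * expR (y k).
Proof.
move=> w0 w1; set b := \sum_k w k * y k.
have h k : w k * (expR b * (1 + (y k - b))) <= w k * expR (y k).
  rewrite ler_wpM2l//.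
  have -> : expR (y k) = expR b * expR (y k - b) by rewrite -expRD; congr expR; ring.
  by rewrite ler_wpM2l ?expR_ge0// expR_ge1Dx.
apply: le_trans (ler_sum _ (fun k _ => h k)).
have -> : \sum_k w k * (expR b * (1 + (y k - b))) =
    \sum_k (expR b * (1 - b) * w k + expR b * (w k * y k)).
  by apply: eq_bigr => k _; ring.
by rewrite big_split /= -!mulr_sumr w1 -/b; lra.
Qed.

(** The test on pairs is the product of [g(u)] and the geometric mean of the [gk(v)] with weights
    [F k (u)]: its logarithm is exactly the sum wanted. By the arithmetic-geometric inequality it
    lies below [g(u)] times the arithmetic mean, whose mass is at most one because the rotation
    preserves Lebesgue measure. [test_split] then returns to one variable. *)
Lemma entropy_chain (P : probability T R) (g : T -> R) (gk F : K -> T -> R) e :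
  law2 P -> test g -> (forall k, test (gk k)) ->
  (forall k, measurable_fun setT (F k)) -> (forall k x, 0 <= F k x) ->
  (forall x, \sum_k F k x = 1) -> 0 < e ->
  exists2 g', test g' & 2 * - Ex P (fun x => ln (g' x)) <=
    - Ex (P \x P)%E (fun p => ln (g (uu p)))
    - \sum_k Ex (P \x P)%E (fun p => F k (uu p) * ln (gk k (vv p))) + e.
Proof.
move=> P2 tg tk mF F0 F1 e0.
pose L p := ln (g (uu p)) + \sum_k F k (uu p) * ln (gk k (vv p)).
have mL1 : measurable_fun setT (fun p : T * T => ln (g (uu p))).
  by apply: (measurableT_comp (test_meas_ln tg)); exact: meas_uu.
have mLk k : measurable_fun setT (fun p : T * T => F k (uu p) * ln (gk k (vv p))).
  apply: measurable_funM; first by apply: measurableT_comp => //; exact: meas_uu.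
  by apply: (measurableT_comp (test_meas_ln (tk k))); exact: meas_vv.
have mL : measurable_fun setT L by apply: measurable_funD => //; exact: measurable_sum.
have F_le1 k x : F k x <= 1 by rewrite -(F1 x) (bigD1 k)//= lerDl sumr_ge0.
have [A [A0 tA kA]] : exists A : R, [/\ 0 < A,
    forall x, expR (- A * (1 + n2 x)) <= g x <= expR (A - n2 x / A) &
    forall k x, expR (- A * (1 + n2 x)) <= gk k x <= expR (A - n2 x / A)].
  have mono (A B : R) f : 0 < A -> A <= B ->
      (forall x : T, expR (- A * (1 + n2 x)) <= f x <= expR (A - n2 x / A)) ->
      (forall x : T, expR (- B * (1 + n2 x)) <= f x <= expR (B - n2 x / B)).
    move=> A0 AB h x; have /andP[h1 h2] := h x; have n0 := n2_ge0 x.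
    apply/andP; split.
      apply: le_trans h1; rewrite ler_expR !mulNr lerN2 ler_wpM2r//.
      by rewrite addr_ge0.
    apply: (le_trans h2); rewrite ler_expR lerB// ler_wpM2l// lef_pV2 ?posrE//.
    exact: lt_le_trans AB.
  have [_ [A A0 gA] _] := tg.
  have /choice[B hB] : forall k, exists B : R, 0 < B /\
      forall x, expR (- B * (1 + n2 x)) <= gk k x <= expR (B - n2 x / B).
    by move=> k; have [_ [B B0 kB] _] := tk k; exists B.
  (* The bounds weaken as the constant grows, so the sum serves all tests. *)
  exists (A + \sum_k B k); split.
  - by rewrite ltr_wpDr// sumr_ge0// => k _; rewrite ltW//; case: (hB k).
  - by apply: (mono A) => //; rewrite lerDl sumr_ge0// => k _; rewrite ltW//; case: (hB k).
  - move=> k; have [Bk0 hk] := hB k; apply: (mono (B k)) => //.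
    rewrite (bigD1 k)//= addrCA lerDl addr_ge0 ?(ltW A0)// sumr_ge0// => j _.
    by rewrite ltW//; case: (hB j).
have Lb p : - (2 * A) * (1 + nn2 p) <= L p <= 2 * A - nn2 p / A.
  have /(ln_bounds A0 (n2_ge0 _))/andP[l1 l2] := tA (uu p).
  have hk k := ln_bounds A0 (n2_ge0 _) (kA k (vv p)).
  have s1 : - A * (1 + n2 (vv p)) <= \sum_k F k (uu p) * ln (gk k (vv p)).
    rewrite (_ : - A * _ = \sum_k F k (uu p) * (- A * (1 + n2 (vv p)))) ?ler_sum// => [k _|]; last by rewrite -mulr_suml F1 mul1r.
    by rewrite ler_wpM2l//; case/andP: (hk k).
  have s2 : \sum_k F k (uu p) * ln (gk k (vv p)) <= A - n2 (vv p) / A.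
    rewrite (_ : A - _ = \sum_k F k (uu p) * (A - n2 (vv p) / A)) ?ler_sum// => [k _|]; last by rewrite -mulr_suml F1 mul1r.
    by rewrite ler_wpM2l//; case/andP: (hk k).
  have nr := n2_rot p; have := mulr_ge0 (ltW A0) (nn2_ge0 p).
  have -> : nn2 p = n2 (uu p) + n2 (vv p) by rewrite nr.
  by rewrite /L mulrDl => h; apply/andP; split; lra.
pose G p := expR (L p).
have mG : measurable_fun setT G by apply: measurableT_comp.
have A20 : 0 < 2 * A by rewrite mulr_gt0.
have GB p : expR (- (2 * A) * (1 + nn2 p)) <= G p <= expR (2 * A - nn2 p / (2 * A)).
  rewrite !ler_expR; have /andP[-> h] := Lb p; apply: (le_trans h).
  by rewrite lerB// ler_wpM2l ?nn2_ge0// lef_pV2 ?posrE//; lra.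
have G1 : (\int[leb R m \x leb R m]_p (G p)%:E <= 1)%E.
  pose H (p : T * T) := g p.1 * \sum_k F k p.1 * gk k p.2.
  have mH : measurable_fun setT H.
    apply: measurable_funM; first by apply: (measurableT_comp (test_meas tg)).
    apply: measurable_sum => k; apply: measurable_funM; first exact: measurableT_comp.
    by apply: (measurableT_comp (test_meas (tk k))).
  have H0 p : 0 <= H p.
    rewrite mulr_ge0 ?(ltW (test_gt0 _ tg))// sumr_ge0// => k _.
    by rewrite mulr_ge0// ltW// test_gt0.
  apply: (@le_trans _ _ (\int[leb R m \x leb R m]_p (H (uu p, vv p))%:E)%E).
    apply: ge0_le_integral => //.
    - by move=> p _; rewrite lee_fin expR_ge0.
    - exact/measurable_EFinP.
    - apply/measurable_EFinP; apply: (measurableT_comp mH).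
      by apply: measurable_fun_pair; [exact: meas_uu|exact: meas_vv].
    - move=> p _; rewrite lee_fin /G /L expRD lnK ?posrE ?test_gt0//.
      rewrite /H /= ler_wpM2l ?(ltW (test_gt0 _ tg))//.
      apply: (le_trans (expR_jensen _ _ _)) => //.
      by apply: ler_sum => k _; rewrite lnK ?posrE ?test_gt0.
  rewrite (@leb_rot R m (fun p => (H p)%:E))//; last exact/measurable_EFinP.
  rewrite fubini_tonelli1//; last exact/measurable_EFinP.
  have [_ _ g1] := tg; apply: le_trans g1; apply: ge0_le_integral => //.
  - by move=> x _; apply: integral_ge0 => y _; rewrite lee_fin.
  - by apply: (measurable_fun_fubini_tonelli_F (EFin \o H)) => //; exact/measurable_EFinP.
  - by apply/measurable_EFinP; exact: test_meas.
  move=> x _; rewrite /fubini_F /H /=.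
  have gx := ltW (test_gt0 x tg).
  under eq_integral do rewrite EFinM -sumEFin.
  rewrite ge0_integralZl_EFin//; last 2 first.
  - by move=> y _; apply: sume_ge0 => k _; rewrite lee_fin mulr_ge0// ltW// test_gt0.
  - apply: emeasurable_sum => k; apply/measurable_EFinP; apply: measurable_funM => //.
    exact: test_meas.
  rewrite -[leRHS]mule1 lee_wpmul2l ?lee_fin//.
  rewrite ge0_integral_sum//; last 2 first.
  - by move=> k; apply/measurable_EFinP; apply: measurable_funM => //; exact: test_meas.
  - by move=> k y _; rewrite lee_fin mulr_ge0// ltW// test_gt0.
  rewrite -[1%E]/(1%:E) -(F1 x) -sumEFin; apply: lee_sum => k _.
  under eq_integral do rewrite EFinM.
  rewrite ge0_integralZl_EFin//; last 2 first.
  - by move=> y _; rewrite lee_fin ltW// test_gt0.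
  - by apply/measurable_EFinP; exact: test_meas.
  by rewrite -[leRHS]mule1 lee_wpmul2l ?lee_fin//; case: (tk k).
have [g' tg' hg'] := test_split P2 mG A20 GB G1 e0.
exists g' => //; apply: (le_trans hg'); rewrite lerD2r.
have i1 : intg (P \x P)%E (fun p => ln (g (uu p))).
  apply: (intg_quad2 (A := A)) => // p.
  apply: (le_trans (ln_norm_bound A0 (n2_ge0 _) (tA _))).
  by rewrite ler_pM2l// lerD2l n2_uu_le.
have ik k : intg (P \x P)%E (fun p => F k (uu p) * ln (gk k (vv p))).
  apply: (intg_quad2 (A := A)) => // p.
  rewrite normrM ger0_norm//.
  apply: (@le_trans _ _ (1 * `|ln (gk k (vv p))|)); first by rewrite ler_wpM2r.
  rewrite mul1r (le_trans (ln_norm_bound A0 (n2_ge0 _) (kA _ _)))//.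
  by rewrite ler_pM2l// lerD2l n2_vv_le.
rewrite -opprD lerN2 -Ex_sum// -ExD//; last exact: intg_sum.
by rewrite /G le_eqVlt; apply/orP; left; apply/eqP; apply: eq_Ex => p; rewrite expRK.
Qed.

End entropy_chain.

(** * Decompositions *)

(** Pieces of mass zero are kept in decompositions; their weighted integrals vanish, whatever law is
    attached to them. *)
Lemma Ex_weight0 d (T : measurableType d) (R : realType) (mu : {measure set T -> \bar R})
    (F f : T -> R) : (forall x, 0 <= F x) -> intg mu F -> Ex mu F = 0 ->
  intg mu (fun x => F x * f x) -> Ex mu (fun x => F x * f x) = 0.
Proof.
move=> F0 iF EF iFf.
have mF : measurable_fun setT (EFin \o F) by apply/measurable_EFinP; exact: intg_meas iF.
have /(ae_eq_integral_abs mu measurableT mF) ae0 : (\int[mu]_x `|(EFin \o F) x| = 0)%E.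
  under eq_integral do rewrite /= ger0_norm//.
  by rewrite ExE// EF.
rewrite /Ex /Rintegral (ae_eq_integral (cst 0%E)) ?integral0//.
- by apply/measurable_EFinP; exact: intg_meas iFf.
- by apply: filterS ae0 => x h _; have := h I => /= -[] ->; rewrite mul0r.
Qed.

Section laws.
Context (R : realType) (m : nat).
Notation T := (m.-tuple R).
Implicit Types (P : probability T R) (f F : T -> R).

(** Laws are compared on these functions only: every law with second moments integrates them, and
    they include coordinates, products of two coordinates and bounded functions. Evenness is read on
    the same class. *)
Definition quad f : Prop :=
  measurable_fun setT f /\ exists A : R, forall x, `|f x| <= A * (1 + n2 x).

Definition negt (x : T) : T := [tuple - tnth x j | j < m].

Definition evenl P : Prop := forall f, quad f -> Ex P (fun x => f (negt x)) = Ex P f.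

Definition mean0 P : Prop := forall j, Ex P (fun x => tnth x j) = 0.

Lemma quad_intg P f : law2 P -> quad f -> intg P f.
Proof. by move=> P2 [mf [A fA]]; exact: intg_quad fA. Qed.

Lemma n2_coord (x : T) j : tnth x j ^+ 2 <= n2 x.
Proof. by rewrite /n2 (bigD1 j)//= lerDl sumr_ge0// => i _; rewrite sqr_ge0. Qed.

Lemma norm_mul_le (a b : R) : `|a * b| <= (a ^+ 2 + b ^+ 2) / 2.
Proof.
rewrite normrM -(real_normK (num_real a)) -(real_normK (num_real b)).
by have := sqr_ge0 (`|a| - `|b|); rewrite sqrrB; lra.
Qed.

Lemma norm_coord (x : T) j : `|tnth x j| <= 1 + n2 x.
Proof.
have := norm_mul_le (tnth x j) 1; rewrite mulr1; have := n2_coord x j.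
by have := n2_ge0 x; rewrite expr1n; lra.
Qed.

Lemma quad_coord j : quad (fun x : T => tnth x j).
Proof.
by split; [exact: measurable_tnth|exists 1 => x; rewrite mul1r norm_coord].
Qed.

Lemma quad_coord2 j j' : quad (fun x : T => tnth x j * tnth x j').
Proof.
split; first by apply: measurable_funM; exact: measurable_tnth.
exists 1 => x; rewrite mul1r; apply: (le_trans (norm_mul_le _ _)).
by have := n2_coord x j; have := n2_coord x j'; lra.
Qed.

Lemma quad_bdM (F f : T -> R) (B : R) : measurable_fun setT F ->
  (forall x, `|F x| <= B) -> quad f -> quad (fun x => f x * F x).
Proof.
move=> mF FB [mf [A fA]]; split; first exact: measurable_funM.
exists (A * B) => x; rewrite normrM mulrAC.
by rewrite ler_pM.
Qed.

Lemma quad_bd F (B : R) : measurable_fun setT F -> (forall x, `|F x| <= B) -> quad F.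
Proof.
move=> mF FB; split => //; exists B => x; apply: (le_trans (FB x)).
have := n2_ge0 x; have : 0 <= B by exact: le_trans (normr_ge0 _) (FB x).
by move=> B0 n0; rewrite mulrDr mulr1 lerDl mulr_ge0.
Qed.

Lemma quadD f g : quad f -> quad g -> quad (fun x => f x + g x).
Proof.
move=> [mf [A fA]] [mg [B gB]]; split; first exact: measurable_funD.
by exists (A + B) => x; rewrite mulrDl (le_trans (ler_normD _ _))// lerD.
Qed.

Lemma quadZ k f : quad f -> quad (fun x => k * f x).
Proof.
move=> [mf [A fA]]; split; first exact: measurable_funM.
by exists (`|k| * A) => x; rewrite normrM -mulrA ler_wpM2l.
Qed.

Lemma quad_sum (I : Type) (r : seq I) (G : I -> T -> R) : (forall i, quad (G i)) ->
  quad (fun x => \sum_(i <- r) G i x).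
Proof.
move=> qG; elim: r => [|i r ih].
  have -> : (fun x : T => \sum_(i <- [::]) G i x) = (fun=> 0).
    by apply/funext => x; rewrite big_nil.
  by apply: (@quad_bd _ 0) => // x; rewrite normr0.
have -> : (fun x : T => \sum_(j <- i :: r) G j x) = (fun x => G i x + \sum_(j <- r) G j x).
  by apply/funext => x; rewrite big_cons.
exact: quadD.
Qed.

Lemma quad_n2 : quad (@n2 R m).
Proof.
split; first exact: meas_n2.
by exists 1 => x; rewrite mul1r ger0_norm ?n2_ge0// lerDr.
Qed.

Lemma quad2_intg P (h : T * T -> R) A : law2 P -> measurable_fun setT h ->
  (forall p, `|h p| <= A * (1 + nn2 p)) ->
  [/\ intg (P \x P)%E h, forall x, intg P (fun y => h (x, y)) &
      forall y, intg P (fun x => h (x, y))].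
Proof.
move=> P2 mh hA; split; first exact: intg_quad2 hA.
- move=> x; apply: (@intg_dom _ _ _ _ _ (fun y => A * (1 + n2 x) + A * n2 y)).
  + exact: measurableT_comp.
  + by apply: intgD; [exact: intg_cst|exact: intgZ].
  + by move=> y; apply: (le_trans (hA _)); rewrite /nn2 /= addrA mulrDr.
- move=> y; apply: (@intg_dom _ _ _ _ _ (fun x => A * (1 + n2 y) + A * n2 x)).
  + exact: measurableT_comp.
  + by apply: intgD; [exact: intg_cst|exact: intgZ].
  + by move=> x; apply: (le_trans (hA _)); rewrite /nn2 /= addrCA addrC mulrDr addrC.
Qed.

Lemma bd_uu_vv (F f : T -> R) : measurable_fun setT F -> (forall x, 0 <= F x <= 1) ->
  quad f -> measurable_fun setT (fun p => F (uu p) * f (vv p)) /\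
  exists A : R, forall p, `|F (uu p) * f (vv p)| <= A * (1 + nn2 p).
Proof.
move=> mF F01 [mf [A fA]]; split.
  by apply: measurable_funM; apply: measurableT_comp => //; [exact: meas_uu|exact: meas_vv].
exists A => p; have /andP[F0 F1] := F01 (uu p).
have A0 : 0 <= A.
  have := le_trans (normr_ge0 _) (fA (vv p)).
  by rewrite pmulr_lge0// ltr_wpDr ?n2_ge0.
rewrite normrM ger0_norm//; apply: (@le_trans _ _ (1 * `|f (vv p)|)); first by rewrite ler_wpM2r.
by rewrite mul1r (le_trans (fA _))// ler_wpM2l// lerD2l n2_vv_le.
Qed.

(** [Q] is the law of [v] under the weight [F (u) / a]. Exchanging the two copies fixes [u] and
    negates [v], hence evenness, whether or not [P] is even. *)
Lemma law_v_ex P (F : T -> R) a : law2 P -> measurable_fun setT F ->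
  (forall x, 0 <= F x <= 1) -> Ex (P \x P)%E (fun p => F (uu p)) = a ->
  exists Q : probability T R, [/\ law2 Q, evenl Q &
    forall f, quad f -> a * Ex Q f = Ex (P \x P)%E (fun p => F (uu p) * f (vv p))].
Proof.
move=> P2; wlog a0 : F a / 0 < a => [hw mF F01 Fa|mF F01 Fa].
  have [a0|] := ltP 0 a; first exact: hw.
  move=> a0.
  have mFu : measurable_fun setT (fun p : T * T => F (uu p)).
    by apply: measurableT_comp => //; exact: meas_uu.
  have F01' p : `|F (uu p)| <= 1 by have /andP[? ?] := F01 (uu p); rewrite ger0_norm.
  have iF : intg (P \x P)%E (fun p => F (uu p)) by exact: (@intg_bd _ _ _ (P \x P)%E) F01'.
  have az : a = 0.
    by apply/eqP; rewrite eq_le a0 -Fa Ex_ge0// => p; have /andP[] := F01 (uu p).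
  (* For [a = 0] both sides of the identity vanish, and the unweighted law of [v] is a valid
     choice. *)
  have [|//|x||Q [Q2 Qe _]] := hw (fun=> 1) 1.
  - by rewrite ltr01.
  - by rewrite lexx ler01.
  - by rewrite (@Ex_cst _ _ _ (P \x P)%E).
  exists Q; split => // f qf; rewrite az mul0r; apply/esym.
  have [mf [A fA]] := bd_uu_vv mF F01 qf.
  have [iff _ _] := quad2_intg P2 mf fA.
  apply: (Ex_weight0 (mu := (P \x P)%E)) => // [p|]; first by have /andP[] := F01 (uu p).
  by rewrite Fa.
pose W p := a^-1 * F (uu p).
have mW : measurable_fun setT W.
  by apply: measurable_funM => //; apply: measurableT_comp => //; exact: meas_uu.
have W0 p : 0 <= W p by have /andP[? _] := F01 (uu p); rewrite mulr_ge0// invr_ge0 ltW.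
have iW : intg (P \x P)%E W.
  apply: (@intg_bd _ _ _ (P \x P)%E _ a^-1) => // p; have /andP[? ?] := F01 (uu p).
  by rewrite ger0_norm// -[leRHS]mulr1 ler_wpM2l// invr_ge0 ltW.
have W1 : (\int[(P \x P)%E]_p (W p)%:E = 1)%E.
  rewrite ExE// ExZ ?Fa ?mulVf ?gt_eqF//.
  by move: iW => /(intgZ a); apply: eq_intg => p; rewrite mulrA mulfV ?mul1r ?gt_eqF.
have [Q HQ] := wlawP mW W0 W1 (@meas_vv R m).
have HQ' f : quad f -> intg Q f /\ a * Ex Q f = Ex (P \x P)%E (fun p => F (uu p) * f (vv p)).
  move=> qf; have [mf [A fA]] := bd_uu_vv mF F01 qf.
  have [iff _ _] := quad2_intg P2 mf fA.
  have e p : W p * f (vv p) = a^-1 * (F (uu p) * f (vv p)) by rewrite mulrA.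
  have [| |? ->] := HQ f; first by case: qf.
    by apply: (eq_intg _ (intgZ a^-1 iff)) => p; rewrite e.
  by split => //; rewrite (eq_Ex _ e) ExZ// mulVKf// gt_eqF.
exists Q; split.
- by have [] := HQ' _ quad_n2.
- move=> f qf.
  have qn : quad (fun x => f (negt x)).
    have [mf [A fA]] := qf; split.
      apply: measurableT_comp => //; apply: meas_tuple => j.
      under eq_fun do rewrite tnth_mktuple; apply: measurableT_comp => //; exact: measurable_tnth.
    exists A => x; rewrite (le_trans (fA _))//.
    rewrite (_ : n2 (negt x) = n2 x)//; apply: eq_bigr => j _.
    by rewrite tnth_mktuple sqrrN.
  apply: (mulfI (x := a)); first by rewrite gt_eqF.
  have [_ ->] := HQ' _ qf; have [_ ->] := HQ' _ qn.
  have [mf1 [A1 fA1]] := bd_uu_vv mF F01 qf; have [i1 i2 i3] := quad2_intg P2 mf1 fA1.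
  have [mf2 [A2 fA2]] := bd_uu_vv mF F01 qn; have [j1 j2 j3] := quad2_intg P2 mf2 fA2.
  rewrite (Ex_fst j1 j2) (Ex_snd i1 i3); apply: eq_Ex => x; apply: eq_Ex => y.
  congr (F _ * f _); apply: eq_from_tnth => j; rewrite !tnth_mktuple /=.
    by rewrite addrC.
  by rewrite -mulNr opprB.
- by move=> f qf; have [] := HQ' _ qf.
Qed.

End laws.

Section decomposition.
Context (R : realType) (n : nat) (d : 'I_n -> nat).
Notation T i := ((d i).-tuple R).
Notation I := {i : 'I_n & 'I_(d i)}.
Notation laws := (forall i, probability (T i) R).
Variable q : I -> I -> R.

Definition is_dec (mu : laws) (K : finType) (F : K -> forall i, T i -> R) (a : K -> R) : Prop :=
  [/\ forall k i, measurable_fun setT (F k i), forall k i x, 0 <= F k i x,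
      forall i x, \sum_k F k i x = 1 & forall k i, Ex (mu i) (F k i) = a k].

Definition mom (mu : laws) (f : forall i, T i -> R) (p : I) : R :=
  Ex (mu (tag p)) (fun x => tnth x (tagged p) * f (tag p) x).

Definition bq (x y : I -> R) : R := \sum_p \sum_p' x p * q p p' * y p'.

(* When [q] is positive semidefinite, a mixture with weights [a k] of couplings of the laws
   [F k i mu_i / a k] has [E q(x, x) >= Val], for any centers [xi]. *)
Definition Val (mu : laws) (K : finType) (F : K -> forall i, T i -> R)
    (a : K -> R) (xi : K -> I -> R) : R :=
  \sum_k (2 * bq (mom mu (F k)) (xi k) - a k * bq (xi k) (xi k)).

Lemma val_alg (v A1 B1 A2 B2 : R) :
  2 * A1 - v * B1 + (2 * A2 - v * B2) = 2 * (A1 + A2) - v * (B1 + B2).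
Proof. ring. Qed.

Lemma val_alg2 (v1 v2 A1 A2 B : R) :
  2 * A1 - v1 * B + (2 * A2 - v2 * B) = 2 * (A1 + A2) - (v1 + v2) * B.
Proof. ring. Qed.

Lemma bq_suml (J : finType) (x : J -> I -> R) y :
  bq (fun p => \sum_j x j p) y = \sum_j bq (x j) y.
Proof.
rewrite /bq [RHS]exchange_big /=; apply: eq_bigr => p _; rewrite [RHS]exchange_big /=.
by apply: eq_bigr => p' _; rewrite -!mulr_suml.
Qed.

Lemma bq_sumb x y z : bq (fun p => x p + y p) z = bq x z + bq y z.
Proof.
rewrite /bq -big_split; apply: eq_bigr => p _; rewrite -big_split.
by apply: eq_bigr => p' _; rewrite /= !mulrDl.
Qed.

Lemma bqZl c x y : bq (fun p => c * x p) y = c * bq x y.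
Proof.
rewrite /bq mulr_sumr; apply: eq_bigr => p _; rewrite mulr_sumr.
by apply: eq_bigr => p' _; rewrite !mulrA.
Qed.

Lemma bq_rot (x y z w : I -> R) :
  bq (fun p => (x p + y p) / Num.sqrt 2) (fun p => (z p + w p) / Num.sqrt 2) +
  bq (fun p => (x p - y p) / Num.sqrt 2) (fun p => (z p - w p) / Num.sqrt 2) =
  bq x z + bq y w.
Proof.
rewrite /bq -!big_split; apply: eq_bigr => p _ /=.
rewrite -!big_split; apply: eq_bigr => p' _ /=.
have := @s2_sqr R; have := @s2_neq0 R; move: (Num.sqrt 2) => s s0 s2.
rewrite -[RHS](mulfK (mulf_neq0 s0 s0)) -[s * s]/(s ^+ 2) s2.
have -> : (x p + y p) / s * q p p' * ((z p' + w p') / s) +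
  (x p - y p) / s * q p p' * ((z p' - w p') / s) =
  (2 * (x p * q p p' * z p' + y p * q p p' * w p')) / s ^+ 2 by field.
by rewrite s2; field.
Qed.

Lemma dec_le1 mu K F a (D : @is_dec mu K F a) k i x : 0 <= F k i x <= 1.
Proof.
have [_ F0 F1 _] := D; rewrite F0 -(F1 i x) (bigD1 k)//= lerDl.
by rewrite sumr_ge0.
Qed.

Lemma dec_norm1 mu K F a (D : @is_dec mu K F a) k i x : `|F k i x| <= 1.
Proof. by have /andP[F0 F1] := dec_le1 D k x; rewrite ger0_norm. Qed.

Lemma dec_quad mu K F a (D : @is_dec mu K F a) k i : quad (F k i).
Proof. by apply: (@quad_bd _ _ _ 1); [case: D|move=> x; exact: (dec_norm1 D k x)]. Qed.

Lemma dec_a_ge0 mu K F a (D : @is_dec mu K F a) (i0 : 'I_n) k : 0 <= a k.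
Proof. by have [_ F0 _ Fa] := D; rewrite -(Fa k i0); exact: Ex_ge0. Qed.

Lemma dec_a_sum mu K F a (D : @is_dec mu K F a) (i0 : 'I_n) : \sum_k a k = 1.
Proof.
have [mF F0 F1 Fa] := D.
have -> : \sum_k a k = \sum_k Ex (mu i0) (F k i0) by apply: eq_bigr => k _; rewrite Fa.
rewrite -Ex_sum; last by move=> k _; apply: (@intg_bd _ _ _ _ _ 1) => [|x]; [exact: mF|exact: (dec_norm1 D k x)].
by rewrite -[RHS](Ex_cst (mu i0) 1); apply: eq_Ex => x; rewrite F1.
Qed.

Lemma dec_trivial mu : @is_dec mu unit (fun _ _ _ => 1) (fun=> 1).
Proof.
split => // [i x|k i]; first by rewrite big_const card_unit /= addr0.
by rewrite Ex_cst.
Qed.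

End decomposition.

(** * Doubling of decompositions *)

Section decomposition_chain.
Context (R : realType) (n : nat) (d : 'I_n -> nat).
Notation T i := ((d i).-tuple R).
Notation I := {i : 'I_n & 'I_(d i)}.
Notation laws := (forall i, probability (T i) R).
Variable q : I -> I -> R.
Unset Implicit Arguments.
Variables (mu P : laws) (K : finType) (F : K -> forall i, T i -> R) (a : K -> R)
  (xi : K -> I -> R).
Hypotheses (mu2 : forall i, law2 (mu i))
  (PE : forall i f, quad f -> Ex (P i) f = Ex (mu i \x mu i)%E (fun p => f (uu p)))
  (DP : is_dec P F a).
Variables (Q : K -> laws) (L : K -> finType) (G : forall k, L k -> forall i, T i -> R)
  (b : forall k, L k -> R) (zeta : forall k, L k -> I -> R).
Hypotheses
  (QE : forall k i f, quad f ->
    a k * Ex (Q k i) f = Ex (mu i \x mu i)%E (fun p => F k i (uu p) * f (vv p)))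
  (DQ : forall k, is_dec (Q k) (@G k) (@b k)).

Notation KL := {k : K & L k}.

Let F01 k i x : 0 <= F k i x <= 1. Proof. exact: (dec_le1 DP k x). Qed.
Let G01 k l i x : 0 <= @G k l i x <= 1. Proof. exact: (dec_le1 (DQ k) l x). Qed.
Let mF k i : measurable_fun setT (F k i). Proof. by case: DP. Qed.
Let mG k l i : measurable_fun setT (@G k l i). Proof. by case: (DQ k). Qed.

Let H (c : KL) i (p : T i * T i) := F (tag c) i (uu p) * G (tag c) (tagged c) i (vv p).

Let mH c i : measurable_fun setT (H c i).
Proof.
rewrite /H; apply: measurable_funM.
  exact: (measurableT_comp (mF _ _) (@meas_uu _ _)).
exact: (measurableT_comp (mG _ _ _) (@meas_vv _ _)).
Qed.

Let H01 c i p : 0 <= H c i p <= 1.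
Proof.
have /andP[f0 f1] := F01 (tag c) i (uu p); have /andP[g0 g1] := G01 (tag c) (tagged c) i (vv p).
by rewrite mulr_ge0// mulr_ile1.
Qed.

Let Hn c i p : `|H c i p| <= 1.
Proof. by have /andP[h0 h1] := H01 c i p; rewrite ger0_norm. Qed.

Let Hq c i (f : T i * T i -> R) A : measurable_fun setT f ->
  (forall p, `|f p| <= A * (1 + nn2 p)) ->
  measurable_fun setT (fun p => f p * H c i p) /\
  forall p, `|f p * H c i p| <= A * (1 + nn2 p).
Proof.
move=> mf fA; split; first exact: (measurable_funM mf (mH c i)).
move=> p; rewrite normrM -[leRHS]mulr1 ler_pM//.
Qed.

Let H_intg c i : [/\ intg (mu i \x mu i)%E (H c i), forall x, intg (mu i) (fun y => H c i (x, y)) &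
  forall y, intg (mu i) (fun x => H c i (x, y))].
Proof.
apply: (quad2_intg (A := 1) (mu2 i) (mH c i)) => p; rewrite mul1r (le_trans (Hn c i p))// lerDl.
exact: nn2_ge0.
Qed.

Let H1 i p : \sum_c H c i p = 1.
Proof.
rewrite -[LHS](sig_big_dep (fun=> true) (fun _ _ => true) (fun k l => F k i (uu p) * G k l i (vv p))) /=.
have [_ _ F1 _] := DP; rewrite -(F1 i (uu p)); apply: eq_bigr => k _.
by rewrite -mulr_sumr; have [_ _ G1 _] := DQ k; rewrite G1 mulr1.
Qed.

Let w (c : KL) := a (tag c) * b (tag c) (tagged c).

Let Hw c i : Ex (mu i \x mu i)%E (H c i) = w c.
Proof.
have [_ _ _ Gb] := DQ (tag c); rewrite /w -(Gb (tagged c) i) QE//.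
exact: dec_quad (DQ (tag c)) _ _.
Qed.

(** Integrating the weights [H c] of pairs over one copy or over the other gives two partitions of
    unity for [mu], both of masses [w]. *)
Let F1 (c : KL) i x := Ex (mu i) (fun y => H c i (x, y)).
Let F2 (c : KL) i y := Ex (mu i) (fun x => H c i (x, y)).

Let D1 : is_dec mu F1 w.
Proof.
split.
- by move=> c i; have [h1 h2 h3] := H_intg c i; exact: (intg_meas (intg_fst h1 h2)).
- by move=> c i x; apply: Ex_ge0 => y; have /andP[] := H01 c i (x, y).
- move=> i x; rewrite -Ex_sum; last by move=> c _; have [h1 h2 h3] := H_intg c i.
  by rewrite -[RHS](Ex_cst (mu i) 1); apply: eq_Ex => y; rewrite H1.
- by move=> c i; have [h1 h2 h3] := H_intg c i; rewrite -(Ex_fst h1 h2) Hw.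
Qed.

Let D2 : is_dec mu F2 w.
Proof.
split.
- by move=> c i; have [h1 h2 h3] := H_intg c i; exact: (intg_meas (intg_snd h1 h3)).
- by move=> c i x; apply: Ex_ge0 => y; have /andP[] := H01 c i (y, x).
- move=> i x; rewrite -Ex_sum; last by move=> c _; have [h1 h2 h3] := H_intg c i.
  by rewrite -[RHS](Ex_cst (mu i) 1); apply: eq_Ex => y; rewrite H1.
- by move=> c i; have [h1 h2 h3] := H_intg c i; rewrite -(Ex_snd h1 h3) Hw.
Qed.

Let coordH (g : forall i, T i * T i -> T i) c (p : I) :=
  Ex (mu (tag p) \x mu (tag p))%E (fun z => tnth (g _ z) (tagged p) * H c _ z).

Let norm_tnth_le i (x : T i) j (z : T i * T i) : n2 x <= nn2 z -> `|tnth x j| <= 1 * (1 + nn2 z).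
Proof. by move=> h; rewrite mul1r (le_trans (norm_coord _ _))// lerD2l. Qed.

(** The centers [(xi, zeta)] belong to the coordinates [(u, v)]; rotating back gives those of the
    first and of the second copy. *)
Let c1 (c : KL) p := (xi (tag c) p + zeta (tag c) (tagged c) p) / Num.sqrt 2.
Let c2 (c : KL) p := (xi (tag c) p - zeta (tag c) (tagged c) p) / Num.sqrt 2.
Let mU c p := coordH (fun i => @uu R (d i)) c p.
Let mV c p := coordH (fun i => @vv R (d i)) c p.

Let iU c (p : I) : intg (mu (tag p) \x mu (tag p))%E (fun z => tnth (uu z) (tagged p) * H c _ z).
Proof.
have mu' : measurable_fun setT (fun z : T (tag p) * T (tag p) => tnth (uu z) (tagged p)).
  by apply: meas_tnth; exact: meas_uu.
have [m h] := Hq c _ _ _ mu' (fun z => norm_tnth_le _ _ (tagged p) _ (n2_uu_le z)).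
by case: (quad2_intg (mu2 (tag p)) m h).
Qed.

Let iV c (p : I) : intg (mu (tag p) \x mu (tag p))%E (fun z => tnth (vv z) (tagged p) * H c _ z).
Proof.
have mu' : measurable_fun setT (fun z : T (tag p) * T (tag p) => tnth (vv z) (tagged p)).
  by apply: meas_tnth; exact: meas_vv.
have [m h] := Hq c _ _ _ mu' (fun z => norm_tnth_le _ _ (tagged p) _ (n2_vv_le z)).
by case: (quad2_intg (mu2 (tag p)) m h).
Qed.

Let mom1 c : mom mu (F1 c) = (fun p => (mU c p + mV c p) / Num.sqrt 2).
Proof.
apply/funext => p; rewrite /mom.
have mf : measurable_fun setT (fun z : T (tag p) * T (tag p) => tnth z.1 (tagged p)).
  exact: meas_tnth.
have nf (z : T (tag p) * T (tag p)) : n2 z.1 <= nn2 z by rewrite lerDl n2_ge0.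
have [m h] := Hq c _ _ _ mf (fun z => norm_tnth_le _ _ (tagged p) _ (nf z)).
have [h1 h2 h3] := quad2_intg (mu2 (tag p)) m h.
have [k1 k2 k3] := H_intg c (tag p).
transitivity (Ex (mu (tag p) \x mu (tag p))%E (fun z => tnth z.1 (tagged p) * H c _ z)).
  by rewrite (Ex_fst h1 h2); apply: eq_Ex => x; rewrite -ExZ.
rewrite mulrC /mU /mV /coordH -ExD// -ExZ; last exact: intgD.
apply: eq_Ex => z; rewrite !tnth_mktuple; move: (H c _ z) (tnth z.1 _) (tnth z.2 _) => h0 x1 x2.
have := @s2_sqr R; have := @s2_neq0 R; move: (Num.sqrt 2) => s s0 s2.
by transitivity (2 * x1 * h0 / s ^+ 2); [rewrite s2; field|field].
Qed.

Let mom2 c : mom mu (F2 c) = (fun p => (mU c p - mV c p) / Num.sqrt 2).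
Proof.
apply/funext => p; rewrite /mom.
have mf : measurable_fun setT (fun z : T (tag p) * T (tag p) => tnth z.2 (tagged p)).
  exact: meas_tnth.
have nf (z : T (tag p) * T (tag p)) : n2 z.2 <= nn2 z by rewrite lerDr n2_ge0.
have [m h] := Hq c _ _ _ mf (fun z => norm_tnth_le _ _ (tagged p) _ (nf z)).
have [h1 h2 h3] := quad2_intg (mu2 (tag p)) m h.
have [k1 k2 k3] := H_intg c (tag p).
transitivity (Ex (mu (tag p) \x mu (tag p))%E (fun z => tnth z.2 (tagged p) * H c _ z)).
  by rewrite (Ex_snd h1 h3); apply: eq_Ex => x; rewrite -ExZ.
rewrite mulrC /mU /mV /coordH -ExB// -ExZ; last exact: intgB.
apply: eq_Ex => z; rewrite !tnth_mktuple; move: (H c _ z) (tnth z.1 _) (tnth z.2 _) => h0 x1 x2.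
have := @s2_sqr R; have := @s2_neq0 R; move: (Num.sqrt 2) => s s0 s2.
by transitivity (2 * x2 * h0 / s ^+ 2); [rewrite s2; field|field].
Qed.

Let sumU k p : \sum_(l : L k) mU (Tagged L l) p = mom P (F k) p.
Proof.
rewrite /mU /coordH -Ex_sum; last by move=> l _; exact: iU.
rewrite /mom PE; last first.
  apply: (quad_bdM (B := 1)) => //; last exact: quad_coord.
  by move=> x; exact: (dec_norm1 DP k x).
apply: eq_Ex => z; rewrite -mulr_sumr; congr (_ * _).
rewrite /H /= -mulr_sumr; have [_ _ G1 _] := DQ k.
by rewrite G1 mulr1.
Qed.

Let momV k (l : L k) p : mV (Tagged L l) p = a k * mom (Q k) (G k l) p.
Proof.
rewrite /mom QE; last first.
  apply: (quad_bdM (B := 1)) => //; last exact: quad_coord.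
  by move=> x; exact: (dec_norm1 (DQ k) l x).
by apply: eq_Ex => z; rewrite /H /= mulrCA.
Qed.

(** The rotation is orthogonal for [bq], so the values of the two decompositions obtained from the
    two copies add up exactly to the left-hand side; the better of the two is kept. *)
Lemma dec_chain (i0 : 'I_n) : exists (J : finType) (F' : J -> forall i, T i -> R) (w' : J -> R)
    (eta : J -> I -> R), is_dec mu F' w' /\
  Val q P F a xi + \sum_k a k * Val q (Q k) (@G k) (@b k) (@zeta k) <= 2 * Val q mu F' w' eta.
Proof.
have E : Val q mu F1 w c1 + Val q mu F2 w c2 =
    Val q P F a xi + \sum_k a k * Val q (Q k) (@G k) (@b k) (@zeta k).
  rewrite /Val -big_split /=.
  transitivity (\sum_(c : KL) (2 * (bq q (mU c) (xi (tag c)) + bq q (mV c) (zeta (tag c) (tagged c))) -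
      w c * (bq q (xi (tag c)) (xi (tag c)) + bq q (zeta (tag c) (tagged c)) (zeta (tag c) (tagged c))))).
    apply: eq_bigr => c _; by rewrite val_alg mom1 mom2 !bq_rot.
  rewrite -(sig_big_dep (fun=> true) (fun _ _ => true) (fun k (l : L k) =>
    2 * (bq q (mU (Tagged L l)) (xi k) + bq q (mV (Tagged L l)) (zeta k l)) -
      a k * b k l * (bq q (xi k) (xi k) + bq q (zeta k l) (zeta k l)))) /=.
  rewrite -big_split /=; apply: eq_bigr => k _.
  have -> : mom P (F k) = (fun p => \sum_(l : L k) mU (Tagged L l) p).
    by apply/funext => p; rewrite sumU.
  rewrite bq_suml.
  have bk : a k * bq q (xi k) (xi k) = \sum_(l : L k) a k * b k l * bq q (xi k) (xi k).
    by rewrite -mulr_suml -mulr_sumr (dec_a_sum (DQ k) i0) mulr1.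
  rewrite bk !mulr_sumr -sumrB -big_split /=; apply: eq_bigr => l _.
  have -> : mV (Tagged L l) = (fun p => a k * mom (Q k) (G k l) p).
    by apply/funext => p; rewrite momV.
  rewrite bqZl mulrBr !mulrA; move: (bq _ _ _) (bq _ _ _) (bq _ _ _) (bq _ _ _) => A B C D; ring.
rewrite -E; have [h|h] := leP (Val q mu F1 w c1) (Val q mu F2 w c2).
  by exists KL, F2, w, c2; split; [exact: D2|rewrite mulr_natl mulr2n lerD2r].
by exists KL, F1, w, c1; split; [exact: D1|rewrite mulr_natl mulr2n lerD2l ltW].
Qed.

End decomposition_chain.
Set Implicit Arguments.

(** * Refining a decomposition along one factor *)

Section refinement.
Context (R : realType) (n : nat) (d : 'I_n -> nat).
Notation T i := ((d i).-tuple R).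
Notation I := {i : 'I_n & 'I_(d i)}.
Notation laws := (forall i, probability (T i) R).
Variable q : I -> I -> R.
Unset Implicit Arguments.
Variables (mu : laws) (K : finType) (F : K -> forall i, T i -> R) (a : K -> R)
  (xi : K -> I -> R) (i0 : 'I_n) (chi : forall i, T i -> R).
Hypotheses (mu2 : forall i, law2 (mu i)) (D : is_dec mu F a)
  (mchi : forall i, measurable_fun setT (chi i)) (chi01 : forall i x, 0 <= chi i x <= 1).

(** Mean of [chi] on the piece [k] of the factor [i0]; on pieces of mass zero the division makes it
    0, which stays in [[0, 1]]. *)
Let pk k := Ex (mu i0) (fun x => F k i0 x * chi i0 x) / a k.

Let mF k i : measurable_fun setT (F k i). Proof. by case: D. Qed.

Let iFc k : intg (mu i0) (fun x => F k i0 x * chi i0 x).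
Proof.
apply: (@intg_bd _ _ _ _ _ 1) => [|x]; first exact: (measurable_funM (mF _ _) (mchi _)).
have /andP[f0 f1] := dec_le1 D k x; have /andP[c0 c1] := chi01 i0 x.
by rewrite ger0_norm ?mulr_ge0// mulr_ile1.
Qed.

Let iF k i : intg (mu i) (F k i).
Proof. by apply: (@intg_bd _ _ _ _ _ 1) => [|x]; [exact: mF|exact: (dec_norm1 D k x)]. Qed.

Let a0 k : 0 <= a k. Proof. exact: (dec_a_ge0 D i0). Qed.

Let Fa k i : Ex (mu i) (F k i) = a k. Proof. by case: D. Qed.

Let pkE k : a k * pk k = Ex (mu i0) (fun x => F k i0 x * chi i0 x).
Proof.
have [ak|ak] := eqVneq (a k) 0; last by rewrite mulrC divfK.
rewrite /pk ak mul0r; apply/esym; apply: Ex_weight0 => //.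
  by move=> x; have /andP[] := dec_le1 D k x.
by rewrite Fa.
Qed.

Let pk01 k : 0 <= pk k <= 1.
Proof.
have le1 : Ex (mu i0) (fun x => F k i0 x * chi i0 x) <= a k.
  rewrite -(Fa k i0); apply: Ex_le => // x; have /andP[c0 c1] := chi01 i0 x.
  by have /andP[f0 f1] := dec_le1 D k x; rewrite -[leRHS]mulr1 ler_wpM2l.
have ge0 : 0 <= Ex (mu i0) (fun x => F k i0 x * chi i0 x).
  apply: Ex_ge0 => x; have /andP[c0 c1] := chi01 i0 x.
  by have /andP[f0 f1] := dec_le1 D k x; rewrite mulr_ge0.
apply/andP; split; first by rewrite divr_ge0.
have := a0 k; rewrite le_eqVlt => /orP[/eqP ak|ak]; first by rewrite /pk -ak invr0 mulr0 ler01.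
by rewrite ler_pdivrMr// mul1r.
Qed.

(** Cutting the pieces by [chi] on the factor [i0] changes their masses, which have to agree on all
    factors; the constant weight [pk] restores this on the others. *)
Definition split_weight (kb : K * bool) i (x : T i) : R :=
  let t := if i == i0 then chi i x else pk kb.1 in if kb.2 then t else 1 - t.

Definition split_dec (kb : K * bool) i (x : T i) : R := F kb.1 i x * split_weight kb i x.

Definition split_mass (kb : K * bool) : R :=
  a kb.1 * (if kb.2 then pk kb.1 else 1 - pk kb.1).

Let sw_sum k i x : split_weight (k, true) i x + split_weight (k, false) i x = 1.
Proof. by rewrite /split_weight /= subrKC. Qed.

Let sw01 kb i x : 0 <= split_weight kb i x <= 1.
Proof.
have h : 0 <= (if i == i0 then chi i x else pk kb.1) <= 1 by case: ifP => _; [exact: chi01|exact: pk01].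
rewrite /split_weight; case: kb.2 => //; move: h => /andP[h0 h1].
by rewrite subr_ge0 h1 gerBl.
Qed.

Let msw kb i : measurable_fun setT (split_weight kb i).
Proof.
rewrite /split_weight; case: kb.2; case: (i == i0) => //.
by apply: measurable_funB; [|exact: mchi].
Qed.

Lemma split_decP : is_dec mu split_dec split_mass.
Proof.
have [_ F0 F1 _] := D; split.
- by move=> kb i; apply: measurable_funM; [exact: mF|exact: msw].
- by move=> kb i x; have /andP[s0 _] := sw01 kb i x; rewrite mulr_ge0.
- move=> i x; rewrite -(F1 i x).
  rewrite (eq_bigr (fun kb => split_dec (kb.1, kb.2) i x)); last by case.
  rewrite -(pair_bigA _ (fun k b => split_dec (k, b) i x)) /=.
  apply: eq_bigr => k _; rewrite big_bool /split_dec /= -mulrDr sw_sum mulr1.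
  by [].
- move=> [k b] i; rewrite /split_dec /split_mass /split_weight /=.
  have [->|ne] := eqVneq i i0; last first.
    rewrite (@eq_Ex _ _ _ _ _ (fun x => (if b then pk k else 1 - pk k) * F k i x)).
      by rewrite (ExZ _ (iF k i)) Fa mulrC.
    by move=> x; rewrite mulrC.
  case: b; first by rewrite pkE.
  rewrite mulrBr mulr1 pkE -(Fa k i0) -ExB//.
  by apply: eq_Ex => x; rewrite mulrBr mulr1.
Qed.

(** Both halves of a piece keep its center, and with centers fixed the value is linear in moments
    and masses. *)
Lemma Val_split : Val q mu split_dec split_mass (fun kb => xi kb.1) = Val q mu F a xi.
Proof.
rewrite /Val.
rewrite (eq_bigr (fun kb => 2 * bq q (mom mu (split_dec (kb.1, kb.2))) (xi kb.1) -
    split_mass (kb.1, kb.2) * bq q (xi kb.1) (xi kb.1))); last by case.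
rewrite -(pair_bigA _ (fun k b => 2 * bq q (mom mu (split_dec (k, b))) (xi k) -
    split_mass (k, b) * bq q (xi k) (xi k))) /=.
apply: eq_bigr => k _; rewrite big_bool /=. rewrite val_alg2.
have -> : split_mass (k, true) + split_mass (k, false) = a k.
  by rewrite /split_mass /= -mulrDr subrKC mulr1.
have imom (kb : K * bool) (p : I) : intg (mu (tag p)) (fun x => tnth x (tagged p) * split_dec kb (tag p) x).
  apply: quad_intg; first exact: mu2.
  apply: (quad_bdM (B := 1)); last exact: quad_coord.
    by have [h _ _ _] := split_decP; exact: h.
  by move=> x; exact: (dec_norm1 split_decP kb x).
congr (2 * _ - _).
rewrite -(bq_sumb q (mom mu (split_dec (k, true))) (mom mu (split_dec (k, false)))); congr bq.
apply/funext => p; rewrite /mom -ExD//; apply: eq_Ex => x.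
by rewrite -mulrDr /split_dec /= -mulrDr sw_sum mulr1.
Qed.

Set Implicit Arguments.
End refinement.

(** * The free energy and its doubling inequality *)

Section free_energy.
Context (R : realType) (n : nat) (d : 'I_n -> nat).
Notation T i := ((d i).-tuple R).
Notation I := {i : 'I_n & 'I_(d i)}.
Notation laws := (forall i, probability (T i) R).
Variables (q : I -> I -> R) (c : 'I_n -> R).

Record deco := Deco {
  dK : finType;
  dF : dK -> forall i, T i -> R;
  da : dK -> R;
  dxi : dK -> I -> R }.

(* The infimum over all tests g and decompositions D of the left-hand side is
   sum_i c_i h(mu_i) minus the best value of a coupling. *)
Definition free_at (mu : laws) (g : forall i, T i -> R) (D : deco) (t : R) : Prop :=
  [/\ forall i, test (g i), is_dec mu (@dF D) (@da D) &
    - (\sum_i c i * Ex (mu i) (fun x => ln (g i x))) - Val q mu (@dF D) (@da D) (@dxi D) <= t].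

Definition free_le (mu : laws) (t : R) : Prop := exists g D, free_at mu g D t.

Lemma free_le_trans mu t s : t <= s -> free_le mu t -> free_le mu s.
Proof. by move=> ts [g [D [tg dD h]]]; exists g, D; split => //; exact: le_trans ts. Qed.

Lemma quad_ln m (f : m.-tuple R -> R) : test f -> quad (fun x => ln (f x)).
Proof.
move=> tf; split; first exact: test_meas_ln.
by have [A A0 h] := test_ln tf; exists A.
Qed.

(** In [entropy_chain] and [dec_chain] alike, two copies of [mu] are compared with the law of [u]
    plus an average over the conditional laws of [v], for the same conditioning by [dF D]. This is
    why the bounds add up and why the result carries a factor one half. *)
Lemma free_chain (i0 : 'I_n) (mu P : laws) (g : forall i, T i -> R) (D : deco)
    (Q : dK D -> laws) s (t : dK D -> R) e :
  (forall i, 0 < c i) -> (forall i, law2 (mu i)) ->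
  (forall i f, quad f -> Ex (P i) f = Ex (mu i \x mu i)%E (fun p => f (uu p))) ->
  free_at P g D s ->
  (forall k i f, quad f ->
    da k * Ex (Q k i) f = Ex (mu i \x mu i)%E (fun p => dF k (uu p) * f (vv p))) ->
  (forall k, free_le (Q k) (t k)) -> 0 < e ->
  free_le mu ((s + \sum_k da k * t k) / 2 + e).
Proof.
move=> c0 mu2 PE [tg dD hs] QE hk e0.
have /choice[gk hgk] := hk; have /choice[E hE] := hgk.
have [J [F' [w' [eta [D' hV]]]]] := @dec_chain R n d q mu P (dK D) (@dF D) (@da D) (@dxi D) mu2 PE dD Q
  (fun k => dK (E k)) (fun k => @dF (E k)) (fun k => @da (E k)) (fun k => @dxi (E k)) QE
  (fun k => let: And3 _ h _ := hE k in h) i0.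
have a0 k := dec_a_ge0 dD i0 k.
(* The entropic losses [e / S], weighted by the [c i], then add up to at most [e]. *)
pose S := \sum_i c i + 1.
have S0 : 0 < S by rewrite ltr_wpDl ?ltr01// sumr_ge0// => i _; rewrite ltW.
have eS : 0 < e / S by rewrite divr_gt0.
have tgk k i : test (gk k i) by case: (hE k).
have [g' hg'] : {g' : forall i, T i -> R | forall i, test (g' i) /\
    2 * - Ex (mu i) (fun x => ln (g' i x)) <=
    - Ex (P i) (fun x => ln (g i x)) -
      \sum_k da k * Ex (Q k i) (fun x => ln (gk k i x)) + e / S}.
  suff h : forall i, exists g' : T i -> R, test g' /\
    2 * - Ex (mu i) (fun x => ln (g' x)) <=
    - Ex (P i) (fun x => ln (g i x)) -
      \sum_k da k * Ex (Q k i) (fun x => ln (gk k i x)) + e / S.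
    by exists (fun i => projT1 (cid (h i))) => i; exact: projT2 (cid (h i)).
  move=> i; have [mF F0 F1 _] := dD.
  have [g' tg' h'] := entropy_chain (mu2 i) (tg i) (fun k => tgk k i) (fun k => mF k i)
    (fun k => F0 k i) (F1 i) eS.
  exists g'; split => //; apply: (le_trans h'); rewrite PE; last exact: quad_ln.
  rewrite lerD2r lerD2l lerN2 le_eqVlt; apply/orP; left; apply/eqP.
  by apply: eq_bigr => k _; rewrite QE//; exact: quad_ln.
exists g', (@Deco J F' w' eta); split => //=; first by move=> i; case: (hg' i).
have h1 : 2 * - (\sum_i c i * Ex (mu i) (fun x => ln (g' i x))) <=
    - (\sum_i c i * Ex (P i) (fun x => ln (g i x))) -
    \sum_k da k * (\sum_i c i * Ex (Q k i) (fun x => ln (gk k i x))) + e.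
  apply: (@le_trans _ _ (\sum_i c i * (- Ex (P i) (fun x => ln (g i x)) -
      \sum_k da k * Ex (Q k i) (fun x => ln (gk k i x)) + e / S))).
    rewrite -sumrN mulr_sumr; apply: ler_sum => i _.
    by have [_ h] := hg' i; rewrite -mulrN mulrCA ler_wpM2l// ltW.
  have -> : \sum_k da k * (\sum_i c i * Ex (Q k i) (fun x => ln (gk k i x))) =
      \sum_i c i * \sum_k da k * Ex (Q k i) (fun x => ln (gk k i x)).
    transitivity (\sum_k \sum_i c i * (da k * Ex (Q k i) (fun x => ln (gk k i x)))).
      by apply: eq_bigr => k _; rewrite mulr_sumr; apply: eq_bigr => i _; rewrite mulrCA.
    by rewrite exchange_big; apply: eq_bigr => i _; rewrite mulr_sumr.
  rewrite -!sumrN -!big_split /=.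
  under eq_bigr do rewrite mulrDr mulrDr !mulrN.
  rewrite big_split /= lerD2l -mulr_suml mulrCA ler_piMr ?(ltW e0)// ler_pdivrMr// mul1r /S.
  by rewrite lerDl ler01.
have h2 : - (\sum_k da k * (\sum_i c i * Ex (Q k i) (fun x => ln (gk k i x)))) -
    \sum_k da k * Val q (Q k) (@dF (E k)) (@da (E k)) (@dxi (E k)) <= \sum_k da k * t k.
  rewrite -opprD -big_split /= -sumrN; apply: ler_sum => k _.
  by rewrite -mulrDr -mulrN opprD ler_wpM2l//; case: (hE k).
have alg (X1 X2 X3 X4 X5 X6 X7 : R) : 2 * - X2 <= - X1 - X3 + e -> - X3 - X6 <= X7 ->
    - X1 - X4 <= s -> X4 + X6 <= 2 * X5 -> - X2 - X5 <= (s + X7) / 2 + e.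
  by move: e0 => /ltW; clear; lra.
exact: (alg _ _ _ _ _ _ _ h1 h2 hs hV).
Qed.

End free_energy.

(** * The covariance penalty *)

Section phi.
Context (R : realType).

Definition phi (t : R) : R := Num.sqrt (1 + t ^+ 2) - 1.

Lemma sqrt1_gt0 (t : R) : 0 < Num.sqrt (1 + t ^+ 2).
Proof. by rewrite sqrtr_gt0 ltr_pwDl// sqr_ge0. Qed.

Lemma sqrt1_sqr (t : R) : Num.sqrt (1 + t ^+ 2) ^+ 2 = 1 + t ^+ 2.
Proof. by rewrite sqr_sqrtr// addr_ge0// sqr_ge0. Qed.

Lemma sqrt1_le (t : R) : Num.sqrt (1 + t ^+ 2) <= 1 + `|t|.
Proof.
rewrite -(ler_pXn2r (n := 2)) ?nnegrE ?sqrtr_ge0 ?addr_ge0// sqrt1_sqr.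
by rewrite sqrrD expr1n mul1r real_normK ?num_real// -addrA lerD2l lerDr mulrn_wge0.
Qed.

Lemma phi_ge0 t : 0 <= phi t.
Proof.
by rewrite subr_ge0 -[leLHS]sqrtr1 ler_wsqrtr// lerDl sqr_ge0.
Qed.

Lemma phi_le t : phi t <= `|t|.
Proof. by rewrite lerBlDl sqrt1_le. Qed.

Definition phi_slope (c : R) := c / Num.sqrt (1 + c ^+ 2).

(** With [A] and [B] the square roots at [y] and [c], the right-hand side minus the left-hand side
    is [(A B - (1 + c y)) ^ 2 / (2 A B ^ 2)]. *)
Lemma phi_gap (c y : R) :
  (y - c) ^+ 2 / (2 * Num.sqrt (1 + y ^+ 2) * (1 + c ^+ 2)) <=
  phi y - phi c - phi_slope c * (y - c).
Proof.
rewrite /phi /phi_slope -[1 + c ^+ 2 in leLHS]sqrt1_sqr.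
have := sqrt1_gt0 y; have := sqrt1_gt0 c; have := sqrt1_sqr y; have := sqrt1_sqr c.
move: (Num.sqrt (1 + y ^+ 2)) (Num.sqrt (1 + c ^+ 2)) => A B B2 A2 B0 A0.
rewrite -subr_ge0.
have -> : A - 1 - (B - 1) - c / B * (y - c) - (y - c) ^+ 2 / (2 * A * B ^+ 2) =
    (2 * A ^+ 2 * B ^+ 2 - 2 * A * B * (B ^+ 2 - c ^+ 2 + c * y) - (y - c) ^+ 2) / (2 * A * B ^+ 2).
  by field; rewrite ?gt_eqF.
rewrite divr_ge0//; last by rewrite !mulr_ge0 ?ltW// exprn_ge0// ltW.
have -> : B ^+ 2 - c ^+ 2 + c * y = 1 + c * y by rewrite B2; ring.
have -> : (y - c) ^+ 2 = A ^+ 2 * B ^+ 2 - (1 + c * y) ^+ 2 by rewrite A2 B2; ring.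
have -> : 2 * A ^+ 2 * B ^+ 2 - 2 * A * B * (1 + c * y) - (A ^+ 2 * B ^+ 2 - (1 + c * y) ^+ 2) =
  (A * B - (1 + c * y)) ^+ 2 by ring.
exact: sqr_ge0.
Qed.

Lemma phi_convex (c y : R) : 0 <= phi y - phi c - phi_slope c * (y - c).
Proof.
apply: le_trans (phi_gap c y); rewrite divr_ge0 ?sqr_ge0//.
by rewrite !mulr_ge0 ?sqrtr_ge0 ?addr_ge0 ?sqr_ge0.
Qed.

(** Arithmetic-geometric mean inequality between the gap and [s A]. The curvature of [phi] decays at
    infinity, so a small gap controls [|y - c|] only up to a small multiple of [1 + |y|]; second
    moments take care of that remainder. *)
Lemma norm_le_gap (s c y : R) : 0 < s ->
  `|y - c| <= (1 + c ^+ 2) / (2 * s) * (phi y - phi c - phi_slope c * (y - c)) + s * (1 + `|y|).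
Proof.
move=> s0; have := phi_gap c y; have := sqrt1_le y; have := sqrt1_gt0 y.
move: (Num.sqrt (1 + y ^+ 2)) (phi y - phi c - _) => A G A0 Ay h.
have B0 : 0 < 1 + c ^+ 2 by rewrite ltr_pwDl// sqr_ge0.
apply: (@le_trans _ _ ((1 + c ^+ 2) / (2 * s) * G + s * A)); last first.
  by rewrite lerD2l ler_wpM2l// ltW.
apply: (@le_trans _ _ ((1 + c ^+ 2) / (2 * s) * ((y - c) ^+ 2 / (2 * A * (1 + c ^+ 2))) + s * A)); last first.
  by rewrite lerD2r ler_wpM2l// divr_ge0 ?ltW// mulr_gt0.
have -> : (1 + c ^+ 2) / (2 * s) * ((y - c) ^+ 2 / (2 * A * (1 + c ^+ 2))) + s * A =
    (`|y - c| ^+ 2 + 4 * s ^+ 2 * A ^+ 2) / (4 * s * A).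
  rewrite real_normK ?num_real//; field.
  by rewrite !gt_eqF.
rewrite ler_pdivlMr ?mulr_gt0//.
have := sqr_ge0 (`|y - c| - 2 * s * A); move: `|y - c| => z h1; rewrite -subr_ge0; apply: (le_trans h1); rewrite le_eqVlt; apply/orP; left; apply/eqP; ring.
Qed.

Lemma jensen_gap (K : finType) (a y : K -> R) c : (forall k, 0 <= a k) ->
  \sum_k a k = 1 -> \sum_k a k * y k = c ->
  \sum_k a k * (phi (y k) - phi c - phi_slope c * (y k - c)) = \sum_k a k * phi (y k) - phi c.
Proof.
move=> a0 a1 ay.
have -> : \sum_k a k * (phi (y k) - phi c - phi_slope c * (y k - c)) =
  \sum_k (a k * phi (y k) + (phi_slope c * c - phi c) * a k - phi_slope c * (a k * y k)).
  by apply: eq_bigr => k _; ring.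
by rewrite sumrB big_split /= -!mulr_sumr a1 ay; ring.
Qed.

End phi.

(** * Laws of the rotated pair *)

Section doubled_laws.
Context (R : realType) (m : nat).
Notation T := (m.-tuple R).
Implicit Types (P : probability T R) (f : T -> R).

Lemma Ex2_fst P f : quad f -> law2 P -> Ex (P \x P)%E (fun p => f p.1) = Ex P f.
Proof.
move=> qf P2; have fi := quad_intg P2 qf.
rewrite (Ex_fst (f := fun p : T * T => f p.1)).
- by apply: eq_Ex => x /=; exact: Ex_cst.
- exact: intg2_fst.
- by move=> x /=; exact: intg_cst.
Qed.

Lemma Ex2_snd P f : quad f -> law2 P -> Ex (P \x P)%E (fun p => f p.2) = Ex P f.
Proof.
move=> qf P2; have fi := quad_intg P2 qf.
rewrite (Ex_snd (f := fun p : T * T => f p.2)).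
- by apply: eq_Ex => x /=; exact: Ex_cst.
- exact: intg2_snd.
- by move=> x /=; exact: intg_cst.
Qed.

Lemma quad2_cross (j j' : 'I_m) : measurable_fun setT (fun p : T * T => tnth p.1 j * tnth p.2 j') /\
  forall p : T * T, `|tnth p.1 j * tnth p.2 j'| <= 1 * (1 + nn2 p).
Proof.
split; first by apply: measurable_funM; exact: meas_tnth.
move=> p; rewrite mul1r (le_trans (norm_mul_le _ _))// /nn2.
have := n2_coord p.1 j; have := n2_coord p.2 j'.
by have := n2_ge0 p.1; have := n2_ge0 p.2; lra.
Qed.

Lemma Ex2_cross P j j' : law2 P -> mean0 P ->
  Ex (P \x P)%E (fun p => tnth p.1 j * tnth p.2 j') = 0.
Proof.
move=> P2 P0; have [mf h] := quad2_cross j j'.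
have [h1 h2 h3] := quad2_intg P2 mf h.
rewrite (Ex_fst h1 h2) -[RHS](Ex0 P); apply: eq_Ex => x.
by rewrite /= ExZ ?P0 ?mulr0//; apply: quad_intg => //; exact: quad_coord.
Qed.

(** [e = 1] is the case of [u] and [e = -1] that of [v]. The mixed products have mean zero because
    the copies are independent and centered. *)
Lemma Ex2_rot P (e : R) j j' : e ^+ 2 = 1 -> law2 P -> mean0 P ->
  Ex (P \x P)%E (fun p => (tnth p.1 j + e * tnth p.2 j) / Num.sqrt 2 *
    ((tnth p.1 j' + e * tnth p.2 j') / Num.sqrt 2)) = Ex P (fun x => tnth x j * tnth x j').
Proof.
move=> e1 P2 P0.
have i0 : intg P (fun x => tnth x j * tnth x j').
  by apply: quad_intg => //; exact: quad_coord2.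
have i1 : intg (P \x P)%E (fun p => tnth p.1 j * tnth p.1 j').
  exact: (@intg2_fst _ _ _ _ _ P P _ i0).
have i2 : intg (P \x P)%E (fun p => tnth p.2 j * tnth p.2 j').
  exact: (@intg2_snd _ _ _ _ _ P P _ i0).
have i3 k k' : intg (P \x P)%E (fun p => tnth p.1 k * tnth p.2 k').
  by have [mf h] := quad2_cross k k'; have [] := quad2_intg P2 mf h.
transitivity (Ex (P \x P)%E (fun p => 2^-1 * (tnth p.1 j * tnth p.1 j') + (2^-1 * (tnth p.2 j * tnth p.2 j') +
   (e / 2 * (tnth p.1 j * tnth p.2 j') + e / 2 * (tnth p.1 j' * tnth p.2 j))))).
  apply: eq_Ex => p; have := @s2_sqr R; have := @s2_neq0 R.
  move: (Num.sqrt 2) (tnth p.1 j) (tnth p.1 j') (tnth p.2 j) (tnth p.2 j') => s x x' y y' s0 s2.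
  transitivity ((x * x' + e ^+ 2 * (y * y') + e * (x * y' + x' * y)) / s ^+ 2); first by field.
  by rewrite e1 s2; field.
do 3 (rewrite ExD; [|by do ?[apply: intgZ|apply: intgD]..]).
rewrite !ExZ// !Ex2_cross// !mulr0 !addr0.
rewrite (Ex2_fst (f := fun x => tnth x j * tnth x j'))//; last exact: quad_coord2.
rewrite (Ex2_snd (f := fun x => tnth x j * tnth x j'))//; last exact: quad_coord2.
by field.
Qed.

Lemma Ex2_uu P j j' : law2 P -> mean0 P ->
  Ex (P \x P)%E (fun p => tnth (uu p) j * tnth (uu p) j') = Ex P (fun x => tnth x j * tnth x j').
Proof.
move=> P2 P0; rewrite -(@Ex2_rot P 1 j j')// ?expr1n//; apply: eq_Ex => p.
by rewrite !tnth_mktuple !mul1r.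
Qed.

Lemma Ex2_vv P j j' : law2 P -> mean0 P ->
  Ex (P \x P)%E (fun p => tnth (vv p) j * tnth (vv p) j') = Ex P (fun x => tnth x j * tnth x j').
Proof.
move=> P2 P0; rewrite -(@Ex2_rot P (-1) j j')// ?sqrrN ?expr1n//; apply: eq_Ex => p.
by rewrite !tnth_mktuple !mulN1r.
Qed.

Lemma evenl_mean0 P : evenl P -> law2 P -> mean0 P.
Proof.
move=> Pe P2 j; have := Pe _ (@quad_coord R m j).
rewrite (eq_Ex P (g := fun x => - tnth x j)); last by move=> x; rewrite tnth_mktuple.
by rewrite ExN; [lra|apply: quad_intg => //; exact: quad_coord].
Qed.

Lemma quad_uu f : quad f -> measurable_fun setT (fun p : T * T => f (uu p)) /\
  exists A : R, forall p, `|f (uu p)| <= A * (1 + nn2 p).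
Proof.
move=> [mf [A fA]]; split; first by apply: measurableT_comp => //; exact: meas_uu.
exists A => p; have A0 : 0 <= A.
  have := le_trans (normr_ge0 _) (fA (uu p)).
  by rewrite pmulr_lge0// ltr_wpDr ?n2_ge0.
by rewrite (le_trans (fA _))// ler_wpM2l// lerD2l n2_uu_le.
Qed.

Lemma quad_negt f : quad f -> quad (fun x => f (negt x)).
Proof.
move=> [mf [A fA]]; split.
  apply: measurableT_comp => //; apply: meas_tuple => j.
  under eq_fun do rewrite tnth_mktuple; apply: measurableT_comp => //; exact: measurable_tnth.
exists A => x; rewrite (le_trans (fA _))//.
rewrite (_ : n2 (negt x) = n2 x)//; apply: eq_bigr => j _.
by rewrite tnth_mktuple sqrrN.
Qed.

Lemma law_u_ex P : law2 P -> exists Q : probability T R, [/\ law2 Q,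
  forall f, quad f -> Ex Q f = Ex (P \x P)%E (fun p => f (uu p)),
  mean0 P -> mean0 Q & evenl P -> evenl Q].
Proof.
move=> P2.
have W1 : (\int[(P \x P)%E]_p ((fun=> 1) p)%:E = 1)%E.
  by rewrite (@ExE _ _ _ (P \x P)%E); [rewrite (@Ex_cst _ _ _ (P \x P)%E)|exact: (@intg_cst _ _ _ (P \x P)%E)].
have [Q HQ] := @wlawP _ _ (T * T)%type T R (P \x P)%E (fun=> 1) (@uu R m)
   (measurable_cst _) (fun _ => ler01) W1 (@meas_uu R m).
have HQ' f : quad f -> intg Q f /\ Ex Q f = Ex (P \x P)%E (fun p => f (uu p)).
  move=> qf; have [mf [A fA]] := quad_uu qf.
  have [iff _ _] := quad2_intg P2 mf fA.
  have [| |? ->] := HQ f; first by case: qf.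
    by apply: (eq_intg _ iff) => p; rewrite mul1r.
  by split => //; apply: eq_Ex => p; rewrite mul1r.
exists Q; split.
- by have [] := HQ' _ (@quad_n2 R m).
- by move=> f /HQ'[].
- move=> P0 j; have [_ ->] := HQ' _ (@quad_coord R m j).
  have i1 : intg P (fun x => tnth x j) by apply: quad_intg => //; exact: quad_coord.
  transitivity (Ex (P \x P)%E (fun p => (Num.sqrt 2)^-1 * tnth p.1 j + (Num.sqrt 2)^-1 * tnth p.2 j)).
    by apply: eq_Ex => p; rewrite tnth_mktuple mulrC mulrDr.
  rewrite ExD; last 2 first.
  - by apply: intgZ; exact: (@intg2_fst _ _ _ _ _ P P _ i1).
  - by apply: intgZ; exact: (@intg2_snd _ _ _ _ _ P P _ i1).
  rewrite !ExZ; last 2 first.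
  - exact: (@intg2_snd _ _ _ _ _ P P _ i1).
  - exact: (@intg2_fst _ _ _ _ _ P P _ i1).
  rewrite (Ex2_fst (@quad_coord R m j))// (Ex2_snd (@quad_coord R m j))// P0.
  by rewrite mulr0 addr0.
- move=> Pe f qf; have [_ ->] := HQ' _ qf; have [_ ->] := HQ' _ (quad_negt qf).
  have [m1 [A1 h1]] := quad_uu qf; have [m2 [A2 h2]] := quad_uu (quad_negt qf).
  have [i1 i2 i3] := quad2_intg P2 m1 h1; have [j1 j2 j3] := quad2_intg P2 m2 h2.
  have sec (h : T * T -> R) A x : measurable_fun setT h -> (forall p, `|h p| <= A * (1 + nn2 p)) ->
      quad (fun y => h (x, y)) /\ quad (fun y => h (y, x)).
    move=> mh hA; have A0 : 0 <= A.
      have := le_trans (normr_ge0 _) (hA (x, x)).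
      by rewrite pmulr_lge0// ltr_wpDr ?nn2_ge0.
    have b y : A * (1 + (n2 x + n2 y)) <= A * (1 + n2 x) * (1 + n2 y).
      rewrite -mulrA ler_wpM2l// mulrDl mul1r mulrDr mulr1.
      have := mulr_ge0 (n2_ge0 x) (n2_ge0 y).
      by move: (n2 x) (n2 y) (n2 x * n2 y) => *; lra.
    split; split; [exact: measurableT_comp| |exact: measurableT_comp|].
    - by exists (A * (1 + n2 x)) => y; rewrite (le_trans (hA _))// b.
    - by exists (A * (1 + n2 x)) => y; rewrite (le_trans (hA _))// /nn2 /= [n2 y + _]addrC b.
  rewrite (Ex_fst j1 j2) (Ex_fst i1 i2).
  (* Evenness of [P] is available on [quad] functions only, and it is applied to one copy at a time:
     to this partial integral and then to the sections. *)
  have qg : quad (fun x => Ex P (fun y => f (uu (x, y)))).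
    split; first exact: (intg_meas (intg_fst i1 i2)).
    exists (A1 * (1 + Ex P (@n2 R m))) => x.
    apply: (le_trans (Ex_norm (i2 x))).
    apply: (@le_trans _ _ (Ex P (fun y => A1 * (1 + n2 x) + A1 * n2 y))).
      apply: Ex_le; first exact: intg_norm (i2 x).
        by apply: intgD; [exact: intg_cst|exact: intgZ].
      by move=> y; rewrite (le_trans (h1 _))// /nn2 /= addrA mulrDr.
    rewrite ExD; [|exact: intg_cst|exact: intgZ].
    rewrite Ex_cst ExZ// -mulrDr -mulrA ler_wpM2l//.
      have := le_trans (normr_ge0 _) (h1 (x, x)).
      by rewrite pmulr_lge0// ltr_wpDr ?nn2_ge0.
    have := n2_ge0 x; have : 0 <= Ex P (@n2 R m) by apply: Ex_ge0; exact: n2_ge0.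
    by move: (n2 x) (Ex P _) => a b a0 b0; have := mulr_ge0 a0 b0; lra.
  rewrite -(Pe _ qg); apply: eq_Ex => x.
  have [q1 _] := sec _ _ (negt x) m1 h1.
  rewrite -(Pe _ q1); apply: eq_Ex => y; congr f.
  by apply: eq_from_tnth => k; rewrite !tnth_mktuple /= -opprD mulNr.
Qed.

End doubled_laws.

Lemma dep_choice (I : Type) (T : I -> Type) (Pr : forall i, T i -> Prop) :
  (forall i, exists x, Pr i x) -> exists f : forall i, T i, forall i, Pr i (f i).
Proof. by move=> h; exists (fun i => projT1 (cid (h i))) => i; exact: projT2 (cid (h i)). Qed.

Lemma le_sum1 (R : numDomainType) (I : finType) (F : I -> R) i :
  (forall j, 0 <= F j) -> F i <= \sum_j F j.
Proof. by move=> F0; rewrite (bigD1 i)//= lerDl sumr_ge0. Qed.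

(** * The penalized functional *)

Section penalized.
Context (R : realType) (n : nat) (d : 'I_n -> nat).
Notation T i := ((d i).-tuple R).
Notation I := {i : 'I_n & 'I_(d i)}.
Notation laws := (forall i, probability (T i) R).
Variables (q : I -> I -> R) (c : 'I_n -> R) (al de : R) (i0 : 'I_n).
Hypotheses (c0 : forall i, 0 < c i) (de0 : 0 < de).

Definition cov m (P : probability (m.-tuple R) R) (j j' : 'I_m) : R :=
  Ex P (fun x => tnth x j * tnth x j').

(** Added to the functional that is maximized. The coefficient [al] will be [kap - lam]: [kap]
    compensates the shift of the quadratic form, and [- lam] times the trace outweighs the convex
    part. *)
Definition pen (mu : laws) : R :=
  al * (\sum_i \sum_j cov (mu i) j j) + de * (\sum_i \sum_j \sum_j' phi (cov (mu i) j j')).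

Definition law0 (mu : laws) : Prop := forall i, law2 (mu i) /\ mean0 (mu i).

Definition lawe (mu : laws) : Prop := forall i, law2 (mu i) /\ evenl (mu i).

Lemma lawe0 mu : lawe mu -> law0 mu.
Proof. by move=> h i; have [h2 he] := h i; split => //; exact: evenl_mean0. Qed.

(** The slack [e] stands for the infimum over witnesses, which need not be attained; [S] will be the
    class of even or of centered laws. *)
Definition bounded_by (S : laws -> Prop) (M : R) : Prop :=
  forall mu, S mu -> forall e, 0 < e -> free_le q c mu (M - pen mu + e).

Section one_law.
Variables (mu P : laws) (g : forall i, T i -> R) (D : @deco R n d) (s M : R).
Hypotheses (mu0 : law0 mu)
  (PE : forall i f, quad f -> Ex (P i) f = Ex (mu i \x mu i)%E (fun p => f (uu p)))
  (gD : free_at q c P g D s) (Mub : bounded_by lawe M).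

Let dD : is_dec P (@dF _ _ _ D) (@da _ _ _ D). Proof. by case: gD. Qed.

Let a0 k : 0 <= @da _ _ _ D k. Proof. exact: (dec_a_ge0 dD i0). Qed.

Let a1 : \sum_k @da _ _ _ D k = 1. Proof. exact: (dec_a_sum dD i0). Qed.

Let F01 k i x : 0 <= @dF _ _ _ D k i x <= 1. Proof. exact: (dec_le1 dD k x). Qed.

Let mF k i : measurable_fun setT (@dF _ _ _ D k i). Proof. by case: dD. Qed.

Lemma conditional_laws : exists Q : dK D -> laws, (forall k, lawe (Q k)) /\
  forall k i f, quad f ->
    da k * Ex (Q k i) f = Ex (mu i \x mu i)%E (fun p => dF k (uu p) * f (vv p)).
Proof.
suff h : forall (k : dK D) i, exists Q : probability (T i) R, (law2 Q /\ evenl Q) /\ forall f, quad f ->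
    da k * Ex Q f = Ex (mu i \x mu i)%E (fun p => dF k (uu p) * f (vv p)).
  exists (fun k i => projT1 (cid (h k i))); split.
    by move=> k i; have [] := projT2 (cid (h k i)).
  by move=> k i f qf; have [_] := projT2 (cid (h k i)); exact.
move=> k i; have [mu2 _] := mu0 i; have [_ _ _ Fa] := dD.
have e : Ex (mu i \x mu i)%E (fun p => dF k (uu p)) = da k.
  by rewrite -PE ?Fa//; exact: (dec_quad dD).
have [Q [Q2 Qe QE]] := law_v_ex mu2 (@mF k i) (@F01 k i) e.
by exists Q.
Qed.

Variable Q : dK D -> laws.
Hypotheses (Qe : forall k, lawe (Q k)) (QE : forall k i f, quad f ->
    da k * Ex (Q k i) f = Ex (mu i \x mu i)%E (fun p => dF k (uu p) * f (vv p))).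

(** The [F k] sum to one, and [v] has the covariances of [mu]. *)
Lemma cov_average i j j' : \sum_k da k * cov (Q k i) j j' = cov (mu i) j j'.
Proof.
have [mu2 m0] := mu0 i.
have qc := @quad_coord2 R (d i) j j'.
under eq_bigr do rewrite /cov QE//.
rewrite -Ex_sum; last first.
  move=> k _; have [mf [A fA]] := bd_uu_vv (@mF k i) (@F01 k i) qc.
  by have [] := quad2_intg mu2 mf fA.
rewrite /cov -(Ex2_vv j j' mu2 m0); apply: eq_Ex => p.
by rewrite -mulr_suml; have [_ _ -> _] := dD; rewrite mul1r.
Qed.

Definition gap i (j j' : 'I_(d i)) : R :=
  \sum_k da k * phi (cov (Q k i) j j') - phi (cov (mu i) j j').

Lemma gap_ge0 i (j j' : 'I_(d i)) : 0 <= gap j j'.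
Proof.
rewrite /gap -(jensen_gap a0 a1 (cov_average j j')); apply: sumr_ge0 => k _.
by rewrite mulr_ge0// phi_convex.
Qed.

Lemma pen_average : \sum_k da k * pen (Q k) = pen mu + de * (\sum_i \sum_(j < d i) \sum_(j' < d i) gap j j').
Proof.
have e1 : \sum_k da k * (\sum_i \sum_j cov (Q k i) j j) = \sum_i \sum_j cov (mu i) j j.
  under eq_bigr do rewrite mulr_sumr.
  rewrite exchange_big; apply: eq_bigr => i _ /=.
  under eq_bigr do rewrite mulr_sumr.
  by rewrite exchange_big; apply: eq_bigr => j _ /=; exact: cov_average.
have e2 : \sum_k da k * (\sum_i \sum_j \sum_j' phi (cov (Q k i) j j')) =
    \sum_i \sum_(j < d i) \sum_(j' < d i) (phi (cov (mu i) j j') + gap j j').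
  under eq_bigr do rewrite mulr_sumr.
  rewrite exchange_big; apply: eq_bigr => i _ /=.
  under eq_bigr do rewrite mulr_sumr.
  rewrite exchange_big; apply: eq_bigr => j _ /=.
  under eq_bigr do rewrite mulr_sumr.
  by rewrite exchange_big; apply: eq_bigr => j' _ /=; rewrite subrKC.
have e3 : \sum_i \sum_(j < d i) \sum_(j' < d i) (phi (cov (mu i) j j') + gap j j') =
   \sum_i \sum_j \sum_j' phi (cov (mu i) j j') + \sum_i \sum_(j < d i) \sum_(j' < d i) gap j j'.
  rewrite -big_split; apply: eq_bigr => i _; rewrite -big_split; apply: eq_bigr => j _.
  by rewrite -big_split.
have -> : \sum_k da k * pen (Q k) =
   al * (\sum_k da k * (\sum_i \sum_j cov (Q k i) j j)) +
   de * (\sum_k da k * (\sum_i \sum_j \sum_j' phi (cov (Q k i) j j'))).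
  rewrite !mulr_sumr -big_split; apply: eq_bigr => k _ /=.
  by rewrite /pen mulrDr [da k * (al * _)]mulrCA [da k * (de * _)]mulrCA.
by rewrite e1 e2 e3 /pen mulrDr addrA.
Qed.

(** The conditional laws are even, so [M] applies to each of them; the average of their penalties is
    [pen mu] plus the Jensen gaps, which therefore lower the bound. *)
Lemma penalized_chain e : 0 < e ->
  free_le q c mu ((s + M - pen mu - de * (\sum_i \sum_(j < d i) \sum_(j' < d i) gap j j')) / 2 + e).
Proof.
move=> e0; have e20 : 0 < e / 2 by rewrite divr_gt0.
have h := @free_chain R n d q c i0 mu P g D Q s (fun k => M - pen (Q k) + e / 2) (e / 2) c0
  (fun i => proj1 (mu0 i)) PE gD QE (fun k => Mub (Qe k) e20) e20.
apply: free_le_trans h.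
have -> : \sum_k da k * (M - pen (Q k) + e / 2) = M + e / 2 - \sum_k da k * pen (Q k).
  rewrite -[in RHS](mul1r (M + e / 2)) -[X in X * (M + _)]a1 mulr_suml -sumrB.
  by apply: eq_bigr => k _; ring.
rewrite pen_average; move: (de * _) (pen mu) => x y; move: (e0); lra.
Qed.

End one_law.

(** Makes a prescribed [chi] a sum of pieces, so that what holds for the conditional laws of [v] on
    pieces of [u] can be tested against any function of [u] with values in [[0, 1]]. *)
Lemma free_at_split (P : laws) g D s i (chi : forall i, T i -> R) :
  (forall i, law2 (P i)) -> free_at q c P g D s ->
  (forall i, measurable_fun setT (chi i)) -> (forall i x, 0 <= chi i x <= 1) ->
  exists D' : @deco R n d, free_at q c P g D' s /\
  exists S : pred (dK D'), forall x : T i, \sum_(k | S k) dF k x = chi i x.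
Proof.
move=> P2 [tg dD h] mchi chi01.
exists (@Deco R n d (dK D * bool)%type
  (@split_dec R n d P (dK D) (@dF _ _ _ D) (@da _ _ _ D) i chi)
  (@split_mass R n d P (dK D) (@dF _ _ _ D) (@da _ _ _ D) i chi) (fun kb => dxi kb.1)).
split.
  split => //=; first exact: split_decP.
  by rewrite Val_split.
exists (fun kb => kb.2) => x /=.
rewrite big_mkcond /= (eq_bigr (fun kb : dK D * bool => if kb.2 then dF kb.1 x * chi i x else 0)); last first.
  by move=> [k []] _ //=; rewrite /split_dec /split_weight /= eqxx.
rewrite -(pair_bigA _ (fun k (b : bool) => if b then dF k x * chi i x else 0)) /=.
under eq_bigr do rewrite big_bool /= addr0.
by rewrite -mulr_suml; have [_ _ -> _] := dD; rewrite mul1r.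
Qed.

(** The law of [u] is centered and the conditional laws of [v] are even: a bound [s] on centered
    laws improves to [(s + M) / 2]. Starting from any [t], iteration converges to [M]. *)
Lemma bounded_by_all M t : bounded_by lawe M -> bounded_by law0 t -> bounded_by law0 M.
Proof.
move=> hM.
have step s : bounded_by law0 s -> bounded_by law0 ((s + M) / 2).
  move=> hs mu mu0 e e0; have e20 : 0 < e / 2 by rewrite divr_gt0.
  have /dep_choice[P hP] : forall i, exists P : probability (T i) R, (law2 P /\ mean0 P) /\
      forall f, quad f -> Ex P f = Ex (mu i \x mu i)%E (fun p => f (uu p)).
    move=> i; have [m2 m0] := mu0 i.
    by have [P [P2 PE P0 _]] := law_u_ex m2; exists P; split => //; split => //; exact: P0.
  have P0 : law0 P by move=> i; have [] := hP i.
  have PE i f : quad f -> Ex (P i) f = Ex (mu i \x mu i)%E (fun p => f (uu p)).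
    by have [_] := hP i; exact.
  have penP : pen P = pen mu.
    have covP i j j' : cov (P i) j j' = cov (mu i) j j'.
      have [m2 m0] := mu0 i; rewrite /cov PE; last exact: quad_coord2.
      exact: Ex2_uu.
    rewrite /pen; congr (_ * _ + _ * _).
      by apply: eq_bigr => i _; apply: eq_bigr => j _.
    apply: eq_bigr => i _; apply: eq_bigr => j _; apply: eq_bigr => j' _.
    by rewrite covP.
  have [g [D gD]] := hs P P0 (e / 2) e20.
  have [Q [Qe QE]] := conditional_laws mu0 PE gD.
  have h := penalized_chain mu0 PE gD hM Qe QE e20.
  apply: free_le_trans h; rewrite penP.
  have : 0 <= de * (\sum_i \sum_(j < d i) \sum_(j' < d i) gap mu Q j j').
    rewrite mulr_ge0 ?(ltW de0)// sumr_ge0// => i _; rewrite sumr_ge0// => j _.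
    by rewrite sumr_ge0// => j' _; exact: (gap_ge0 mu0 gD QE).
  by move: (de * _) (pen mu) => x y; move: e0; lra.
move=> ht; have [tM|Mt] := leP t M.
  by move=> mu mu0 e e0; apply: free_le_trans (ht mu mu0 e e0); rewrite !lerD2r.
have iter k : bounded_by law0 (M + (t - M) / 2 ^+ k).
  elim: k => [|k ih]; first by rewrite expr0 divr1 subrKC.
  have -> : M + (t - M) / 2 ^+ k.+1 = (M + (t - M) / 2 ^+ k + M) / 2.
    by rewrite exprS; field; rewrite expf_eq0 pnatr_eq0 andbF.
  exact: step.
move=> mu mu0 e e0; have e20 : 0 < e / 2 by rewrite divr_gt0.
have [k hk] : exists k, (t - M) / 2 ^+ k <= e / 2.
  have tM0 : 0 < t - M by rewrite subr_gt0.
  have [k hk] : exists k : nat, (t - M) / (e / 2) <= k%:R.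
    by exists (Num.truncn ((t - M) / (e / 2))).+1; rewrite ltW// truncnS_gt.
  exists k; rewrite ler_pdivrMr ?exprn_gt0// -ler_pdivrMl// mulrC.
  by rewrite (le_trans hk)// -natrX ler_nat ltnW// ltn_expl.
apply: free_le_trans (iter k mu mu0 (e / 2) e20).
by move: hk; move: (_ / 2 ^+ k) (pen mu) => x y; move: e0; lra.
Qed.

(** The covariance of [v] hardly depends on [u]. Once [chi] is a sum of pieces, the left-hand side
    is a weighted sum of deviations of conditional covariances, which [norm_le_gap] bounds by the
    Jensen gap. *)
Lemma near_max_gap M eta mu : bounded_by lawe M -> lawe mu -> 0 < eta ->
  ~ free_le q c mu (M - eta - pen mu) ->
  forall i (chi : forall i, T i -> R) (j j' : 'I_(d i)) s, 0 < s ->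
  (forall i, measurable_fun setT (chi i)) -> (forall i x, 0 <= chi i x <= 1) ->
  `|Ex (mu i \x mu i)%E (fun p => (tnth (vv p) j * tnth (vv p) j' - cov (mu i) j j') * chi i (uu p))| <=
  (1 + cov (mu i) j j' ^+ 2) / (2 * s) * (6 * eta / de) + s * (1 + Ex (mu i) (@n2 R (d i))).
Proof.
move=> hM mue eta0 nle i chi j j' s s0 mchi chi01.
have mu0 := lawe0 mue.
have /dep_choice[P hP] : forall i, exists P : probability (T i) R, (law2 P /\ evenl P) /\
    forall f, quad f -> Ex P f = Ex (mu i \x mu i)%E (fun p => f (uu p)).
  move=> i'; have [m2 me] := mue i'.
  by have [P [P2 PE _ Pe]] := law_u_ex m2; exists P; split => //; split => //; exact: Pe.
have Pe : lawe P by move=> i'; have [] := hP i'.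
have PE i' f : quad f -> Ex (P i') f = Ex (mu i' \x mu i')%E (fun p => f (uu p)).
  by have [_] := hP i'; exact.
have penP : pen P = pen mu.
  have covP i' k k' : cov (P i') k k' = cov (mu i') k k'.
    have [m2 m0] := mu0 i'; rewrite /cov PE; last exact: quad_coord2.
    exact: Ex2_uu.
  rewrite /pen; congr (_ * _ + _ * _).
    by apply: eq_bigr => i' _; apply: eq_bigr => k _.
  apply: eq_bigr => i' _; apply: eq_bigr => k _; apply: eq_bigr => k' _.
  by rewrite covP.
have [g [D0 gD0]] := hM P Pe eta eta0.
have [D [gD [S hS]]] := @free_at_split P g D0 _ i chi (fun i => proj1 (Pe i)) gD0 mchi chi01.
have [Q [Qe QE]] := conditional_laws mu0 PE gD.
have h := penalized_chain mu0 PE gD hM Qe QE eta0.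
have dD : is_dec P (@dF _ _ _ D) (@da _ _ _ D) by case: gD.
have a0 k : 0 <= @da _ _ _ D k by exact: (dec_a_ge0 dD i0).
have a1 : \sum_k @da _ _ _ D k = 1 by exact: (dec_a_sum dD i0).
have g0 := gap_ge0 mu0 gD QE.
(* With both slacks equal to [eta] the chain loses [3 / 2 * eta]; a gap above [6 * eta / de] would
   gain more than [3 * eta] and contradict [nle]. *)
have hgap : gap mu Q j j' <= 6 * eta / de.
  rewrite ler_pdivlMr// mulrC.
  have le1 : gap mu Q j j' <= \sum_i \sum_(j < d i) \sum_(j' < d i) gap mu Q j j'.
    apply: (le_trans (le_sum1 j' (F := fun j' => gap mu Q j j') _)) => //.
    apply: (le_trans (le_sum1 j (F := fun j => \sum_(j' < d i) gap mu Q j j') _)) => //.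
      by move=> j0; rewrite sumr_ge0.
    apply: (le_sum1 i (F := fun i => \sum_(j < d i) \sum_(j' < d i) gap mu Q j j')) => i1.
    by rewrite sumr_ge0// => j0 _; rewrite sumr_ge0.
  apply: (@le_trans _ _ (de * \sum_i \sum_(j < d i) \sum_(j' < d i) gap mu Q j j')).
    by rewrite ler_wpM2l// ltW.
  rewrite leNgt; apply/negP => lt; apply: nle; apply: free_le_trans h.
  rewrite penP; move: lt; move: (de * _) (pen mu) => x y; lra.
have [m2 m0] := mu0 i.
have av := cov_average mu0 gD QE j j'.
have mF k : measurable_fun setT (@dF _ _ _ D k i) by case: dD.
have F01 k x : 0 <= @dF _ _ _ D k i x <= 1 by exact: (dec_le1 dD k x).
have ii (k : dK D) f : quad f -> intg (mu i \x mu i)%E (fun p => dF k (uu p) * f (vv p)).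
  move=> qf; have [mf [A fA]] := bd_uu_vv (mF k) (F01 k) qf.
  by have [] := quad2_intg m2 mf fA.
have qf : quad (fun x : T i => tnth x j * tnth x j' - cov (mu i) j j').
  apply: quadD; first exact: quad_coord2.
  by apply: (@quad_bd _ _ _ `|cov (mu i) j j'|) => // x; rewrite normrN.
have -> : Ex (mu i \x mu i)%E (fun p => (tnth (vv p) j * tnth (vv p) j' - cov (mu i) j j') * chi i (uu p)) =
    \sum_(k | S k) da k * (cov (Q k i) j j' - cov (mu i) j j').
  transitivity (Ex (mu i \x mu i)%E (fun p => \sum_(k | S k) dF k (uu p) * (tnth (vv p) j * tnth (vv p) j' - cov (mu i) j j'))).
    by apply: eq_Ex => p; rewrite -mulr_suml hS mulrC.
  rewrite Ex_sum; last by move=> k _; exact: ii k _ qf.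
  apply: eq_bigr => k _; rewrite -(QE k i _ qf); congr (_ * _).
  have [q2 _] := Qe k i.
  rewrite ExB; [by rewrite Ex_cst| |exact: intg_cst].
  by apply: quad_intg => //; exact: quad_coord2.
apply: (le_trans (ler_norm_sum _ _ _)).
apply: (@le_trans _ _ (\sum_k da k * `|cov (Q k i) j j' - cov (mu i) j j'|)).
  rewrite [leRHS](bigID S) /= -[leLHS]addr0 lerD//.
    by apply: ler_sum => k _; rewrite normrM ger0_norm.
  by apply: sumr_ge0 => k _; rewrite mulr_ge0.
apply: (@le_trans _ _ (\sum_k da k * ((1 + cov (mu i) j j' ^+ 2) / (2 * s) *
   (phi (cov (Q k i) j j') - phi (cov (mu i) j j') - phi_slope (cov (mu i) j j') * (cov (Q k i) j j' - cov (mu i) j j'))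
   + s * (1 + `|cov (Q k i) j j'|)))).
  by apply: ler_sum => k _; rewrite ler_wpM2l// norm_le_gap.
set G := (X in \sum_k da k * (_ / _ * X k + _)).
have -> : \sum_k da k * ((1 + cov (mu i) j j' ^+ 2) / (2 * s) * G k + s * (1 + `|cov (Q k i) j j'|)) =
   (1 + cov (mu i) j j' ^+ 2) / (2 * s) * (\sum_k da k * G k) + s * (1 + \sum_k da k * `|cov (Q k i) j j'|).
  rewrite -[X in s * (X + _)]a1 -big_split /= !mulr_sumr -big_split /=.
  by apply: eq_bigr => k _; ring.
rewrite /G (jensen_gap a0 a1 av).
apply: lerD.
  rewrite ler_wpM2l// divr_ge0//; last by rewrite mulr_ge0// ltW.
  by rewrite addr_ge0// sqr_ge0.
rewrite ler_wpM2l ?(ltW s0)// lerD2l.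
have -> : Ex (mu i) (@n2 R (d i)) = \sum_k da k * Ex (Q k i) (@n2 R (d i)).
  have -> : Ex (mu i) (@n2 R (d i)) = \sum_j0 cov (mu i) j0 j0.
    rewrite /cov -Ex_sum; first by apply: eq_Ex => x; apply: eq_bigr => j0 _; rewrite expr2.
    by move=> j0 _; apply: quad_intg => //; exact: quad_coord2.
  have e k : Ex (Q k i) (@n2 R (d i)) = \sum_j0 cov (Q k i) j0 j0.
    have [q2 _] := Qe k i.
    rewrite /cov -Ex_sum; first by apply: eq_Ex => x; apply: eq_bigr => j0 _; rewrite expr2.
    by move=> j0 _; apply: quad_intg => //; exact: quad_coord2.
  under [RHS]eq_bigr do rewrite e mulr_sumr.
  by rewrite exchange_big; apply: eq_bigr => j0 _; rewrite (cov_average mu0 gD QE).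
apply: ler_sum => k _; rewrite ler_wpM2l//.
have [q2 _] := Qe k i.
have iq : intg (Q k i) (fun x => tnth x j * tnth x j') by apply: quad_intg => //; exact: quad_coord2.
apply: (le_trans (Ex_norm iq)); apply: Ex_le => //; first exact: intg_norm iq.
move=> x; apply: (le_trans (norm_mul_le _ _)).
by have := n2_coord x j; have := n2_coord x j'; lra.
Qed.

End penalized.

(** * Characteristic functions of near-maximizers *)

Section ode.
Context (R : realType).
Variables (psi psi1 psi2 : R -> R) (s2 e : R).
Hypotheses (d1 : forall t, is_derive t (1 : R) psi (psi1 t))
  (d2 : forall t, is_derive t (1 : R) psi1 (psi2 t))
  (psi0 : psi 0 = 1) (psi10 : psi1 0 = 0) (s20 : 0 <= s2) (e0 : 0 <= e)
  (hr : forall t, 0 <= t <= 1 -> `|psi2 t * psi t - psi1 t ^+ 2 + s2 * psi t ^+ 2| <= e)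
  (he : 4 * e * expR s2 <= 1 / 4).

(** Half of the least value of [expR (- s2 t ^ 2 / 2)] on [[0, 1]]. While [psi > c0], the second
    derivative of [ln psi + s2 t ^ 2 / 2] is at most [e / c0 ^ 2] in absolute value, and this number
    is [kap]. *)
Let c0 : R := expR (- (s2 / 2)) / 2.
Let kap : R := 4 * e * expR s2.

Let c00 : 0 < c0. Proof. by rewrite divr_gt0 ?expR_gt0. Qed.
Let kap0 : 0 <= kap. Proof. by rewrite !mulr_ge0 ?expR_ge0. Qed.

Let k t := psi1 t * (psi t)^-1 + s2 * t.
Let f t := ln (psi t) + (s2 / 2) * (t * t).

Let dk t : 0 < psi t -> is_derive t (1 : R) k
  ((psi2 t * psi t - psi1 t ^+ 2 + s2 * psi t ^+ 2) / psi t ^+ 2).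
Proof.
move=> p0; have pn : psi t != 0 by rewrite gt_eqF.
have hv := is_deriveV pn (d1 t).
have hm := is_deriveM (d2 t) hv.
have hs := is_deriveZ s2 (is_derive_id t (1 : R)).
apply: is_derive_eq (is_deriveD hm hs) _.
by rewrite /GRing.scale /=; field.
Qed.

Let df t : 0 < psi t -> is_derive t (1 : R) f (k t).
Proof.
move=> p0.
have hl := is_derive1_comp (is_derive1_ln p0) (d1 t).
have hs := is_deriveZ (s2 / 2) (is_deriveM (is_derive_id t (1 : R)) (is_derive_id t (1 : R))).
apply: is_derive_eq (is_deriveD hl hs) _.
by rewrite /k /GRing.scale /=; field; rewrite gt_eqF.
Qed.

Let mvt (h h1 : R -> R) t B : 0 <= t -> (forall s : R, 0 <= s <= t -> is_derive s (1 : R) h (h1 s)) ->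
  (forall s : R, 0 <= s <= t -> `|h1 s| <= B) -> `|h t - h 0| <= B * t.
Proof.
move=> t0 hd hB.
have [x xt||c] := @MVT_segment R h h1 0 t t0.
- by apply: hd; move: xt; rewrite in_itv /= => /andP[a b]; rewrite !ltW.
- apply: derivable_within_continuous => x; rewrite in_itv /= => xt.
  by have [] := hd x xt.
- rewrite in_itv /= => ct ->; rewrite subr0 normrM (ger0_norm t0) ler_wpM2r//.
  exact: hB.
Qed.

Let f_small t : 0 <= t <= 1 -> (forall s, 0 <= s <= t -> c0 < psi s) -> `|f t| <= kap.
Proof.
move=> /andP[t0 t1] hp.
have pp s : 0 <= s <= t -> 0 < psi s by move=> /hp; exact: lt_trans.
have k_small s : 0 <= s <= t -> `|k s| <= kap.
  move=> /andP[s0 st].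
  have sub r : 0 <= r <= s -> 0 <= r <= t.
    by move=> /andP[-> rs]; exact: le_trans st.
  have := mvt s0 (fun r rs => dk (pp r (sub r rs))) (B := kap).
  have -> : k 0 = 0 by rewrite /k psi10 mul0r mulr0 addr0.
  rewrite subr0 => /(_ _)/le_trans; apply.
    move=> r rs; rewrite normrM normfV (ger0_norm (sqr_ge0 _)).
    have pr := pp r (sub r rs).
    rewrite ler_pdivrMr ?exprn_gt0//.
    apply: (le_trans (hr _)).
      by have /andP[-> rt] := sub r rs; exact: le_trans t1.
    have -> : e = kap * c0 ^+ 2.
      rewrite /kap /c0 expr_div_n -expRM_natl.
      have -> : expR (2 * - (s2 / 2)) = (expR s2)^-1 by rewrite -expRN; congr expR; field.
      by field; rewrite gt_eqF ?expR_gt0.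
    rewrite ler_wpM2l// lerXn2r ?nnegrE ?(ltW c00) ?(ltW pr)//.
    exact/ltW/hp/sub.
  by rewrite ler_piMr//; exact: le_trans t1.
have := mvt t0 (fun r rs => df (pp r rs)) k_small.
have -> : f 0 = 0 by rewrite /f psi0 ln1 !mulr0 addr0.
by rewrite subr0 => /le_trans; apply; rewrite ler_piMr.
Qed.

Let psiE t : 0 < psi t -> psi t = expR (f t - (s2 / 2) * (t * t)).
Proof. by move=> p; rewrite /f addrK lnK. Qed.

(** [he] says [kap <= 1 / 4], hence [expR (f t) >= 3 / 4]: the bound [psi > c0] improves by itself
    to [3 / 2 * c0], which is what continuation needs. *)
Let psi_big t : 0 <= t <= 1 -> (forall s, 0 <= s <= t -> c0 < psi s) -> 3 / 2 * c0 <= psi t.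
Proof.
move=> t01 hp; have h := f_small t01 hp; have /andP[t0 t1] := t01.
have pt : 0 < psi t by apply: lt_trans (hp t _); rewrite ?t0 ?lexx.
rewrite psiE// expRD /c0.
have h1 : 3 / 4 <= expR (f t).
  apply: le_trans (expR_ge1Dx _); move: h; rewrite ler_norml => /andP[h _].
  by have := he; move: h; rewrite /kap; lra.
have h2 : expR (- (s2 / 2)) <= expR (- (s2 / 2 * (t * t))).
  rewrite ler_expR lerN2 ler_piMr ?divr_ge0// mulr_ile1//.
have := ler_pM _ (expR_ge0 _) h1 h2.
by move: (expR _) (expR _ * expR _) => x y; lra.
Qed.

Let psi_cont t : continuous_at t psi.
Proof. by apply: differentiable_continuous; apply/derivable1_diffP; have [] := d1 t. Qed.

Let psi_gt t : 0 <= t <= 1 -> c0 < psi t.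
Proof.
move=> /andP[t0 t1]; rewrite ltNge; apply/negP => pt.
(* [r] is the first time at which [psi] drops to [c0]; slightly before it [psi] is still at least
   [3 / 2 * c0], against continuity. *)
pose A := [set s | 0 <= s <= 1 /\ psi s <= c0].
have At : A t by split => //; rewrite t0.
have lbA : lbound A 0 by move=> s [/andP[]].
have hA : has_inf A by split; [exists t|exists 0].
set r := inf A.
have r0 : 0 <= r by apply: lb_le_inf => //; exists t.
have r1 : r <= 1 by apply: le_trans t1; apply: ge_inf => //; exists 0.
have below s : 0 <= s < r -> c0 < psi s.
  move=> /andP[s0 sr]; rewrite ltNge; apply/negP => ps.
  have : r <= s.
    by apply: ge_inf; [exists 0|split => //; rewrite s0 (ltW (lt_le_trans sr r1))].
  by rewrite leNgt sr.
have pr : psi r <= c0.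
  rewrite leNgt; apply/negP => pr.
  have e1 : 0 < psi r - c0 by rewrite subr_gt0.
  have /cvgrPdist_lt/(_ _ e1)/nbhs_ballP[del /= del0 hd] := @psi_cont r.
  have [s [s01 ps] sr] := inf_adherent del0 hA.
  have rs : r <= s by apply: ge_inf; [exists 0|].
  have : `|psi r - psi s| < psi r - c0.
    apply: hd; rewrite /ball /= ler0_norm ?subr_le0// opprB ltrBlDl//.
  by rewrite ltr_norml => /andP[_]; move: ps; lra.
have rp : 0 < r.
  rewrite lt_neqAle r0 andbT; apply/eqP => r00; move: pr; rewrite -r00 psi0 /c0.
  have : expR (- (s2 / 2)) <= 1 by rewrite expR_le1 oppr_le0 divr_ge0.
  lra.
have e1 : 0 < c0 / 2 by rewrite divr_gt0.
have /cvgrPdist_lt/(_ _ e1)/nbhs_ballP[del /= del0 hd] := @psi_cont r.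
pose s := Num.max 0 (r - del / 2).
have s0 : 0 <= s by rewrite le_max lexx.
have sr : s < r by rewrite gt_max rp ltrBlDr ltrDl divr_gt0.
have big : 3 / 2 * c0 <= psi s.
  apply: psi_big; first by rewrite s0 (le_trans (ltW sr)).
  by move=> x /andP[x0 xs]; apply: below; rewrite x0 (le_lt_trans xs).
have : `|psi r - psi s| < c0 / 2.
  apply: hd; rewrite /ball /= ger0_norm ?subr_ge0 ?(ltW sr)//.
  have : r - del / 2 <= s by rewrite le_max lexx orbT.
  by move: del0; rewrite /=; lra.
rewrite ltr_norml => /andP[+ _]; move: c00; lra.
Qed.

(** [psi 1] is the Gaussian value times [expR (f 1)] with [|f 1| <= kap], and
    [|expR (f 1) - 1| <= 2 * kap] for so small a [kap]. *)
Lemma ode_estimate : `|psi 1 - expR (- (s2 / 2))| <= 8 * e * expR s2.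
Proof.
have t01 : 0 <= (1 : R) <= 1 by rewrite ler01 lexx.
have h : `|f 1| <= kap.
  by apply: f_small => // s /andP[s0 s1]; apply: psi_gt.
have p1 : 0 < psi 1 by apply: lt_trans (psi_gt _).
rewrite psiE// !mulr1 expRD -[X in _ - X]mul1r -mulrBl normrM (ger0_norm (expR_ge0 _)).
apply: (@le_trans _ _ `|expR (f 1) - 1|).
  by rewrite ler_piMr// expR_le1 oppr_le0 divr_ge0.
have -> : 8 * e * expR s2 = 2 * kap by rewrite /kap; ring.
move: h (he); rewrite -/kap; move: (f 1) => x; rewrite ler_norml => /andP[h1 h2] hk.
have g1 := expR_ge1Dx x; have g2 := expR_ge1Dx (- x).
have xp := expR_gt0 x.
have g3 : (1 - x) * expR x <= 1.
  have := ler_wpM2r (ltW xp) g2; rewrite -expRD addNr expR0; exact.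
rewrite ler_norml; apply/andP; split; first by move: g1; lra.
have : 0 <= (kap - x) * expR x by rewrite mulr_ge0 ?subr_ge0// ltW.
nra.
Qed.

End ode.

Lemma Ex_is_derive d (T : measurableType d) (R : realType) (P : {measure set T -> \bar R})
    (f f1 : R -> T -> R) (G : T -> R) a :
  (forall t, intg P (f t)) -> (forall t y, is_derive t (1 : R) (f^~ y) (f1 t y)) ->
  intg P G -> (forall t y, `|f1 t y| <= G y) ->
  is_derive a (1 : R) (fun t => Ex P (f t)) (Ex P (f1 a)).
Proof.
move=> fi fd Gi f1G.
have G0 y : 0 <= G y by exact: le_trans (normr_ge0 _) (f1G a y).
have e t y : partial1of2 f t y = f1 t y by rewrite /partial1of2 derive1E; have [_ ->] := fd t y.
have Ia : `]a - 1, a + 1[%classic a by rewrite /= in_itv /= ltrBlDr ltrDl ltr01.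
have D : derivable (fun t => Ex P (f t)) a 1.
  apply: (@derivable_under_integral _ _ _ P f setT measurableT a _ _ Ia _ _ G) => //.
  - by move=> t _; exact: fi.
  - by move=> t y _ _; rewrite e.
apply: DeriveDef => //; rewrite -derive1E.
rewrite /Ex (@differentiation_under_integral _ _ _ P f setT measurableT a _ _ Ia _ _ G)//.
- exact: (eq_Ex P (e a)).
- by move=> t _; exact: fi.
- by move=> t y _ _; rewrite e.
Qed.

Section product_of_functions.
Context d1 d2 (T1 : measurableType d1) (T2 : measurableType d2) (R : realType).
Variables (m1 : {sigma_finite_measure set T1 -> \bar R})
  (m2 : {sigma_finite_measure set T2 -> \bar R}) (f : T1 -> R) (g : T2 -> R).
Hypotheses (fi : intg m1 f) (gi : intg m2 g).

Lemma intg_prod : intg (m1 \x m2)%E (fun p => f p.1 * g p.2).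
Proof.
have mf := intg_meas fi; have mg := intg_meas gi.
apply/integrable12ltyP; first by apply/measurable_EFinP/measurable_funM; exact: measurableT_comp.
have -> : (\int[m1]_x \int[m2]_y `|(EFin \o (fun p : T1 * T2 => (f p.1 * g p.2)%R)) (x, y)| =
    \int[m1]_x (`|f x| * Ex m2 (fun y => `|g y|)%R)%R%:E)%E.
  apply: eq_integral => x _.
  rewrite -ExZ ?intg_norm// -ExE; first by apply: eq_integral => y _; rewrite /= normrM.
  exact/intgZ/intg_norm.
rewrite ExE ?ltry//; have := intgZ (Ex m2 (fun y => `|g y|)) (intg_norm fi).
by apply: eq_intg => x; rewrite mulrC.
Qed.

Lemma Ex_prod : Ex (m1 \x m2)%E (fun p => f p.1 * g p.2) = Ex m1 f * Ex m2 g.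
Proof.
rewrite (Ex_fst intg_prod); last by move=> x /=; exact: intgZ.
rewrite mulrC -ExZ//; apply: eq_Ex => x.
by rewrite /= ExZ// mulrC.
Qed.

End product_of_functions.

Lemma meas_cos (R : realType) : measurable_fun setT (@cos R).
Proof. by apply: continuous_measurable_fun; exact: continuous_cos. Qed.

Lemma meas_sin (R : realType) : measurable_fun setT (@sin R).
Proof. by apply: continuous_measurable_fun; exact: continuous_sin. Qed.

Section characteristic_function.
Context (R : realType) (m : nat).
Notation T := (m.-tuple R).
Implicit Types (th : 'I_m -> R) (x : T).

Definition lin th x : R := \sum_j th j * tnth x j.

Lemma quad_lin th : quad (lin th).
Proof. by apply: quad_sum => j; apply: quadZ; exact: quad_coord. Qed.

Lemma quad_lin2 th : quad (fun x => lin th x ^+ 2).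
Proof.
rewrite (_ : (fun x => _) = fun x => \sum_j \sum_j' (th j * th j') * (tnth x j * tnth x j')).
  by apply: quad_sum => j; apply: quad_sum => j'; apply: quadZ; exact: quad_coord2.
apply/funext => x; rewrite expr2 /lin mulr_suml; apply: eq_bigr => j _.
by rewrite mulr_sumr; apply: eq_bigr => j' _; ring.
Qed.

Lemma lin_uu th (p : T * T) : lin th (uu p) = (lin th p.1 + lin th p.2) / Num.sqrt 2.
Proof.
rewrite /lin -big_split /= mulr_suml; apply: eq_bigr => j _.
by rewrite tnth_mktuple; ring.
Qed.

Lemma lin_vv th (p : T * T) : lin th (vv p) = (lin th p.1 - lin th p.2) / Num.sqrt 2.
Proof.
rewrite /lin -sumrB mulr_suml; apply: eq_bigr => j _.
by rewrite tnth_mktuple; ring.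
Qed.

Lemma lin_negt th x : lin th (negt x) = - lin th x.
Proof. by rewrite /lin -sumrN; apply: eq_bigr => j _; rewrite tnth_mktuple mulrN. Qed.

(** With [y], [y'] the values of [lin th] on the two copies, [sqrt 2 lin th (u) = y + y'] and
    [2 lin th (v) ^ 2 = (y - y') ^ 2]. Expanding the cosine of the sum, the mean of
    [(lin th (v) ^ 2 - s2) cos (t (y + y'))] becomes minus the differential expression in [psi], the
    means of odd functions being zero; [ode_estimate] concludes at [t = 1]. *)
Lemma chf_estimate (P : probability T R) th (s2 e : R) : law2 P -> evenl P -> 0 <= s2 ->
  (forall chi : T -> R, measurable_fun setT chi -> (forall x, 0 <= chi x <= 1) ->
    `|Ex (P \x P)%E (fun p => (lin th (vv p) ^+ 2 - s2) * chi (uu p))| <= e) ->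
  4 * (3 * e) * expR s2 <= 1 / 4 ->
  `|Ex P (fun x => cos (lin th x)) - expR (- (s2 / 2))| <= 8 * (3 * e) * expR s2.
Proof.
move=> P2 Pe s20 he e4.
have my : measurable_fun setT (lin th) by have [] := quad_lin th.
have iy : intg P (fun x => `|lin th x|) by apply: intg_norm; exact: quad_intg P2 (quad_lin th).
have iy2 : intg P (fun x => lin th x ^+ 2) by exact: quad_intg P2 (quad_lin2 th).
have mC t : measurable_fun setT (fun x => cos (t * lin th x)).
  by apply: measurableT_comp; [exact: meas_cos|exact: measurable_funM].
have mS t : measurable_fun setT (fun x => sin (t * lin th x)).
  by apply: measurableT_comp; [exact: meas_sin|exact: measurable_funM].
have iC t : intg P (fun x => cos (t * lin th x)).
  by apply: (@intg_bd _ _ _ _ _ 1) => // x; rewrite cos_max.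
have iS t : intg P (fun x => sin (t * lin th x)).
  by apply: (@intg_bd _ _ _ _ _ 1) => // x; rewrite sin_max.
have iyC t : intg P (fun x => lin th x * cos (t * lin th x)).
  apply: (intg_dom _ iy); first exact: measurable_funM.
  by move=> x; rewrite normrM ler_piMr// cos_max.
have iyS t : intg P (fun x => lin th x * sin (t * lin th x)).
  apply: (intg_dom _ iy); first exact: measurable_funM.
  by move=> x; rewrite normrM ler_piMr// sin_max.
have bC t x : `|lin th x ^+ 2 * cos (t * lin th x)| <= lin th x ^+ 2.
  by rewrite normrM (ger0_norm (sqr_ge0 _)) ler_piMr ?sqr_ge0// cos_max.
have bS t x : `|lin th x ^+ 2 * sin (t * lin th x)| <= lin th x ^+ 2.
  by rewrite normrM (ger0_norm (sqr_ge0 _)) ler_piMr ?sqr_ge0// sin_max.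
have iy2C t : intg P (fun x => lin th x ^+ 2 * cos (t * lin th x)).
  by apply: (intg_dom _ iy2) => //; apply: measurable_funM => //; exact: measurable_funX.
have iy2S t : intg P (fun x => lin th x ^+ 2 * sin (t * lin th x)).
  by apply: (intg_dom _ iy2) => //; apply: measurable_funM => //; exact: measurable_funX.
pose psi t := Ex P (fun x => cos (t * lin th x)).
pose psi1 t := Ex P (fun x => - (lin th x * sin (t * lin th x))).
pose psi2 t := Ex P (fun x => - (lin th x ^+ 2 * cos (t * lin th x))).
have dlin t x : is_derive t (1 : R) (fun t => t * lin th x) (lin th x).
  have := is_deriveM (is_derive_id t (1 : R)) (is_derive_cst (lin th x) t (1 : R)).
  by move=> /is_derive_eq; apply; rewrite /GRing.scale /= mulr0 add0r mulr1.
have d1 t : is_derive t (1 : R) psi (psi1 t).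
  apply: (@Ex_is_derive _ _ _ P (fun t x => cos (t * lin th x)) (fun t x => - (lin th x * sin (t * lin th x))) (fun x => `|lin th x|)) => //.
    move=> s x; apply: is_derive_eq (is_derive1_comp (is_derive_cos _) (dlin s x)) _.
    by rewrite mulNr mulrC.
  by move=> s x; rewrite normrN normrM ler_piMr// sin_max.
have d2 t : is_derive t (1 : R) psi1 (psi2 t).
  apply: (@Ex_is_derive _ _ _ P (fun t x => - (lin th x * sin (t * lin th x))) (fun t x => - (lin th x ^+ 2 * cos (t * lin th x))) (fun x => lin th x ^+ 2)) => //.
  - by move=> s; exact: intgN.
  - move=> s x.
    have := is_deriveN (is_deriveZ (lin th x) (is_derive1_comp (is_derive_sin _) (dlin s x))).
    move=> /is_derive_eq; apply; rewrite /GRing.scale /=; ring.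
  - by move=> s x; rewrite normrN.
have psi0 : psi 0 = 1.
  by rewrite -[RHS](Ex_cst P); apply: eq_Ex => x; rewrite mul0r cos0.
have psi10 : psi1 0 = 0.
  by rewrite -[RHS](Ex_cst P); apply: eq_Ex => x; rewrite mul0r sin0 mulr0 oppr0.
have qS t : quad (fun x => sin (t * lin th x)).
  by apply: (@quad_bd _ _ _ 1) => // x; rewrite sin_max.
have qC t : quad (fun x => lin th x * cos (t * lin th x)).
  by apply: (quad_bdM (B := 1)) => [//|x|]; [rewrite cos_max|exact: quad_lin].
have ES t : Ex P (fun x => sin (t * lin th x)) = 0.
  have := Pe _ (qS t).
  rewrite (eq_Ex P (g := fun x => - sin (t * lin th x))); last first.
    by move=> x; rewrite lin_negt mulrN sinN.
  by rewrite ExN//; lra.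
have EC t : Ex P (fun x => lin th x * cos (t * lin th x)) = 0.
  have := Pe _ (qC t).
  rewrite (eq_Ex P (g := fun x => - (lin th x * cos (t * lin th x)))); last first.
    by move=> x; rewrite lin_negt mulrN cosN mulNr.
  by rewrite ExN//; lra.
have key t : Ex (P \x P)%E (fun p => (lin th (vv p) ^+ 2 - s2) * cos (t * (Num.sqrt 2 * lin th (uu p)))) =
    - (psi2 t * psi t - psi1 t ^+ 2 + s2 * psi t ^+ 2).
  pose C := fun x => cos (t * lin th x); pose S := fun x => sin (t * lin th x).
  pose y := lin th.
  have -> : (fun p => (lin th (vv p) ^+ 2 - s2) * cos (t * (Num.sqrt 2 * lin th (uu p)))) =
      (fun p : T * T =>
      ((1 / 2) * ((y p.1 ^+ 2 * C p.1) * C p.2) +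
      ((1 / 2) * (C p.1 * (y p.2 ^+ 2 * C p.2)) +
      ((1 / 2) * (- ((y p.1 ^+ 2 * S p.1) * S p.2)) +
      ((1 / 2) * (- (S p.1 * (y p.2 ^+ 2 * S p.2))) +
      (- ((y p.1 * C p.1) * (y p.2 * C p.2)) +
      ((y p.1 * S p.1) * (y p.2 * S p.2) +
      (s2 * (- (C p.1 * C p.2)) + s2 * (S p.1 * S p.2))))))))).
    apply/funext => p; rewrite lin_uu lin_vv /C /S /y.
    have -> : t * (Num.sqrt 2 * ((lin th p.1 + lin th p.2) / Num.sqrt 2)) = t * lin th p.1 + t * lin th p.2.
      by field; exact: s2_neq0.
    rewrite cosD exprMn exprVn s2_sqr.
    by field.
  have I1 := intg_prod (iy2C t) (iC t); have E1 := Ex_prod (iy2C t) (iC t).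
  have I2 := intg_prod (iC t) (iy2C t); have E2 := Ex_prod (iC t) (iy2C t).
  have I3 := intg_prod (iy2S t) (iS t); have E3 := Ex_prod (iy2S t) (iS t).
  have I4 := intg_prod (iS t) (iy2S t); have E4 := Ex_prod (iS t) (iy2S t).
  have I5 := intg_prod (iyC t) (iyC t); have E5 := Ex_prod (iyC t) (iyC t).
  have I6 := intg_prod (iyS t) (iyS t); have E6 := Ex_prod (iyS t) (iyS t).
  have I7 := intg_prod (iC t) (iC t); have E7 := Ex_prod (iC t) (iC t).
  have I8 := intg_prod (iS t) (iS t); have E8 := Ex_prod (iS t) (iS t).
  have J8 := intgZ s2 I8.
  have J7 := intgZ s2 (intgN I7); have J78 := intgD J7 J8.
  have J6 := intgD I6 J78; have J5 := intgD (intgN I5) J6.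
  have J4 := intgD (intgZ (1 / 2) (intgN I4)) J5; have J3 := intgD (intgZ (1 / 2) (intgN I3)) J4.
  have J2 := intgD (intgZ (1 / 2) I2) J3.
  rewrite /C /S /y.
  rewrite (ExD (intgZ (1 / 2) I1) J2) (ExD (intgZ (1 / 2) I2) J3).
  rewrite (ExD (intgZ (1 / 2) (intgN I3)) J4) (ExD (intgZ (1 / 2) (intgN I4)) J5).
  rewrite (ExD (intgN I5) J6) (ExD I6 J78) (ExD J7 J8).
  rewrite !(ExZ _ (intgN _)) ?(ExZ _ I1) ?(ExZ _ I2) ?(ExZ _ I8)//.
  rewrite !ExN// E1 E2 E3 E4 E5 E6 E7 E8 ES EC /psi2 /psi1 !ExN// /psi; by field.
(* The cosine is [2 * chi - 1] with [chi] and [1] both admissible in [he], whence [2 * e + e]. *)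
have hr t : `|psi2 t * psi t - psi1 t ^+ 2 + s2 * psi t ^+ 2| <= 3 * e.
  rewrite -normrN -key.
  pose chi (x : T) := (1 + cos (t * (Num.sqrt 2 * lin th x))) / 2.
  have mchi : measurable_fun setT chi.
    apply: measurable_funM => //; apply: measurable_funD => //.
    apply: measurableT_comp; first exact: meas_cos.
    by do 2 apply: measurable_funM => //.
  have chi01 x : 0 <= chi x <= 1.
    rewrite /chi; have := cos_le1 (t * (Num.sqrt 2 * lin th x)).
    have := cos_geN1 (t * (Num.sqrt 2 * lin th x)); lra.
  have qv : quad (fun x => lin th x ^+ 2 - s2).
    by apply: quadD; [exact: quad_lin2|apply: (@quad_bd _ _ _ `|s2|) => // x; rewrite normrN].
  have [m1 [A1 b1]] := bd_uu_vv mchi chi01 qv; have [j1 _ _] := quad2_intg P2 m1 b1.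
  have one01 (x : T) : 0 <= (1 : R) <= 1 by rewrite ler01 lexx.
  have m1' : measurable_fun setT ((fun=> 1) : T -> R) by [].
  have [m2 [A2 b2]] := bd_uu_vv m1' one01 qv; have [j2 _ _] := quad2_intg P2 m2 b2.
  have h1 := he _ mchi chi01; have h2 := he _ m1' one01.
  rewrite (eq_Ex _ (g := fun p => 2 * (chi (uu p) * (lin th (vv p) ^+ 2 - s2)) - 1 * (lin th (vv p) ^+ 2 - s2))); last first.
    by move=> p; rewrite /chi; field.
  rewrite ExB; [|exact: intgZ|exact: j2].
  rewrite ExZ//.
  have c1 (p : T * T) : (lin th (vv p) ^+ 2 - s2) * chi (uu p) = chi (uu p) * (lin th (vv p) ^+ 2 - s2) by rewrite mulrC.
  have c2 (p : T * T) : (lin th (vv p) ^+ 2 - s2) * 1 = 1 * (lin th (vv p) ^+ 2 - s2) by rewrite mulrC.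
  rewrite (eq_Ex _ c1) in h1; rewrite (eq_Ex _ c2) in h2; move: h1 h2.
  move: (Ex _ _) (Ex _ _) => a b; rewrite !ler_norml => /andP[a1 a2] /andP[b1' b2'].
  by clear one01; apply/andP; split; lra.
have e0 : 0 <= 3 * e by exact: le_trans (hr 0).
have := @ode_estimate R psi psi1 psi2 s2 (3 * e) d1 d2 psi0 psi10 s20 e0 (fun t _ => hr t) e4.
rewrite /psi (eq_Ex P (g := fun x => cos (lin th x)))// => x.
by rewrite mul1r.
Qed.

End characteristic_function.

(** * Gaussian densities *)

Section gaussian_moments_1d.
Context (R : realType).
Notation leb1 := (@lebesgue_measure R).

Let intg_gauss (a : R) : 0 < a -> intg leb1 (fun x => expR (- a * x ^+ 2)).
Proof.
move=> a0; apply: intg_ge0 => [|x|]; rewrite ?expR_ge0//.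
  by apply: measurableT_comp => //; exact: measurable_funM.
by rewrite integral_gauss_scaled// ltry.
Qed.

Let Ex_gauss (a : R) : 0 < a -> Ex leb1 (fun x => expR (- a * x ^+ 2)) = Num.sqrt pi / Num.sqrt a.
Proof.
by move=> a0; have := integral_gauss_scaled a0; rewrite (ExE (intg_gauss a0)) => -[].
Qed.

Let meas_sq (a : R) : measurable_fun setT (fun x : R => x ^+ 2 * expR (- a * x ^+ 2)).
Proof.
apply: measurable_funM => //; apply: measurableT_comp => //.
by apply: measurable_funM => //; exact: measurable_funX.
Qed.

Let sq_ge0 (a x : R) : 0 <= x ^+ 2 * expR (- a * x ^+ 2).
Proof. by apply: mulr_ge0; rewrite ?sqr_ge0 ?expR_ge0. Qed.

Let sq_le (x : R) : x ^+ 2 * expR (- 1 * x ^+ 2) <= 2 * expR (- 2^-1 * x ^+ 2).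
Proof.
have -> : - 1 * x ^+ 2 = - 2^-1 * x ^+ 2 + - (x ^+ 2 / 2) by field.
rewrite expRD mulrCA mulrC ler_wpM2r ?expR_ge0// expRN.
rewrite ler_pdivrMr ?expR_gt0//.
by have := expR_ge1Dx (x ^+ 2 / 2); lra.
Qed.

Let intg_sq1 : intg leb1 (fun x => x ^+ 2 * expR (- 1 * x ^+ 2)).
Proof.
apply: (intg_dom _ (intgZ 2 (intg_gauss (a := 2^-1) _))) => [||x]; [exact: meas_sq|by rewrite invr_gt0|].
by rewrite (ger0_norm (sq_ge0 _ _)); exact: sq_le.
Qed.

(* Differentiate [t |-> int exp (- (2 + sin t) x^2) dx] at [t = 0]: the sine
   keeps the domination uniform in [t]. *)
Lemma Ex_gauss_sq2 : Ex leb1 (fun x => x ^+ 2 * expR (- 2 * x ^+ 2)) = Num.sqrt pi / (4 * Num.sqrt 2).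
Proof.
pose a t : R := 2 + sin t.
have a1 t : 1 <= a t by rewrite /a; have := sin_geN1 t; lra.
have a0 t : 0 < a t by apply: lt_le_trans (a1 t).
have da t : is_derive t (1 : R) a (cos t).
  have h := is_deriveD (is_derive_cst (2 : R) t (1 : R)) (is_derive_sin t).
  by apply: is_derive_eq h _; rewrite add0r.
have D1 : is_derive (0 : R) (1 : R) (fun t => Ex leb1 (fun x => expR (- a t * x ^+ 2)))
    (Ex leb1 (fun x => - cos 0 * x ^+ 2 * expR (- a 0 * x ^+ 2))).
  apply: (@Ex_is_derive _ _ _ leb1 (fun t x => expR (- a t * x ^+ 2))
    (fun t x => - cos t * x ^+ 2 * expR (- a t * x ^+ 2)) (fun x => x ^+ 2 * expR (- 1 * x ^+ 2))); [|move=> t x|exact: intg_sq1|].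
  - by move=> t; exact: intg_gauss.
  - have h := is_deriveM (is_deriveN (da t)) (is_derive_cst (x ^+ 2) t (1 : R)).
    apply: is_derive_eq (is_derive1_comp (is_derive_expR _) h) _.
    by rewrite /GRing.scale /= mulr0 add0r; ring.
  - move=> t x; rewrite !mulNr normrN -mulrA normrM -mulNr (ger0_norm (sq_ge0 _ _)) -mulNr.
    apply: (@le_trans _ _ (x ^+ 2 * expR (- a t * x ^+ 2))).
      by rewrite ler_piMl ?cos_max.
    by rewrite ler_wpM2l ?sqr_ge0// ler_expR ler_wpM2r ?sqr_ge0// lerN2.
have D2 : is_derive (0 : R) (1 : R) (fun t => Ex leb1 (fun x => expR (- a t * x ^+ 2)))
    (- (Num.sqrt pi / (4 * Num.sqrt 2))).
  have -> : (fun t => Ex leb1 (fun x => expR (- a t * x ^+ 2))) =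
      (fun t => Num.sqrt pi * expR (- 2^-1 * ln (a t))).
    apply/funext => t; rewrite Ex_gauss//; congr (_ * _).
    by rewrite -powR12_sqrt ?(ltW (a0 t))// -powRN /powR gt_eqF// mulNr.
  have h := is_deriveZ (- 2^-1) (is_derive1_comp (is_derive1_ln (a0 0)) (da 0)).
  apply: is_derive_eq (is_deriveZ (Num.sqrt pi) (is_derive1_comp (is_derive_expR _) h)) _.
  rewrite /GRing.scale /= cos0 /a sin0 addr0 mulr1.
  have -> : expR (- 2^-1 * ln 2) = (Num.sqrt 2)^-1 :> R.
    by rewrite -powR12_sqrt// -powRN /powR gt_eqF// mulNr.
  by field; exact: s2_neq0.
have := @derive_val _ _ _ _ _ _ _ D1; rewrite (@derive_val _ _ _ _ _ _ _ D2) cos0 /a sin0 addr0.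
under eq_Ex do rewrite mulN1r mulNr.
rewrite ExN; first by move=> /oppr_inj ->.
apply: (intg_dom _ intg_sq1) => [|x]; first exact: meas_sq.
rewrite (ger0_norm (sq_ge0 _ _)).
rewrite ler_wpM2l ?sqr_ge0// ler_expR ler_wpM2r ?sqr_ge0//; lra.
Qed.

Definition gauss1 (s x : R) : R := (Num.sqrt (2 * pi * s))^-1 * expR (- (x ^+ 2 / s) / 2).

Lemma gauss1_ge0 s x : 0 <= gauss1 s x.
Proof. by rewrite mulr_ge0 ?invr_ge0 ?sqrtr_ge0 ?expR_ge0. Qed.

Lemma meas_gauss1 s : measurable_fun setT (gauss1 s).
Proof.
apply: measurable_funM => //; apply: measurableT_comp => //.
apply: measurable_funM => //; apply: measurableT_comp => //.
by apply: measurable_funM => //; exact: measurable_funX.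
Qed.

Lemma gauss1_moment (s al be : R) : 0 < s ->
  (\int[leb1]_x ((al + be * x) ^+ 2 * gauss1 s x)%:E = (al ^+ 2 + be ^+ 2 * s)%:E)%E.
Proof.
move=> s0.
pose K := (Num.sqrt (2 * pi * s))^-1; pose r := 2 * Num.sqrt s.
have K0 : 0 <= K by rewrite invr_ge0 sqrtr_ge0.
have ss0 : 0 < Num.sqrt s by rewrite sqrtr_gt0.
have r0 : 0 < r by rewrite mulr_gt0.
have pi0 : 0 < Num.sqrt pi :> R by rewrite sqrtr_gt0 pi_gt0.
have KE : K = (Num.sqrt 2 * Num.sqrt pi * Num.sqrt s)^-1.
  by rewrite /K -mulrA sqrtrM// sqrtrM ?pi_ge0// mulrA.
pose f (y : R) := (al + be * (r * y)) ^+ 2 * (K * expR (- 2 * y ^+ 2)).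
have E y : f (r^-1 * y + 0) = (al + be * y) ^+ 2 * gauss1 s y.
  rewrite /f /gauss1 -/K addr0 [r * _]mulrA mulfV ?gt_eqF// mul1r; congr (_ * (_ * expR _)).
  rewrite exprMn exprVn /r exprMn sqr_sqrtr ?(ltW s0)//.
  by field; rewrite gt_eqF.
have mf : measurable_fun setT (EFin \o f).
  apply/measurable_EFinP; apply: measurable_funM.
    apply: measurable_funX; apply: measurable_funD => //; apply: measurable_funM => //.
  apply: measurable_funM => //; apply: measurableT_comp => //.
  by apply: measurable_funM => //; exact: measurable_funX.
have f0 y : (0 <= (EFin \o f) y)%E.
  by rewrite lee_fin mulr_ge0 ?sqr_ge0// mulr_ge0 ?expR_ge0.
have rV0 : r^-1 != 0 by rewrite invr_eq0 gt_eqF.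
under eq_integral do rewrite -E.
rewrite (@integral_lebesgue_affine R r^-1 0 (EFin \o f) rV0 mf f0) ger0_norm ?invr_ge0 ?(ltW r0)// invrK.
have i0 := intg_gauss (a := 2) (ltr0n _ 2).
have i2 : intg leb1 (fun x => x ^+ 2 * expR (- 2 * x ^+ 2)).
  apply: (intg_dom _ intg_sq1) => [|x]; first exact: meas_sq.
  rewrite (ger0_norm (sq_ge0 _ _)).
  rewrite ler_wpM2l ?sqr_ge0// ler_expR ler_wpM2r ?sqr_ge0//; lra.
have n1 : (-1 : R) != 0 by rewrite oppr_eq0 oner_eq0.
(* Adding the reflected integral cancels the odd term [2 al be x] of the square. *)
have eJ := @integral_lebesgue_affine R (-1) 0 (EFin \o f) n1 mf f0.
rewrite normrN1 invr1 mul1e in eJ.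
pose J := (\int[leb1]_x (EFin \o f) x)%E; rewrite -/J in eJ *.
have mfn : measurable_fun setT (fun x : R => (EFin \o f) (-1 * x + 0)).
  apply: (measurableT_comp mf); apply: measurable_funD => //.
have : (J + J = (r^-1 * (2 * (al ^+ 2 + be ^+ 2 * s)))%:E)%E.
  rewrite -[X in (X + _)%E]eJ /J -ge0_integralD//.
  transitivity (\int[leb1]_y ((2 * al ^+ 2 * K) * expR (- 2 * y ^+ 2) +
     (2 * (be * r) ^+ 2 * K) * (y ^+ 2 * expR (- 2 * y ^+ 2)))%:E)%E.
    apply: eq_integral => y _; rewrite /= -EFinD /f addr0 mulN1r sqrrN; congr (_%:E); ring.
  rewrite ExE ?ExD ?ExZ//; [|exact: intgZ|exact: intgZ|apply: intgD; exact: intgZ].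
  rewrite (Ex_gauss (a := 2))// Ex_gauss_sq2; congr (_%:E).
  have := @s2_sqr R; have := @s2_neq0 R; have := sqr_sqrtr (ltW s0); rewrite KE /r.
  move: pi0 ss0; move: (Num.sqrt pi) (Num.sqrt s) (Num.sqrt 2) => p t u p0 t0 <- u0 u2.
  transitivity ((2 * al ^+ 2 / t + 2 * be ^+ 2 * t) / u ^+ 2); first by field; rewrite u0 !gt_eqF.
  by rewrite u2; field; rewrite gt_eqF.
have J0 : (0 <= J)%E by exact: integral_ge0.
case: J J0 {eJ} => [j||]//= _ [] h; rewrite -EFinM; congr (_%:E).
have -> : j = r^-1 * (al ^+ 2 + be ^+ 2 * s).
  by apply: (mulfI (x := 2)) => //; rewrite mulr_natl mulr2n h; ring.
by rewrite mulVKf// gt_eqF.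
Qed.

End gaussian_moments_1d.

(** * Positive definite forms and Schur complements *)

Section quadratic_forms.
Context (R : realType).

Definition qf m (S : 'M[R]_m) (v : 'rV[R]_m) : R := (v *m S *m v^T) 0 0.

Lemma qfE m (S : 'M[R]_m) v : qf S v = \sum_j \sum_j' v 0 j * S j j' * v 0 j'.
Proof.
rewrite /qf mxE exchange_big; apply: eq_bigr => j' _ /=.
by rewrite !mxE mulr_suml.
Qed.

Lemma qfD m (S1 S2 : 'M[R]_m) v : qf (S1 + S2) v = qf S1 v + qf S2 v.
Proof. by rewrite /qf mulmxDr mulmxDl mxE. Qed.


Lemma scalar_mxE (A B : 'M[R]_1) : (A *m B) 0 0 = A 0 0 * B 0 0.
Proof. by rewrite mxE big_ord1. Qed.

Lemma tr1 (A : 'M[R]_1) : A^T 0 0 = A 0 0. Proof. by rewrite mxE. Qed.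

Lemma qf_block m (s : R) (b : 'rV[R]_m) (D : 'M[R]_m) (a : R) (w : 'rV[R]_m) :
  qf (block_mx s%:M b b^T D : 'M[R]_(1 + m)) (row_mx a%:M w) =
  a ^+ 2 * s + 2 * a * ((w *m b^T) 0 0) + qf D w.
Proof.
have addE (A B : 'M[R]_1) : (A + B) 0 0 = A 0 0 + B 0 0 by rewrite mxE.
rewrite /qf mul_row_block tr_row_mx mul_row_col mulmxDl [(_ *m w^T)]mulmxDl !addE.
rewrite tr_scalar_mx -!mulmxA.
rewrite (_ : (a%:M *m (b *m w^T)) 0 0 = a * (w *m b^T) 0 0); last first.
  by rewrite mul_scalar_mx mxE; congr (_ * _); rewrite -tr1 trmx_mul trmxK.
rewrite (_ : (w *m (b^T *m a%:M)) 0 0 = a * (w *m b^T) 0 0); last first.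
  by rewrite mul_mx_scalar -scalemxAr mxE.
rewrite (_ : (a%:M *m (s%:M *m a%:M)) 0 0 = a ^+ 2 * s); last first.
  by rewrite -!scalar_mxM !mxE eqxx mulr1n; ring.
by ring.
Qed.

Lemma qf0_posdef m (S : 'M[R]_m) v : posdef S -> 0 <= qf S v.
Proof.
move=> [_ h]; have [->|v0] := eqVneq v 0; last exact/ltW/h.
by rewrite /qf !mul0mx mxE.
Qed.

Lemma posdef_unit m (S : 'M[R]_m) : posdef S -> S \in unitmx.
Proof.
move=> [_ h]; rewrite -row_free_unit -kermx_eq0; apply/eqP/row_matrixP => i.
rewrite row0; apply/eqP/negPn/negP => /h.
have /sub_kermxP -> : (row i (kermx S) <= kermx S)%MS by exact: row_sub.
by rewrite mul0mx mxE ltxx.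
Qed.

Lemma qf_inv m (S : 'M[R]_m) v : posdef S -> qf (invmx S) v = qf S (v *m invmx S).
Proof.
move=> pS; have uS := posdef_unit pS; have [sS _] := pS.
rewrite /qf mulmxKV// trmx_mul trmx_inv sS.
by rewrite mulmxA.
Qed.

Section schur.
Variables (m : nat) (s : R) (b : 'rV[R]_m) (D : 'M[R]_m).
Let S : 'M[R]_(1 + m) := block_mx s%:M b b^T D.
(** For a Gaussian covariance this is the covariance of the remaining coordinates conditionally on
    the first one. *)
Definition schur : 'M[R]_m := D - s^-1 *: (b^T *m b).
Lemma qf_schur w : qf schur w = qf D w - ((w *m b^T) 0 0) ^+ 2 / s.
Proof.
rewrite /schur -[X in qf D w - X]opprK opprK qfD; congr (_ + _).
rewrite /qf mulmxN mulNmx mxE -scalemxAr -scalemxAl mxE; congr (- _).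
rewrite mulrC; congr (_ / _); rewrite (mulmxA w) -(mulmxA (w *m b^T)) scalar_mxE expr2; congr (_ * _).
by rewrite -tr1 trmx_mul trmxK.
Qed.

Hypothesis pS : posdef S.

Lemma schur_s_gt0 : 0 < s.
Proof.
have [_ h] := pS.
have : 0 < qf S (row_mx 1%:M 0).
  apply: h; apply/eqP => /(congr1 (fun v : 'rV[R]_(1 + m) => v 0 (lshift m 0))).
  by rewrite row_mxEl !mxE eqxx => /eqP; rewrite oner_eq0.
by rewrite qf_block mul0mx /qf !mul0mx !mxE expr1n mul1r mulr0 !addr0.
Qed.

Lemma schur_posdef : posdef schur.
Proof.
have s0 := schur_s_gt0; have [sS h] := pS.
have sD : D^T = D.
  by have := congr1 drsubmx sS; rewrite /S tr_block_mx !block_mxKdr.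
split.
  by rewrite /schur linearB /= linearZ /= trmx_mul trmxK sD.
move=> w w0; rewrite -/(qf _ _) qf_schur.
have : 0 < qf S (row_mx (- ((w *m b^T) 0 0) / s)%:M w).
  apply: h; apply/eqP => e; move/eqP: w0; apply.
  by have := congr1 rsubmx e; rewrite row_mxKr linear0.
rewrite qf_block; move: ((w *m b^T) 0 0) (qf D w) => x y.
rewrite (_ : _ + y = y - x ^+ 2 / s)//; by field; rewrite gt_eqF.
Qed.

Lemma schur_det : \det S = s * \det schur.
Proof.
have s0 := schur_s_gt0.
have -> : S = block_mx 1%:M 0 (s^-1 *: b^T) 1%:M *m block_mx s%:M b 0 schur.
  rewrite mulmx_block !mul1mx ?mul0mx ?mulmx0 ?addr0 /S /schur.
  rewrite mul_mx_scalar scalerA mulfV ?gt_eqF// scale1r -scalemxAl addrC subrK.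
  by [].
by rewrite det_mulmx det_lblock det_ublock !det1 det_scalar1 mulr1 mul1r.
Qed.

(** Completion of the square in the exponent of a Gaussian: the marginal part in the first
    coordinate plus the conditional part centered at the regression [(a / s) b]. *)
Lemma schur_qf_inv (a : R) (w : 'rV[R]_m) :
  qf (invmx S) (row_mx a%:M w) = a ^+ 2 / s + qf (invmx schur) (w - (a / s) *: b).
Proof.
have s0 := schur_s_gt0; have pc := schur_posdef.
rewrite !qf_inv//.
set z := _ *m invmx S.
have ez : z *m S = row_mx a%:M w by rewrite mulmxKV// posdef_unit.
rewrite -[z]hsubmxK [lsubmx z]mx11_scalar; set z0 := (lsubmx z) 0 0; set z1 := rsubmx z.
have : row_mx (z0%:M) z1 *m S = row_mx a%:M w by rewrite /z0 -mx11_scalar hsubmxK.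
rewrite /S mul_row_block => /eq_row_mx[e1 e2].
have ea : a = z0 * s + (z1 *m b^T) 0 0.
  by have := congr1 (fun M : 'M[R]_1 => M 0 0) e1; rewrite -scalar_mxM !mxE eqxx mulr1n.
have ew : w - (a / s) *: b = z1 *m schur.
  rewrite -e2 /schur mulmxBr ea mul_scalar_mx mulrDl mulfK ?gt_eqF// scalerDl.
  rewrite opprD addrACA subrr add0r -scalemxAr mulmxA.
  rewrite [z1 *m b^T]mx11_scalar mul_scalar_mx scalerA [s^-1 * _]mulrC; congr (_ - (_ *: _)).
  by rewrite mxE eqxx mulr1n.
rewrite ew mulmxK ?posdef_unit//.
rewrite -[in LHS]/S qf_block qf_schur ea; move: ((z1 *m b^T) 0 0) (qf D z1) => x y.
by field; rewrite gt_eqF.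
Qed.

End schur.

Lemma posdef_block m (S : 'M[R]_(1 + m)) : S^T = S -> S =
  block_mx (S 0 0)%:M (ursubmx S) (ursubmx S)^T (drsubmx S).
Proof.
move=> sS; rewrite -[LHS]submxK [ulsubmx S]mx11_scalar; congr block_mx.
  by congr (_%:M); rewrite !mxE; congr (S _ _); apply: val_inj.
by rewrite trmx_ursub sS.
Qed.

End quadratic_forms.

Section gaussian_density.
Context (R : realType).
Implicit Types (m : nat).

Definition rowt m (x : m.-tuple R) : 'rV[R]_m := \row_j tnth x j.

Lemma qf_rowtE m (S : 'M[R]_m) x :
  qf S (rowt x) = \sum_j \sum_j' tnth x j * S j j' * tnth x j'.
Proof.
by rewrite qfE; apply: eq_bigr => j _; apply: eq_bigr => j' _; rewrite !mxE.
Qed.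

Lemma gauss_densityE m (S : 'M[R]_m) x :
  gauss_density S x = (Num.sqrt ((2 * pi) ^+ m * \det S))^-1 * expR (- qf (invmx S) (rowt x) / 2).
Proof. by []. Qed.

Lemma meas_qf m (S : 'M[R]_m) : measurable_fun setT (fun x => qf S (rowt x)).
Proof.
rewrite (_ : (fun x => _) = fun x => \sum_j \sum_j' tnth x j * S j j' * tnth x j'); last first.
  by apply/funext => x; exact: qf_rowtE.
apply: measurable_sum => j; apply: measurable_sum => j'.
by apply: measurable_funM; [apply: measurable_funM => //|]; exact: measurable_tnth.
Qed.

Lemma meas_gauss_density m (S : 'M[R]_m) : measurable_fun setT (gauss_density S).
Proof.
apply: measurable_funM => //; apply: measurableT_comp => //.
apply: measurable_funM => //; apply: measurableT_comp => //; exact: meas_qf.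
Qed.

Lemma gauss_density_ge0 m (S : 'M[R]_m) x : 0 <= gauss_density S x.
Proof. by rewrite gauss_densityE mulr_ge0 ?expR_ge0// invr_ge0 sqrtr_ge0. Qed.

Definition schur1 m (S : 'M[R]_m.+1) : 'M[R]_m :=
  schur (S 0 0) (ursubmx (S : 'M[R]_(1 + m))) (drsubmx (S : 'M[R]_(1 + m))).

Lemma schur1_posdef m (S : 'M[R]_m.+1) : posdef S ->
  [/\ 0 < S 0 0, posdef (schur1 S) & \det S = S 0 0 * \det (schur1 S)].
Proof.
move=> pS; have [sS _] := pS; have eS := @posdef_block R m S sS.
have pb : posdef (block_mx (S 0 0)%:M (ursubmx (S : 'M[R]_(1 + m)))
   (ursubmx (S : 'M[R]_(1 + m)))^T (drsubmx (S : 'M[R]_(1 + m)))) by rewrite -eS.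
split; [exact: schur_s_gt0 pb|exact: schur_posdef pb|].
by rewrite [in LHS]eS; exact: schur_det pb.
Qed.

Lemma posdef_det m (S : 'M[R]_m) : posdef S -> 0 < \det S.
Proof.
elim: m S => [|m ih] S; first by rewrite det_mx00.
by move=> /schur1_posdef[s0 /ih d0 ->]; exact: mulr_gt0.
Qed.

Lemma gauss_density_cons m (S : 'M[R]_m.+1) x (t : m.-tuple R) : posdef S ->
  gauss_density S (cons_tuple x t) = gauss1 (S 0 0) x *
    gauss_density (schur1 S) (aff 1 [tuple - (x / S 0 0 * S 0 (lift ord0 j)) | j < m] t).
Proof.
move=> pS; have [s0 pc ed] := schur1_posdef pS; have [sS _] := pS.
have eS := @posdef_block R m S sS.
rewrite !gauss_densityE /gauss1 ed.
have -> : (2 * pi) ^+ m.+1 * (S 0 0 * \det (schur1 S)) =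
    2 * pi * S 0 0 * ((2 * pi) ^+ m * \det (schur1 S)) by rewrite exprS; ring.
rewrite sqrtrM ?invfM; last by rewrite !mulr_ge0// ?pi_ge0// ltW.
rewrite -[LHS]mulrA -[RHS]mulrA; congr (_ * _); rewrite [RHS]mulrCA; congr (_ * _).
rewrite -expRD; congr expR.
have -> : rowt (cons_tuple x t) = row_mx x%:M (rowt t) :> 'rV[R]_(1 + m).
  apply/rowP => j; rewrite !mxE; case: splitP => j' jj'; rewrite !mxE.
    by rewrite ord1 eqxx mulr1n (_ : j = ord0) ?tnth0//; apply: val_inj; rewrite /= jj' ord1.
  by rewrite (_ : j = lift ord0 j') ?tnthS//; apply: val_inj; rewrite /= jj'.
have -> : qf (invmx S) (row_mx x%:M (rowt t)) =
  x ^+ 2 / S 0 0 + qf (invmx (schur1 S)) (rowt t - (x / S 0 0) *: ursubmx (S : 'M[R]_(1 + m))).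
  rewrite [in LHS]eS; apply: schur_qf_inv.
  by rewrite -eS.
rewrite (_ : rowt (aff _ _ _) = rowt t - (x / S 0 0) *: ursubmx (S : 'M[R]_(1 + m))).
  by rewrite opprD mulrDl.
apply/rowP => j; rewrite !mxE !tnth_mktuple mul1r; congr (_ - _ * S _ _).
  by apply: val_inj.
by apply: val_inj.
Qed.

Lemma lin_aff m (th : 'I_m -> R) (b x : m.-tuple R) : lin th (aff 1 b x) = lin th x + lin th b.
Proof.
by rewrite /lin -big_split; apply: eq_bigr => j _; rewrite tnth_mktuple mul1r mulrDr.
Qed.

Lemma meas_sq_lin m (al : R) (th : 'I_m -> R) :
  measurable_fun setT (fun x : m.-tuple R => (al + lin th x) ^+ 2).
Proof. by apply: measurable_funX; apply: measurable_funD => //; have [] := quad_lin th. Qed.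

(** The square of an affine function is stable under integrating out the conditional law: [al]
    becomes [al + (th ord0 + be / s) x], up to a constant added to the square. One induction on
    nonnegative integrands thus gives the mass and, by polarization, the covariances. *)
Lemma gauss_moment m (S : 'M[R]_m) (al : R) (th : 'I_m -> R) : posdef S ->
  leb_int_nn (fun x => ((al + lin th x) ^+ 2 * gauss_density S x)%:E) =
  (al ^+ 2 + qf S (\row_j th j))%:E.
Proof.
elim: m S al th => [|m ih] S al th pS.
  rewrite /= gauss_densityE /lin big_ord0 addr0 expr0 mul1r det_mx00 sqrtr1 invr1 mul1r.
  by rewrite !qfE !big_ord0 oppr0 mul0r expR0 mulr1 addr0.
have [s0 pc _] := schur1_posdef pS; have [sS _] := pS.
have eS := @posdef_block R m S sS.
set s := S 0 0 in s0 *; rewrite /=.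
pose th' (j : 'I_m) := th (lift ord0 j).
pose be := \sum_j th' j * S 0 (lift ord0 j).
transitivity (\int[@lebesgue_measure R]_x (((al + (th ord0 + be / s) * x) ^+ 2 * gauss1 s x)%:E +
    (qf (schur1 S) (\row_j th' j))%:E * ((1 + 0 * x) ^+ 2 * gauss1 s x)%:E))%E.
  apply: eq_integral => x _; rewrite -!EFinM -EFinD mul0r addr0 expr1n mul1r -mulrDl.
  pose y := [tuple - (x / s * S 0 (lift ord0 j)) | j < m].
  pose f (t : m.-tuple R) := (((al + (th ord0 + be / s) * x) + lin th' t) ^+ 2 * gauss_density (schur1 S) t)%:E.
  have mf : measurable_fun setT f.
    by apply/measurable_EFinP/measurable_funM; [exact: meas_sq_lin|exact: meas_gauss_density].
  have f0 t : (0 <= f t)%E by rewrite lee_fin mulr_ge0 ?sqr_ge0// gauss_density_ge0.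
  have -> : (fun t : m.-tuple R => ((al + lin th (cons_tuple x t)) ^+ 2 * gauss_density S (cons_tuple x t))%:E) =
      (fun t => (gauss1 s x)%:E * f (aff 1 y t))%E.
    apply/funext => t; rewrite gauss_density_cons// -/y -/s /f -EFinM mulrCA; congr ((_ * (_ ^+ 2 * _))%:E).
    rewrite lin_aff -!addrA; congr (_ + _).
    rewrite {1}/lin big_ord_recl tnth0 mulrDl -!addrA; congr (_ + _).
    rewrite (_ : \sum_(i < m) _ = lin th' t); last by apply: eq_bigr => j _; rewrite tnthS.
    rewrite addrCA -[LHS]addr0; congr (_ + _).
    rewrite /lin /be -mulrA mulrC mulr_sumr -big_split /= big1// => j _.
    by rewrite tnth_mktuple; ring.
  have mfa : measurable_fun setT (fun t => f (aff 1 y t)).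
    by apply: measurableT_comp => //; exact: meas_aff.
  rewrite leb_int_nnE; last 2 first.
  - exact: measurable_funeM.
  - by move=> t; rewrite mule_ge0// lee_fin gauss1_ge0.
  rewrite ge0_integralZl_EFin ?gauss1_ge0//.
  rewrite leb_affine ?oner_neq0// normr1 expr1n invr1 mul1e -leb_int_nnE// ih//.
  by rewrite -EFinM mulrC.
have q0 : 0 <= qf (schur1 S) (\row_j th' j) by exact: qf0_posdef.
have mg (a b : R) : measurable_fun setT (fun x : R => ((a + b * x) ^+ 2 * gauss1 s x)%:E).
  apply/measurable_EFinP/measurable_funM; last exact: meas_gauss1.
  by apply: measurable_funX; apply: measurable_funD => //; exact: measurable_funM.
have g0 (a b x : R) : (0 <= ((a + b * x) ^+ 2 * gauss1 s x)%:E)%E.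
  by rewrite lee_fin mulr_ge0 ?sqr_ge0// gauss1_ge0.
rewrite ge0_integralD//; last 3 first.
- exact: mg.
- by move=> x _; rewrite mule_ge0// lee_fin.
- by apply: measurable_funeM; exact: mg.
rewrite gauss1_moment// (@ge0_integralZl_EFin _ _ _ (@lebesgue_measure R) _ measurableT (fun x => ((1 + 0 * x) ^+ 2 * gauss1 s x)%:E) (fun x _ => g0 1 0 x) (mg 1 0) _ q0).
rewrite gauss1_moment// -EFinM -EFinD; congr (_%:E).
rewrite expr1n expr0n /= mul0r addr0 mulr1 -addrA; congr (_ + _).
have -> : \row_j th j = row_mx (th ord0)%:M (\row_j th' j) :> 'rV[R]_(1 + m).
  apply/rowP => j; rewrite !mxE; case: splitP => j' jj'; rewrite !mxE.
    by rewrite ord1 eqxx mulr1n (_ : j = ord0)//; apply: val_inj; rewrite /= jj' ord1.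
  by rewrite (_ : j = lift ord0 j')//; apply: val_inj; rewrite /= jj'.
rewrite [X in _ = qf X _]eS qf_block qf_schur -/s.
have -> : (\row_j th' j *m (ursubmx (S : 'M[R]_(1 + m)))^T) 0 0 = be.
  by rewrite mxE; apply: eq_bigr => j _; rewrite !mxE; congr (_ * S _ _); apply: val_inj.
by field; rewrite gt_eqF.
Qed.

End gaussian_density.

Section gaussian_law.
Context (R : realType) (m : nat).
Notation T := (m.-tuple R).
Implicit Types (S : 'M[R]_m) (x : T) (v w : 'rV[R]_m).

Let absS S := \sum_j \sum_j' `|S j j'|.

Let absS_ge0 S : 0 <= absS S.
Proof. by rewrite sumr_ge0// => j _; rewrite sumr_ge0. Qed.

Lemma n2_rowt x : n2 x = \sum_j (rowt x) 0 j ^+ 2.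
Proof. by apply: eq_bigr => j _; rewrite mxE. Qed.

Lemma qf_le S x : `|qf S (rowt x)| <= absS S * n2 x.
Proof.
rewrite qf_rowtE /absS mulr_suml (le_trans (ler_norm_sum _ _ _))//; apply: ler_sum => j _.
rewrite mulr_suml (le_trans (ler_norm_sum _ _ _))//; apply: ler_sum => j' _.
rewrite -mulrA mulrCA normrM ler_wpM2l//.
rewrite (le_trans (norm_mul_le _ _))//.
by have := n2_coord x j; have := n2_coord x j'; lra.
Qed.

(** Expand [qf S (w - v / B) >= 0] with [w = v S^-1] and bound [qf S v] by [B |v| ^ 2]: this is an
    explicit lower bound for the spectrum of the inverse. *)
Lemma n2_le_qf_inv S x : posdef S -> n2 x <= (absS S + 1) * qf (invmx S) (rowt x).
Proof.
move=> pS; have uS := posdef_unit pS; have [sS _] := pS.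
set v := rowt x; set B := absS S + 1.
have B0 : 0 < B by rewrite ltr_wpDl ?ltr01.
rewrite qf_inv//; set w := v *m invmx S.
have := @qf0_posdef _ _ _ (w - B^-1 *: v) pS.
have -> : qf S (w - B^-1 *: v) = qf S w - 2 / B * n2 x + B^-2 * qf S v.
  have e1 : w *m S *m v^T = v *m v^T by rewrite /w mulmxKV.
  have e2 : v *m S *m w^T = v *m v^T.
    by rewrite /w trmx_mul trmx_inv sS mulmxA mulmxK.
  have e3 : (w - B^-1 *: v)^T = w^T - B^-1 *: v^T by rewrite linearB linearZ.
  rewrite /qf e3 !mulmxBl !mulmxBr -!scalemxAl -!scalemxAr e1 e2 !mxE.
  have -> : \sum_j v 0 j * v^T j 0 = n2 x.
    by rewrite n2_rowt; apply: eq_bigr => j _; rewrite [v^T _ _]mxE -expr2.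
  by field; rewrite gt_eqF.
have h : B^-2 * qf S v <= B^-1 * n2 x.
  rewrite expr2 invfM -mulrA ler_wpM2l ?invr_ge0 ?(ltW B0)// ler_pdivrMl//.
  have /ler_normlP[_ h] := qf_le S x; apply: (le_trans h).
  by rewrite ler_wpM2r ?n2_ge0// lerDl.
move=> h2; rewrite -ler_pdivrMl//.
move: h h2; rewrite -[2 / B * _]mulrA; move: (B^-1 * n2 x) => a; lra.
Qed.

Lemma gauss_testlike S : posdef S -> exists2 A : R, 0 < A & forall x,
  expR (- A * (1 + n2 x)) <= gauss_density S x <= expR (A - n2 x / A).
Proof.
move=> pS.
set B := absS S + 1; have B0 : 0 < B by rewrite ltr_wpDl ?ltr01.
set C := absS (invmx S); have C0 : 0 <= C by exact: absS_ge0.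
pose K := (Num.sqrt ((2 * pi) ^+ m * \det S))^-1.
have K0 : 0 < K.
  rewrite invr_gt0 sqrtr_gt0 mulr_gt0 ?posdef_det// exprn_gt0// mulr_gt0// pi_gt0.
  by [].
pose A := `|ln K| + C / 2 + 2 * B.
have A0 : 0 < A by rewrite ltr_wpDl ?mulr_gt0// addr_ge0// divr_ge0.
exists A => // x; rewrite gauss_densityE -/K -{1 2}[K]lnK ?posrE// -expRD !ler_expR.
have /ler_normlP[_ h1] := qf_le (invmx S) x; have h2 := n2_le_qf_inv x pS.
have x0 := n2_ge0 x; have := ler_norm (ln K); have := ler_norm (- ln K); rewrite normrN => l1 l2.
have h3 : n2 x / A <= qf (invmx S) (rowt x) / 2.
  rewrite ler_pdivrMr// (le_trans h2)//.
  have q0 : 0 <= qf (invmx S) (rowt x).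
    by have := le_trans x0 h2; rewrite pmulr_rge0.
  rewrite -/B mulrC -mulrA ler_wpM2l//.
  have : 2 * B <= A by rewrite /A lerDr addr_ge0// divr_ge0.
  lra.
apply/andP; split.
  have : C * n2 x / 2 <= A * n2 x.
    rewrite mulrAC ler_wpM2r// /A addrAC lerDr addr_ge0// mulr_ge0// ltW//.
  have : `|ln K| <= A by rewrite /A -addrA lerDl addr_ge0 ?divr_ge0// mulr_ge0// ltW.
  by rewrite -/C in h1; lra.
have : ln K <= A by rewrite (le_trans l2)// /A -addrA lerDl addr_ge0 ?divr_ge0// mulr_ge0// ltW.
by lra.
Qed.

Lemma gauss_mass S : posdef S -> (\int[leb R m]_x (gauss_density S x)%:E = 1)%E.
Proof.
move=> pS; rewrite -leb_int_nnE; last 2 first.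
- by apply/measurable_EFinP; exact: meas_gauss_density.
- by move=> x; rewrite lee_fin gauss_density_ge0.
have := @gauss_moment R m S 1 (fun=> 0) pS.
rewrite (_ : (fun x => ((1 + lin _ x) ^+ 2 * _)%:E) = (fun x => (gauss_density S x)%:E)); last first.
  apply/funext => x; rewrite /lin big1 ?addr0 ?expr1n ?mul1r// => j _; exact: mul0r.
move=> ->; rewrite qfE big1 ?addr0 ?expr1n// => j _; rewrite big1// => j' _.
by rewrite !mxE !mul0r.
Qed.

Lemma gauss_test S : posdef S -> test (gauss_density S).
Proof.
move=> pS; split; [exact: meas_gauss_density|exact: gauss_testlike|].
by rewrite gauss_mass.
Qed.

Lemma gauss_law_ex S : posdef S -> exists P : probability T R,
  [/\ forall g : T -> \bar R, measurable_fun setT g -> (forall x, 0 <= g x)%E ->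
        (\int[P]_x g x = \int[leb R m]_x ((gauss_density S x)%:E * g x))%E,
      law2 P,
      forall f, quad f -> intg (leb R m) (fun x => gauss_density S x * f x) /\
        Ex P f = Ex (leb R m) (fun x => gauss_density S x * f x) &
      forall (al : R) th, Ex P (fun x => (al + lin th x) ^+ 2) = al ^+ 2 + qf S (\row_j th j)].
Proof.
move=> pS.
have mg := @meas_gauss_density R m S; have g0 := @gauss_density_ge0 R m S.
have [P [hP hR]] := wlaw_ex2 mg g0 (gauss_mass pS) (@measurable_id _ T setT).
have lq (al : R) th : intg (leb R m) (fun x => gauss_density S x * (al + lin th x) ^+ 2) /\
    Ex (leb R m) (fun x => gauss_density S x * (al + lin th x) ^+ 2) = al ^+ 2 + qf S (\row_j th j).
  have e : (\int[leb R m]_x (gauss_density S x * (al + lin th x) ^+ 2)%:E =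
      (al ^+ 2 + qf S (\row_j th j))%:E)%E.
    rewrite -gauss_moment// leb_int_nnE; last 2 first.
    - by apply/measurable_EFinP/measurable_funM => //; exact: meas_sq_lin.
    - by move=> x; rewrite lee_fin mulr_ge0 ?sqr_ge0.
    by apply: eq_integral => x _; rewrite mulrC.
  have i : intg (leb R m) (fun x => gauss_density S x * (al + lin th x) ^+ 2).
    apply: intg_ge0; first by apply: measurable_funM => //; exact: meas_sq_lin.
      by move=> x; rewrite mulr_ge0 ?sqr_ge0.
    by rewrite e ltry.
  by split=> //; move: e; rewrite ExE// => -[].
have ig : intg (leb R m) (gauss_density S).
  by apply: intg_ge0 => //; rewrite gauss_mass// ltry.
have in2 : intg (leb R m) (fun x => gauss_density S x * n2 x).
  rewrite (_ : (fun x => _) = (fun x => \sum_j gauss_density S x * (0 + lin (fun j' => (j' == j)%:R) x) ^+ 2)).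
    by apply: intg_sum => j _; have [] := lq 0 (fun j' => (j' == j)%:R).
  apply/funext => x; rewrite /n2 mulr_sumr; apply: eq_bigr => j _.
  rewrite add0r /lin (bigD1 j)//= eqxx mul1r big1 ?addr0// => j' /negbTE ->.
  by rewrite mul0r.
have iq f : quad f -> intg (leb R m) (fun x => gauss_density S x * f x).
  move=> [mf [A fA]].
  apply: (intg_dom _ (intgD (intgZ A ig) (intgZ A in2))); first exact: measurable_funM.
  move=> x; rewrite normrM ger0_norm//.
  have -> : A * gauss_density S x + A * (gauss_density S x * n2 x) = gauss_density S x * (A * (1 + n2 x)) by ring.
  by rewrite ler_wpM2l.
exists P; split => //.
- by have [] := hR _ (@meas_n2 R m) (iq _ (@quad_n2 R m)).
- by move=> f qf; split; [exact: iq|have [] := hR f (proj1 qf) (iq _ qf)].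
- move=> al th; have [i <-] := lq al th.
  by have [] := hR _ (meas_sq_lin al th) i.
Qed.

End gaussian_law.

Section gaussian_symmetry.
Context (R : realType) (m : nat) (S : 'M[R]_m) (P : probability (m.-tuple R) R).
Notation T := (m.-tuple R).
Hypotheses (pS : posdef S)
  (hP : forall g : T -> \bar R, measurable_fun setT g -> (forall x, 0 <= g x)%E ->
        (\int[P]_x g x = \int[leb R m]_x ((gauss_density S x)%:E * g x))%E)
  (P2 : law2 P)
  (hq : forall (al : R) th, Ex P (fun x => (al + lin th x) ^+ 2) = al ^+ 2 + qf S (\row_j th j)).

Let mg := @meas_gauss_density R m S.
Let g0 := @gauss_density_ge0 R m S.

Lemma gauss_even : evenl P.
Proof.
have h0 f : quad f -> (forall x, 0 <= f x) -> Ex P (fun x => f (negt x)) = Ex P f.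
  move=> fq f0; have qn := quad_negt fq; have [mf _] := fq; have [mfn _] := qn.
  suff : ((Ex P (fun x => f (negt x)))%:E = (Ex P f)%:E)%E by case.
  rewrite -!ExE; [|exact: quad_intg|exact: quad_intg].
  rewrite hP; [|exact/measurable_EFinP|by move=> x; rewrite lee_fin].
  rewrite hP; [|exact/measurable_EFinP|by move=> x; rewrite lee_fin].
  have n1 : (-1 : R) != 0 by rewrite oppr_eq0 oner_eq0.
  have e x : aff (-1) [tuple 0 | _ < m] x = negt x.
    by apply: eq_from_tnth => j; rewrite !tnth_mktuple mulN1r addr0.
  have := @leb_affine R m (-1) [tuple 0 | _ < m] (fun x => (gauss_density S x)%:E * (f x)%:E)%E n1.
  rewrite normrN1 expr1n invr1 mul1e => <-.
  - apply: eq_integral => x _; rewrite e; congr (_%:E * _)%E.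
    rewrite !gauss_densityE (_ : qf _ (rowt (negt x)) = qf (invmx S) (rowt x))//.
    by rewrite !qf_rowtE; apply: eq_bigr => j _; apply: eq_bigr => j' _; rewrite !tnth_mktuple; ring.
  - by apply: emeasurable_funM; exact/measurable_EFinP.
  - by move=> x; rewrite mule_ge0 ?lee_fin.
move=> f fq; have [mf [A fA]] := fq.
have qA : quad (fun x : T => A * (1 + n2 x)).
  by apply: quadZ; apply: quadD; [apply: (@quad_bd _ _ _ 1) => // x; rewrite normr1|exact: quad_n2].
have fA0 x : 0 <= f x + A * (1 + n2 x).
  by have := fA x; rewrite ler_norml => /andP[h _]; move: h; lra.
have A0 (x : T) : 0 <= A * (1 + n2 x) by apply: le_trans (fA x).
have h1 := h0 _ (quadD fq qA) fA0; have h2 := h0 _ qA A0.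
have i1 := quad_intg P2 fq; have i2 := quad_intg P2 qA.
have i1' := quad_intg P2 (quad_negt fq); have i2' := quad_intg P2 (quad_negt qA).
by move: h1; rewrite !ExD// h2 => /addIr.
Qed.

(** The exponent of the product density is a quadratic form summed over the two copies, invariant
    under the rotation; hence [u] and [v] are again independent with law [P]. *)
Let E2rot (H : T * T -> R) : measurable_fun setT H -> (forall p, 0 <= H p) ->
  (\int[P \x P]_p (H (uu p, vv p))%:E = \int[P \x P]_p (H p)%:E)%E.
Proof.
move=> mH H0.
have dens (G : T * T -> R) : measurable_fun setT G -> (forall p, 0 <= G p) ->
    (\int[P \x P]_p (G p)%:E = \int[leb R m \x leb R m]_p
      (gauss_density S p.1 * gauss_density S p.2 * G p)%:E)%E.
  move=> mG G0.
  have mGx x : measurable_fun setT (fun y => (G (x, y))%:E).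
    by apply/measurable_EFinP; exact: measurableT_comp.
  rewrite fubini_tonelli1; [|exact/measurable_EFinP|by move=> p; rewrite lee_fin].
  rewrite fubini_tonelli1; last 2 first.
  - apply/measurable_EFinP; apply: measurable_funM => //.
    by apply: measurable_funM; apply: measurableT_comp.
  - by move=> p; rewrite lee_fin mulr_ge0// mulr_ge0.
  rewrite hP; last 2 first.
  - by apply: measurable_fun_fubini_tonelli_F => //; exact/measurable_EFinP.
  - by move=> x; apply: integral_ge0 => y _; rewrite lee_fin.
  apply: eq_integral => x _; rewrite /fubini_F /= hP//; last by move=> y; rewrite lee_fin.
  rewrite -ge0_integralZl_EFin//.
  - by apply: eq_integral => y _; rewrite -!EFinM mulrA.
  - by move=> y _; rewrite mule_ge0 ?lee_fin.
  - by apply: emeasurable_funM => //; exact/measurable_EFinP.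
have muv : measurable_fun setT (fun p : T * T => (uu p, vv p)).
  by apply: measurable_fun_pair; [exact: meas_uu|exact: meas_vv].
rewrite dens//; last exact: measurableT_comp.
rewrite dens//.
have me : measurable_fun setT (fun p : T * T => gauss_density S p.1 * gauss_density S p.2 * H p).
  by apply: measurable_funM => //; apply: measurable_funM; apply: measurableT_comp.
rewrite -[RHS]leb_rot; last 2 first.
- exact/measurable_EFinP.
- by move=> p; rewrite lee_fin mulr_ge0// mulr_ge0.
apply: eq_integral => p _ /=; congr ((_ * _)%:E).
rewrite !gauss_densityE mulrACA -expRD [RHS]mulrACA -expRD -!mulrDl -!opprD.
suff -> : qf (invmx S) (rowt (uu p)) + qf (invmx S) (rowt (vv p)) =
  qf (invmx S) (rowt p.1) + qf (invmx S) (rowt p.2) by [].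
rewrite !qf_rowtE -!big_split; apply: eq_bigr => j _ /=.
rewrite -!big_split; apply: eq_bigr => j' _ /=; rewrite !tnth_mktuple.
have := @s2_sqr R; have := @s2_neq0 R; move: (Num.sqrt 2) => s s0 ss.
transitivity ((2 * (tnth p.1 j * invmx S j j' * tnth p.1 j' + tnth p.2 j * invmx S j j' * tnth p.2 j')) / s ^+ 2).
  by field.
by rewrite ss; field.
Qed.

(** Independence of [u] and [v] makes the hypothesis of [chf_estimate] true with [e = 0], and the
    estimate becomes an equality. Near-maximizers and Gaussians are thus compared through the same
    equation. *)
Lemma gauss_chf th : Ex P (fun x => cos (lin th x)) = expR (- (qf S (\row_j th j) / 2)).
Proof.
set s2 := qf S _.
have s20 : 0 <= s2 by exact: qf0_posdef.
have El : Ex P (fun x => lin th x ^+ 2) = s2.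
  have := hq 0 th; rewrite expr0n add0r -/s2 => <-; apply: eq_Ex => x; by rewrite add0r.
apply/eqP; rewrite -subr_eq0 -normr_le0.
have := @chf_estimate R m P th s2 0 P2 gauss_even s20.
rewrite !mulr0 mul0r => h; apply: h; last by rewrite divr_ge0.
move=> chi mchi chi01.
have ei (a b : R) : a%:E = b%:E -> a = b by case.
have chin x : `|chi x| <= 1 by have /andP[? ?] := chi01 x; rewrite ger0_norm.
have ic : intg P chi by exact: (@intg_bd _ _ _ P chi 1).
have il2 := quad_intg P2 (quad_lin2 th).
have [m1 [A1 b1]] := bd_uu_vv mchi chi01 (quad_lin2 th); have [j1 _ _] := quad2_intg P2 m1 b1.
have q1 : quad ((fun=> 1) : T -> R) by apply: (@quad_bd R m _ 1) => // x; rewrite normr1.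
have [m2 [A2 b2]] := bd_uu_vv mchi chi01 q1; have [j2 _ _] := quad2_intg P2 m2 b2.
have e1 : Ex (P \x P)%E (fun p => chi (uu p) * lin th (vv p) ^+ 2) = Ex P chi * s2.
  rewrite -El -(Ex_prod ic il2).
  have := @E2rot (fun p => chi p.1 * lin th p.2 ^+ 2).
  rewrite (ExE j1) (ExE (intg_prod ic il2)) => h.
  apply/ei/h.
    apply: measurable_funM; first exact: (measurableT_comp mchi).
    exact: (measurableT_comp (proj1 (quad_lin2 th))).
  by move=> p; have /andP[? _] := chi01 p.1; rewrite mulr_ge0 ?sqr_ge0.
have e2 : Ex (P \x P)%E (fun p => chi (uu p) * 1) = Ex P chi.
  have := @E2rot (fun p => chi p.1 * 1).
  have i1 := intg_prod ic (intg_cst P 1).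
  rewrite (ExE j2) (ExE i1) (Ex_prod ic (intg_cst P 1)) Ex_cst mulr1 => h; apply/ei/h.
    by apply: measurable_funM => //; apply: measurableT_comp.
  by move=> p; have /andP[? _] := chi01 p.1; rewrite mulr1.
rewrite (eq_Ex _ (g := fun p => chi (uu p) * lin th (vv p) ^+ 2 - s2 * (chi (uu p) * 1))); last first.
  by move=> p; ring.
rewrite (ExB j1 (intgZ s2 j2)) (ExZ _ j2) e1 e2 mulrC subrr normr0.
by [].
Qed.

End gaussian_symmetry.

(** * Transfer of couplings along convergent laws *)

Lemma mvt_bound (R : realType) (f f1 : R -> R) y B : (forall x, is_derive x (1 : R) f (f1 x)) ->
  (forall x, `|x| <= `|y| -> `|f1 x| <= B) -> `|f y - f 0| <= B * `|y|.
Proof.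
move=> fd hB; have B0 : 0 <= B by apply: le_trans (hB y (lexx _)).
have dw (a b : R) : {within `[a, b], continuous f}.
  by apply: derivable_within_continuous => x _; have [] := fd x.
have [y0|/ltW y0] := leP 0 y.
  have [c] := @MVT_segment R f f1 0 y y0 (fun x _ => fd x) (dw 0 y).
  rewrite in_itv /= => /andP[c0 cy] ->; rewrite subr0 normrM ler_wpM2r// hB//.
  by rewrite !ger0_norm.
have [c] := @MVT_segment R f f1 y 0 y0 (fun x _ => fd x) (dw y 0).
rewrite in_itv /= => /andP[cy c0] h; rewrite distrC h sub0r normrM normrN ler_wpM2r// hB//.
by rewrite !ler0_norm// lerN2.
Qed.

Lemma sin_dist_sq (R : realType) (y : R) : `|y - sin y| <= y ^+ 2.
Proof.
have dc (x : R) : `|1 - cos x| <= `|x|.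
  rewrite distrC -[X in _ - X]cos0 -[leRHS]mul1r.
  apply: (@mvt_bound _ cos (fun x => - sin x)) => z _.
  by rewrite normrN sin_max.
have := @mvt_bound R (fun x => x - sin x) (fun x => 1 - cos x) y `|y|.
rewrite sin0 !subr0 -normrM -expr2 [`|y ^+ 2|]ger0_norm ?sqr_ge0//; apply.
by move=> x xy; exact: le_trans (dc x) xy.
Qed.

Lemma sin_dist_norm (R : realType) (y : R) : `|y - sin y| <= 2 * `|y|.
Proof.
have h : `|sin y| <= `|y|.
  rewrite -[X in `|X|]subr0 -{1}(sin0 R) -[leRHS]mul1r.
  apply: (@mvt_bound _ sin cos) => z _.
  by rewrite cos_max.
by rewrite (le_trans (ler_normB _ _))//; move: h; lra.
Qed.

Section trigonometric_functions.
Context (R : realType) (m : nat).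
Notation T := (m.-tuple R).
Implicit Types (f g : T -> R) (th : 'I_m -> R).

(** The phase brings in sines and, by the product formula for cosines, makes the class closed under
    products; convergence of characteristic functions then extends to all of it. *)
Inductive trig : (T -> R) -> Prop :=
| trig_cos c th al : trig (fun x => c * cos (lin th x + al))
| trigD f g : trig f -> trig g -> trig (fun x => f x + g x).

Lemma linD th th' x : lin (fun j => th j + th' j) x = lin th x + lin th' x.
Proof. by rewrite /lin -big_split; apply: eq_bigr => j _; rewrite mulrDl. Qed.

Lemma linB th th' x : lin (fun j => th j - th' j) x = lin th x - lin th' x.
Proof. by rewrite /lin -sumrB; apply: eq_bigr => j _; rewrite mulrBl. Qed.

Lemma linZ c th x : lin (fun j => c * th j) x = c * lin th x.
Proof. by rewrite /lin mulr_sumr; apply: eq_bigr => j _; rewrite mulrA. Qed.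

Lemma lin_delta j (x : T) : lin (fun j' => (j' == j)%:R) x = tnth x j.
Proof.
rewrite /lin (bigD1 j)//= eqxx mul1r big1 ?addr0// => j' /negbTE ->.
by rewrite mul0r.
Qed.

Lemma trig_cst c : trig (fun=> c).
Proof.
rewrite (_ : (fun _ => _) = fun x => c * cos (lin (fun=> 0) x + 0)); first exact: trig_cos.
apply/funext => x; rewrite addr0 /lin big1 ?cos0 ?mulr1// => j _.
by rewrite mul0r.
Qed.

Lemma trig_sin c th : trig (fun x => c * sin (lin th x)).
Proof.
rewrite (_ : (fun x => _) = fun x => c * cos (lin th x + - (pi / 2))); first exact: trig_cos.
apply/funext => x; rewrite cosD cosN sinN cos_pihalf sin_pihalf; ring.
Qed.

Lemma trigM f g : trig f -> trig g -> trig (fun x => f x * g x).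
Proof.
move=> tf; elim: tf g => {f} [c th al|f1 f2 _ h1 _ h2] g tg; last first.
  rewrite (_ : (fun x => _) = fun x => f1 x * g x + f2 x * g x).
    by apply: trigD; [exact: h1|exact: h2].
  by apply/funext => x; rewrite mulrDl.
elim: tg => {g} [c' th' al'|g1 g2 _ h1 _ h2]; last first.
  rewrite (_ : (fun x => _) = fun x => c * cos (lin th x + al) * g1 x + c * cos (lin th x + al) * g2 x).
    exact: trigD.
  by apply/funext => x; rewrite mulrDr.
rewrite (_ : (fun x => _) = fun x =>
  (c * c' / 2) * cos (lin (fun j => th j + th' j) x + (al + al')) +
  (c * c' / 2) * cos (lin (fun j => th j - th' j) x + (al - al'))).
  by apply: trigD; exact: trig_cos.
apply/funext => x; rewrite linD linB.
have -> : lin th x + lin th' x + (al + al') = (lin th x + al) + (lin th' x + al') by ring.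
have -> : lin th x - lin th' x + (al - al') = (lin th x + al) - (lin th' x + al') by ring.
by move: (lin th x + al) (lin th' x + al') => a b; rewrite cosB cosD; field.
Qed.

Lemma trig_prod (K : Type) (s : seq K) (f : K -> T -> R) : (forall k, trig (f k)) ->
  trig (fun x => \prod_(k <- s) f k x).
Proof.
move=> tf; elim: s => [|k s ih].
  rewrite (_ : (fun x => _) = fun=> 1); first exact: trig_cst.
  by apply/funext => x; rewrite big_nil.
rewrite (_ : (fun x => _) = fun x => f k x * \prod_(k <- s) f k x); first exact: trigM.
by apply/funext => x; rewrite big_cons.
Qed.

Lemma trig_meas f : trig f -> measurable_fun setT f.
Proof.
elim=> {f} [c th al|f g _ h1 _ h2]; last exact: measurable_funD.
apply: measurable_funM => //; apply: measurableT_comp; first exact: meas_cos.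
by apply: measurable_funD => //; have [] := quad_lin th.
Qed.

Lemma trig_bd f : trig f -> exists B : R, forall x, `|f x| <= B.
Proof.
elim=> {f} [c th al|f g _ [A hA] _ [B hB]].
  by exists `|c| => x; rewrite normrM ler_piMr// cos_max.
by exists (A + B) => x; rewrite (le_trans (ler_normD _ _))// lerD.
Qed.

Section convergence.
Context (J : Type) (F : set_system J) {FF : Filter F} d (Om : measurableType d).
Variables (rho : J -> probability T R) (G : probability Om R) (X : Om -> T) (B : R).
Hypotheses (mX : measurable_fun setT X) (X2 : intg G (fun o => n2 (X o)))
  (rho2 : forall j, law2 (rho j)) (rhoB : forall j, Ex (rho j) (@n2 R m) <= B)
  (cv : forall th al, Ex (rho j) (fun x => cos (lin th x + al)) @[j --> F] -->
    Ex G (fun o => cos (lin th (X o) + al))).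

Lemma trig_cvg f : trig f -> Ex (rho j) f @[j --> F] --> Ex G (fun o => f (X o)).
Proof.
move=> tf.
have ii (P : probability T R) g : trig g -> intg P g.
  by move=> tg; have [A hA] := trig_bd tg; exact: (@intg_bd _ _ _ P g A (trig_meas tg) hA).
have iG g : trig g -> intg G (fun o => g (X o)).
  move=> tg; have [A hA] := trig_bd tg; apply: (@intg_bd _ _ _ _ _ A) => // o.
  by apply: measurableT_comp => //; exact: trig_meas.
elim: tf => {f} [c th al|f g tf hf tg hg].
  have t1 : trig (fun x => cos (lin th x + al)).
    rewrite (_ : (fun x => _) = fun x => 1 * cos (lin th x + al)); first exact: trig_cos.
    by apply/funext => x; rewrite mul1r.
  rewrite (_ : (fun j => _) = fun j => c * Ex (rho j) (fun x => cos (lin th x + al))).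
    by rewrite (ExZ c (iG _ t1)); apply: cvgMr; exact: cv.
  by apply/funext => j; rewrite ExZ//; exact: ii.
rewrite (_ : (fun j => _) = fun j => Ex (rho j) f + Ex (rho j) g).
  by rewrite (ExD (iG _ tf) (iG _ tg)); exact: cvgD.
by apply/funext => j; rewrite (ExD (ii _ _ tf) (ii _ _ tg)).
Qed.

(** The coordinate is replaced by [L sin (x / L)], which is in [trig]; the error is at most
    [x ^ 2 / L], uniformly small in mean by the bound on second moments. [L] makes it at most
    [e / 3] for each of the two laws. *)
Lemma coord_cvg f a : trig f ->
  Ex (rho j) (fun x => tnth x a * f x) @[j --> F] --> Ex G (fun o => tnth (X o) a * f (X o)).
Proof.
move=> tf; have [A hA] := trig_bd tf; have mf := trig_meas tf.
have A0 : 0 <= A by exact: le_trans (normr_ge0 _) (hA [tuple 0 | _ < m]).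
pose C := `|B| + Ex G (fun o => n2 (X o)) + 1.
have EG0 : 0 <= Ex G (fun o => n2 (X o)) by apply: Ex_ge0 => o; exact: n2_ge0.
have C0 : 0 < C by rewrite ltr_wpDl ?ltr01// addr_ge0.
apply/cvgrPdist_lt => e e0.
pose L := 3 * (A + 1) * C / e.
have A10 : 0 < A + 1 by rewrite ltr_wpDl.
have L0 : 0 < L by rewrite divr_gt0// !mulr_gt0.
pose g (x : T) := L * sin (L^-1 * tnth x a) * f x.
have tg : trig g.
  apply: trigM => //; rewrite (_ : (fun x => _) = fun x => L * sin (lin (fun j => L^-1 * (j == a)%:R) x)).
    exact: trig_sin.
  by apply/funext => x; rewrite linZ lin_delta.
have gd x : `|tnth x a * f x - g x| <= (A + 1) / L * n2 x.
  rewrite /g -mulrBl normrM mulrC.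
  have -> : tnth x a - L * sin (L^-1 * tnth x a) = L * (L^-1 * tnth x a - sin (L^-1 * tnth x a)).
    by field; rewrite gt_eqF.
  rewrite normrM (gtr0_norm L0).
  apply: (@le_trans _ _ (A * (L * (L^-1 * tnth x a) ^+ 2))).
    by apply: ler_pM => //; [rewrite mulr_ge0// ltW|rewrite ler_pM2l// sin_dist_sq].
  rewrite exprMn expr2 -mulrA mulVKf ?gt_eqF// mulrA.
  apply: ler_pM; [by rewrite mulr_ge0// invr_ge0 ltW|exact: sqr_ge0| |exact: n2_coord].
  by rewrite ler_wpM2r ?invr_ge0 ?(ltW L0)// lerDl.
have small (t : R) : t <= C -> (A + 1) / L * t <= e / 3.
  move=> tC; have -> : e / 3 = (A + 1) / L * C.
    by rewrite /L; field; rewrite !gt_eqF.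
  by rewrite ler_wpM2l// divr_ge0// ltW.
have bnd d' (Om' : measurableType d') (P : probability Om' R) (Y : Om' -> T) :
    measurable_fun setT Y -> intg P (fun o => n2 (Y o)) -> Ex P (fun o => n2 (Y o)) <= C ->
    `|Ex P (fun o => tnth (Y o) a * f (Y o)) - Ex P (fun o => g (Y o))| <= e / 3.
  move=> mY Y2 YC.
  have i1 : intg P (fun o => tnth (Y o) a * f (Y o)).
    apply: (@intg_dom _ _ _ _ _ (fun o => A + A * n2 (Y o))).
    - by apply: measurable_funM; [exact: meas_tnth|exact: measurableT_comp].
    - by apply: intgD; [exact: intg_cst|exact: intgZ].
    - move=> o; rewrite normrM mulrC -[X in X + _]mulr1 -mulrDr.
      by apply: ler_pM => //; exact: norm_coord.
  have i2 : intg P (fun o => g (Y o)).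
    have [A' hA'] := trig_bd tg; apply: (@intg_bd _ _ _ _ _ A') => //.
    by apply: measurableT_comp => //; exact: trig_meas.
  rewrite -(ExB i1 i2) (le_trans (Ex_norm (intgB i1 i2)))//.
  apply: le_trans (small _ YC); rewrite -(ExZ _ Y2); apply: Ex_le => //.
    exact/intg_norm/intgB.
  exact: intgZ.
have h1 := bnd _ _ G X mX X2.
have /cvgrPdist_lt/(_ (e / 3)) hg := trig_cvg tg.
have e30 : 0 < e / 3 by rewrite divr_gt0.
near=> j.
have n1 : `|Ex G (fun o => g (X o)) - Ex (rho j) g| < e / 3 by near: j; exact: hg.
have h2 := bnd _ _ (rho j) id (@measurable_id _ _ _) (rho2 j).
have {h1} : `|Ex G (fun o => tnth (X o) a * f (X o)) - Ex G (fun o => g (X o))| <= e / 3.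
  by apply: h1; rewrite /C addrAC lerDr addr_ge0.
have {h2} : `|Ex (rho j) (fun o => tnth o a * f o) - Ex (rho j) g| <= e / 3.
  apply: h2; apply: (le_trans (rhoB j)); apply: (le_trans (ler_norm _)).
  by rewrite /C -addrA lerDl addr_ge0.
move: n1; rewrite ltr_norml !ler_norml ltr_norml => /andP[? ?] /andP[? ?] /andP[? ?].
by apply/andP; split; lra.
Unshelve. all: by end_near.
Qed.

End convergence.

End trigonometric_functions.

Lemma cvg_fsum (R : realType) (J : Type) (F : set_system J) (K : finType) (f : K -> J -> R) (l : K -> R) :
  Filter F -> (forall k, f k j @[j --> F] --> l k) -> (\sum_k f k j) @[j --> F] --> \sum_k l k.
Proof. by move=> FF h; apply: cvg_big => //; exact: add_continuous. Qed.

Lemma near_fin (J : Type) (F : set_system J) (K : finType) (Pr : K -> J -> Prop) :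
  Filter F -> (forall k, \forall j \near F, Pr k j) -> \forall j \near F, forall k, Pr k j.
Proof.
move=> FF h.
have : forall s : seq K, \forall j \near F, forall k, k \in s -> Pr k j.
  elim=> [|k s ih]; first exact: nearW.
  apply: filterS (filterI (h k) ih) => j [h1 h2] k'; rewrite inE => /orP[/eqP ->//|].
  exact: h2.
move=> /(_ (enum K)); apply: filterS => j hj k; apply: hj.
by rewrite mem_enum.
Qed.

Lemma big_option (R : nmodType) (K : finType) (f : option K -> R) :
  \sum_o f o = f None + \sum_k f (Some k).
Proof.
rewrite (bigD1 None)//=; congr (_ + _); rewrite (reindex_omap Some id)/=; last by case.
by apply: eq_bigl => k; rewrite eqxx.
Qed.

(* Summing out the other factors of a product of partitions of unity. *)
Lemma marginal_sum (R : comPzRingType) (I K : finType) (f : I -> K -> R) (g : K -> R) (i : I) :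
  (forall i, \sum_l f i l = 1) ->
  \sum_(k : {ffun I -> K}) (\prod_i' f i' (k i')) * g (k i) = \sum_l f i l * g l.
Proof.
move=> f1; pose h i' l := f i' l * (if i' == i then g l else 1).
transitivity (\sum_(k : {ffun I -> K}) \prod_i' h i' (k i')).
  apply: eq_bigr => k _; rewrite /h big_split /=; congr (_ * _).
  by rewrite (bigD1 i)//= eqxx big1 ?mulr1// => i' /negbTE ->.
rewrite -(bigA_distr_bigA h) (bigD1 i)//= [X in _ * X]big1 ?mulr1.
  by apply: eq_bigr => l _; rewrite /h eqxx.
by move=> i' /negbTE ii; rewrite -(f1 i'); apply: eq_bigr => l _; rewrite /h ii mulr1.
Qed.

(** * From a coupling of the limits to decompositions of the approximating laws *)

Section label_transfer.
Context (R : realType) (n : nat) (d : 'I_n -> nat).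
Notation T i := ((d i).-tuple R).
Notation I := {i : 'I_n & 'I_(d i)}.
Notation laws := (forall i, probability (T i) R).
Context (J : Type) (F : set_system J) {FF : Filter F} dO (Om : measurableType dO).
Variables (q : I -> I -> R) (rho : J -> laws) (G : probability Om R).
Unset Implicit Arguments.
Variables (X : forall i, Om -> T i) (L : finType) (chi : forall i, L -> T i -> R) (i0 : 'I_n).
Hypotheses (mX : forall i, measurable_fun setT (X i))
  (X2 : forall i, intg G (fun o => n2 (X i o)))
  (rho2 : forall j i, law2 (rho j i))
  (mchi : forall i l, measurable_fun setT (chi i l))
  (chi0 : forall i l x, 0 < chi i l x) (chi1 : forall i x, \sum_l chi i l x = 1)
  (cv0 : forall i l, Ex (rho j i) (chi i l) @[j --> F] --> Ex G (fun o => chi i l (X i o)))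
  (cv1 : forall i l a, Ex (rho j i) (fun x => tnth x a * chi i l x) @[j --> F] -->
     Ex G (fun o => tnth (X i o) a * chi i l (X i o))).

Notation K := {ffun 'I_n -> L}.

(** Think of labels drawn independently given [X], the label of the factor [i] being [l] with
    probability [chi i l (X i)]. Then [w] is the joint law of the labels, [W] its marginals, and
    [ctr p l] the conditional mean of the coordinate [p] given the label [l] of its factor. *)
Let chiX (k : K) o : R := \prod_i chi i (k i) (X i o).
Let w (k : K) : R := Ex G (chiX k).
Let W i l : R := Ex G (fun o => chi i l (X i o)).
Let ctr (p : I) l : R := Ex G (fun o => tnth (X (tag p) o) (tagged p) * chi (tag p) l (X (tag p) o)) / W (tag p) l.
Let mu (k : K) (p : I) : R := ctr p (k (tag p)).
Let r j i l : R := Ex (rho j i) (chi i l).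
Let Xp o (p : I) : R := tnth (X (tag p) o) (tagged p).

Let chi_le1 i l x : 0 <= chi i l x <= 1.
Proof. by rewrite (ltW (chi0 i l x)) -(chi1 i x) le_sum1// => l'; exact/ltW/chi0. Qed.

Let chi_n i l x : `|chi i l x| <= 1.
Proof. by have /andP[h0 h1] := chi_le1 i l x; rewrite ger0_norm. Qed.

Let mchiX i l : measurable_fun setT (fun o => chi i l (X i o)).
Proof. exact: (measurableT_comp (mchi i l) (mX i)). Qed.

Let ichiX i l : intg G (fun o => chi i l (X i o)).
Proof. by apply: (@intg_bd _ _ _ G _ 1). Qed.

Let ichi (P : forall i, probability (T i) R) i l : intg (P i) (chi i l).
Proof. exact: (@intg_bd _ _ _ (P i) _ 1 (mchi i l) (chi_n i l)). Qed.

Let chiX01 k o : 0 <= chiX k o <= 1.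
Proof.
rewrite /chiX; apply: (big_ind (fun y => 0 <= y <= 1)) => [|x y /andP[x0 x1] /andP[y0 y1]|i _].
- by rewrite ler01 lexx.
- by rewrite mulr_ge0// mulr_ile1.
- exact: chi_le1.
Qed.

Let mchiXk k : measurable_fun setT (chiX k).
Proof. by rewrite /chiX; apply: measurable_prod => i _. Qed.

Let iprod (f : Om -> R) k : intg G f -> intg G (fun o => chiX k o * f o).
Proof.
move=> fi; have mf := intg_meas fi.
apply: (intg_dom _ (intg_norm fi)); first exact: measurable_funM.
by move=> o; have /andP[h0 h1] := chiX01 k o; rewrite normrM (ger0_norm h0) ler_piMl.
Qed.

Let iw k : intg G (chiX k).
Proof.
by apply: (@intg_bd _ _ _ G _ 1) => // o; have /andP[h0 h1] := chiX01 k o; rewrite ger0_norm.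
Qed.

Let margG i (g : L -> R) o : \sum_k chiX k o * g (k i) = \sum_l chi i l (X i o) * g l.
Proof. exact: (@marginal_sum R _ L (fun i l => chi i l (X i o)) g i (fun i' => chi1 i' (X i' o))). Qed.

Let margw i (g : L -> R) : \sum_k w k * g (k i) = \sum_l W i l * g l.
Proof.
transitivity (Ex G (fun o => \sum_k chiX k o * g (k i))).
  rewrite Ex_sum; last by move=> k _; apply: iprod; exact: intg_cst.
  apply: eq_bigr => k _; rewrite mulrC -ExZ//; apply: eq_Ex => o.
  by rewrite mulrC.
rewrite (eq_Ex _ (margG i g)) Ex_sum.
  apply: eq_bigr => l _; rewrite mulrC -ExZ//; apply: eq_Ex => o.
  by rewrite mulrC.
move=> l _; apply: (eq_intg _ (intgZ (g l) (ichiX i l))) => o.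
by rewrite mulrC.
Qed.

Let W0 i l : 0 < W i l.
Proof.
rewrite lt_neqAle Ex_ge0 ?andbT; last by move=> o; exact/ltW/chi0.
apply/eqP => e0; have : Ex G (fun o => chi i l (X i o) * (chi i l (X i o))^-1) = 0.
  apply: Ex_weight0 => //; first by move=> o; exact/ltW/chi0.
  rewrite (_ : (fun o => _) = fun=> 1); first exact: intg_cst.
  by apply/funext => o; rewrite mulfV// gt_eqF.
rewrite (_ : (fun o => _) = fun=> 1); first by rewrite Ex_cst => /eqP; rewrite oner_eq0.
by apply/funext => o; rewrite mulfV// gt_eqF.
Qed.

Let w0 k : 0 <= w k. Proof. by apply: Ex_ge0 => o; have /andP[] := chiX01 k o. Qed.

Let w1 : \sum_k w k = 1.
Proof.
have := margw i0 (fun=> 1); under eq_bigr do rewrite mulr1.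
under [RHS]eq_bigr do rewrite mulr1.
move=> ->; rewrite -Ex_sum//.
by rewrite -[RHS](Ex_cst G); apply: eq_Ex => o; exact: chi1.
Qed.

Section fixed_index.
Variables (j : J) (eta : R).
Hypotheses (eta0 : 0 < eta < 1) (near_r : forall i l, (1 - eta) * W i l < r j i l).

Let r0 i l : 0 < r j i l.
Proof.
apply: lt_trans (near_r i l); rewrite mulr_gt0//.
by have /andP[_] := eta0; rewrite subr_gt0.
Qed.

(** Each factor of [rho j] is labelled on its own, and labels are glued according to the joint law
    [w]: the quotient [w k / r] prescribes the mass. As [r] only approximates [W], a fraction [eta]
    is given up so that the remainder, the piece [None], is nonnegative. *)
Definition lab_dec (k : option K) i (x : T i) : R :=
  match k with
  | Some k => (1 - eta) * (w k / r j i (k i)) * chi i (k i) x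
  | None => 1 - \sum_(k : K) (1 - eta) * (w k / r j i (k i)) * chi i (k i) x
  end.

Definition lab_mass (k : option K) : R := if k is Some k then (1 - eta) * w k else eta.

Definition lab_ctr (k : option K) (p : I) : R := if k is Some k then mu k p else 0.

Lemma lab_decP : is_dec (rho j) lab_dec lab_mass.
Proof.
have /andP[e0 e1] := eta0; have e1' : 0 <= 1 - eta by rewrite subr_ge0 ltW.
have mS i (k : K) : measurable_fun setT (lab_dec (Some k) i) by apply: measurable_funM => //; exact: mchi.
have iS i (k : K) : intg (rho j i) (lab_dec (Some k) i) by apply: intgZ; exact: (ichi (rho j)).
have eS i (k : K) : Ex (rho j i) (lab_dec (Some k) i) = (1 - eta) * w k.
  by rewrite /lab_dec ExZ; [rewrite -mulrA divfK// gt_eqF|exact: (ichi (rho j))].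
split.
- move=> [k|] i; first exact: mS.
  by apply: measurable_funB => //; apply: measurable_sum => k; exact: mS.
- move=> [k|] i x /=.
    by rewrite mulr_ge0 ?(ltW (chi0 _ _ _))// mulr_ge0// divr_ge0// ltW.
  rewrite subr_ge0.
  have -> : \sum_(k : K) (1 - eta) * (w k / r j i (k i)) * chi i (k i) x =
     \sum_k w k * ((1 - eta) / r j i (k i) * chi i (k i) x).
    by apply: eq_bigr => k _; ring.
  rewrite (margw i (fun l => (1 - eta) / r j i l * chi i l x)) -[leRHS](chi1 i x); apply: ler_sum => l _.
  rewrite mulrA ler_piMl ?(ltW (chi0 _ _ _))// mulrA ler_pdivrMr// mul1r mulrC.
  exact/ltW/near_r.
- move=> i x.
  by rewrite big_option /= subrK.
- move=> [k|] i /=; first exact: eS.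
  rewrite ExB ?Ex_cst//; [|exact: intg_cst|by apply: intg_sum => k _; exact: iS].
  rewrite Ex_sum; last by move=> k _; exact: iS.
  under eq_bigr do rewrite eS.
  by rewrite -mulr_sumr w1 mulr1 subKr.
Qed.

End fixed_index.

Let V : R := \sum_k w k * bq q (mu k) (mu k).

(** The moments of the piece [k] converge to [(1 - eta) w k] times its center, so its term tends to
    [2 b - b] with [b] the value of the form at the center times the mass; the remainder has center
    0 and contributes nothing. *)
Lemma lab_Val_cvg eta : Val q (rho j) (lab_dec j eta) (lab_mass eta) (lab_ctr) @[j --> F] --> (1 - eta) * V.
Proof.
pose m1 (k : K) (p : I) j : R := (1 - eta) * (w k / r j (tag p) (k (tag p))) *
  Ex (rho j (tag p)) (fun x => tnth x (tagged p) * chi (tag p) (k (tag p)) x).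
have ic (p : I) j l : intg (rho j (tag p)) (fun x => tnth x (tagged p) * chi (tag p) l x).
  apply: quad_intg => //; apply: (quad_bdM (B := 1)) => //; exact: quad_coord.
have m1E k p j : mom (rho j) (lab_dec j eta (Some k)) p = m1 k p j.
  by rewrite /mom /m1 -ExZ//; apply: eq_Ex => x /=; rewrite mulrCA mulrA.
have m1c k p : m1 k p j @[j --> F] --> (1 - eta) * w k * mu k p.
  have -> : (1 - eta) * w k * mu k p = (1 - eta) * (w k / W (tag p) (k (tag p))) *
      Ex G (fun o => tnth (X (tag p) o) (tagged p) * chi (tag p) (k (tag p)) (X (tag p) o)).
    by rewrite /mu /ctr; ring.
  apply: cvgM; last exact: cv1.
  apply: cvgMr; apply: cvgMr; apply: cvgV; first by rewrite gt_eqF.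
  exact: cv0.
have -> : (fun j => Val q (rho j) (lab_dec j eta) (lab_mass eta) lab_ctr) =
   (fun j => \sum_k (2 * (\sum_p \sum_p' m1 k p j * q p p' * mu k p') -
      (1 - eta) * w k * bq q (mu k) (mu k))).
  apply/funext => j; rewrite /Val big_option /=.
  rewrite [X in X + _](_ : _ = 0) ?add0r; last first.
    rewrite /bq !big1 ?mulr0 ?subrr// => p _; rewrite big1// => p' _.
      by rewrite mulr0.
    by rewrite mulr0.
  apply: eq_bigr => k _; congr (2 * _ - _).
  by rewrite /bq; apply: eq_bigr => p _; apply: eq_bigr => p' _; rewrite m1E.
have -> : (1 - eta) * V = \sum_k (2 * (\sum_p \sum_p' (1 - eta) * w k * mu k p * q p p' * mu k p') -
      (1 - eta) * w k * bq q (mu k) (mu k)).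
  rewrite /V mulr_sumr; apply: eq_bigr => k _.
  have -> : \sum_p \sum_p' (1 - eta) * w k * mu k p * q p p' * mu k p' = (1 - eta) * w k * bq q (mu k) (mu k).
    rewrite /bq mulr_sumr; apply: eq_bigr => p _; rewrite mulr_sumr; apply: eq_bigr => p' _; ring.
  ring.
apply: cvg_fsum => k; apply: cvgB; last exact: cvg_cst.
apply: cvgMr; apply: cvg_fsum => p; apply: cvg_fsum => p'.
by apply: cvgMl; apply: cvgMl; exact: m1c.
Qed.

(** Young's inequality with weight [t] on each entry; [t <= 1] absorbs [t S] into [S / t]. *)
Let bq_dist (u v : I -> R) (t : R) : 0 < t -> t <= 1 ->
  `|bq q u u - bq q v v| <= (\sum_p \sum_p' `|q p p'|) *
    (3 / t * (\sum_p (v p - u p) ^+ 2) + 3 * t * (\sum_p v p ^+ 2)).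
Proof.
move=> t0 t1; set S := \sum_p (v p - u p) ^+ 2; set Vv := \sum_p v p ^+ 2.
rewrite /bq -sumrB mulr_suml (le_trans (ler_norm_sum _ _ _))//; apply: ler_sum => p _.
rewrite -sumrB mulr_suml (le_trans (ler_norm_sum _ _ _))//; apply: ler_sum => p' _.
have -> : u p * q p p' * u p' - v p * q p p' * v p' = q p p' * (u p * u p' - v p * v p') by ring.
rewrite normrM ler_wpM2l//.
have Sp z : (v z - u z) ^+ 2 <= S by apply: (@le_sum1 _ _ (fun z => (v z - u z) ^+ 2)) => ?; exact: sqr_ge0.
have Vp z : v z ^+ 2 <= Vv by apply: (@le_sum1 _ _ (fun z => v z ^+ 2)) => ?; exact: sqr_ge0.
have cr (a b : R) : `|a * b| <= a ^+ 2 / (2 * t) + t * b ^+ 2 / 2.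
  have [a1 a2] : 0 <= (a - t * b) ^+ 2 / (2 * t) /\ 0 <= (a + t * b) ^+ 2 / (2 * t).
    by split; rewrite divr_ge0 ?sqr_ge0// mulr_ge0// ltW.
  rewrite ler_norml; apply/andP; split.
    rewrite -subr_ge0 (_ : _ - _ = (a + t * b) ^+ 2 / (2 * t))//; by field; rewrite gt_eqF.
  rewrite -subr_ge0 (_ : _ - _ = (a - t * b) ^+ 2 / (2 * t))//; by field; rewrite gt_eqF.
have -> : u p * u p' - v p * v p' = - ((v p - u p) * u p') - (v p' - u p') * v p by ring.
apply: (le_trans (ler_normB _ _)); rewrite normrN.
have c1 := cr (v p - u p) (u p'); have c2 := cr (v p' - u p') (v p).
have up : u p' ^+ 2 <= 2 * Vv + 2 * S.
  have -> : u p' = v p' - (v p' - u p') by ring.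
  have := Sp p'; have := Vp p'; have := sqr_ge0 (v p' + (v p' - u p')).
  move: (v p') (v p' - u p') => a b; nra.
have S0 : 0 <= S by apply: le_trans (Sp p); exact: sqr_ge0.
have V0 : 0 <= Vv by apply: le_trans (Vp p); exact: sqr_ge0.
apply: (le_trans (lerD c1 c2)).
apply: (@le_trans _ _ (S / (2 * t) + t * (2 * Vv + 2 * S) / 2 + (S / (2 * t) + t * Vv / 2))).
  have t2 : 0 <= (2 * t)^-1 by rewrite invr_ge0 mulr_ge0// ltW.
  apply: lerD; apply: lerD.
  - by rewrite ler_wpM2r.
  - by rewrite ler_wpM2r// ler_wpM2l// ltW.
  - by rewrite ler_wpM2r.
  - by rewrite ler_wpM2r// ler_wpM2l// ltW.
have -> : 3 / t * S = 3 * (S / t) by ring.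
have -> : S / (2 * t) = (S / t) / 2 by field; rewrite gt_eqF.
have tS : t * S <= S / t.
  rewrite ler_pdivlMr// mulrC mulrA ler_piMl// mulr_ile1// ltW//.
have tV : 0 <= t * Vv by rewrite mulr_ge0// ltW.
have : 0 <= S / t by rewrite divr_ge0// ltW.
by move: tS tV; move: (S / t) => *; lra.
Qed.

(** [V] is the mean of the form at the conditional means [ctr], and these minimize the mean square
    deviation; hence the bound holds with any centers [xi], in particular with explicit ones. *)
Lemma lab_V_dist (xi : I -> L -> R) (t : R) : 0 < t -> t <= 1 ->
  `|V - Ex G (fun o => bq q (Xp o) (Xp o))| <= (\sum_p \sum_p' `|q p p'|) *
    (3 / t * (\sum_p Ex G (fun o => \sum_l chi (tag p) l (X (tag p) o) * (Xp o p - xi p l) ^+ 2)) +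
     3 * t * (\sum_p Ex G (fun o => Xp o p ^+ 2))).
Proof.
move=> t0 t1.
have mXp p : measurable_fun setT (fun o => Xp o p) by apply: meas_tnth; exact: mX.
have iX2 p : intg G (fun o => Xp o p ^+ 2).
  apply: (intg_dom _ (X2 (tag p))); first exact: measurable_funX.
  by move=> o; rewrite ger0_norm ?sqr_ge0// n2_coord.
have iXX p p' : intg G (fun o => Xp o p * Xp o p').
  apply: (intg_dom _ (intgD (iX2 p) (iX2 p'))); first exact: measurable_funM.
  move=> o; apply: (le_trans (norm_mul_le _ _)).
  by have := sqr_ge0 (Xp o p); have := sqr_ge0 (Xp o p'); lra.
have iX p : intg G (fun o => Xp o p).
  apply: (intg_dom _ (intgD (intg_cst G 1) (iX2 p))) => // o.
  have := norm_mul_le (Xp o p) 1; rewrite mulr1 expr1n.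
  by have := sqr_ge0 (Xp o p); lra.
have isq p (c : R) : intg G (fun o => (Xp o p - c) ^+ 2).
  apply: (eq_intg (f := fun o => Xp o p ^+ 2 + (c ^+ 2 - (2 * c) * Xp o p))) => [z|]; first by ring.
  by apply: intgD => //; apply: intgB; [exact: intg_cst|exact: intgZ].
have ibq : intg G (fun o => bq q (Xp o) (Xp o)).
  apply: intg_sum => p _; apply: intg_sum => p' _.
  by apply: (eq_intg (f := fun o => q p p' * (Xp o p * Xp o p'))) => [z|]; [ring|exact: intgZ].
have isl p (c : L -> R) l : intg G (fun o => chi (tag p) l (X (tag p) o) * (Xp o p - c l) ^+ 2).
  apply: (intg_dom _ (isq p (c l))).
    by apply: measurable_funM => //; apply: measurable_funX; exact: measurable_funB.
  move=> o; have /andP[h0 h1] := chi_le1 (tag p) l (X (tag p) o).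
  by rewrite normrM (ger0_norm h0) (ger0_norm (sqr_ge0 _)) ler_piMl// sqr_ge0.
set Q := \sum_p \sum_p' `|q p p'|.
have Q0 : 0 <= Q by rewrite sumr_ge0// => p _; rewrite sumr_ge0.
have best p : Ex G (fun o => \sum_l chi (tag p) l (X (tag p) o) * (Xp o p - ctr p l) ^+ 2) <=
    Ex G (fun o => \sum_l chi (tag p) l (X (tag p) o) * (Xp o p - xi p l) ^+ 2).
  rewrite !Ex_sum; [|by move=> l _; exact: isl|by move=> l _; exact: isl].
  apply: ler_sum => l _; rewrite -subr_ge0 -ExB; [|exact: isl|exact: isl].
  have iXc : intg G (fun o => Xp o p * chi (tag p) l (X (tag p) o)).
    apply: (intg_dom _ (intg_norm (iX p))); first exact: measurable_funM.
    by move=> o; rewrite normrM ler_piMr.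
  rewrite (eq_Ex _ (g := fun o => (2 * (ctr p l - xi p l)) * (Xp o p * chi (tag p) l (X (tag p) o)) -
     ((ctr p l - xi p l) * (ctr p l + xi p l)) * chi (tag p) l (X (tag p) o))); last by move=> o; ring.
  rewrite ExB; [|exact: intgZ|exact: intgZ].
  rewrite !ExZ//.
  have -> : Ex G (fun o => Xp o p * chi (tag p) l (X (tag p) o)) = W (tag p) l * ctr p l.
    by rewrite /ctr mulrC divfK// gt_eqF.
  rewrite -/(W _ _) (_ : _ - _ = W (tag p) l * (ctr p l - xi p l) ^+ 2); last by ring.
  by rewrite mulr_ge0 ?sqr_ge0// ltW.
have iS k : intg G (fun o => \sum_p (Xp o p - mu k p) ^+ 2) by apply: intg_sum => p _; exact: isq.
have iV : intg G (fun o => \sum_p Xp o p ^+ 2) by apply: intg_sum => p _.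
pose Bk k o := Q * (3 / t * (\sum_p (Xp o p - mu k p) ^+ 2) + 3 * t * (\sum_p Xp o p ^+ 2)).
have iBk k : intg G (Bk k) by apply: intgZ; apply: intgD; exact: intgZ.
have iD k : intg G (fun o => bq q (mu k) (mu k) - bq q (Xp o) (Xp o)).
  by apply: intgB => //; exact: intg_cst.
have -> : V - Ex G (fun o => bq q (Xp o) (Xp o)) =
    \sum_k Ex G (fun o => chiX k o * (bq q (mu k) (mu k) - bq q (Xp o) (Xp o))).
  rewrite -Ex_sum; last by move=> k _; exact: iprod.
  have -> : V = Ex G (fun o => \sum_k chiX k o * bq q (mu k) (mu k)).
    rewrite Ex_sum; last by move=> k _; apply: iprod; exact: intg_cst.
    apply: eq_bigr => k _; rewrite mulrC -ExZ//; apply: eq_Ex => o.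
    by rewrite mulrC.
  rewrite -ExB//; last by apply: intg_sum => k _; apply: iprod; exact: intg_cst.
  apply: eq_Ex => o; under [RHS]eq_bigr do rewrite mulrBr.
  rewrite sumrB -mulr_suml; congr (_ - _).
  rewrite [X in _ = X * _](_ : _ = 1) ?mul1r//.
  have := margG i0 (fun=> 1) o; under eq_bigr do rewrite mulr1.
  by move=> ->; under eq_bigr do rewrite mulr1; exact: chi1.
apply: (le_trans (ler_norm_sum _ _ _)).
apply: (@le_trans _ _ (\sum_k Ex G (fun o => chiX k o * Bk k o))).
  apply: ler_sum => k _; apply: (le_trans (Ex_norm (iprod _ _ (iD k)))).
  apply: Ex_le; [apply: intg_norm; exact: iprod|exact: iprod|].
  move=> o; have /andP[h0 h1] := chiX01 k o.
  by rewrite normrM (ger0_norm h0) ler_wpM2l// bq_dist.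
rewrite -Ex_sum; last by move=> k _; exact: iprod.
have pw o : \sum_k chiX k o * Bk k o = Q * (3 / t * (\sum_p \sum_l chi (tag p) l (X (tag p) o) * (Xp o p - ctr p l) ^+ 2) +
    3 * t * (\sum_p Xp o p ^+ 2)).
  have -> : \sum_k chiX k o * Bk k o = Q * (3 / t * (\sum_k \sum_p chiX k o * (Xp o p - mu k p) ^+ 2) +
     3 * t * (\sum_p Xp o p ^+ 2) * \sum_k chiX k o).
    rewrite /Bk; move: (\sum_p Xp o p ^+ 2) => v; rewrite !mulrDr !mulr_sumr -big_split /=.
    by apply: eq_bigr => k _; rewrite -mulr_sumr; ring.
  rewrite (_ : \sum_k chiX k o = 1); last first.
    have := margG i0 (fun=> 1) o; under eq_bigr do rewrite mulr1.
    by move=> ->; under eq_bigr do rewrite mulr1; exact: chi1.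
  rewrite mulr1 exchange_big; congr (_ * (_ * _ + _)); apply: eq_bigr => p _.
  by rewrite (margG (tag p) (fun l => (Xp o p - ctr p l) ^+ 2)).
rewrite (eq_Ex _ pw).
have iC p : intg G (fun o => \sum_l chi (tag p) l (X (tag p) o) * (Xp o p - ctr p l) ^+ 2).
  by apply: intg_sum => l _; exact: isl.
have iCC : intg G (fun o => \sum_p \sum_l chi (tag p) l (X (tag p) o) * (Xp o p - ctr p l) ^+ 2).
  by apply: intg_sum => p _.
rewrite (ExZ _ (intgD (intgZ (3 / t) iCC) (intgZ (3 * t) iV))) ExD; [|exact: intgZ|exact: intgZ].
rewrite !ExZ// !Ex_sum//.
rewrite ler_wpM2l// lerD2r ler_wpM2l ?divr_ge0 ?(ltW t0)//.
by apply: ler_sum.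
Qed.

Lemma label_transfer (xi : I -> L -> R) (t e : R) : 0 < t -> t <= 1 -> 0 < e ->
  (\sum_p \sum_p' `|q p p'|) *
    (3 / t * (\sum_p Ex G (fun o => \sum_l chi (tag p) l (X (tag p) o) * (Xp o p - xi p l) ^+ 2)) +
     3 * t * (\sum_p Ex G (fun o => Xp o p ^+ 2))) <= e / 2 ->
  \forall j \near F, exists D : @deco R n d, is_dec (rho j) (@dF _ _ _ D) (@da _ _ _ D) /\
    Ex G (fun o => bq q (Xp o) (Xp o)) - e <= Val q (rho j) (@dF _ _ _ D) (@da _ _ _ D) (@dxi _ _ _ D).
Proof.
move=> t0 t1 e0 he; have hV := le_trans (lab_V_dist xi t t0 t1) he.
(* Budget: [e / 2] for the labels, [e / 4] for the remainder piece, [e / 4] for the convergence. *)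
pose eta := Num.min (1 / 2) (e / (4 * (`|V| + 1))).
have V10 : 0 < `|V| + 1 by rewrite ltr_wpDl.
have eta0 : 0 < eta by rewrite lt_min divr_gt0//= divr_gt0// mulr_gt0.
have eta1 : eta < 1.
  have : eta <= 1 / 2 by rewrite ge_min lexx.
  by lra.
have etaV : `|eta * V| <= e / 4.
  rewrite normrM gtr0_norm//.
  have h : eta <= e / (4 * (`|V| + 1)) by rewrite ge_min lexx orbT.
  apply: (le_trans (ler_wpM2r (normr_ge0 V) h)).
  rewrite -mulrA -[e / 4]mulr1 invfM -!mulrA ler_wpM2l ?(ltW e0)// ler_wpM2l//.
  by rewrite mulrC ler_pdivrMr// mul1r lerDl.
have nr : \forall j \near F, forall il : 'I_n * L, (1 - eta) * W il.1 il.2 < r j il.1 il.2.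
  apply: near_fin => -[i l] /=.
  have g0 : 0 < eta * W i l by rewrite mulr_gt0.
  have /cvgrPdist_lt/(_ _ g0) := cv0 i l; apply: filterS => j.
  by rewrite -/(W _ _) -/(r _ _ _) ltr_norml => /andP[_]; lra.
have e40 : 0 < e / 4 by rewrite divr_gt0.
have /cvgrPdist_lt/(_ _ e40) nV := lab_Val_cvg eta.
apply: filterS (filterI nr nV) => j [hr hv].
exists (@Deco R n d (option K) (lab_dec j eta) (lab_mass eta) lab_ctr); split.
  apply: lab_decP; first by rewrite eta0.
  by move=> i l; exact: (hr (i, l)).
move: hv hV etaV; rewrite /= ltr_norml !ler_norml => /andP[_ h1] /andP[h2 _] /andP[h3 h4].
by move: h1 h2 h4; lra.
Qed.

Set Implicit Arguments.
End label_transfer.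

(** * Independent random bits *)

Section bits.
Context (R : realType) (A : finType).
Implicit Types (p : A -> R) (h : A -> bool -> R).

Definition wt (b : bool) (p : R) : R := if b then p else 1 - p.

Lemma bits_prod p h :
  \sum_(k : {ffun A -> bool}) \prod_a (wt (k a) (p a) * h a (k a)) =
  \prod_a (p a * h a true + (1 - p a) * h a false).
Proof.
rewrite -(bigA_distr_bigA (fun a b => wt b (p a) * h a b)); apply: eq_bigr => a _.
by rewrite big_bool.
Qed.

Let trueE : true%:R = 1 :> R. Proof. by []. Qed.
Let falseE : false%:R = 0 :> R. Proof. by []. Qed.

Lemma bits_sum p : \sum_(k : {ffun A -> bool}) \prod_a wt (k a) (p a) = 1.
Proof.
transitivity (\sum_(k : {ffun A -> bool}) \prod_a (wt (k a) (p a) * 1)).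
  by apply: eq_bigr => k _; apply: eq_bigr => a _; rewrite mulr1.
by rewrite (bits_prod p (fun _ _ => 1)) big1// => a _; rewrite !mulr1 subrKC.
Qed.

Lemma bits_mean p a0 : \sum_(k : {ffun A -> bool}) (\prod_a wt (k a) (p a)) * ((k a0)%:R - p a0) = 0.
Proof.
pose h a (b : bool) : R := if a == a0 then b%:R - p a0 else 1.
transitivity (\sum_(k : {ffun A -> bool}) \prod_a (wt (k a) (p a) * h a (k a))).
  apply: eq_bigr => k _; rewrite big_split /=; congr (_ * _).
  by rewrite (bigD1 a0)//= /h eqxx big1 ?mulr1// => a /negbTE ->.
by rewrite bits_prod (bigD1 a0)//= /h eqxx; rewrite [X in X * _](_ : _ = 0) ?mul0r// trueE falseE; ring.
Qed.

Lemma bits_cov p a0 a1 : \sum_(k : {ffun A -> bool}) (\prod_a wt (k a) (p a)) *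
  (((k a0)%:R - p a0) * ((k a1)%:R - p a1)) = if a0 == a1 then p a0 * (1 - p a0) else 0.
Proof.
pose h c a (b : bool) : R := if a == c then b%:R - p c else 1.
transitivity (\sum_(k : {ffun A -> bool}) \prod_a (wt (k a) (p a) * (h a0 a (k a) * h a1 a (k a)))).
  apply: eq_bigr => k _; rewrite big_split /=; congr (_ * _); rewrite big_split /=; congr (_ * _).
    by rewrite (bigD1 a0)//= /h eqxx big1 ?mulr1// => a /negbTE ->.
  by rewrite (bigD1 a1)//= /h eqxx big1 ?mulr1// => a /negbTE ->.
rewrite (bits_prod p (fun a b => h a0 a b * h a1 a b)) (bigD1 a0)//= /h eqxx.
have [->|ne] := eqVneq a0 a1.
  rewrite big1 ?mulr1; first by rewrite trueE falseE; ring.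
  by move=> a /negbTE ->; rewrite !mulr1 subrKC.
by rewrite [X in X * _](_ : _ = 0) ?mul0r// trueE falseE; ring.
Qed.

(** Bias plus variance: by independence only the diagonal of the double sum is left. *)
Lemma bits_variance p (m : nat) (f : 'I_m -> A) (p0 y c : R) : injective f ->
  (forall s, p (f s) = p0) ->
  \sum_(k : {ffun A -> bool}) (\prod_a wt (k a) (p a)) *
    (y - c * \sum_s ((k (f s))%:R - p0)) ^+ 2 = y ^+ 2 + c ^+ 2 * (m%:R * (p0 * (1 - p0))).
Proof.
move=> fi fp; pose z (k : {ffun A -> bool}) s := (k (f s))%:R - p (f s).
transitivity (\sum_(k : {ffun A -> bool}) ((\prod_a wt (k a) (p a)) * y ^+ 2 -
   (2 * y * c * \sum_s (\prod_a wt (k a) (p a)) * z k s) +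
   c ^+ 2 * \sum_s \sum_s' (\prod_a wt (k a) (p a)) * (z k s * z k s'))).
  apply: eq_bigr => k _.
  have -> : \sum_s ((k (f s))%:R - p0) = \sum_s z k s by apply: eq_bigr => s _; rewrite /z fp.
  rewrite -mulr_sumr.
  have -> : \sum_s \sum_s' (\prod_a wt (k a) (p a)) * (z k s * z k s') =
    (\prod_a wt (k a) (p a)) * (\sum_s z k s) ^+ 2.
    rewrite expr2 mulr_suml mulr_sumr; apply: eq_bigr => s _.
    by rewrite mulr_sumr mulr_sumr.
  ring.
rewrite big_split sumrB /= -mulr_suml bits_sum mul1r -!mulr_sumr exchange_big /=.
rewrite big1 => [|s _]; last exact: bits_mean.
rewrite mulr0 subr0; congr (_ + _ * _); rewrite exchange_big /=.
rewrite (eq_bigr (fun=> p0 * (1 - p0))) => [|s _].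
  by rewrite sumr_const card_ord mulr_natl.
rewrite exchange_big /= (bigD1 s)//= [X in X + _](_ : _ = p0 * (1 - p0)); last first.
  by rewrite /z bits_cov eqxx fp.
rewrite big1 ?addr0// => s' ss.
by rewrite /z bits_cov ifF//; apply/negbTE; rewrite (inj_eq fi) eq_sym.
Qed.

End bits.

Section transfer.
Context (R : realType) (n : nat) (d : 'I_n -> nat).
Notation T i := ((d i).-tuple R).
Notation I := {i : 'I_n & 'I_(d i)}.
Notation laws := (forall i, probability (T i) R).
Context (J : Type) (F : set_system J) {FF : Filter F} dO (Om : measurableType dO).
Variables (q : I -> I -> R) (rho : J -> laws) (G : probability Om R).
Unset Implicit Arguments.
Variables (X : forall i, Om -> T i) (i0 : 'I_n) (B : R).
Hypotheses (mX : forall i, measurable_fun setT (X i))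
  (X2 : forall i, intg G (fun o => n2 (X i o)))
  (rho2 : forall j i, law2 (rho j i)) (rhoB : forall j i, Ex (rho j i) (@n2 R (d i)) <= B)
  (cv : forall i th al, Ex (rho j i) (fun x => cos (lin th x + al)) @[j --> F] -->
    Ex G (fun o => cos (lin th (X i o) + al))).

Let Dm := \sum_i d i.

Let dle i : (d i <= Dm)%N. Proof. by rewrite /Dm (bigD1 i)//= leq_addr. Qed.

Section labels.
Variables (m : nat) (s : R).
Hypothesis (m0 : (0 < m)%N).

(** Each coordinate [y] is encoded by [m] independent bits, equal to one with this probability. The
    sine makes label probabilities trigonometric, and the range [[1/4, 3/4]] makes them positive. *)
Let prb (y : R) : R := 1 / 2 + 1 / 4 * sin (s^-1 * y).

Let prb_bd y : 1 / 4 <= prb y <= 3 / 4.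
Proof.
by rewrite /prb; have := sin_le1 (s^-1 * y); have := sin_geN1 (s^-1 * y); move=> ? ?; apply/andP; split; lra.
Qed.

(** One label type for all factors: bits are indexed by [Dm] coordinates, and those beyond [d i]
    read the default value 0, hence are fair coins. *)
Definition bit_chi i (l : {ffun 'I_Dm * 'I_m -> bool}) (x : T i) : R :=
  \prod_a wt (l a) (prb (nth 0 x a.1)).

(** Inverts [prb]: [4 s] times the excess of the empirical frequency over one half is an unbiased
    estimate of [s sin (y / s)]. *)
Definition bit_ctr (p : I) (l : {ffun 'I_Dm * 'I_m -> bool}) : R :=
  4 * s * (m%:R^-1 * \sum_r (l (widen_ord (dle (tag p)) (tagged p), r))%:R - 1 / 2).

Lemma bit_chi_trig i l : trig (bit_chi i l).
Proof.
apply: trig_prod => a.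
have [th hth] : exists th : 'I_(d i) -> R, forall x : T i, nth 0 x a.1 = lin th x.
  have [ai|ai] := ltnP a.1 (d i).
    exists (fun j' => (j' == Ordinal ai)%:R) => x.
    by rewrite lin_delta (tnth_nth 0).
  exists (fun=> 0) => x; rewrite nth_default ?size_tuple//.
  by rewrite /lin big1// => j _; rewrite mul0r.
have tp : trig (fun x : T i => prb (nth 0 x a.1)).
  rewrite (_ : (fun x => _) = fun x => 1 / 2 + 1 / 4 * sin (lin (fun j => s^-1 * th j) x)).
    by apply: trigD; [exact: trig_cst|exact: trig_sin].
  by apply/funext => x; rewrite linZ -hth.
rewrite /wt; case: (l a) => //.
rewrite (_ : (fun x => _) = fun x : T i => 1 + (-1) * prb (nth 0 x a.1)).
  by apply: trigD; [exact: trig_cst|apply: trigM => //; exact: trig_cst].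
by apply/funext => x; rewrite mulN1r.
Qed.

Lemma bit_chi_gt0 i l x : 0 < bit_chi i l x.
Proof.
apply: prodr_gt0 => a _; have /andP[h0 h1] := prb_bd (nth 0 x a.1).
by rewrite /wt; case: (l a); lra.
Qed.

Lemma bit_chi_sum i x : \sum_l bit_chi i l x = 1.
Proof. exact: bits_sum. Qed.

Lemma bit_chi_dist (p : I) (x : T (tag p)) : s != 0 ->
  \sum_l bit_chi (tag p) l x * (tnth x (tagged p) - bit_ctr p l) ^+ 2 <=
  (tnth x (tagged p) - s * sin (s^-1 * tnth x (tagged p))) ^+ 2 + 4 * s ^+ 2 / m%:R.
Proof.
move=> s0; set y := tnth x _; have mn : m%:R != 0 :> R by rewrite pnatr_eq0 -lt0n.
pose f (r : 'I_m) : 'I_Dm * 'I_m := (widen_ord (dle (tag p)) (tagged p), r).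
have fi : injective f by move=> r r' [].
have fE r : prb (nth 0 x (f r).1) = prb y by rewrite /f /= /y (tnth_nth 0).
have := @bits_variance R _ (fun a : 'I_Dm * 'I_m => prb (nth 0 x a.1)) m f (prb y) (y - s * sin (s^-1 * y)) (4 * s / m%:R) fi fE.
have -> : \sum_(k : {ffun 'I_Dm * 'I_m -> bool}) (\prod_a wt (k a) (prb (nth 0 x a.1))) *
    (y - s * sin (s^-1 * y) - 4 * s / m%:R * \sum_r ((k (f r))%:R - prb y)) ^+ 2 =
  \sum_l bit_chi (tag p) l x * (y - bit_ctr p l) ^+ 2.
  apply: eq_bigr => l _; congr (_ * _ ^+ 2).
  rewrite sumrB sumr_const card_ord -mulr_natl /bit_ctr /f /prb.
  by move: (\sum_r _) => v; field.
move=> ->; rewrite lerD2l.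
(* The variance of a bit is at most [1 / 4]. *)
have -> : (4 * s / m%:R) ^+ 2 * (m%:R * (prb y * (1 - prb y))) =
  4 * s ^+ 2 / m%:R * (4 * (prb y * (1 - prb y))) by field.
rewrite ler_piMr//; last by have := sqr_ge0 (prb y - 1 / 2); nra.
by rewrite divr_ge0// mulr_ge0// sqr_ge0.
Qed.

End labels.

(** With [r = k.+1], the error [f - r sin (f / r)] is at most [f ^ 2 / r] and at most [2 |f|] in
    absolute value, so dominated convergence applies to its square. *)
Lemma sin_approx (f : Om -> R) : measurable_fun setT f -> intg G (fun o => f o ^+ 2) ->
  Ex G (fun o => (f o - k.+1%:R * sin (k.+1%:R^-1 * f o)) ^+ 2) @[k --> \oo] --> 0.
Proof.
move=> mf f2.
pose g k o : R := (f o - k.+1%:R * sin (k.+1%:R^-1 * f o)) ^+ 2.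
have gE k o : g k o = k.+1%:R ^+ 2 * (k.+1%:R^-1 * f o - sin (k.+1%:R^-1 * f o)) ^+ 2.
  by rewrite -exprMn mulrBr mulrA mulfV ?mul1r// pnatr_eq0.
have mg k : measurable_fun setT (g k).
  apply: measurable_funX; apply: measurable_funB => //; apply: measurable_funM => //.
  by apply: measurableT_comp; [exact: meas_sin|exact: measurable_funM].
have gb k o : `|g k o| <= 4 * f o ^+ 2.
  rewrite ger0_norm ?sqr_ge0// gE.
  have -> : 4 * f o ^+ 2 = k.+1%:R ^+ 2 * (2 * `|k.+1%:R^-1 * f o|) ^+ 2.
    rewrite exprMn real_normK ?num_real// exprMn exprVn.
    have : k.+1%:R != 0 :> R by rewrite pnatr_eq0.
    by move: (k.+1%:R) => r r0; field.
  rewrite ler_wpM2l ?sqr_ge0// -[leLHS]real_normK ?num_real//.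
  by rewrite lerXn2r ?nnegrE ?mulr_ge0// sin_dist_norm.
have gc o : g k o @[k --> \oo] --> (0 : R).
  have c0 : k.+1%:R^-1 * f o ^+ 2 @[k --> \oo] --> (0 : R).
    by rewrite -[X in _ --> X](mul0r (f o ^+ 2)); apply: cvgMl; exact: cvg_harmonic.
  have h k : `|f o - k.+1%:R * sin (k.+1%:R^-1 * f o)| <= k.+1%:R^-1 * f o ^+ 2.
    have -> : f o - k.+1%:R * sin (k.+1%:R^-1 * f o) = k.+1%:R * (k.+1%:R^-1 * f o - sin (k.+1%:R^-1 * f o)).
      by rewrite mulrBr mulrA mulfV ?mul1r// pnatr_eq0.
    rewrite normrM ger0_norm//; apply: (le_trans (ler_wpM2l (ler0n _ _) (sin_dist_sq _))).
    by rewrite exprMn expr2 -!mulrA mulVKf// pnatr_eq0.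
  have d0 : f o - k.+1%:R * sin (k.+1%:R^-1 * f o) @[k --> \oo] --> (0 : R).
    apply/norm_cvg0P; apply: (squeeze_cvgr _ (@cvg_cst _ (0 : R) _ _ _) c0).
    by apply: nearW => k; rewrite normr_ge0 h.
  rewrite -[X in _ --> X](mulr0 (0 : R)) (_ : (fun k => _) = fun k =>
    (f o - k.+1%:R * sin (k.+1%:R^-1 * f o)) * (f o - k.+1%:R * sin (k.+1%:R^-1 * f o))).
    exact: cvgM.
  by apply/funext => k; rewrite /g expr2.
have ig k : intg G (g k) by apply: (intg_dom (mg k) (intgZ 4 f2)).
have [|||||_ _] := @dominated_convergence _ _ R G setT measurableT (fun k o => (g k o)%:E) (fun=> 0%E)
  (fun o => (4 * f o ^+ 2)%:E).
- by move=> k; exact/measurable_EFinP.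
- exact: measurable_cst.
- by apply: aeW => o _; apply: cvg_EFin; [exact: nearW|exact: gc].
- exact: (intgZ 4 f2).
- by apply: aeW => o k _; rewrite lee_fin.
rewrite integral0 => /fine_cvgP[_]; apply: cvg_trans; apply: near_eq_cvg; apply: nearW => k.
by rewrite /= ExE.
Qed.

(** The order of choice matters: [t] bounds the term in [V2] by [e / 4]; the scale [s] then brings
    the truncation error below [del], and the number [m] of bits, which depends on [s], brings the
    sampling error below [del]. [del] is fitted to the remaining [e / 4]. *)
Lemma transfer (e : R) : 0 < e ->
  \forall j \near F, exists D : @deco R n d, is_dec (rho j) (@dF _ _ _ D) (@da _ _ _ D) /\
    Ex G (fun o => bq q (fun p => tnth (X (tag p) o) (tagged p)) (fun p => tnth (X (tag p) o) (tagged p))) - e <=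
    Val q (rho j) (@dF _ _ _ D) (@da _ _ _ D) (@dxi _ _ _ D).
Proof.
move=> e0; pose Q : R := \sum_p \sum_p' `|q p p'|.
pose Xp o (p : I) : R := tnth (X (tag p) o) (tagged p).
pose V2 := \sum_p Ex G (fun o => Xp o p ^+ 2).
pose N : R := \sum_(p : I) 1.
have Q0 : 0 <= Q by rewrite sumr_ge0// => p _; rewrite sumr_ge0.
have V20 : 0 <= V2 by apply: sumr_ge0 => p _; apply: Ex_ge0 => o; exact: sqr_ge0.
have N0 : 0 <= N by apply: sumr_ge0.
pose t := Num.min 1 (e / (12 * (Q + 1) * (V2 + 1))).
have Q1 : 0 < Q + 1 by rewrite ltr_wpDl.
have V21 : 0 < V2 + 1 by rewrite ltr_wpDl.
have N1 : 0 < N + 1 by rewrite ltr_wpDl.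
have t0 : 0 < t by rewrite lt_min ltr01/= divr_gt0// !mulr_gt0.
have t1 : t <= 1 by rewrite ge_min lexx.
have tV : Q * (3 * t * V2) <= e / 4.
  have h : t <= e / (12 * (Q + 1) * (V2 + 1)) by rewrite ge_min lexx orbT.
  rewrite ler_pdivlMr ?mulr_gt0// in h.
  apply: (@le_trans _ _ ((t * (12 * (Q + 1) * (V2 + 1))) / 4)); last by rewrite ler_wpM2r.
  have -> : t * (12 * (Q + 1) * (V2 + 1)) / 4 = 3 * t * ((Q + 1) * (V2 + 1)) by field.
  have -> : Q * (3 * t * V2) = 3 * t * (Q * V2) by ring.
  by rewrite ler_wpM2l ?mulr_ge0 ?(ltW t0)// ler_pM// lerDl.
pose del := e * t / (24 * (Q + 1) * (N + 1)).
have del0 : 0 < del by rewrite divr_gt0 ?mulr_gt0.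
have mXp p : measurable_fun setT (fun o => Xp o p) by apply: meas_tnth; exact: mX.
have iX2 p : intg G (fun o => Xp o p ^+ 2).
  apply: (intg_dom _ (X2 (tag p))); first exact: measurable_funX.
  by move=> o; rewrite ger0_norm ?sqr_ge0// n2_coord.
have [k hk] : exists k : nat, forall p : I,
    Ex G (fun o => (Xp o p - k.+1%:R * sin (k.+1%:R^-1 * Xp o p)) ^+ 2) <= del.
  have /near_fin : forall p : I, \forall k \near \oo,
      Ex G (fun o => (Xp o p - k.+1%:R * sin (k.+1%:R^-1 * Xp o p)) ^+ 2) <= del.
    move=> p; have /cvgrPdist_lt/(_ _ del0) := sin_approx _ (mXp p) (iX2 p).
    by apply: filterS => k; rewrite /= sub0r normrN ltr_norml => /andP[_ /ltW].
  by case=> k _ hk; exists k => p; apply: hk => /=.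
pose s : R := k.+1%:R.
have s0 : s != 0 by rewrite pnatr_eq0.
pose m := (Num.truncn (4 * s ^+ 2 / del)).+1.
have hm : 4 * s ^+ 2 / m%:R <= del.
  rewrite ler_pdivrMr ?ltr0n// [del * _]mulrC -ler_pdivrMr//.
  by rewrite ltW// truncnS_gt.
have m0 : (0 < m)%N by [].
have ic i l := bit_chi_trig m s i l.
apply: (@label_transfer R n d J F FF dO Om q rho G X _ (bit_chi m s) i0 mX X2 rho2
  (fun i l => trig_meas (ic i l)) (bit_chi_gt0 m s) (bit_chi_sum m s)
  (fun i l => @trig_cvg R (d i) J F FF dO Om (rho ^~ i) G (X i) (mX i) (cv i) _ (ic i l))
  (fun i l a => @coord_cvg R (d i) J F FF dO Om (rho ^~ i) G (X i) B (mX i) (X2 i) (rho2 ^~ i) (rhoB ^~ i) (cv i) _ a (ic i l))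
  (bit_ctr m s) t e t0 t1 e0).
rewrite -/Q -/V2 mulrDr.
suff h : Q * (3 / t * (\sum_p Ex G (fun o => \sum_l bit_chi m s (tag p) l (X (tag p) o) *
     (tnth (X (tag p) o) (tagged p) - bit_ctr m s p l) ^+ 2))) <= e / 4.
  by have := lerD h tV; rewrite -[e / 4 + _]mulrDl; lra.
have h p : Ex G (fun o => \sum_l bit_chi m s (tag p) l (X (tag p) o) *
     (tnth (X (tag p) o) (tagged p) - bit_ctr m s p l) ^+ 2) <= 2 * del.
  have mS : measurable_fun setT (fun o => (Xp o p - s * sin (s^-1 * Xp o p)) ^+ 2).
    apply: measurable_funX; apply: measurable_funB => //; apply: measurable_funM => //.
    by apply: measurableT_comp; [exact: meas_sin|exact: measurable_funM].
  have iS : intg G (fun o => (Xp o p - s * sin (s^-1 * Xp o p)) ^+ 2).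
    apply: (intg_dom mS (intgD (intgZ 2 (iX2 p)) (intg_cst G (2 * s ^+ 2)))) => o.
    rewrite ger0_norm ?sqr_ge0//.
    have sin1 : sin (s^-1 * Xp o p) ^+ 2 <= 1.
      by have := cos2Dsin2 (s^-1 * Xp o p); have := sqr_ge0 (cos (s^-1 * Xp o p)); lra.
    have := ler_wpM2l (sqr_ge0 s) sin1.
    have := sqr_ge0 (Xp o p + s * sin (s^-1 * Xp o p)).
    by move: (sin (s^-1 * Xp o p)) (Xp o p) => a b; nra.
  have iB := intgD iS (intg_cst G (4 * s ^+ 2 / m%:R)).
  apply: (@le_trans _ _ (Ex G (fun o => (Xp o p - s * sin (s^-1 * Xp o p)) ^+ 2 + 4 * s ^+ 2 / m%:R))).
    apply: Ex_le => //; last by move=> o; exact: bit_chi_dist.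
    apply: (intg_dom _ iB).
      apply: measurable_sum => l; apply: measurable_funM.
        exact: (measurableT_comp (trig_meas (ic _ l)) (mX _)).
      by apply: measurable_funX; apply: measurable_funB => //; exact: mXp.
    move=> o; rewrite ger0_norm ?bit_chi_dist//.
    by apply: sumr_ge0 => l _; rewrite mulr_ge0 ?sqr_ge0// ltW// bit_chi_gt0.
  rewrite ExD//; last exact: intg_cst.
  by rewrite Ex_cst; have := hk p; rewrite -/s; move: hm; lra.
have hs : \sum_p Ex G (fun o => \sum_l bit_chi m s (tag p) l (X (tag p) o) *
     (tnth (X (tag p) o) (tagged p) - bit_ctr m s p l) ^+ 2) <= N * (2 * del).
  apply: (@le_trans _ _ (\sum_(p : I) 2 * del)); first by apply: ler_sum.
  by rewrite /N mulr_suml; apply: ler_sum => p _; rewrite mul1r.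
apply: (@le_trans _ _ (Q * (3 / t * (N * (2 * del))))).
  by rewrite ler_wpM2l// ler_wpM2l// divr_ge0// ltW.
have -> : Q * (3 / t * (N * (2 * del))) = e / 4 * (Q / (Q + 1)) * (N / (N + 1)).
  by rewrite /del; field; rewrite !gt_eqF.
rewrite -mulrA ler_piMr ?divr_ge0 ?(ltW e0)// mulr_ile1 ?divr_ge0 ?(ltW Q1) ?(ltW N1)//.
  by rewrite ler_pdivrMr// mul1r lerDl.
by rewrite ler_pdivrMr// mul1r lerDl.
Qed.

Set Implicit Arguments.
End transfer.

(** * Couplings from decompositions *)

Section mixture.
Context d (T : measurableType d) (R : realType).

Lemma mk_probability (nu : {measure set T -> \bar R}) : (nu setT = 1)%E ->
  exists P : probability T R, P = nu :> (set T -> \bar R).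
Proof.
case: nu => nu cl h; pose num : {measure set T -> \bar R} := Measure.Pack cl.
pose P : probability T R := HB.pack nu (Measure.on num) (Measure_isProbability.Build _ _ _ num h).
by exists P.
Qed.

Lemma mixture_ex (K : finType) (a : K -> R) (G : K -> probability T R) :
  (forall k, 0 <= a k) -> \sum_k a k = 1 -> exists P : probability T R,
  (forall g : T -> \bar R, measurable_fun setT g -> (forall x, 0 <= g x)%E ->
    (\int[P]_x g x = \sum_k (a k)%:E * \int[G k]_x g x)%E) /\
  forall g : T -> R, measurable_fun setT g -> (forall k, intg (G k) g) ->
    intg P g /\ Ex P g = \sum_k a k * Ex (G k) g.
Proof.
move=> a0 a1.
have [k0 _] : exists k0 : K, k0 \in K.
  have [k0 _|K0] := pickP K; first by exists k0.
  by move/eqP: a1; rewrite big_pred0 ?(eq_sym 0) ?oner_eq0.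
pose s := enum K.
pose m_ j : {measure set T -> \bar R} := mscale (NngNum (a0 (nth k0 s j))) (G (nth k0 s j)).
have sumE (F : K -> \bar R) : (\sum_(j < size s) F (nth k0 s j) = \sum_k F k)%E.
  by rewrite -(big_mkord xpredT (fun j => F (nth k0 s j))) -(big_nth k0 xpredT F) big_enum.
have m1 : (msum m_ (size s) setT = 1)%E.
  rewrite /msum /m_ (sumE (fun k => mscale (NngNum (a0 k)) (G k) setT)).
  rewrite (eq_bigr (fun k => (a k)%:E)); last first.
    by move=> k _; rewrite /mscale /=; have := @probability_setT _ _ _ (G k); rewrite /= => ->; rewrite mule1.
  by rewrite sumEFin a1.
have [P PE] := mk_probability m1.
have nn (g : T -> \bar R) : measurable_fun setT g -> (forall x, 0 <= g x)%E ->
    (\int[P]_x g x = \sum_k (a k)%:E * \int[G k]_x g x)%E.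
  move=> mg g0.
  rewrite (eq_measure_integral (msum m_ (size s))); last by move=> A _ _; first [exact: (congr1 (@^~ A) PE)|exact: (esym (congr1 (@^~ A) PE))].
  rewrite ge0_integral_measure_sum// -sumE; apply: eq_bigr => j _.
  by rewrite /m_ ge0_integral_mscale.
exists P; split => // g mg gi.
have h0 (f : T -> R) : measurable_fun setT f -> (forall x, 0 <= f x) -> (forall k, intg (G k) f) ->
    intg P f /\ Ex P f = \sum_k a k * Ex (G k) f.
  move=> mf f0 fi.
  have e : (\int[P]_x (f x)%:E = (\sum_k a k * Ex (G k) f)%:E)%E.
    rewrite nn//; last exact/measurable_EFinP.
    by rewrite -sumEFin; apply: eq_bigr => k _; rewrite ExE.
  have iP : intg P f by apply: intg_ge0 => //; rewrite e ltry.
  by split=> //; move: e; rewrite ExE// => -[].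
have mn : measurable_fun setT (fun x => `|g x|) by exact: measurableT_comp.
have [i1 e1] := h0 _ mn (fun x => normr_ge0 _) (fun k => intg_norm (gi k)).
have mp : measurable_fun setT (fun x => g x + `|g x|) by exact: measurable_funD.
have p0 x : 0 <= g x + `|g x| by have := ler_norm (- g x); rewrite normrN; lra.
have [i2 e2] := h0 _ mp p0 (fun k => intgD (gi k) (intg_norm (gi k))).
have eg x : g x = (g x + `|g x|) - `|g x| by rewrite addrK.
split; first by rewrite (funext eg); exact: intgB.
rewrite (eq_Ex _ eg) ExB// e1 e2 -sumrB; apply: eq_bigr => k _.
by rewrite ExD ?addrK -?mulrBr ?addrK//; exact: intg_norm.
Qed.

End mixture.

Section couplings.
Context (R : realType) (n : nat) (d : 'I_n -> nat).
Notation T i := ((d i).-tuple R).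
Notation I := {i : 'I_n & 'I_(d i)}.
Notation laws := (forall i, probability (T i) R).
Notation Om := ((\sum_(k < n) d k).-tuple R).
Local Notation proj := Defs.proj.

Lemma tnth_proj i (x : Om) (j : 'I_(d i)) : tnth (proj i x) j = tnth x (@tagnat.Rank n d i j).
Proof. by rewrite tnth_mktuple. Qed.

Lemma meas_proj i : measurable_fun setT (@Defs.proj R n d i).
Proof.
apply: meas_tuple => j; rewrite (_ : (fun x => _) = fun x : Om => tnth x (@tagnat.Rank n d i j)).
  exact: measurable_tnth.
by apply/funext => x; rewrite tnth_proj.
Qed.

Definition has_margin (G : probability Om R) i (P : probability (T i) R) : Prop :=
  forall g : T i -> \bar R, measurable_fun setT g -> (forall x, 0 <= g x)%E ->
  (\int[G]_x g (proj i x) = \int[P]_x g x)%E.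

Lemma margin_real G i P : @has_margin G i P -> forall f : T i -> R, measurable_fun setT f ->
  intg P f -> intg G (fun x => f (proj i x)) /\ Ex G (fun x => f (proj i x)) = Ex P f.
Proof.
move=> h f mf fi.
exact: (@law_transport _ _ _ (T i) Om (T i) R P id G (proj i) (@measurable_id _ _ _) (@meas_proj i) h f mf fi).
Qed.

Definition put (k : 'I_n) (p : Om * T k) : Om :=
  [tuple if tagnat.sig1 a == k then nth 0 p.2 (tagnat.sig2 a) else tnth p.1 a
    | a < \sum_(k < n) d k].

Lemma proj_put_neq k i p : i != k -> proj i (@put k p) = proj i p.1.
Proof.
move=> ik; apply: eq_from_tnth => j; rewrite !tnth_proj tnth_mktuple.
by rewrite ifF// tagnat.Rank1K (negbTE ik).
Qed.

Lemma proj_put k p : proj k (@put k p) = p.2.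
Proof.
apply: eq_from_tnth => j; rewrite tnth_proj tnth_mktuple ifT ?tagnat.Rank1K//.
by rewrite (tnth_nth 0); congr nth; rewrite tagnat.Rank2K.
Qed.

Lemma meas_put k : measurable_fun setT (@put k).
Proof.
apply: meas_tuple => a.
rewrite (_ : (fun p => _) = fun p : Om * T k => if tagnat.sig1 a == k then nth 0 p.2 (tagnat.sig2 a) else tnth p.1 a); last first.
  by apply/funext => p; rewrite tnth_mktuple.
case: eqP => [e|_]; last by apply: meas_tnth.
have lt : (tagnat.sig2 a < d k)%N by rewrite -e.
rewrite (_ : (fun p => _) = fun p : Om * T k => tnth p.2 (Ordinal lt)); first exact: meas_tnth.
by apply/funext => p; rewrite (tnth_nth 0).
Qed.

Lemma put_law (G : probability Om R) k (P : probability (T k) R) :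
  exists G' : probability Om R,
    (forall g : Om -> \bar R, measurable_fun setT g -> (forall y, 0 <= g y)%E ->
      (\int[G']_y g y = \int[G \x P]_p g (put p))%E) /\
    (forall g : Om -> R, measurable_fun setT g -> intg (G \x P)%E (fun p => g (put p)) ->
      intg G' g /\ Ex G' g = Ex (G \x P)%E (fun p => g (put p))).
Proof.
have W1 : (\int[(G \x P)%E]_p ((fun=> 1) p)%:E = 1)%E.
  by rewrite (@ExE _ _ _ (G \x P)%E); [rewrite (@Ex_cst _ _ _ (G \x P)%E)|exact: (@intg_cst _ _ _ (G \x P)%E)].
have [G' [h1 h2]] := @wlaw_ex2 _ _ _ _ R (G \x P)%E (fun=> 1) (@put k) (measurable_cst _) (fun=> ler01) W1 (@meas_put k).
exists G'; split => [g mg g0|g mg ig].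
  by rewrite h1//; apply: eq_integral => p _; rewrite mul1e.
have e (p : Om * T k) : 1 * g (put p) = g (put p) by rewrite mul1r.
by have := h2 g mg; rewrite (eq_Ex _ e) (funext e); apply.
Qed.

(** Starting from a Dirac mass, block after block is overwritten by an independent sample. Of
    independence the product formula for two blocks is kept, as it is what quadratic forms see; the
    order [i < i'] follows the induction. *)
Lemma indep_coupling (mu : laws) : exists G : probability Om R,
  (forall i, has_margin G (mu i)) /\
  forall i i' (f : T i -> R) (g : T i' -> R), (i < i')%N ->
    measurable_fun setT f -> measurable_fun setT g -> intg (mu i) f -> intg (mu i') g ->
    intg G (fun x => f (proj i x) * g (proj i' x)) /\
    Ex G (fun x => f (proj i x) * g (proj i' x)) = Ex (mu i) f * Ex (mu i') g.
Proof.
suff : forall k, (k <= n)%N -> exists G : probability Om R,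
  (forall i : 'I_n, (i < k)%N -> has_margin G (mu i)) /\
  forall (i i' : 'I_n) (f : T i -> R) (g : T i' -> R), (i < i')%N -> (i' < k)%N ->
    measurable_fun setT f -> measurable_fun setT g -> intg (mu i) f -> intg (mu i') g ->
    intg G (fun x => f (proj i x) * g (proj i' x)) /\
    Ex G (fun x => f (proj i x) * g (proj i' x)) = Ex (mu i) f * Ex (mu i') g.
  move=> /(_ n (leqnn n))[G [h1 h2]]; exists G; split => [i|i i' f g ii].
    exact: h1.
  exact: h2.
elim=> [_|k ih kn].
  pose z : Om := [tuple 0 | _ < _].
  by exists (\d_ z : probability Om R); split => // i i' f g _; rewrite ltn0.
have [G [h1 h2]] := ih (ltnW kn).
pose K := Ordinal kn.
have [G' [e1 e2]] := put_law G (mu K).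
have neq (i : 'I_n) : (i < k)%N -> i != K.
  by move=> ik; apply/eqP => e; move: ik; rewrite e ltnn.
exists G'; split.
  move=> i; rewrite ltnS leq_eqVlt => /orP[/eqP ik|ik] g mg g0.
    have eK : i = K by exact: val_inj.
    move: g mg g0; rewrite eK => g mg g0.
    rewrite e1//; last by apply: measurableT_comp => //; exact: meas_proj.
    under eq_integral do rewrite proj_put.
    rewrite fubini_tonelli1//; last by apply: measurableT_comp.
    rewrite /fubini_F /=; exact: prob_integral_cst.
  have ne := neq i ik.
  rewrite e1//; last by apply: measurableT_comp => //; exact: meas_proj.
  under eq_integral do rewrite (proj_put_neq _ ne).
  rewrite fubini_tonelli1//; last first.
    apply: measurableT_comp => //; apply: (measurableT_comp (@meas_proj i)) => //.
  rewrite -(h1 i ik g mg g0); apply: eq_integral => x _; rewrite /fubini_F /=.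
  exact: prob_integral_cst.
move=> i i' f g ii; rewrite ltnS leq_eqVlt => /orP[/eqP ik|ik] mf mg fi gi.
  have eK : i' = K by exact: val_inj.
  move: g mg gi; rewrite eK => g mg gi.
  have ik' : (i < k)%N by rewrite -ik.
  have ne := neq i ik'.
  have [f1 f2] := margin_real (h1 i ik') mf fi.
  have e p : f (proj i (put p)) * g (proj K (put p)) = f (proj i p.1) * g p.2.
    by rewrite proj_put (proj_put_neq _ ne).
  have mm : measurable_fun setT (fun x => f (proj i x) * g (proj K x)).
    by apply: measurable_funM; apply: measurableT_comp => //; exact: meas_proj.
  have ip : intg (G \x mu K)%E (fun p => f (proj i (put p)) * g (proj K (put p))).
    by rewrite (funext e); exact: (intg_prod f1 gi).
  have [j1 j2] := e2 _ mm ip; split => //.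
  by rewrite j2 (eq_Ex _ e) (Ex_prod f1 gi) f2.
have [f1 f2] := h2 i i' f g ii ik mf mg fi gi.
have n1 := neq i (ltn_trans ii ik); have n2 := neq i' ik.
have e p : f (proj i (@put K p)) * g (proj i' (@put K p)) = f (proj i p.1) * g (proj i' p.1).
  by rewrite (proj_put_neq _ n1) (proj_put_neq _ n2).
have mm : measurable_fun setT (fun x => f (proj i x) * g (proj i' x)).
  by apply: measurable_funM; apply: measurableT_comp => //; exact: meas_proj.
have ip0 := @intg2_fst _ _ _ _ _ G (mu K) _ f1.
have ip : intg (G \x mu K)%E (fun p => f (proj i (put p)) * g (proj i' (put p))).
  by rewrite (funext e).
have [j1 j2] := e2 _ mm ip; split => //.
rewrite j2 (eq_Ex _ e) (Ex_fst ip0); last by move=> x /=; exact: intg_cst.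
by rewrite -f2; apply: eq_Ex => x /=; exact: Ex_cst.
Qed.

Section decomposition_coupling.
Variables (q : I -> I -> R) (P : laws) (D : @deco R n d) (i0 : 'I_n).
Hypotheses (P2 : forall i, law2 (P i)) (dD : is_dec P (@dF _ _ _ D) (@da _ _ _ D))
  (q_sym : forall p p', q p p' = q p' p) (q_psd : forall x, 0 <= bq q x x).

Let Xp (x : Om) (p : I) : R := tnth (proj (tag p) x) (tagged p).

Let a0 k : 0 <= @da _ _ _ D k. Proof. exact: (dec_a_ge0 dD i0). Qed.

Let bq_lower (x y : I -> R) : 2 * bq q x y - bq q y y <= bq q x x.
Proof.
rewrite -subr_ge0; have := q_psd (fun p => x p - y p).
have -> : bq q (fun p => x p - y p) (fun p => x p - y p) = bq q x x - (2 * bq q x y - bq q y y).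
  have e : bq q x y = bq q y x.
    rewrite /bq exchange_big; apply: eq_bigr => p _; apply: eq_bigr => p' _.
    by rewrite q_sym; ring.
  rewrite mulr_natl mulr2n {2}e /bq -!big_split -!sumrB /=; apply: eq_bigr => p _.
  rewrite -!big_split -!sumrB /=; apply: eq_bigr => p' _; ring.
by [].
Qed.

(** Mixture of independent couplings of the conditioned laws. Expanding [q (x - xi, x - xi) >= 0]
    bounds the value of each piece from below by a function of its means, whichever coupling is
    used. *)
Lemma dec_coupling : exists G : probability Om R, [/\
  forall i, has_margin G (P i), intg G (fun x => bq q (Xp x) (Xp x)) &
  Val q P (@dF _ _ _ D) (@da _ _ _ D) (@dxi _ _ _ D) <= Ex G (fun x => bq q (Xp x) (Xp x))].
Proof.
have [mF F0 F1 Fa] := dD.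
have cond (k : dK D) i : exists Pk : probability (T i) R,
  (forall g : T i -> \bar R, measurable_fun setT g -> (forall y, 0 <= g y)%E ->
    ((da k)%:E * \int[Pk]_y g y = \int[P i]_y ((dF k y)%:E * g y))%E) /\
  forall f, quad f -> intg Pk f /\ da k * Ex Pk f = Ex (P i) (fun y => f y * dF k y).
  have mFk : measurable_fun setT (dF k (i := i)) := mF k i.
  have iFf f : quad f -> intg (P i) (fun y => f y * dF k y).
    by move=> qf; exact: (quad_intg (P2 i) (quad_bdM (mF k i) (dec_norm1 dD k (i := i)) qf)).
  have iF : intg (P i) (dF k (i := i)) by apply: (quad_intg (P2 i)); exact: (dec_quad dD).
  (* A piece of mass zero is given the law [P i]. *)
  have [ak|ak] := eqVneq (da k) 0.
    have w0 f : intg (P i) (fun y => dF k y * f y) -> Ex (P i) (fun y => dF k y * f y) = 0.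
      by move=> fi; apply: Ex_weight0 => //; rewrite Fa.
    exists (P i); split => [g mg g0|f qf].
      rewrite ak mul0e.
      have ae0 : (\int[P i]_x `|(EFin \o dF k (i := i)) x| = 0)%E.
        under eq_integral do rewrite /= ger0_norm//.
        by rewrite ExE// Fa ak.
      have mEF : measurable_fun setT (EFin \o dF k (i := i)) by exact/measurable_EFinP.
      move/(ae_eq_integral_abs _ measurableT mEF) : ae0 => ae0.
      rewrite (ae_eq_integral (cst 0%E)) ?integral0//.
        by apply: emeasurable_funM.
      by apply: filterS ae0 => y h _; have := h Logic.I => /= -[] ->; rewrite mul0e.
    split; first exact: quad_intg.
    rewrite ak mul0r (eq_Ex _ (g := fun y => dF k y * f y)); last by move=> y; rewrite mulrC.
    by rewrite w0//; apply: (eq_intg _ (iFf f qf)) => y; rewrite mulrC.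
  have ak0 : 0 < da k by rewrite lt_neqAle eq_sym ak a0.
  pose W y := (da k)^-1 * dF k (i := i) y.
  have mW : measurable_fun setT W by exact: measurable_funM.
  have W0 y : 0 <= W y by rewrite mulr_ge0// invr_ge0.
  have iW : intg (P i) W by exact: intgZ.
  have W1 : (\int[P i]_y (W y)%:E = 1)%E by rewrite ExE// ExZ// Fa mulVf.
  have [Pk [h1 h2]] := wlaw_ex2 mW W0 W1 (@measurable_id _ (T i) setT).
  exists Pk; split => [g mg g0|f qf].
    rewrite h1// -ge0_integralZl_EFin//.
    - apply: eq_integral => y _; rewrite /W muleA -EFinM mulrA mulfV// mul1r.
      by [].
    - by move=> y _; rewrite mule_ge0// lee_fin.
    - by apply: emeasurable_funM => //; exact/measurable_EFinP.
  have [mf _] := qf.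
  have e y : W y * f y = (da k)^-1 * (f y * dF k y) by rewrite /W; ring.
  have iWf : intg (P i) (fun y => W y * f y) by rewrite (funext e); apply: intgZ; exact: iFf.
  have [j1 ->] := h2 f mf iWf; split => //.
  by rewrite (eq_Ex _ e) ExZ ?mulVKf//; exact: iFf.
have /dep_choice[Pk hPk] := fun k : dK D => dep_choice (cond k).
have /choice[Gk hGk] := fun k : dK D => indep_coupling (Pk k).
have mar k i := proj1 (hGk k) i.
have a1 : \sum_k @da _ _ _ D k = 1 by exact: (dec_a_sum dD i0).
have [G [h1 h2]] := mixture_ex Gk a0 a1.
have iXX k p p' : intg (Gk k) (fun x => Xp x p * Xp x p').
  have i2 p1 : intg (Gk k) (fun x => Xp x p1 ^+ 2).
    have q2 := @quad_coord2 R (d (tag p1)) (tagged p1) (tagged p1).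
    have [iq _] := proj2 (hPk k (tag p1)) _ q2; have [mq _] := q2.
    by have [h _] := margin_real (mar k (tag p1)) mq iq; apply: (eq_intg _ h) => x; rewrite expr2.
  apply: (intg_dom _ (intgD (i2 p) (i2 p'))).
    by apply: measurable_funM; apply: meas_tnth; exact: meas_proj.
  move=> x; apply: (le_trans (norm_mul_le _ _)).
  by have := sqr_ge0 (Xp x p); have := sqr_ge0 (Xp x p'); lra.
have ibq k : intg (Gk k) (fun x => bq q (Xp x) (Xp x)).
  apply: intg_sum => p _; apply: intg_sum => p' _.
  by apply: (eq_intg (f := fun x => q p p' * (Xp x p * Xp x p'))) => [x|]; [ring|exact: intgZ].
have mbq : measurable_fun setT (fun x => bq q (Xp x) (Xp x)).
  apply: measurable_sum => p; apply: measurable_sum => p'.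
  by apply: measurable_funM; [apply: measurable_funM => //|]; apply: meas_tnth; exact: meas_proj.
have [iG eG] := h2 _ mbq ibq.
exists G; split => //.
  move=> i g mg g0; rewrite h1//; last by apply: measurableT_comp => //; exact: meas_proj.
  transitivity (\sum_(k : dK D) \int[P i]_y ((dF k y)%:E * g y))%E.
    by apply: eq_bigr => k _; rewrite (mar k i g mg g0); exact: (proj1 (hPk k i)).
  rewrite -ge0_integral_sum//.
  - apply: eq_integral => y _; rewrite -ge0_sume_distrl//.
      by rewrite sumEFin F1 mul1e.
    by move=> k _; rewrite lee_fin.
  - by move=> k; apply: emeasurable_funM => //; apply/measurable_EFinP; exact: mF.
  - by move=> k y _; rewrite mule_ge0// lee_fin.
rewrite eG /Val; apply: ler_sum => k _.
have iX p : intg (Gk k) (fun x => Xp x p) /\ da k * Ex (Gk k) (fun x => Xp x p) = mom P (@dF _ _ _ D k) p.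
  have qc := @quad_coord R (d (tag p)) (tagged p); have [mq _] := qc.
  have [iq eq] := proj2 (hPk k (tag p)) _ qc.
  have [j1 j2] := margin_real (mar k (tag p)) mq iq.
  by split => //; rewrite j2 eq.
have ib : intg (Gk k) (fun x => bq q (Xp x) (dxi k)).
  apply: intg_sum => p _; apply: intg_sum => p' _.
  apply: (eq_intg (f := fun x => (q p p' * dxi k p') * Xp x p)) => [x|]; first by ring.
  by apply: intgZ; case: (iX p).
have eb : da k * Ex (Gk k) (fun x => bq q (Xp x) (dxi k)) = bq q (mom P (@dF _ _ _ D k)) (dxi k).
  have ip p p' : intg (Gk k) (fun x => Xp x p * q p p' * dxi k p').
    apply: (eq_intg (f := fun x => (q p p' * dxi k p') * Xp x p)) => [x|]; first by ring.
    by apply: intgZ; case: (iX p).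
  rewrite /bq Ex_sum; last by move=> p _; apply: intg_sum => p' _.
  rewrite mulr_sumr; apply: eq_bigr => p _.
  rewrite Ex_sum; last by move=> p' _.
  rewrite mulr_sumr; apply: eq_bigr => p' _.
  have [j1 <-] := iX p.
  rewrite (eq_Ex _ (g := fun x => (q p p' * dxi k p') * Xp x p)); last by move=> x; ring.
  by rewrite ExZ//; ring.
have -> : 2 * bq q (mom P (@dF _ _ _ D k)) (dxi k) - da k * bq q (dxi k) (dxi k) =
   da k * Ex (Gk k) (fun x => 2 * bq q (Xp x) (dxi k) - bq q (dxi k) (dxi k)).
  rewrite ExB ?Ex_cst; [|exact: intgZ|exact: intg_cst].
  by rewrite ExZ// -eb; ring.
rewrite ler_wpM2l//; apply: Ex_le => //.
by apply: intgB; [exact: intgZ|exact: intg_cst].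
Qed.

End decomposition_coupling.

End couplings.

(** * Rank-one covariances *)

Section rank_one.
Context (R : realType) (m : nat) (v : 'rV[R]_m).

Let nv : R := \sum_j v 0 j ^+ 2.

(** Covariances perturbed in one direction, with explicit determinant, inverse and range of
    positivity; they probe the direction [v], and [v = 0] gives the isotropic ones. *)
Definition rank1 (a w : R) : 'M[R]_m := a *: (1%:M + w *: (v^T *m v)).

Let vvE : v *m v^T = nv%:M.
Proof.
rewrite [LHS]mx11_scalar; congr (_%:M); rewrite mxE; apply: eq_bigr => j _.
by rewrite mxE expr2.
Qed.

Lemma rank1_entry a w j j' : rank1 a w j j' = a * ((j == j')%:R + w * (v 0 j * v 0 j')).
Proof. by rewrite /rank1 !mxE big_ord1 !mxE. Qed.

Lemma qf_rank1 a w (x : 'rV[R]_m) : qf (rank1 a w) x =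
  a * (\sum_j x 0 j ^+ 2 + w * (\sum_j x 0 j * v 0 j) ^+ 2).
Proof.
rewrite qfE expr2 mulr_suml mulr_sumr -big_split mulr_sumr; apply: eq_bigr => j _ /=.
rewrite mulr_sumr mulr_sumr -[x 0 j ^+ 2]mulr1.
rewrite (_ : x 0 j ^+ 2 * 1 = \sum_j' (x 0 j * (j == j')%:R * x 0 j')); last first.
  rewrite (bigD1 j)//= eqxx !mulr1 -expr2 big1 ?addr0//.
  by move=> j' jj; rewrite eq_sym (negbTE jj) mulr0 mul0r.
rewrite -big_split mulr_sumr; apply: eq_bigr => j' _ /=.
by rewrite rank1_entry; ring.
Qed.

(** For negative [w], Cauchy-Schwarz reduces positivity to the case of [v] itself. *)
Lemma rank1_posdef a w : 0 < a -> 0 < 1 + w * nv -> posdef (rank1 a w).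
Proof.
move=> a0 w0; split.
  by apply/matrixP => j j'; rewrite mxE !rank1_entry eq_sym [v 0 j' * _]mulrC.
move=> x x0; rewrite -/(qf _ _) qf_rank1 pmulr_rgt0//.
set n := \sum_j x 0 j ^+ 2; set s := \sum_j x 0 j * v 0 j.
have n0 : 0 < n.
  rewrite lt_neqAle sumr_ge0 ?andbT; last by move=> j _; exact: sqr_ge0.
  apply: contra x0 => /eqP/esym n0; apply/eqP/rowP => j; rewrite mxE.
  have := @le_sum1 _ _ (fun j => x 0 j ^+ 2) j (fun j => sqr_ge0 _); rewrite -/n n0 => h.
  by apply/eqP; rewrite -sqrf_eq0 eq_le h sqr_ge0.
have nv0 : 0 <= nv by apply: sumr_ge0 => j _; exact: sqr_ge0.
have cs : s ^+ 2 <= n * nv.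
  have [nv_eq0|nvp] := eqVneq nv 0.
    rewrite nv_eq0 mulr0 (_ : s = 0) ?expr0n//=; rewrite /s big1// => j _.
    have := @le_sum1 _ _ (fun j => v 0 j ^+ 2) j (fun j => sqr_ge0 _); rewrite -/nv nv_eq0 => h.
    suff -> : v 0 j = 0 by rewrite mulr0.
    by apply/eqP; rewrite -sqrf_eq0 eq_le h sqr_ge0.
  have : 0 <= \sum_j (x 0 j - s / nv * v 0 j) ^+ 2 by apply: sumr_ge0 => j _; exact: sqr_ge0.
  have -> : \sum_j (x 0 j - s / nv * v 0 j) ^+ 2 = n - s ^+ 2 / nv.
    transitivity (\sum_j (x 0 j ^+ 2 - (2 * (s / nv)) * (x 0 j * v 0 j) + (s / nv) ^+ 2 * v 0 j ^+ 2)).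
      by apply: eq_bigr => j _; ring.
    rewrite big_split sumrB /= -!mulr_sumr -/n -/s -/nv; field.
    by [].
  by rewrite subr_ge0 ler_pdivrMr// lt_neqAle eq_sym nvp.
have [w1|w1] := leP 0 w; first by rewrite ltr_pwDl// mulr_ge0 ?sqr_ge0.
have : w * (n * nv) <= w * s ^+ 2 by rewrite ler_wnM2l// ltW.
have : 0 < n * (1 + w * nv) by rewrite mulr_gt0.
by move: (s ^+ 2) => z; nra.
Qed.

(** The bordered matrix [M] has two block triangular factorizations, eliminating one diagonal block
    or the other; comparing their determinants gives the formula. *)
Lemma rank1_det a w : \det (rank1 a w) = a ^+ m * (1 + w * nv).
Proof.
rewrite /rank1 detZ; congr (_ * _).
pose M : 'M[R]_(1 + m) := block_mx 1%:M (- w *: v) v^T 1%:M.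
have e1 : M = block_mx 1%:M 0 v^T 1%:M *m block_mx 1%:M (- w *: v) 0 (1%:M + w *: (v^T *m v)).
  rewrite mulmx_block ?mul1mx ?mulmx1 ?mul0mx ?mulmx0 ?addr0 -scalemxAr /M.
  by rewrite !scaleNr addrCA addNr addr0.
have e2 : M = block_mx (1 + w * nv)%:M (- w *: v) 0 1%:M *m block_mx 1%:M 0 v^T 1%:M.
  rewrite mulmx_block ?mul1mx ?mulmx1 ?mul0mx ?mulmx0 ?addr0 ?add0r -scalemxAl vvE /M.
  congr block_mx; apply/matrixP => i j; rewrite !ord1 !mxE eqxx !mulr1n; ring.
have := congr1 determinant e1; rewrite {1}e2 !det_mulmx !det_lblock !det_ublock !det1 !mulr1 !mul1r.
by rewrite det_scalar1.
Qed.

Lemma rank1_inv a w : a != 0 -> 1 + w * nv != 0 ->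
  invmx (rank1 a w) = rank1 a^-1 (- w / (1 + w * nv)).
Proof.
move=> a0 w0.
have e : rank1 a w *m rank1 a^-1 (- w / (1 + w * nv)) = 1%:M.
  rewrite /rank1 -scalemxAl -scalemxAr scalerA mulfV// scale1r.
  rewrite mulmxDl mul1mx mulmxDr mulmx1 -scalemxAl -scalemxAr -mulmxA (mulmxA v) vvE.
  rewrite mul_scalar_mx -scalemxAr scalerA scalerA.
  rewrite -addrA -scalerDl -scalerDl [X in _ + X *: _](_ : _ = 0) ?scale0r ?addr0//.
  by field.
have uS : rank1 a w \in unitmx by have [] := mulmx1_unit e.
by rewrite -[RHS]mul1mx -(mulVmx uS) -mulmxA e mulmx1.
Qed.

End rank_one.

(** * Gaussian tests and covariances *)

Section gauss_log.
Context (R : realType) (m : nat).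
Implicit Types (S : 'M[R]_m) (P : probability (m.-tuple R) R).

Lemma Ex_qf S P : law2 P -> Ex P (fun x => qf S (rowt x)) = \sum_j \sum_j' S j j' * cov P j j'.
Proof.
move=> P2; rewrite (eq_Ex P (@qf_rowtE R m S)).
have ii j j' : intg P (fun x => tnth x j * S j j' * tnth x j').
  apply: (eq_intg (f := fun x : m.-tuple R => S j j' * (tnth x j * tnth x j'))) => [x|]; first by ring.
  by apply: intgZ; apply: quad_intg => //; exact: quad_coord2.
rewrite Ex_sum; last by move=> j _; apply: intg_sum => j' _.
apply: eq_bigr => j _; rewrite Ex_sum//; apply: eq_bigr => j' _.
rewrite (eq_Ex P (g := fun x => S j j' * (tnth x j * tnth x j'))); last by move=> x; ring.
by rewrite ExZ//; apply: quad_intg => //; exact: quad_coord2.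
Qed.

Lemma Ex_ln_gauss S P : posdef S -> law2 P ->
  - Ex P (fun x => ln (gauss_density S x)) =
  ln ((2 * pi) ^+ m * \det S) / 2 + (\sum_j \sum_j' invmx S j j' * cov P j j') / 2.
Proof.
move=> pS P2; have d0 := posdef_det pS.
have p0 : 0 < (2 * pi) ^+ m * \det S.
  by rewrite mulr_gt0// exprn_gt0// mulr_gt0// pi_gt0.
have e x : ln (gauss_density S x) = - (ln ((2 * pi) ^+ m * \det S) / 2) + - 2^-1 * qf (invmx S) (rowt x).
  have -> : ln (gauss_density S x) = - ln (Num.sqrt ((2 * pi) ^+ m * \det S)) + - qf (invmx S) (rowt x) / 2.
    rewrite gauss_densityE [LHS]lnM ?posrE ?expR_gt0 ?invr_gt0 ?sqrtr_gt0//.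
    by rewrite expRK lnV ?posrE ?sqrtr_gt0.
  rewrite -powR12_sqrt ?(ltW p0)// ln_powR; ring.
have iq : intg P (fun x => qf (invmx S) (rowt x)).
  apply: quad_intg => //; rewrite (funext (@qf_rowtE R m (invmx S))).
  apply: quad_sum => j; apply: quad_sum => j'.
  rewrite (_ : (fun x => _) = fun x => (invmx S) j j' * (tnth x j * tnth x j')).
    by apply: quadZ; exact: quad_coord2.
  by apply/funext => x; ring.
rewrite (eq_Ex P e) ExD; [|exact: intg_cst|exact: intgZ].
by rewrite Ex_cst ExZ// Ex_qf//; ring.
Qed.

Lemma cov_sym P j j' : cov P j j' = cov P j' j.
Proof. by rewrite /cov; apply: eq_Ex => x; rewrite mulrC. Qed.

Lemma cov_diag_ge0 P j : 0 <= cov P j j.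
Proof. by apply: Ex_ge0 => x; rewrite -expr2 sqr_ge0. Qed.

Lemma cov_le P j j' : law2 P -> `|cov P j j'| <= (cov P j j + cov P j' j') / 2.
Proof.
move=> P2; have ic a b : intg P (fun x => tnth x a * tnth x b).
  by apply: quad_intg => //; exact: quad_coord2.
apply: (le_trans (Ex_norm (ic j j'))); rewrite /cov -(ExD (ic j j) (ic j' j')) mulrC -ExZ; last exact: intgD.
apply: Ex_le; [exact/intg_norm|by apply: intgZ; exact: intgD|] => x.
by rewrite (le_trans (norm_mul_le _ _))// !expr2 mulrC.
Qed.

Lemma Ex_lin2 P (th : 'I_m -> R) : law2 P ->
  Ex P (fun x => lin th x ^+ 2) = \sum_j \sum_j' (th j * th j') * cov P j j'.
Proof.
move=> P2; have ic a b : intg P (fun x => tnth x a * tnth x b).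
  by apply: quad_intg => //; exact: quad_coord2.
rewrite (eq_Ex P (g := fun x => \sum_j \sum_j' (th j * th j') * (tnth x j * tnth x j'))).
  rewrite Ex_sum; last by move=> j _; apply: intg_sum => j' _; exact: intgZ.
  apply: eq_bigr => j _; rewrite Ex_sum; last by move=> j' _; exact: intgZ.
  by apply: eq_bigr => j' _; rewrite ExZ.
move=> x; rewrite expr2 /lin mulr_suml; apply: eq_bigr => j _.
by rewrite mulr_sumr; apply: eq_bigr => j' _; ring.
Qed.

Lemma Ex_n2 P : law2 P -> Ex P (@n2 R m) = \sum_j cov P j j.
Proof.
move=> P2; rewrite /n2 Ex_sum => [|j _]; first by apply: eq_bigr => j _; apply: eq_Ex => x; rewrite expr2.
by apply: quad_intg => //; apply: (@eq_ind _ _ (fun f => quad f) (@quad_coord2 R m j j)); apply/funext => x; rewrite expr2.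
Qed.

(** Polarization: diagonal entries from unit vectors, the others from sums of two of them. *)
Lemma cov_of_moments S P : S^T = S -> law2 P ->
  (forall (al : R) th, Ex P (fun x => (al + lin th x) ^+ 2) = al ^+ 2 + qf S (\row_j th j)) ->
  forall j j', cov P j j' = S j j'.
Proof.
move=> sS P2 h j j'.
have q th : qf S (\row_a th a) = \sum_a \sum_b (th a * th b) * cov P a b.
  rewrite -Ex_lin2//; have := h 0 th; rewrite expr0n add0r => <-.
  by apply: eq_Ex => x; rewrite add0r.
have q1 (th : 'I_m -> R) (C : 'I_m -> 'I_m -> R) : (forall a b, C a b = C b a) ->
   let e a := fun b : 'I_m => (b == a)%:R : R in
   \sum_a \sum_b ((e j a + e j' a) * (e j b + e j' b)) * C a b = C j j + C j j' *+ 2 + C j' j'.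
  move=> Cs e; rewrite (eq_bigr (fun a => (e j a + e j' a) * (C a j + C a j'))); last first.
    move=> a _; rewrite (eq_bigr (fun b => (e j a + e j' a) * (e j b * C a b + e j' b * C a b))); last first.
      by move=> b _; ring.
    rewrite -mulr_sumr big_split /=; congr (_ * (_ + _)).
      by rewrite (bigD1 j)//= /e eqxx mul1r big1 ?addr0// => b /negbTE ->; rewrite mul0r.
    by rewrite (bigD1 j')//= /e eqxx mul1r big1 ?addr0// => b /negbTE ->; rewrite mul0r.
  rewrite (eq_bigr (fun a => e j a * (C a j + C a j') + e j' a * (C a j + C a j'))); last by move=> a _; ring.
  rewrite big_split /= (bigD1 j)//= /e eqxx mul1r big1 ?addr0; last by move=> a /negbTE ->; rewrite mul0r.
  rewrite (bigD1 j')//= eqxx mul1r big1 ?addr0; last by move=> a /negbTE ->; rewrite mul0r.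
  by rewrite (Cs j' j); ring.
have d a : cov P a a = S a a.
  have := q (fun b => (b == a)%:R); rewrite qfE.
  rewrite (bigD1 a)//= (bigD1 a)//= !mxE eqxx mul1r mulr1 big1 => [|b /negbTE ab]; last by rewrite !mxE ab mulr0.
  rewrite big1 => [|b /negbTE ab]; last by rewrite big1// => c _; rewrite !mxE ab !mul0r.
  rewrite !addr0 => ->; rewrite (bigD1 a)//= (bigD1 a)//= eqxx !mul1r big1 => [|b /negbTE ->]; last by rewrite mulr0 mul0r.
  by rewrite big1 ?addr0// => b /negbTE ->; rewrite big1// => c _; rewrite !mul0r.
have := q (fun b => (b == j)%:R + (b == j')%:R).
rewrite (q1 (fun=> 0) (cov P) (cov_sym P)) qfE.
rewrite (eq_bigr (fun a => \sum_b (((a == j)%:R + (a == j')%:R) * ((b == j)%:R + (b == j')%:R)) * S a b)); last first.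
  by move=> a _; apply: eq_bigr => b _; rewrite !mxE; ring.
rewrite (q1 (fun=> 0) (fun a b => S a b)); last by move=> a b; rewrite -[in LHS]sS mxE.
by rewrite !d; lra.
Qed.

End gauss_log.

(** * Consequences of the Gaussian bound *)

Section gaussian_bound.
Context (R : realType) (n : nat) (d : 'I_n -> nat).
Notation T i := ((d i).-tuple R).
Notation I := {i : 'I_n & 'I_(d i)}.
Notation laws := (forall i, probability (T i) R).
Notation Om := ((\sum_(k < n) d k).-tuple R).

Definition coord (x : Om) (p : I) : R := tnth (Defs.proj (tag p) x) (tagged p).

Definition gaussian_law m (S : 'M[R]_m) (P : probability (m.-tuple R) R) : Prop :=
  [/\ law2 P, evenl P, forall th, Ex P (fun x => cos (lin th x)) = expR (- (qf S (\row_j th j) / 2)) &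
      forall j j', cov P j j' = S j j'].

Lemma meas_coord p : measurable_fun setT (fun x => coord x p).
Proof. by apply: meas_tnth; exact: meas_proj. Qed.

Lemma intg_coord2 (mu : laws) (G : probability Om R) p p' : (forall i, law2 (mu i)) ->
  (forall i, has_margin G (mu i)) -> intg G (fun x => coord x p * coord x p').
Proof.
move=> mu2 mG.
have i2 p1 : intg G (fun x => coord x p1 ^+ 2).
  have q2 := @quad_coord2 R (d (tag p1)) (tagged p1) (tagged p1).
  have [h _] := margin_real (mG (tag p1)) (proj1 q2) (quad_intg (mu2 _) q2).
  by apply: (eq_intg _ h) => x; rewrite expr2.
apply: (intg_dom _ (intgD (i2 p) (i2 p'))); first by apply: measurable_funM; exact: meas_coord.
move=> x; apply: (le_trans (norm_mul_le _ _)).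
by have := sqr_ge0 (coord x p); have := sqr_ge0 (coord x p'); lra.
Qed.

Lemma Ex_bq (q : I -> I -> R) (G : probability Om R) :
  (forall p p', intg G (fun x => coord x p * coord x p')) ->
  intg G (fun x => bq q (coord x) (coord x)) /\
  Ex G (fun x => bq q (coord x) (coord x)) =
    \sum_p \sum_p' q p p' * Ex G (fun x => coord x p * coord x p').
Proof.
move=> ii.
have e x p p' : coord x p * q p p' * coord x p' = q p p' * (coord x p * coord x p') by ring.
have iq p p' : intg G (fun x => coord x p * q p p' * coord x p').
  by apply: (eq_intg _ (intgZ (q p p') (ii p p'))) => x; rewrite e.
split; first by apply: intg_sum => p _; apply: intg_sum => p' _.
rewrite /bq Ex_sum; last by move=> p _; apply: intg_sum => p' _.
apply: eq_bigr => p _; rewrite Ex_sum//; apply: eq_bigr => p' _.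
by rewrite (eq_Ex G (fun x => e x p p')) ExZ.
Qed.

Lemma Ex_coord2 (mu : laws) (G : probability Om R) p : (forall i, law2 (mu i)) ->
  (forall i, has_margin G (mu i)) ->
  Ex G (fun x => coord x p * coord x p) = cov (mu (tag p)) (tagged p) (tagged p).
Proof.
move=> mu2 mG; have q2 := @quad_coord2 R (d (tag p)) (tagged p) (tagged p).
by have [_ h] := margin_real (mG (tag p)) (proj1 q2) (quad_intg (mu2 _) q2).
Qed.

Lemma cov_block (mu : laws) (G : probability Om R) (f : I -> I -> R) : (forall i, law2 (mu i)) ->
  (forall i, has_margin G (mu i)) ->
  (forall i j j', cov (mu i) j j' = f (Tagged (fun i => 'I_(d i)) j) (Tagged (fun i => 'I_(d i)) j')) ->
  forall p p', tag p = tag p' -> Ex G (fun x => coord x p * coord x p') = f p p'.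
Proof.
move=> mu2 mG h [i j] [i' j'] /= e; subst i'; rewrite -h.
have q2 := @quad_coord2 R (d i) j j'.
by have [_ h2] := margin_real (mG i) (proj1 q2) (quad_intg (mu2 _) q2).
Qed.

Lemma sum_tag (F : forall i, 'I_(d i) -> R) : \sum_i \sum_j F i j = \sum_(p : I) F (tag p) (tagged p).
Proof. by rewrite sig_big_dep. Qed.

Variables (c : 'I_n -> R) (q0 : I -> I -> R) (D : R).
Hypothesis c0 : forall i, 0 < c i.

(** The inequality for Gaussians in terms of laws: the entropy is the mean of minus the logarithm of
    the density, and the supremum is replaced by a coupling up to [e]. *)
Definition gaussian_bound : Prop := forall S : forall i, 'M[R]_(d i), (forall i, posdef (S i)) ->
  exists ga : laws, (forall i, gaussian_law (S i) (ga i)) /\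
  forall e, 0 < e -> exists G : probability Om R, (forall i, has_margin G (ga i)) /\
    - (\sum_i c i * Ex (ga i) (fun x => ln (gauss_density (S i) x))) <=
    Ex G (fun x => bq q0 (coord x) (coord x)) + D + e.

Hypothesis HG : gaussian_bound.

Let Q := \sum_p \sum_p' `|q0 p p'|.

Let Q0 : 0 <= Q.
Proof. by rewrite /Q sumr_ge0// => p _; rewrite sumr_ge0. Qed.

Let N : R := \sum_(p : I) 1.

Let N0 : 0 <= N. Proof. exact: sumr_ge0. Qed.

(* Otherwise the Gaussian entropies of [1 + t x^T x] stay bounded below while the
   best coupling gains at most [t bq q0 x x + o(t)]. *)
Lemma block_psd i0 (x : I -> R) : (forall p, tag p != i0 -> x p = 0) -> 0 <= bq q0 x x.
Proof.
move=> x0; rewrite leNgt; apply/negP => neg.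
set be := - bq q0 x x; have be0 : 0 < be by rewrite oppr_gt0.
pose X := \sum_p x p ^+ 2.
have X0 : 0 <= X by apply: sumr_ge0 => p _; exact: sqr_ge0.
(* So small that the cross terms, which contain [Q * X * eta * t], use up only half of the linear
   gain [be * t]. *)
pose eta := Num.min 1 (be / (2 * (Q * X + 1))).
have QX : 0 < Q * X + 1 by rewrite ltr_wpDl// mulr_ge0.
have eta0 : 0 < eta by rewrite lt_min ltr01/= divr_gt0// mulr_gt0.
have eta1 : eta <= 1 by rewrite ge_min lexx.
have etaQ : Q * X * eta <= be / 2.
  have h : eta <= be / (2 * (Q * X + 1)) by rewrite ge_min lexx orbT.
  rewrite ler_pdivlMr ?mulr_gt0// in h.
  have : 0 <= eta by exact: ltW.
  by move: h; lra.
pose A0 := \sum_p \sum_p' (if (tag p == i0) && (tag p' == i0) then q0 p p' * (p == p')%:R else 0).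
(* Large enough for the remaining gain [be * t / 2] to exceed all terms that do not depend on
   [t]. *)
pose t := 2 * (`|A0| + Q * (N / eta) + `|D| + 2) / be.
have t0 : 0 <= t.
  by rewrite divr_ge0 ?(ltW be0)// mulr_ge0// !addr_ge0// mulr_ge0// divr_ge0// ltW.
pose v i := \row_(j < d i) x (Tagged (fun i => 'I_(d i)) j).
pose S i := rank1 (v i) 1 t.
have nv i : 0 <= \sum_j (v i) 0 j ^+ 2 by apply: sumr_ge0 => j _; exact: sqr_ge0.
have pS i : posdef (S i).
  by apply: rank1_posdef => //; rewrite ltr_pwDl// mulr_ge0.
have [ga [hga /(_ 1 ltr01)[G [mG hG]]]] := HG pS.
have ga2 i : law2 (ga i) by case: (hga i).
have lhs0 : 0 <= - (\sum_i c i * Ex (ga i) (fun x => ln (gauss_density (S i) x))).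
  rewrite -sumrN; apply: sumr_ge0 => i _; rewrite -mulrN mulr_ge0 ?(ltW (c0 i))//.
  rewrite Ex_ln_gauss// addr_ge0//.
    rewrite divr_ge0// ln_ge0// rank1_det expr1n mul1r.
    rewrite -[leLHS]mul1r ler_pM//; last by rewrite lerDl mulr_ge0.
    rewrite exprn_ege1//; have := @pi_ge2 R; lra.
  rewrite divr_ge0// -Ex_qf//; apply: Ex_ge0 => y.
  by rewrite qf_inv//; exact: qf0_posdef.
have ii p p' := intg_coord2 p p' ga2 mG.
have same p p' : tag p = tag p' -> Ex G (fun y => coord y p * coord y p') = (p == p')%:R + t * (x p * x p').
  apply: (cov_block (f := fun p p' => (p == p')%:R + t * (x p * x p')) ga2 mG) => i j j'.
  have [_ _ _ ->] := hga i; rewrite rank1_entry mul1r !mxE eq_Tagged /=.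
  by [].
(* Weights with [om p * om p' >= 1] unless both blocks are [i0]: mixed moments are then below [W],
   in which the large covariance of the block [i0] counts only with the factor [eta]. *)
pose om (p : I) : R := if tag p == i0 then eta else eta^-1.
have om0 p : 0 < om p by rewrite /om; case: ifP => _ //; rewrite invr_gt0.
pose W y := \sum_p om p * coord y p ^+ 2.
have Wp y p : om p * coord y p ^+ 2 <= W y.
  apply: (@le_sum1 _ _ (fun p => om p * coord y p ^+ 2)) => p1.
  by rewrite mulr_ge0 ?sqr_ge0// ltW.
have isq p : intg G (fun y => coord y p ^+ 2) by apply: (eq_intg _ (ii p p)) => y; rewrite expr2.
have iW : intg G W by apply: intg_sum => p _; exact: intgZ.
have EW : Ex G W <= N / eta + t * (eta * X).
  rewrite /W Ex_sum; last by move=> p _; exact: intgZ.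
  rewrite /N /X mulr_suml !mulr_sumr -big_split; apply: ler_sum => p _ /=.
  rewrite ExZ// (eq_Ex G (g := fun y => coord y p * coord y p)); last by move=> y; rewrite expr2.
  rewrite same// eqxx mul1r mulrDr mulr1 /om; case: ifP => [_|/negbT/x0 ->].
    apply: lerD; last by rewrite expr2; lra.
    by rewrite (le_trans eta1)// -[leLHS]invr1 lef_pV2 ?posrE.
  by rewrite !mulr0 expr0n /= !mulr0.
have cross p p' y : ~~ ((tag p == i0) && (tag p' == i0)) -> `|coord y p * coord y p'| <= W y.
  move=> h.
  have a1 : `|coord y p * coord y p'| <= (om p * coord y p ^+ 2 + om p' * coord y p' ^+ 2) / 2.
    have o1 : 1 <= om p * om p'.
      move: h; rewrite /om; case: eqP; case: eqP => //= _ _ _.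
      - by rewrite mulfV// gt_eqF.
      - by rewrite mulVf// gt_eqF.
      - by rewrite -[leLHS]mulr1 ler_pM// -[leLHS]invr1 lef_pV2 ?posrE.
    rewrite -(ler_pXn2r (n := 2)) ?nnegrE//; last first.
      by rewrite divr_ge0// addr_ge0// mulr_ge0 ?sqr_ge0// ltW.
    rewrite real_normK ?num_real// exprMn.
    have := ler_wpM2r (mulr_ge0 (sqr_ge0 (coord y p)) (sqr_ge0 (coord y p'))) o1.
    rewrite mul1r => h1; apply: (le_trans h1).
    have := sqr_ge0 (om p * coord y p ^+ 2 - om p' * coord y p' ^+ 2).
    by move: (coord y p ^+ 2) (coord y p' ^+ 2) => a b; nra.
  have w1 := Wp y p; have w2 := Wp y p'.
  by apply: (le_trans a1); lra.
have bound : Ex G (fun y => bq q0 (coord y) (coord y)) <= A0 + t * bq q0 x x + Q * Ex G W.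
  have [_ ->] := Ex_bq q0 ii.
  rewrite /A0 /bq /Q mulr_sumr mulr_suml -!big_split; apply: ler_sum => p _ /=.
  rewrite mulr_sumr mulr_suml -!big_split; apply: ler_sum => p' _ /=.
  have EW0 : 0 <= Ex G W.
    by apply: Ex_ge0 => y; apply: le_trans (Wp y p); rewrite mulr_ge0 ?sqr_ge0// ltW.
  have [h|h] := boolP ((tag p == i0) && (tag p' == i0)).
    have /andP[/eqP e1 /eqP e2] := h.
    rewrite same ?e1 ?e2// mulrDr -[leLHS]addr0 lerD// ?mulr_ge0//.
    by rewrite le_eqVlt; apply/orP; left; apply/eqP; ring.
  have -> : x p * q0 p p' * x p' = 0.
    move: h; rewrite negb_and => /orP[] /x0 ->; first by rewrite !mul0r.
    by rewrite mulr0.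
  rewrite mulr0 !add0r (le_trans (ler_norm _))// normrM ler_wpM2l//.
  rewrite (le_trans (Ex_norm (ii p p')))//; apply: Ex_le => //; first exact: intg_norm.
  by move=> y; exact: cross.
have := le_trans lhs0 hG.
have : Q * Ex G W <= Q * (N / eta + t * (eta * X)) by rewrite ler_wpM2l.
have e3 : Q * (N / eta + t * (eta * X)) = Q * (N / eta) + t * (Q * X * eta) by ring.
have e4 : t * (Q * X * eta) <= t * be / 2 by rewrite -[leRHS]mulrA ler_wpM2l.
have e5 : t * be = 2 * (`|A0| + Q * (N / eta) + `|D| + 2) by rewrite /t divfK// gt_eqF.
have e6 : t * bq q0 x x = - (t * be) by rewrite /be mulrN opprK.
have := ler_norm A0; have := ler_norm D; move: bound; rewrite e6 e3.
move: e4 e5; move: (t * be) (Ex G _) (Q * Ex G W) (t * (Q * X * eta)) (Q * (N / eta)) (`|A0|) (`|D|).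
by move=> *; lra.
Qed.

Variables (kap lam de : R).
Hypotheses (lam0 : 0 < lam) (de0 : 0 < de) (deN : de * N <= lam / 2).

(** Adding [kap |x| ^ 2] changes the value of every coupling by [kap * trC mu], which depends on the
    marginals only; [kap] is later chosen to make the form positive semidefinite. *)
Definition shift_form (p p' : I) : R := q0 p p' + (p == p')%:R * kap.

Definition trC (mu : laws) : R := \sum_i \sum_j cov (mu i) j j.

Notation q := shift_form.
Notation pen := (@pen R n d (kap - lam) de).

Lemma bq_shift (x : I -> R) : bq q x x = bq q0 x x + kap * \sum_p x p ^+ 2.
Proof.
rewrite /bq mulr_sumr -big_split; apply: eq_bigr => p _ /=.
rewrite (eq_bigr (fun p' => x p * q0 p p' * x p' + x p * ((p == p')%:R * kap) * x p')); last first.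
  by move=> p' _; rewrite /shift_form mulrDr mulrDl.
rewrite big_split /= [X in _ + X](bigD1 p)//= eqxx mul1r [X in _ + (_ + X)]big1 ?addr0.
  by congr (_ + _); ring.
by move=> p' pp; rewrite eq_sym (negbTE pp) mul0r mulr0 mul0r.
Qed.

Lemma trC_ge0 mu : 0 <= trC mu.
Proof. by apply: sumr_ge0 => i _; apply: sumr_ge0 => j _; exact: cov_diag_ge0. Qed.

(** [phi] is below the absolute value, a covariance is below the mean of two variances, and each
    variance is then counted at most [N] times. Half of the trace term thus pays for the convex
    part. *)
Lemma pen_phi_le (mu : laws) : (forall i, law2 (mu i)) ->
  0 <= de * (\sum_i \sum_j \sum_j' phi (cov (mu i) j j')) <= lam / 2 * trC mu.
Proof.
move=> mu2; apply/andP; split.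
  rewrite mulr_ge0 ?(ltW de0)// sumr_ge0// => i _; rewrite sumr_ge0// => j _.
  by rewrite sumr_ge0// => j' _; exact: phi_ge0.
apply: (@le_trans _ _ (de * (N * trC mu))); last first.
  by rewrite mulrA ler_wpM2r// trC_ge0.
rewrite ler_wpM2l ?(ltW de0)// /trC mulr_sumr; apply: ler_sum => i _.
apply: (@le_trans _ _ ((\sum_(j < d i) 1) * \sum_j cov (mu i) j j)); last first.
  rewrite ler_wpM2r ?sumr_ge0// => [j _|]; first exact: cov_diag_ge0.
  rewrite /N -(sum_tag (fun _ _ => 1)).
  by apply: (@le_sum1 _ _ (fun i => \sum_(j < d i) 1)) => i'; exact: sumr_ge0.
apply: (@le_trans _ _ (\sum_(j < d i) \sum_(j' < d i) (cov (mu i) j j + cov (mu i) j' j') / 2)).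
  apply: ler_sum => j _; apply: ler_sum => j' _.
  by rewrite (le_trans (phi_le _))// cov_le.
have e1 : \sum_(j < d i) \sum_(j' < d i) (cov (mu i) j j + cov (mu i) j' j') / 2 =
  \sum_(j < d i) \sum_(j' < d i) cov (mu i) j j / 2 + \sum_(j < d i) \sum_(j' < d i) cov (mu i) j' j' / 2.
  rewrite -big_split; apply: eq_bigr => j _; rewrite -big_split; apply: eq_bigr => j' _.
  by rewrite mulrDl.
have e2 : \sum_(j < d i) \sum_(j' < d i) cov (mu i) j' j' / 2 =
    (\sum_(j < d i) 1) * (\sum_j cov (mu i) j j) / 2.
  rewrite -mulrA mulr_suml; apply: eq_bigr => j _.
  by rewrite mul1r mulr_suml.
have e3 : \sum_(j < d i) \sum_(j' < d i) cov (mu i) j j / 2 =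
    (\sum_(j < d i) 1) * (\sum_j cov (mu i) j j) / 2.
  by rewrite exchange_big e2.
by rewrite e1 e2 e3; lra.
Qed.

Lemma Ex_bq_shift (mu : laws) (G : probability Om R) : (forall i, law2 (mu i)) ->
  (forall i, has_margin G (mu i)) ->
  Ex G (fun x => bq q (coord x) (coord x)) = Ex G (fun x => bq q0 (coord x) (coord x)) + kap * trC mu.
Proof.
move=> mu2 mG; have ii p p' := intg_coord2 p p' mu2 mG.
have [iq0 _] := Ex_bq q0 ii.
have isq p : intg G (fun x => coord x p ^+ 2) by apply: (eq_intg _ (ii p p)) => x; rewrite expr2.
rewrite (eq_Ex G (fun x => bq_shift (coord x))) ExD//; last first.
  by apply: intgZ; apply: intg_sum => p _.
rewrite ExZ; last by apply: intg_sum => p _.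
congr (_ + kap * _).
rewrite Ex_sum// /trC sum_tag; apply: eq_bigr => p _; rewrite -(Ex_coord2 p mu2 mG).
by apply: eq_Ex => x; rewrite expr2.
Qed.

Lemma margin_cos i (P : probability (T i) R) (G : probability Om R) th (b : R) : has_margin G P ->
  Ex G (fun o => cos (lin th (Defs.proj i o) + b)) = Ex P (fun x => cos (lin th x + b)).
Proof.
move=> mG; have mc : measurable_fun setT (fun x : T i => cos (lin th x + b)).
  apply: measurableT_comp; first exact: meas_cos.
  by apply: measurable_funD => //; have [] := quad_lin th.
by have [_ ->] := margin_real mG mc (@intg_bd _ _ _ P _ 1 mc (fun x => cos_max _)).
Qed.

Lemma margin_n2 i (P : probability (T i) R) (G : probability Om R) : law2 P -> has_margin G P ->
  intg G (fun o => n2 (Defs.proj i o)).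
Proof. by move=> P2 mG; have [] := margin_real mG (@meas_n2 R (d i)) P2. Qed.

(** Witnesses: the isotropic Gaussian test of variance [a], so large that its quadratic part costs
    at most [lam / 4 * trC mu], and the independent coupling, of value at least [kap * trC mu] since
    mixed blocks vanish and diagonal ones are nonnegative by [block_psd]. With [lam / 2] for the
    convex part, [lam / 4] of the trace is left. *)
Lemma coercive (i0 : 'I_n) : exists K s, 0 < s /\ forall mu, law0 mu ->
  free_le q c mu (K - s * trC mu - pen mu).
Proof.
pose C := \sum_i c i.
have C0 : 0 <= C by apply: sumr_ge0 => i _; exact: ltW.
pose a := 2 * (C + 1) / lam.
have a0 : 0 < a by rewrite divr_gt0// mulr_gt0// ltr_wpDl.
pose S i : 'M[R]_(d i) := rank1 0 a 0.
have w0 m : 0 < 1 + 0 * \sum_(j < m) (0 : 'rV[R]_m) 0 j ^+ 2 by rewrite mul0r addr0.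
have pS i : posdef (S i) by exact: rank1_posdef.
pose K := \sum_i c i * (ln ((2 * pi) ^+ (d i) * \det (S i)) / 2).
exists (K + 1), (lam / 4); split; first by rewrite divr_gt0.
move=> mu mu0; have mu2 i : law2 (mu i) by case: (mu0 i).
have [G [mG indG]] := indep_coupling mu.
have ii p p' := intg_coord2 p p' mu2 mG.
have mean (p : I) : Ex (mu (tag p)) (fun x => tnth x (tagged p)) = 0 by case: (mu0 (tag p)).
have off0 (p p' : I) : (tag p < tag p')%N -> Ex G (fun x => coord x p * coord x p') = 0.
  move=> lt; have qp := @quad_coord R _ (tagged p); have qp' := @quad_coord R _ (tagged p').
  have [_ h] := indG _ _ _ _ lt (proj1 qp) (proj1 qp') (quad_intg (mu2 _) qp) (quad_intg (mu2 _) qp').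
  by rewrite [LHS]h mean mul0r.
have off (p p' : I) : tag p != tag p' -> Ex G (fun x => coord x p * coord x p') = 0.
  rewrite neq_ltn => /orP[/off0//|/off0 h].
  by rewrite -[RHS]h; apply: eq_Ex => x; rewrite mulrC.
have EG : kap * trC mu <= Ex G (fun x => bq q (coord x) (coord x)).
  have [iq0 eq0] := Ex_bq q0 ii.
  rewrite (Ex_bq_shift mu2 mG).
  rewrite lerDr eq0.
  pose r (i : 'I_n) x (p : I) : R := if tag p == i then coord x p else 0.
  have -> : \sum_p \sum_p' q0 p p' * Ex G (fun x => coord x p * coord x p') =
      Ex G (fun x => \sum_i bq q0 (r i x) (r i x)).
    have ir i p p' : intg G (fun x => r i x p * q0 p p' * r i x p').
      rewrite /r; case: (tag p == i); case: (tag p' == i).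
      - by apply: (eq_intg _ (intgZ (q0 p p') (ii p p'))) => x; ring.
      - by apply: (eq_intg _ (intg0 G)) => x; rewrite mulr0.
      - by apply: (eq_intg _ (intg0 G)) => x; rewrite !mul0r.
      - by apply: (eq_intg _ (intg0 G)) => x; rewrite !mul0r.
    rewrite Ex_sum; last by move=> i _; apply: intg_sum => p _; apply: intg_sum => p' _.
    under [RHS]eq_bigr => i _.
      rewrite Ex_sum; last by move=> p _; apply: intg_sum => p' _.
      under eq_bigr do rewrite Ex_sum//.
      over.
    rewrite [RHS]exchange_big; apply: eq_bigr => p _.
    rewrite [RHS]exchange_big; apply: eq_bigr => p' _ /=.
    rewrite [RHS](bigD1 (tag p))//= [X in _ = _ + X]big1 ?addr0; last first.
      move=> i ip; rewrite -[RHS](Ex0 G); apply: eq_Ex => x.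
      by rewrite /r eq_sym (negbTE ip) !mul0r.
    have [e|e] := eqVneq (tag p) (tag p').
      rewrite -ExZ//; apply: eq_Ex => x; rewrite /r eqxx e eqxx; ring.
    rewrite off// mulr0 -[LHS](Ex0 G); apply: eq_Ex => x.
    by rewrite /r eqxx eq_sym (negbTE e) mulr0.
  apply: Ex_ge0 => x; apply: sumr_ge0 => i _.
  by apply: (@block_psd i) => p /negbTE h; rewrite /r h.
have cv i (th : 'I_(d i) -> R) (b : R) : Ex (mu i) (fun x => cos (lin th x + b)) @[_ --> globally [set tt]] -->
    Ex G (fun o => cos (lin th (Defs.proj i o) + b)).
  by rewrite (margin_cos _ _ (mG i)); exact: cvg_cst.
have X2 i := margin_n2 (mu2 i) (mG i).
have nB i : Ex (mu i) (@n2 R (d i)) <= trC mu.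
  rewrite Ex_n2//; apply: (@le_sum1 _ _ (fun i => \sum_j cov (mu i) j j)) => i'.
  by apply: sumr_ge0 => j _; exact: cov_diag_ge0.
(* [transfer] along a constant family turns the independent coupling into a decomposition, at the
   cost 1 that appears in [K + 1]. *)
have := @transfer R n d unit (globally [set tt]) _ _ Om q (fun=> mu) G (fun i => Defs.proj i) i0 (trC mu)
  (fun i => @meas_proj R n d i) X2 (fun _ => mu2) (fun _ => nB) cv 1 ltr01.
move=> /(_ _ tt erefl)[Dc [dD hV]].
exists (fun i => gauss_density (S i)), Dc; split => //; first by move=> i; exact: gauss_test.
have ent : - (\sum_i c i * Ex (mu i) (fun x => ln (gauss_density (S i) x))) = K + \sum_i c i * (a^-1 * (\sum_j cov (mu i) j j) / 2).
  rewrite /K -big_split -sumrN; apply: eq_bigr => i _ /=.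
  rewrite -mulrN Ex_ln_gauss// -mulrDr; congr (_ * (_ + _ / 2)).
  rewrite /S rank1_inv; [|by rewrite gt_eqF|by rewrite gt_eqF].
  rewrite [RHS]mulr_sumr; apply: eq_bigr => j _.
  rewrite [LHS](bigD1 j)//= [X in _ + X = _]big1 ?addr0; first by rewrite rank1_entry eqxx oppr0 !mul0r addr0 mulr1.
  by move=> j' jj; rewrite rank1_entry eq_sym (negbTE jj) oppr0 !mul0r addr0 mulr0 mul0r.
have small : \sum_i c i * (a^-1 * (\sum_j cov (mu i) j j) / 2) <= lam / 4 * trC mu.
  rewrite /trC mulr_sumr; apply: ler_sum => i _.
  rewrite mulrA mulrA mulrAC ler_wpM2r//; first by apply: sumr_ge0 => j _; exact: cov_diag_ge0.
  have ci : c i <= C + 1.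
    have : c i <= C by apply: (@le_sum1 _ _ c) => i'; exact: ltW.
    by lra.
  have -> : lam / 4 = (C + 1) / a / 2.
    by rewrite /a; field; rewrite !gt_eqF// ltr_wpDl.
  by rewrite ler_wpM2r// ler_wpM2r// invr_ge0 ltW.
rewrite ent /pen.
have /andP[_ ph] := pen_phi_le mu2.
move: hV; rewrite -/(trC mu) => hV.
have hV2 := le_trans (lerB EG (lexx 1)) hV.
move: small ph hV2; move: (trC mu) (de * _) (Val _ _ _ _ _) (\sum_i c i * _) => x y z u.
by rewrite mulrBl; lra.
Qed.

End gaussian_bound.

(** * Limits of near-maximizers *)

(** A compact interval contains the whole sequence, so the image ultrafilter converges. One
    ultrafilter serves all entries of all covariances at once. *)
Lemma ultra_cvg (R : realType) (U : set_system nat) (f : nat -> R) (B : R) :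
  UltraFilter U -> (forall j, `|f j| <= B) -> exists l : R, f j @[j --> U] --> l.
Proof.
move=> UU fB; pose F : set_system R := f @ U.
have FF : ProperFilter F by exact: fmap_proper_filter.
have FU : UltraFilter F.
  split=> // G GG FG; rewrite predeqE => A; split; last exact: FG.
  move=> GA; have [//|nA] := in_ultra_setVsetC (f @^-1` A) UU.
  have : G (~` A) by apply: FG; exact: nA.
  by move=> GnA; have [x [xA xnA]] := filter_ex (filterI GA GnA); case: (xnA xA).
have FI : F `[- B, B]%classic.
  change (U (f @^-1` `[- B, B]%classic)); apply: filterE => j.
  by rewrite /= in_itv /= -ler_norml.
have := @segment_compact R (- B) B; rewrite compact_ultra => /(_ F FU FI)[l [_ hl]].
by exists l.
Qed.

Section even_cos.
Context (R : realType) (m : nat) (P : probability (m.-tuple R) R).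
Hypotheses (P2 : law2 P) (Pe : evenl P).

Lemma even_cos_shift (th : 'I_m -> R) (al : R) :
  Ex P (fun x => cos (lin th x + al)) = cos al * Ex P (fun x => cos (lin th x)).
Proof.
have ml : measurable_fun setT (lin th) by have [] := quad_lin th.
have mc : measurable_fun setT (fun x => cos (lin th x)) by apply: measurableT_comp => //; exact: meas_cos.
have ms : measurable_fun setT (fun x => sin (lin th x)) by apply: measurableT_comp => //; exact: meas_sin.
have ic : intg P (fun x => cos (lin th x)) by apply: (@intg_bd _ _ _ P _ 1 mc) => x; exact: cos_max.
have isn : intg P (fun x => sin (lin th x)) by apply: (@intg_bd _ _ _ P _ 1 ms) => x; exact: sin_max.
have s0 : Ex P (fun x => sin (lin th x)) = 0.
  have qs : quad (fun x => sin (lin th x)).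
    split=> //; exists 1 => x; rewrite mul1r (le_trans (sin_max _))// lerDl.
    by apply: sumr_ge0 => j _; exact: sqr_ge0.
  have h := Pe qs.
  have h2 : Ex P (fun x => sin (lin th (negt x))) = - Ex P (fun x => sin (lin th x)).
    rewrite -ExN//; apply: eq_Ex => x; rewrite -sinN; congr sin.
    by rewrite /lin -sumrN; apply: eq_bigr => j _; rewrite /negt tnth_mktuple mulrN.
  by move: h; rewrite h2; lra.
rewrite (eq_Ex P (g := fun x => cos al * cos (lin th x) - sin al * sin (lin th x))); last first.
  by move=> x; rewrite cosD; ring.
by rewrite ExB ?ExZ//; [rewrite s0 mulr0 subr0|exact: intgZ|exact: intgZ].
Qed.

End even_cos.

Section near_maximizers.
Context (R : realType) (n : nat) (d : 'I_n -> nat).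
Notation T i := ((d i).-tuple R).
Notation I := {i : 'I_n & 'I_(d i)}.
Notation laws := (forall i, probability (T i) R).
Variables (i0 : 'I_n) (c : 'I_n -> R) (q : I -> I -> R) (al de M B : R).
Hypotheses (c0 : forall i, 0 < c i) (de0 : 0 < de).
Variables (U : set_system nat) (mu : nat -> laws) (Sg : forall i, 'M[R]_(d i)).
Hypothesis UF : ProperFilter U.
Hypotheses (Uoo : \oo%classic `<=` U) (mue : forall k, lawe (mu k)) (muB : forall k, trC (mu k) <= B).
Hypothesis cvS : forall i j j', cov (mu k i) j j' @[k --> U] --> Sg i j j'.

Let mu2 k i : law2 (mu k i). Proof. by have [] := mue k i. Qed.

Lemma cov_le_trC k i j j' : `|cov (mu k i) j j'| <= B.
Proof.
have h a : cov (mu k i) a a <= B.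
  apply: le_trans (muB k).
  apply: (@le_trans _ _ (\sum_j cov (mu k i) j j)).
    by apply: (@le_sum1 _ _ (fun j => cov (mu k i) j j)) => j1; exact: cov_diag_ge0.
  apply: (@le_sum1 _ _ (fun i => \sum_j cov (mu k i) j j)) => i1.
  by apply: sumr_ge0 => j1 _; exact: cov_diag_ge0.
by have := cov_le j j' (mu2 k i); have := h j; have := h j'; lra.
Qed.

Lemma cov_form_cvg i (a : 'I_(d i) -> 'I_(d i) -> R) :
  \sum_j \sum_j' a j j' * cov (mu k i) j j' @[k --> U] --> \sum_j \sum_j' a j j' * Sg i j j'.
Proof.
apply: cvg_fsum => j; apply: cvg_fsum => j'.
by apply: cvgMr; exact: cvS.
Qed.

Lemma Uge (e : R) : 0 < e -> \forall k \near U, k.+1%:R^-1 <= e.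
Proof.
move=> e0; apply: Uoo.
have h := near_infty_natSinv_lt (PosNum e0).
by apply: filterS h => k /ltW.
Qed.

Hypotheses (bM : bounded_by q c al de (@lawe R n d) M)
  (nearM : forall k, ~ free_le q c (mu k) (M - k.+1%:R^-1 - pen al de (mu k))).

(** The square of [lin th] is expanded and [near_max_gap] applied to each pair of coordinates. Its
    bound has a part [s (1 + B)], made small by the choice of [s], and a part [X] times [k.+1^-1],
    with [X] depending on [s], which becomes small along [U]. *)
Lemma gap_small i (th : 'I_(d i) -> R) e : 0 < e -> \forall k \near U,
  forall chi : T i -> R, measurable_fun setT chi -> (forall x, 0 <= chi x <= 1) ->
  `|Ex (mu k i \x mu k i)%E (fun p => (lin th (vv p) ^+ 2 -
      \sum_j \sum_j' (th j * th j') * cov (mu k i) j j') * chi (uu p))| <= e.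
Proof.
move=> e0.
pose Th := \sum_j \sum_j' `|th j * th j'|.
have Th0 : 0 <= Th by rewrite sumr_ge0// => j _; rewrite sumr_ge0.
have B0 : 0 <= B by apply: le_trans (muB 0); exact: trC_ge0.
pose s := e / (2 * (Th + 1) * (B + 1)).
have s0 : 0 < s by rewrite divr_gt0// !mulr_gt0// ltr_wpDl.
pose X := (1 + B ^+ 2) / (2 * s) * (6 / de).
have X0 : 0 <= X by rewrite mulr_ge0// divr_ge0 ?addr_ge0 ?sqr_ge0// ?ltW// mulr_gt0.
pose et := e / (2 * (Th + 1) * (X + 1)).
have et0 : 0 < et by rewrite divr_gt0// !mulr_gt0// ltr_wpDl.
apply: filterS (Uge et0) => k hk chi mchi chi01.
(* [near_max_gap] takes one function per factor; those of the other factors are set to 0. *)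
pose Chi : forall i, T i -> R := dfwith (fun i (_ : T i) => 0) i chi.
have mC i' : measurable_fun setT (Chi i').
  by rewrite /Chi; case: dfwithP => // j _; exact: measurable_cst.
have C01 i' x : 0 <= Chi i' x <= 1.
  by move: x; rewrite /Chi; case: dfwithP => [x|j _ x]; rewrite ?lexx ?ler01.
have g0 : 0 < (k.+1%:R^-1 : R) by rewrite invr_gt0.
have one j j' : `|Ex (mu k i \x mu k i)%E (fun p => (tnth (vv p) j * tnth (vv p) j' - cov (mu k i) j j') * chi (uu p))| <=
    X * et + s * (1 + B).
  have := near_max_gap i0 c0 de0 bM (mue k) g0 (@nearM k) j j' s0 mC C01.
  rewrite /Chi dfwithin => h; apply: (le_trans h); apply: lerD; last first.
    rewrite ler_wpM2l ?(ltW s0)// lerD2l Ex_n2//.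
    apply: le_trans (muB k).
    apply: (@le_sum1 _ _ (fun i => \sum_j cov (mu k i) j j)) => i1.
    by apply: sumr_ge0 => j1 _; exact: cov_diag_ge0.
  have -> : X * et = (1 + B ^+ 2) / (2 * s) * (6 * et / de) by rewrite /X; ring.
  rewrite ler_pM//.
  - by rewrite divr_ge0 ?addr_ge0 ?sqr_ge0// ltW// mulr_gt0.
  - by rewrite divr_ge0 ?(ltW de0)// mulr_ge0// ltW.
  - rewrite ler_wpM2r ?invr_ge0 ?(ltW (mulr_gt0 _ s0))// lerD2l.
    by rewrite -[leLHS]real_normK ?num_real// lerXn2r ?nnegrE// cov_le_trC.
  - by rewrite ler_wpM2r ?invr_ge0 ?(ltW de0)// ler_wpM2l.
have ii j j' : intg (mu k i \x mu k i)%E (fun p => (tnth (vv p) j * tnth (vv p) j' - cov (mu k i) j j') * chi (uu p)).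
  have q1 : quad (fun x : T i => tnth x j * tnth x j' - cov (mu k i) j j').
    by apply: quadD; [exact: quad_coord2|exact: (@quad_bd R (d i) _ `|- cov (mu k i) j j'|)].
  have [mf [A fA]] := bd_uu_vv mchi chi01 q1.
  by apply: (eq_intg (f := fun p => chi (uu p) * (tnth (vv p) j * tnth (vv p) j' - cov (mu k i) j j'))) => [p|];
    [rewrite mulrC|have [] := quad2_intg (mu2 k i) mf fA].
rewrite (eq_Ex _ (g := fun p => \sum_j \sum_j' (th j * th j') * ((tnth (vv p) j * tnth (vv p) j' - cov (mu k i) j j') * chi (uu p)))); last first.
  move=> p; rewrite /lin expr2 mulr_suml -sumrB mulr_suml; apply: eq_bigr => j _.
  rewrite mulr_sumr -sumrB mulr_suml; apply: eq_bigr => j' _; ring.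
rewrite Ex_sum; last by move=> j _; apply: intg_sum => j' _; exact: intgZ.
apply: (le_trans (ler_norm_sum _ _ _)).
apply: (@le_trans _ _ (Th * (X * et + s * (1 + B)))).
  rewrite mulr_suml; apply: ler_sum => j _.
  rewrite Ex_sum; last by move=> j' _; exact: intgZ.
  apply: (le_trans (ler_norm_sum _ _ _)).
  rewrite mulr_suml; apply: ler_sum => j' _.
  by rewrite ExZ// normrM ler_wpM2l.
have h1 : Th * (X * et) <= e / 2.
  have -> : Th * (X * et) = (e / 2) * ((Th / (Th + 1)) * (X / (X + 1))).
    by rewrite /et; field; rewrite !gt_eqF// ltr_wpDl.
  rewrite -[leRHS]mulr1 ler_wpM2l ?divr_ge0 ?(ltW e0)// mulr_ile1 ?divr_ge0 ?ler_pdivrMr ?addr_ge0 ?ltr_wpDl//.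
  by rewrite mul1r lerDl. by rewrite mul1r lerDl.
have h2 : Th * (s * (1 + B)) <= e / 2.
  have -> : Th * (s * (1 + B)) = (e / 2) * (Th / (Th + 1)).
    by rewrite /s; field; rewrite !gt_eqF// ltr_wpDl.
  rewrite -[leRHS]mulr1 ler_wpM2l ?divr_ge0 ?(ltW e0)// ler_pdivrMr ?ltr_wpDl//.
  by rewrite mul1r lerDl.
by rewrite mulrDr; lra.
Qed.

Lemma near_max_chf i (th : 'I_(d i) -> R) :
  Ex (mu k i) (fun x => cos (lin th x)) @[k --> U] --> expR (- (qf (Sg i) (\row_j th j) / 2)).
Proof.
pose s2 k := \sum_j \sum_j' (th j * th j') * cov (mu k i) j j'.
have s20 k : 0 <= s2 k by rewrite /s2 -Ex_lin2//; apply: Ex_ge0 => x; exact: sqr_ge0.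
pose C := \sum_j \sum_j' `|th j * th j'| * B.
have sC k : s2 k <= C.
  apply: ler_sum => j _; apply: ler_sum => j' _.
  by rewrite (le_trans (ler_norm _))// normrM ler_wpM2l// cov_le_trC.
have c1 : expR (- (s2 k / 2)) @[k --> U] --> expR (- (qf (Sg i) (\row_j th j) / 2)).
  apply: continuous_cvg; first exact: continuous_expR.
  apply: cvgN; apply: cvgMl.
  have -> : qf (Sg i) (\row_j th j) = \sum_j \sum_j' (th j * th j') * Sg i j j'.
    by rewrite qfE; apply: eq_bigr => j _; apply: eq_bigr => j' _; rewrite !mxE; ring.
  exact: cov_form_cvg.
have c2 : (Ex (mu k i) (fun x => cos (lin th x)) - expR (- (s2 k / 2))) @[k --> U] --> (0 : R).
  apply/cvgrPdist_le => e e0.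
  (* [24 = 8 * 3] comes from the conclusion of [chf_estimate], [48 = 4 * 3 * 4] from its smallness
     hypothesis; [C] bounds all the variances [s2 k], which makes both uniform in [k]. *)
  pose e1 := Num.min (e / (24 * expR C)) (1 / (48 * expR C)).
  have E0 := expR_gt0 C.
  have e10 : 0 < e1 by rewrite lt_min !divr_gt0// mulr_gt0.
  have a1 : e1 * (24 * expR C) <= e by rewrite -ler_pdivlMr ?mulr_gt0// ge_min lexx.
  have a2 : e1 * (48 * expR C) <= 1 by rewrite -ler_pdivlMr ?mulr_gt0// ge_min lexx orbT.
  apply: filterS (gap_small th e10) => k hk.
  have EC : expR (s2 k) <= expR C by rewrite ler_expR.
  have a3 : e1 * expR (s2 k) <= e1 * expR C by rewrite ler_wpM2l// ltW.
  have a4 : 4 * (3 * e1) * expR (s2 k) <= 1 / 4.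
    have -> : 4 * (3 * e1) * expR (s2 k) = 12 * (e1 * expR (s2 k)) by ring.
    by lra.
  have := chf_estimate (mu2 k i) (proj2 (mue k i)) (s20 k) hk a4.
  have -> : 8 * (3 * e1) * expR (s2 k) = 24 * (e1 * expR (s2 k)) by ring.
  by rewrite sub0r normrN => h; apply: (le_trans h); lra.
have FU : Filter U by exact: UF.
have /(_ FU) := cvgD c2 c1; rewrite add0r.
have e (f g : nat -> R) : ((fun k => f k - g k) + g)%R = f by apply/funext => k; exact: subrK.
by rewrite e.
Qed.

(* Along a null direction the tests [rank1 v 1 w] with [1 + w |v|^2 -> 0] make the
   entropy bound tend to [-oo]. *)
Lemma limit_posdef L : (forall k, ~ free_le q c (mu k) L) -> forall i, posdef (Sg i).
Proof.
move=> nL i1; split.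
  apply/matrixP => j j'; rewrite mxE.
  have h := @cvS i1 j' j; rewrite (_ : (fun k => _) = fun k => cov (mu k i1) j j') in h; last first.
    by apply/funext => k; rewrite cov_sym.
  exact: (cvg_unique _ h (@cvS i1 j j')).
move=> v v0; rewrite ltNge; apply/negP => neg.
pose vf : forall i, 'rV[R]_(d i) := dfwith (fun i => 0 : 'rV[R]_(d i)) i1 v.
have hq i : qf (Sg i) (vf i) <= 0.
  by rewrite /vf; case: dfwithP => [//|j _]; rewrite /qf !mul0mx mxE.
pose nv i := \sum_j (vf i) 0 j ^+ 2.
have nv0 i : 0 <= nv i by apply: sumr_ge0 => j _; exact: sqr_ge0.
have nvi1 : nv i1 != 0.
  apply: contra_neq v0 => h; apply/rowP => j; rewrite mxE; apply/eqP.
  have := h; rewrite /nv /vf dfwithin => h1; rewrite -sqrf_eq0.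
  by rewrite (psumr_eq0P _ h1)// => j' _; exact: sqr_ge0.
pose C := \sum_i c i * (ln ((2 * pi) ^+ (d i)) / 2 + (B + 1) / 2).
(* Chosen so that [c i1 * t / 2 = |C| + |L|], which brings the bound [C] down to [L]. *)
pose t := 2 * (`|C| + `|L|) / c i1.
have t0 : 0 <= t by rewrite divr_ge0 ?(ltW (c0 _))// mulr_ge0// addr_ge0.
pose ep := expR (- t); have ep0 : 0 < ep by exact: expR_gt0.
have ep1 : ep <= 1 by rewrite -expR0 ler_expR oppr_le0.
(* At [i1] this makes the determinant of [S i] equal to [ep]; on the other factors [nv i = 0], the
   quotient is 0 and [S i] is the identity. *)
pose w i := - (1 - ep) / nv i.
have wE i : 1 + w i * nv i = if nv i == 0 then 1 else ep.
  rewrite /w; case: eqP => [->|/eqP n0]; first by rewrite mulr0 addr0.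
  by rewrite divfK// opprB addrCA subrr addr0.
have w0 i : 0 < 1 + w i * nv i by rewrite wE; case: ifP.
have w1 i : 1 + w i * nv i <= 1 by rewrite wE; case: ifP.
have wn i : 0 <= - w i / (1 + w i * nv i).
  by rewrite divr_ge0 ?(ltW (w0 i))// /w mulNr opprK divr_ge0// subr_ge0.
pose S i := rank1 (vf i) 1 (w i).
have pS i : posdef (S i) by exact: rank1_posdef.
have /near_fin hn : forall i, \forall k \near U,
    - w i / (1 + w i * nv i) * (\sum_j \sum_j' ((vf i) 0 j * (vf i) 0 j') * cov (mu k i) j j') <= 1.
  move=> i; have h : - w i / (1 + w i * nv i) * (\sum_j \sum_j' ((vf i) 0 j * (vf i) 0 j') * cov (mu k i) j j') @[k --> U] -->
      - w i / (1 + w i * nv i) * qf (Sg i) (vf i).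
    have -> : qf (Sg i) (vf i) = \sum_j \sum_j' ((vf i) 0 j * (vf i) 0 j') * Sg i j j'.
      by rewrite qfE; apply: eq_bigr => j _; apply: eq_bigr => j' _; ring.
    by apply: cvgMr; exact: cov_form_cvg.
  have h1 : - w i / (1 + w i * nv i) * qf (Sg i) (vf i) < 1.
    by apply: (@le_lt_trans _ _ 0) => //; rewrite mulr_ge0_le0.
  exact: cvgr_le h _ h1.
have [k hk] := filter_ex hn; apply: (nL k).
exists (fun i => gauss_density (S i)), (@Deco R n d unit (fun _ _ _ => 1) (fun=> 1) (fun _ _ => 0)).
split; [by move=> i; exact: gauss_test|exact: dec_trivial|].
have -> : Val q (mu k) (fun (_ : unit) i (_ : T i) => 1) (fun=> 1) (fun _ _ => 0) = 0.
  rewrite /Val big1// => u _; rewrite mul1r /bq big1 ?big1 ?mulr0 ?subrr// => p _.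
    by apply: big1 => p' _; rewrite mulr0.
  by apply: big1 => p' _; rewrite mulr0.
rewrite subr0 -sumrN.
apply: (@le_trans _ _ (C - c i1 * t / 2)).
  have -> : c i1 * t / 2 = \sum_i c i * (if i == i1 then t / 2 else 0).
    rewrite (bigD1 i1)//= eqxx big1 ?addr0 ?mulrA// => i /negbTE ->.
    by rewrite mulr0.
  rewrite /C -sumrB; apply: ler_sum => i _; rewrite -mulrN -mulrBr ler_wpM2l ?(ltW (c0 i))//.
  rewrite Ex_ln_gauss// rank1_det expr1n mul1r lnM ?posrE//; last first.
    by rewrite exprn_gt0// mulr_gt0// pi_gt0.
  have ld : ln (1 + w i * nv i) <= - (if i == i1 then t else 0).
    case: eqP => [->|_]; last by rewrite oppr0 ln_le0.
    by rewrite wE (negbTE nvi1) expRK.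
  have cb : \sum_j \sum_j' invmx (S i) j j' * cov (mu k i) j j' <= B + 1.
    rewrite /S rank1_inv ?oner_eq0 ?gt_eqF// invr1 -/(nv i).
    move: (hk i); set w' := - w i / (1 + w i * nv i) => hki.
    have -> : \sum_j \sum_j' rank1 (vf i) 1 w' j j' * cov (mu k i) j j' =
      \sum_j cov (mu k i) j j + w' * (\sum_j \sum_j' ((vf i) 0 j * (vf i) 0 j') * cov (mu k i) j j').
      rewrite mulr_sumr -big_split; apply: eq_bigr => j _ /=.
      rewrite mulr_sumr -[X in _ = X + _]mul1r.
      have -> : 1 * cov (mu k i) j j = \sum_j' (j == j')%:R * cov (mu k i) j j'.
        rewrite (bigD1 j)//= eqxx big1 ?addr0// => j' jj.
        by rewrite eq_sym (negbTE jj) mul0r.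
      by rewrite -big_split; apply: eq_bigr => j' _ /=; rewrite rank1_entry; ring.
    apply: lerD; last exact: hki.
    apply: le_trans (muB k).
    apply: (@le_sum1 _ _ (fun i => \sum_j cov (mu k i) j j)) => i'.
    by apply: sumr_ge0 => j _; exact: cov_diag_ge0.
  by move: ld cb; case: ifP => _; lra.
have -> : c i1 * t / 2 = `|C| + `|L|.
  by rewrite /t; field; rewrite gt_eqF.
by have := ler_norm C; have := ler_norm (- L); rewrite normrN; lra.
Qed.

End near_maximizers.

(** * The penalized functional against the Gaussian constant *)

Section even_bound.
Context (R : realType) (n : nat) (d : 'I_n -> nat).
Notation T i := ((d i).-tuple R).
Notation I := {i : 'I_n & 'I_(d i)}.
Notation laws := (forall i, probability (T i) R).
Notation Om := ((\sum_(k < n) d k).-tuple R).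
Variables (i0 : 'I_n) (c : 'I_n -> R) (q0 : I -> I -> R) (D kap lam de : R).
Hypotheses (c0 : forall i, 0 < c i) (HG : gaussian_bound c q0 D).
Hypotheses (lam0 : 0 < lam) (de0 : 0 < de) (deN : de * \sum_(p : I) 1 <= lam / 2).

Notation q := (shift_form q0 kap).
Notation pen := (@pen R n d (kap - lam) de).

Lemma pen_le_trC (mu : laws) : (forall i, law2 (mu i)) -> pen mu <= kap * trC mu.
Proof.
move=> mu2; have /andP[_ h] := pen_phi_le de0 deN mu2.
rewrite /pen -/(trC mu); have := mulr_ge0 (ltW lam0) (trC_ge0 mu).
by move: h; move: (de * _) (trC mu) => x y; rewrite mulrBl; lra.
Qed.

(* The maximizers of the penalized functional are approached by the Gaussians with the
   limiting covariances, for which the bound [D] holds. *)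
Lemma near_maximizers_bound (U : set_system nat) (mu : nat -> laws) (Sg : forall i, 'M[R]_(d i)) M B :
  ProperFilter U -> \oo%classic `<=` U -> (forall k, lawe (mu k)) -> (forall k, trC (mu k) <= B) ->
  (forall i j j', cov (mu k i) j j' @[k --> U] --> Sg i j j') ->
  bounded_by q c (kap - lam) de (@lawe R n d) M ->
  (forall k, ~ free_le q c (mu k) (M - k.+1%:R^-1 - pen (mu k))) -> M <= D.
Proof.
move=> UF Uoo mue muB cvS bM nearM; rewrite leNgt; apply/negP => DM.
have mu2 k i : law2 (mu k i) by have [] := mue k i.
have B0 : 0 <= B by apply: le_trans (muB 0); exact: trC_ge0.
have pS : forall i, posdef (Sg i).
  (* This level lies below [M - k.+1^-1 - pen (mu k)] for every [k], since [pen] is at most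
     [|kap| * B]. *)
  apply: (@limit_posdef R n d c q B c0 U mu Sg UF mue muB cvS (M - 1 - `|kap| * B)) => k.
  move/(free_le_trans _); apply: contra_not (nearM k); apply.
  have := pen_le_trC (mu2 k); have : kap * trC (mu k) <= `|kap| * B.
    by rewrite (le_trans (ler_norm _))// normrM ler_wpM2l// ger0_norm// trC_ge0.
  have : (k.+1%:R^-1 : R) <= 1 by rewrite invf_le1// ler1n.
  by move: (pen _) (kap * _) (`|kap| * _) (k.+1%:R^-1) => *; lra.
have [ga [hga hG]] := HG pS.
have ga2 i : law2 (ga i) by case: (hga i).
(* Five losses of at most [e] follow: the Gaussian coupling, [transfer], the limits [Hcv] and [Tcv],
   and [k.+1^-1]. *)
pose e := (M - D) / 8; have e0 : 0 < e by rewrite divr_gt0// subr_gt0.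
have [G [mG {}hG]] := hG e e0.
have X2 i := margin_n2 (ga2 i) (mG i).
have nB k i : Ex (mu k i) (@n2 R (d i)) <= B.
  rewrite Ex_n2//; apply: le_trans (muB k).
  apply: (@le_sum1 _ _ (fun i => \sum_j cov (mu k i) j j)) => i'.
  by apply: sumr_ge0 => j _; exact: cov_diag_ge0.
have cv i (th : 'I_(d i) -> R) (b : R) : Ex (mu k i) (fun x => cos (lin th x + b)) @[k --> U] -->
    Ex G (fun o => cos (lin th (Defs.proj i o) + b)).
  rewrite (margin_cos _ _ (mG i)); have [_ Ge chf _] := hga i.
  rewrite even_cos_shift// chf.
  rewrite (_ : (fun k => _) = fun k => cos b * Ex (mu k i) (fun x => cos (lin th x))); last first.
    by apply/funext => k; rewrite even_cos_shift//; have [] := mue k i.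
  apply: cvgMr.
  exact: (@near_max_chf R n d i0 c q (kap - lam) de M B c0 de0 U mu Sg UF Uoo mue muB cvS bM nearM).
have FU : Filter U by exact: UF.
have tr := @transfer R n d nat U FU _ Om q mu G (fun i => Defs.proj i) i0 B
  (fun i => @meas_proj R n d i) X2 mu2 nB cv e e0.
pose H k := - (\sum_i c i * Ex (mu k i) (fun x => ln (gauss_density (Sg i) x))).
have lnE (P : laws) : (forall i, law2 (P i)) -> - (\sum_i c i * Ex (P i) (fun x => ln (gauss_density (Sg i) x))) =
    \sum_i c i * (ln ((2 * pi) ^+ (d i) * \det (Sg i)) / 2 +
      (\sum_j \sum_j' invmx (Sg i) j j' * cov (P i) j j') / 2).
  by move=> P2; rewrite -sumrN; apply: eq_bigr => i _; rewrite -mulrN Ex_ln_gauss.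
have Hcv : H k @[k --> U] --> - (\sum_i c i * Ex (ga i) (fun x => ln (gauss_density (Sg i) x))).
  rewrite lnE// (_ : H = fun k => \sum_i c i * (ln ((2 * pi) ^+ (d i) * \det (Sg i)) / 2 +
      (\sum_j \sum_j' invmx (Sg i) j j' * cov (mu k i) j j') / 2)); last first.
    by apply/funext => k; exact: lnE.
  apply: cvg_fsum => i; apply: cvgMr; apply: cvgD; first exact: cvg_cst.
  apply: cvgMl.
  rewrite (_ : \sum_j _ = \sum_j \sum_j' invmx (Sg i) j j' * Sg i j j'); first exact: cov_form_cvg.
  apply: eq_bigr => j _; apply: eq_bigr => j' _; by have [_ _ _ ->] := hga i.
have Tcv : kap * trC (mu k) @[k --> U] --> kap * trC ga.
  apply: cvgMr; apply: cvg_fsum => i; apply: cvg_fsum => j.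
  by have [_ _ _ ->] := hga i; exact: cvS.
have n1 := cvgr_le _ Hcv _ (ltr_pwDr e0 (lexx _)).
have n2' := cvgr_le _ Tcv _ (ltr_pwDr e0 (lexx _)).
have n3 := Uge Uoo e0.
have [k [[[h1 h2] h3] [Dc [dD hV]]]] := filter_ex (filterI (filterI (filterI (n1 FU) (n2' FU)) n3) tr).
apply: (nearM k); exists (fun i => gauss_density (Sg i)), Dc; split => //.
  by move=> i; exact: gauss_test.
have := pen_le_trC (mu2 k).
have hV2 : Ex G (fun o => bq q (coord o) (coord o)) - e <= Val q (mu k) (@dF _ _ _ Dc) (@da _ _ _ Dc) (@dxi _ _ _ Dc) by [].
rewrite (Ex_bq_shift q0 kap ga2 mG) in hV2.
have e8 : 8 * e = M - D by rewrite /e; field.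
move: h1 h2 h3 hV2 hG e8; rewrite /H.
move: (Ex G _) (Val _ _ _ _ _) (kap * trC ga) (kap * trC (mu k)) (k.+1%:R^-1) (pen _).
move: (\sum_i c i * Ex (mu k i) (fun x => ln (gauss_density (Sg i) x))).
move: (\sum_i c i * Ex (ga i) (fun x => ln (gauss_density (Sg i) x))).
by move=> *; lra.
Qed.

(** If [D] fails for centered laws, it fails for even ones by [bounded_by_all]. The infimum [M] of
    the bounds on even laws is then above [D], and [coercive] keeps the traces of its
    near-maximizers bounded, which [near_maximizers_bound] excludes. *)
Lemma free_bound : bounded_by q c (kap - lam) de (@law0 R n d) D.
Proof.
have [K [s [s0 coer]]] := coercive c0 HG kap lam0 de0 deN i0.
have mono (S : laws -> Prop) t t' : t <= t' -> bounded_by q c (kap - lam) de S t ->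
    bounded_by q c (kap - lam) de S t'.
  by move=> tt h mu Smu e e0; apply: free_le_trans (h mu Smu e e0); rewrite lerD2r lerD2r.
have bK : bounded_by q c (kap - lam) de (@law0 R n d) K.
  move=> mu mu0 e e0; apply: free_le_trans (coer mu mu0).
  by have := mulr_ge0 (ltW s0) (trC_ge0 mu); lra.
apply: contrapT => nD.
have nDe : ~ bounded_by q c (kap - lam) de (@lawe R n d) D.
  by move=> h; apply: nD; exact: (bounded_by_all i0 c0 de0 h bK).
pose A := [set t | bounded_by q c (kap - lam) de (@lawe R n d) t]%classic.
have lbA t : A t -> D <= t.
  by move=> At; rewrite leNgt; apply/negP => tD; apply: nDe; exact: mono (ltW tD) At.
have hA : has_inf A.
  by split; [exists K => mu /lawe0; exact: bK|exists D => t /lbA].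
pose M := inf A.
have bM : bounded_by q c (kap - lam) de (@lawe R n d) M.
  move=> mu hmu e e0; have e20 : 0 < e / 2 by rewrite divr_gt0.
  have [t At tM] := inf_adherent e20 hA.
  by apply: free_le_trans (At mu hmu _ e20); move: tM; rewrite -/M; lra.
have DM : D < M.
  by rewrite lt_neqAle; apply/andP; split; [apply/eqP => e; apply: nDe; rewrite e|exact: lbA].
have /choice[mu hmu] : forall k : nat, exists mu : laws, lawe mu /\ ~ free_le q c mu (M - k.+1%:R^-1 - pen mu).
  move=> k; apply: contrapT => h.
  have : A (M - k.+1%:R^-1).
    move=> mu hmu e e0; apply: contrapT => h2; apply: h; exists mu; split=> // h3; apply: h2.
      by apply: free_le_trans h3; rewrite lerDl ltW.
  move/(ge_inf (proj2 hA)); rewrite -/M.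
  have : 0 < (k.+1%:R^-1 : R) by rewrite invr_gt0.
  by move: (k.+1%:R^-1) => *; lra.
have mue k : lawe (mu k) by case: (hmu k).
have nearM k := proj2 (hmu k).
(* A larger trace would put [K - s * trC (mu k)] below [M - 1], against near-maximality. *)
pose B := (K - M + 1) / s.
have muB k : trC (mu k) <= B.
  rewrite ler_pdivlMr//; rewrite leNgt; apply/negP => h; apply: (nearM k).
  apply: free_le_trans (coer _ (lawe0 (mue k))).
  have : (k.+1%:R^-1 : R) <= 1 by rewrite invf_le1// ler1n.
  by move: h; rewrite [_ * s]mulrC; move: (pen _) (s * _) (k.+1%:R^-1) => *; lra.
have [U [UU Uoo]] := ultraFilterLemma (F := \oo%classic) _.
have UF : ProperFilter U by exact: ultra_proper.
have hS i j j' := ultra_cvg UU (fun k => @cov_le_trC R n d B mu mue muB k i j j').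
pose Sg i : 'M[R]_(d i) := \matrix_(j, j') projT1 (cid (hS i j j')).
have cvS i j j' : cov (mu k i) j j' @[k --> U] --> Sg i j j'.
  by rewrite mxE; exact: projT2 (cid (hS i j j')).
by have := near_maximizers_bound UF Uoo mue muB cvS bM nearM; rewrite leNgt DM.
Qed.

End even_bound.

(** * From laws to densities *)

Section centered_densities.
Context (R : realType) (m : nat).
Notation T := (m.-tuple R).
Implicit Types rho : T -> R.

Lemma leb_intE (f : T -> \bar R) : measurable_fun setT f -> leb_int f = (\int[leb R m]_x f x)%E.
Proof.
move=> mf; rewrite integralE /leb_int !leb_int_nnE//.
- exact: measurable_funeneg.
- exact: measurable_funepos.
Qed.

Definition has_density (P : probability T R) rho : Prop :=
  (forall g : T -> \bar R, measurable_fun setT g -> (forall x, 0 <= g x)%E ->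
    (\int[P]_x g x = \int[leb R m]_x ((rho x)%:E * g x))%E) /\
  (forall f, quad f -> intg (leb R m) (fun x => rho x * f x) /\
    Ex P f = Ex (leb R m) (fun x => rho x * f x)).

Lemma density_intg rho : measurable_fun setT rho -> (forall x, 0 <= rho x) ->
  (\int[leb R m]_x (rho x)%:E < +oo)%E -> intg (leb R m) rho.
Proof.
move=> mr r0 h; apply/integrableP; split; first exact/measurable_EFinP.
by under eq_integral => x _ do rewrite gee0_abs ?lee_fin//.
Qed.

Lemma centered_law rho : centered_density rho -> exists P : probability T R,
  [/\ has_density P rho, law2 P & mean0 P].
Proof.
move=> [mr r0 mass second mean].
have mE : measurable_fun setT (fun x => (rho x)%:E) by exact/measurable_EFinP.
have W1 : (\int[leb R m]_x (rho x)%:E = 1)%E.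
  by rewrite -mass leb_int_nnE// => x; rewrite lee_fin.
have mn : measurable_fun setT (fun x => n2 x * rho x).
  by apply: measurable_funM => //; exact: meas_n2.
have n0 x : 0 <= n2 x * rho x by rewrite mulr_ge0// n2_ge0.
have ir : intg (leb R m) rho by apply: density_intg => //; rewrite W1 ltry.
have inr : intg (leb R m) (fun x => n2 x * rho x).
  apply: density_intg => //; move: second; rewrite leb_int_nnE//; exact/measurable_EFinP.
have iq f : quad f -> intg (leb R m) (fun x => rho x * f x).
  move=> [mf [A fA]].
  apply: (intg_dom _ (intgZ A (intgD ir inr))); first exact: measurable_funM.
  move=> x; rewrite normrM ger0_norm//.
  apply: (@le_trans _ _ (rho x * (A * (1 + n2 x)))); first by rewrite ler_wpM2l.
  by rewrite le_eqVlt; apply/orP; left; apply/eqP; ring.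
have [P [hP hR]] := wlaw_ex2 mr r0 W1 (@measurable_id _ T setT).
have P2 : law2 P.
  have [] // := hR (@n2 R m) (@meas_n2 R m).
  by apply: (eq_intg _ inr) => x; rewrite mulrC.
exists P; split => //.
  by split=> // f fq; split; [exact: iq|have [mf _] := fq; have [] := hR f mf (iq f fq)].
move=> j; have qj := @quad_coord R m j.
have [_ ->] := hR _ (proj1 qj) (iq _ qj).
have := mean j; rewrite leb_intE; last first.
  by apply/measurable_EFinP; apply: measurable_funM => //; exact: measurable_tnth.
have e x : tnth x j * rho x = rho x * tnth x j by rewrite mulrC.
rewrite (funext (fun x => congr1 EFin (e x))) ExE; last exact: iq.
by case.
Qed.

Lemma gauss_centered (S : 'M[R]_m) : posdef S -> centered_density (gauss_density S).
Proof.
move=> pS; have [P [hP P2 hR hq]] := gauss_law_ex pS.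
have mg := @meas_gauss_density R m S; have g0 := @gauss_density_ge0 R m S.
have qn : quad (@n2 R m).
  by split; [exact: meas_n2|exists 1 => x; rewrite mul1r ger0_norm ?n2_ge0// lerDr].
split => //.
- by rewrite leb_int_nnE ?gauss_mass//; exact/measurable_EFinP.
- rewrite leb_int_nnE; last 2 first.
  + by apply/measurable_EFinP; apply: measurable_funM => //; exact: meas_n2.
  + by move=> x; rewrite lee_fin mulr_ge0// n2_ge0.
  have [ig _] := hR _ qn.
  rewrite (eq_integral (fun x => (gauss_density S x * n2 x)%:E)); last first.
    by move=> x _; rewrite mulrC.
  by rewrite ExE// ltry.
- move=> j; have qj := @quad_coord R m j; have [ig eg] := hR _ qj.
  rewrite leb_intE; last by apply/measurable_EFinP; apply: measurable_funM => //; exact: measurable_tnth.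
  rewrite (eq_integral (fun x => (gauss_density S x * tnth x j)%:E)); last first.
    by move=> x _; rewrite mulrC.
  by rewrite ExE// -eg evenl_mean0//; exact: (gauss_even hP).
Qed.

Lemma gauss_has_density (S : 'M[R]_m) : posdef S -> exists P : probability T R,
  has_density P (gauss_density S) /\ gaussian_law S P.
Proof.
move=> pS; have [P [hP P2 hR hq]] := gauss_law_ex pS.
exists P; split=> //; split => //.
- exact: (gauss_even hP).
- by move=> th; exact: gauss_chf.
- by apply: cov_of_moments => //; case: pS.
Qed.

Lemma gauss_entropy (S : 'M[R]_m) (P : probability T R) : posdef S -> has_density P (gauss_density S) ->
  entropy (gauss_density S) = (- Ex P (fun x => ln (gauss_density S x)))%:E.
Proof.
move=> pS [_ hR]; have [ig ->] := hR _ (quad_ln (gauss_test pS)).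
by rewrite /entropy leb_intE ?ExE//; exact: measurable_int ig.
Qed.

(** Gibbs' inequality in the pointwise form [rho ln g + rho - g <= rho ln rho]. Only the left-hand
    side is known to be integrable, so the integrals are compared through positive and negative
    parts, which covers infinite entropy. *)
Lemma entropy_le_test rho (P : probability T R) (g : T -> R) : centered_density rho ->
  has_density P rho -> test g -> (entropy rho <= (- Ex P (fun x => ln (g x)))%:E)%E.
Proof.
move=> [mr r0 mass _ _] [hP hR] tg.
have [mg _ g1] := tg; have g0 x : 0 < g x by exact: test_gt0.
have [il ->] := hR _ (quad_ln tg).
have mE : measurable_fun setT (fun x => (rho x)%:E) by exact/measurable_EFinP.
have W1 : (\int[leb R m]_x (rho x)%:E = 1)%E.
  by rewrite -mass leb_int_nnE// => x; rewrite lee_fin.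
have ir : intg (leb R m) rho by apply: density_intg => //; rewrite W1 ltry.
have ig : intg (leb R m) g.
  by apply: density_intg => // [x|]; [exact: ltW|rewrite (le_lt_trans g1)// ltry].
have Er : Ex (leb R m) rho = 1 by move: W1; rewrite ExE//; case.
have Eg : Ex (leb R m) g <= 1 by move: g1; rewrite ExE.
pose h x := rho x * ln (g x) + rho x - g x.
have ih : intg (leb R m) h by apply: intgB => //; exact: intgD.
have Eh : Ex (leb R m) h = Ex (leb R m) (fun x => rho x * ln (g x)) + 1 - Ex (leb R m) g.
  by rewrite /h ExB//; [rewrite ExD// Er|exact: intgD].
have mrl : measurable_fun setT (fun x => (rho x * ln (rho x))%:E).
  by apply/measurable_EFinP; apply: measurable_funM => //; apply: measurableT_comp => //; exact: measurable_ln.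
have hle x : h x <= rho x * ln (rho x).
  rewrite /h; have := r0 x; rewrite le_eqVlt => /orP[/eqP <-|rx].
    by rewrite !mul0r !add0r oppr_le0 ltW.
  have := @le_ln1Dx R (g x / rho x - 1).
  rewrite ltrBrDl subrr divr_gt0// => /(_ isT).
  rewrite addrCA subrr addr0 ln_div ?posrE// => h1.
  have : rho x * (ln (g x) - ln (rho x)) <= rho x * (g x / rho x - 1) by rewrite ler_wpM2l.
  rewrite !mulrBr mulr1 mulrCA divff ?gt_eqF// mulr1; lra.
rewrite /entropy leb_intE// -leeN2 oppeK -EFinN opprK.
apply: (@le_trans _ _ (\int[leb R m]_x (h x)%:E)%E).
  by rewrite ExE// lee_fin Eh; move: (Ex _ _) Eg => *; lra.
rewrite integralE [leRHS]integralE; apply: leeB; apply: ge0_le_integral => //.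
- by apply: measurable_funepos; exact: measurable_int ih.
- by apply: measurable_funepos.
- by move=> x _; apply: (@funepos_le _ _ setT) => [y _|]; rewrite ?lee_fin ?inE.
- by apply: measurable_funeneg.
- by apply: measurable_funeneg; exact: measurable_int ih.
- by move=> x _; apply: (@funeneg_le _ _ setT) => [y _|]; rewrite ?lee_fin ?inE.
Qed.

End centered_densities.

Lemma mul_frac_le (R : realFieldType) (a x : R) : 0 <= a -> 0 <= x -> a * (x / (x + 1)) <= a.
Proof.
move=> a0 x0; rewrite -[leRHS]mulr1 ler_wpM2l// ler_pdivrMr ?ltr_wpDl//.
by rewrite mul1r lerDl.
Qed.

Section coupling_margins.
Context (R : realType) (n : nat) (d : 'I_n -> nat).
Notation T i := ((d i).-tuple R).
Notation I := {i : 'I_n & 'I_(d i)}.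
Notation laws := (forall i, probability (T i) R).
Notation Om := ((\sum_(k < n) d k).-tuple R).

(** Passes from sets, as in [is_coupling], to nonnegative functions, the image of [G] and [P i]
    being the same measure. *)
Lemma coupling_margin (rho : forall i, T i -> R) (P : laws) (G : probability Om R) :
  (forall i, measurable_fun setT (rho i)) -> (forall i x, 0 <= rho i x) ->
  (forall i, has_density (P i) (rho i)) -> is_coupling rho G <-> forall i, has_margin G (P i).
Proof.
move=> mr r0 hP.
have ind d' (T' : measurableType d') (nu : probability T' R) B : measurable B ->
  nu B = (\int[nu]_x (\1_B x)%:E)%E by move=> mB; rewrite integral_indic// setIT.
have PE i (A : set (T i)) : measurable A -> P i A = leb_int_nn (fun x => (\1_A x * rho i x)%:E).
  move=> mA; have mI : measurable_fun setT (\1_A : T i -> R) by exact: measurable_indic.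
  rewrite leb_int_nnE; last 2 first.
  - by apply/measurable_EFinP; exact: measurable_funM mI (mr i).
  - by move=> x; rewrite lee_fin mulr_ge0.
  rewrite ind// (proj1 (hP i)).
  - by apply: eq_integral => x _; rewrite -EFinM mulrC.
  - exact/measurable_EFinP.
  - by move=> x; rewrite lee_fin.
split=> [hG i g mg g0|hG i A mA]; last first.
  rewrite -PE// [RHS]ind// -hG; last 2 first.
  - exact/measurable_EFinP/measurable_indic.
  - by move=> x; rewrite lee_fin.
  rewrite [LHS]ind//.
  by rewrite -[X in measurable X]setTI; exact: (@meas_proj R n d i).
pose X : {mfun Om >-> T i} := HB.pack (@Defs.proj R n d i) (isMeasurableFun.Build _ _ _ _ _ (@meas_proj R n d i)).
have <- : (\int[distribution G X]_x g x = \int[P i]_x g x)%E.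
  apply: (@eq_measure_integral _ _ _ _ (P i) (distribution G X)) => A mA _.
  by rewrite [RHS]PE//; exact: hG.
by rewrite ge0_integral_pushforward// preimage_setT.
Qed.

Definition form_of (Q : 'M[R]_(\sum_(k < n) d k)) (p p' : I) : R :=
  Q (tagnat.Rank (tag p) (tagged p)) (tagnat.Rank (tag p') (tagged p')).

Lemma qformE Q (x : Om) : qform Q x = bq (form_of Q) (coord x) (coord x).
Proof.
have cE p : coord x p = tnth x (tagnat.rank p) by rewrite /coord tnth_proj tagnat.rankE.
rewrite /qform /bq (reindex _ tagnat.rank_bij_on); apply: eq_bigr => p _.
rewrite (reindex _ tagnat.rank_bij_on); apply: eq_bigr => p' _.
by rewrite !cE /form_of !tagnat.rankE.
Qed.

Lemma form_of_sym Q p p' : Q^T = Q -> form_of Q p p' = form_of Q p' p.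
Proof. by move=> e; rewrite /form_of -[in LHS]e mxE. Qed.

Lemma shift_form_psd (q0 : I -> I -> R) : exists kap, forall x, 0 <= bq (shift_form q0 kap) x x.
Proof.
pose A := \sum_p \sum_p' `|q0 p p'|.
exists A => x; rewrite bq_shift.
suff : - bq q0 x x <= A * \sum_p x p ^+ 2 by lra.
rewrite /bq -sumrN mulr_suml; apply: ler_sum => p _; rewrite -sumrN mulr_suml; apply: ler_sum => p' _.
rewrite (le_trans (ler_norm _))// normrN mulrAC normrM mulrC ler_wpM2l//.
have h1 : x p ^+ 2 <= \sum_p x p ^+ 2 by apply: (@le_sum1 _ _ (fun p => x p ^+ 2)) => p1; exact: sqr_ge0.
have h2 : x p' ^+ 2 <= \sum_p x p ^+ 2 by apply: (@le_sum1 _ _ (fun p => x p ^+ 2)) => p1; exact: sqr_ge0.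
by apply: (le_trans (norm_mul_le _ _)); lra.
Qed.

Lemma coupling_qform Q (P : laws) (G : probability Om R) : (forall i, law2 (P i)) ->
  (forall i, has_margin G (P i)) ->
  (\int[G]_x (qform Q x)%:E = (Ex G (fun x => bq (form_of Q) (coord x) (coord x)))%:E)%E.
Proof.
move=> P2 mG; have [ib _] := Ex_bq (form_of Q) (fun p p' => intg_coord2 p p' P2 mG).
by rewrite -ExE//; apply: eq_integral => x _; rewrite qformE.
Qed.

Variables (c : 'I_n -> R) (Q : 'M[R]_(\sum_(k < n) d k)).
Hypothesis c0 : forall i, 0 < c i.

Lemma gaussian_bound_of_star D :
  (forall rho : forall i, T i -> R, (forall i, is_centered_gaussian (rho i)) -> star_ineq c Q rho D) ->
  gaussian_bound c (form_of Q) D.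
Proof.
move=> star S pS; have /dep_choice[ga hga] := fun i => gauss_has_density (pS i).
exists ga; split => [i|e e0]; first by case: (hga i).
have dga i : has_density (ga i) (gauss_density (S i)) by case: (hga i).
have ga2 i : law2 (ga i) by have [_ []] := hga i.
have := star (fun i => gauss_density (S i)) (fun i => ex_intro _ (S i) (conj (pS i) erefl)).
rewrite /star_ineq (eq_bigr (fun i => (c i * - Ex (ga i) (fun x => ln (gauss_density (S i) x)))%:E)); last first.
  by move=> i _; rewrite (gauss_entropy (pS i) (dga i)) EFinM.
rewrite sumEFin; under eq_bigr do rewrite mulrN.
rewrite sumrN; set H := - _ => h.
(* A strict inequality yields a coupling above this level, also if the supremum is [+oo]. *)
have : ((H - D - e)%:E < sup_couplings Q (fun i => gauss_density (S i)))%E.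
  move: h; case: (sup_couplings _ _) => [r| |] //=; last by rewrite ltry.
  by rewrite -EFinD lee_fin lte_fin; lra.
move=> /ereal_sup_gt[_ [G hG <-]] lt; exists G.
have mG : forall i, has_margin G (ga i).
  apply/(coupling_margin (rho := fun i => gauss_density (S i))) => //.
  - by move=> i; exact: meas_gauss_density.
  - by move=> i x; exact: gauss_density_ge0.
split=> //; move: lt; rewrite (coupling_qform Q ga2 mG) lte_fin; lra.
Qed.

(** [lam] and [de] are fitted to the trace of the given laws, so that the penalty changes the
    inequality by at most [e / 2], while [D] does not depend on them. Of the witnesses given by
    [free_bound], the tests bound the entropies from above and the decomposition yields a
    coupling. *)
Lemma star_of_gaussian_bound (i0 : 'I_n) D : Q^T = Q -> gaussian_bound c (form_of Q) D ->
  forall rho : forall i, T i -> R, (forall i, centered_density (rho i)) -> star_ineq c Q rho D.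
Proof.
move=> Qs HG rho cr; have /dep_choice[P hP] := fun i => centered_law (cr i).
have dP i : has_density (P i) (rho i) by case: (hP i).
have P2 i : law2 (P i) by case: (hP i).
have P0 : law0 P by move=> i; case: (hP i).
have [kap psd] := shift_form_psd (form_of Q).
have sym p p' : shift_form (form_of Q) kap p p' = shift_form (form_of Q) kap p' p.
  by rewrite /shift_form form_of_sym// eq_sym.
apply/lee_addgt0Pr => e e0.
pose lam := e / (2 * (trC P + 1)).
have t0 := trC_ge0 P.
have lam0 : 0 < lam by rewrite divr_gt0// mulr_gt0// ltr_wpDl.
pose N : R := \sum_(p : I) 1.
have N0 : 0 <= N by exact: sumr_ge0.
pose de := lam / (2 * (N + 1)).
have de0 : 0 < de by rewrite divr_gt0// mulr_gt0// ltr_wpDl.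
have deN : de * N <= lam / 2.
  have -> : de * N = lam / 2 * (N / (N + 1)) by rewrite /de; field; rewrite gt_eqF// ltr_wpDl.
  by rewrite mul_frac_le// divr_ge0// ltW.
have e20 : 0 < e / 2 by rewrite divr_gt0.
have [g [Dc [tg dD hfree]]] := free_bound i0 kap c0 HG lam0 de0 deN P0 e20.
have [G [mG _ hV]] := dec_coupling i0 P2 dD sym psd.
have hV2 : Val (shift_form (form_of Q) kap) P (@dF _ _ _ Dc) (@da _ _ _ Dc) (@dxi _ _ _ Dc) <=
    Ex G (fun x => bq (shift_form (form_of Q) kap) (coord x) (coord x)) by [].
rewrite (Ex_bq_shift _ kap P2 mG) in hV2.
have cG : is_coupling rho G.
  have mr i : measurable_fun setT (rho i) by case: (cr i).
  have r0 i x : 0 <= rho i x by case: (cr i) => _ /(_ x).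
  by have [_] := coupling_margin G mr r0 dP; exact.
have sG : ((Ex G (fun x => bq (form_of Q) (coord x) (coord x)))%:E <= sup_couplings Q rho)%E.
  by rewrite -(coupling_qform Q P2 mG); apply: ereal_sup_ubound; exists G.
apply: (@le_trans _ _ (\sum_i (c i * - Ex (P i) (fun x => ln (g i x)))%:E)%E).
  apply: lee_sum => i _; rewrite EFinM lee_wpmul2l ?lee_fin ?(ltW (c0 i))//.
  exact: entropy_le_test.
rewrite sumEFin; under eq_bigr do rewrite mulrN.
rewrite sumrN.
apply: (@le_trans _ _ ((Ex G (fun x => bq (form_of Q) (coord x) (coord x)))%:E + D%:E + e%:E)%E); last first.
  by rewrite leeD2r// leeD2r.
rewrite -!EFinD lee_fin.
have /andP[ph _] := pen_phi_le de0 deN P2.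
have lt : lam * trC P <= e / 2.
  have -> : lam * trC P = e / 2 * (trC P / (trC P + 1)) by rewrite /lam; field; rewrite gt_eqF// ltr_wpDl.
  by rewrite mul_frac_le// ltW.
move: hfree; rewrite /pen -/(trC P); move: ph hV2 lt.
move: (Ex G _) (Val _ _ _ _ _) (de * _) (trC P) => a b f t.
move: (\sum_i c i * Ex (P i) (fun x => ln (g i x))) => h.
by rewrite mulrBl; lra.
Qed.

End coupling_margins.

Theorem theorem2 (R : realType) (n : nat) (d : 'I_n -> nat) (c : 'I_n -> R)
  (Q : 'M[R]_(\sum_(k < n) d k)) :
  (0 < n)%N -> (forall i, 0 < c i) -> Q^T = Q ->
  D_const c Q = Dg_const c Q.
Proof.
(* The two constants are infima of one and the same set of reals, so an empty set, with value [+oo],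
   is covered too. *)
move=> n0 c0 Qs; congr (ereal_inf [set D%:E | D in _]).
apply/seteqP; split=> D /= h rho hrho.
  apply: h => i; have [S [pS ->]] := hrho i; exact: gauss_centered.
exact: (star_of_gaussian_bound c0 (Ordinal n0) Qs (gaussian_bound_of_star h)).
Qed.
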